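(* Let $N=2$ or $N=3$, and let $\psi_c:\mathbb R^N\to[0,+\infty)$ be a Lipschitz, positively $1$-homogeneous and convex function such that $\{(x,y):|x|\le a,\ y=b\}\subset\partial W_{\psi_c}$ for some $a,b>0$. Then for every $d>0$ the flat configuration $(d,v_0)$ is a local minimizer for the functional $F_c$; that is, there exists $\delta>0$ such that $F_c(d,v_0)\le F_c(g,v)$ for all $(g,v)\in X'$ with $\|g-d\|_\infty<\delta$, $|\Omega_g|=|\Omega_d|$ and $\|\nabla v-\nabla v_0\|_{L^\infty(\Omega';\mathbb M^N)}<\delta$.
   Context: Setting. Write $z=(x,y)\in\mathbb R^{N-1}\times\mathbb R$, let $e_1,\dots,e_N$ be the canonical basis, $\mathbb M^N$ the real $N\times N$ matrices with $A:B=\mathrm{tr}(A^TB)$, $\mathbb M^N_+$ those with positive determinant, and $Q=(0,1)^{N-1}$. ''One-periodic'' means $1$-periodic in each coordinate direction of $x$. $AP(Q)$ is the set of one-periodic Lipschitz functions $\mathbb R^{N-1}\to(0,+\infty)$. For $g\in AP(Q)$: $\Omega_g=\{(x,y):x\in Q,\,0<y<g(x)\}$, $\Omega_g^\#=\{(x,y):x\in\mathbb R^{N-1},\,0<y<g(x)\}$, $\Gamma_g=\{(x,g(x)):x\in Q\}$, and $\nu_g$ is the exterior unit normal to $\Omega_g$ on $\Gamma_g$. $\mathcal V(\Omega_g)$ is the space of $w\in W^{1,\infty}(\Omega_g^\#;\mathbb R^N)$ with $w(x,0)=0$ and $w(x+e_i,y)=w(x,y)$ for $i=1,\dots,N-1$;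 $\widetilde{\mathcal V}(\Omega_g)$ is its completion in the norm of $H^1(\Omega_g;\mathbb R^N)$. The boundary datum is $u_0(x,y)=(A[x],0)$ with $A\in\mathbb M^{N-1}_+$. $X$ is the set of pairs $(g,v)$ with $g\in AP(Q)$, $v:\Omega_g^\#\to\mathbb R^N$, $v-u_0\in\mathcal V(\Omega_g)$ and $\det\nabla v>0$ a.e. in $\Omega_g$. $W:\mathbb M^N_+\to[0,+\infty)$ is of class $C^3$, $W_\xi=DW$, $W_{\xi\xi}=D^2W$. The energy associated with $\psi_c$ is $F_c(g,v)=\int_{\Omega_g}W(\nabla v)\,dz+\int_{\Gamma_g}\psi_c(\nu_g)\,d\mathcal H^{N-1}$. Wulff shape. $W_{\psi_c}=\{z\in\mathbb R^N: z\cdot\nu\le\psi_c(\nu)\text{ for every }\nu\in S^{N-1}\}$; it is assumed that $W_{\psi_c}$ contains a neighborhood of the origin. Flat configuration. For $d>0$ (identified with the constant profile; $\Omega_d=Q\times(0,d)$, $\Gamma_d=Q\times\{d\}$), $(d,v_0)\in X$ is a flat configuration with volume $d$ if $v_0(z)=M[z]$ for some $M\in\mathbb M^N_+$, $v_0-u_0\in\mathcal V(\Omega_d)$, $W_\xi(\nabla v_0)[e_N]=0$ on $\Gamma_d$ (and $\mathrm{div}(W_\xi(\nabla v_0))=0$ in $\Omega_d$, which is automatic), and there is $c_0>0$ such that $\int_{\Omega_d}W_{\xi\xi}(\nabla v_0)\nabla w:\nabla w\,dz\ge c_0\|w\|^2_{H^1(\Omega_d;\mathbb R^N)}$ for all $w\in\widetilde{\mathcal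 V}(\Omega_d)$. It is assumed throughout that $W$ (and the datum) admit a flat configuration $(d,v_0)$. Competitors. $\Omega'=\Omega_{d+\eta}$ for a fixed $\eta>0$, $\Omega'_\#=\Omega^\#_{d+\eta}$, and $v_0$ is extended as the affine map. $X'$ is the set of $(g,v)$ with $g\in AP(Q)$, $\Omega_g\subset\Omega'$, $v:\Omega'_\#\to\mathbb R^N$, $v-u_0\in W^{1,\infty}(\Omega'_\#;\mathbb R^N)$, $(g,v|_{\Omega_g^\#})\in X$, and $\det\nabla v>0$ a.e. in $\Omega'$. *)

(* Defs.v *)
From HB Require Import structures.
From mathcomp Require Import all_boot all_order all_algebra.
From mathcomp Require Import all_classical all_reals all_analysis.
From mathcomp Require Import ess_sup_inf.

Set Implicit Arguments.
Unset Strict Implicit.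
Unset Printing Implicit Defensive.

Import Order.TTheory GRing.Theory Num.Theory.
Import numFieldNormedType.Exports.

Local Open Scope classical_set_scope.
Local Open Scope ring_scope.

(* Points of R^m are column vectors 'cV[R]_m, and the ambient dimension N is
   n.+1, so that N - 1 = n.  The library norm of a matrix is the maximum norm;
   all norms below are Euclidean (Frobenius on matrices). *)

Section euclidean.
Context {R : realType}.

Definition inner m p (A B : 'M[R]_(m, p)) : R := \tr (A^T *m B).

Definition enorm m p (A : 'M[R]_(m, p)) : R := Num.sqrt (inner A A).

Definition basis_vec m (j : 'I_m) : 'cV[R]_m := delta_mx j ord0.

Definition pt n (x : 'cV[R]_n) (y : R) : 'cV[R]_n.+1 :=
  \col_i (if unlift ord_max i is Some j then x j ord0 else y).

Definition hpart n (z : 'cV[R]_n.+1) : 'cV[R]_n :=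
  \col_j z (lift ord_max j) ord0.

Definition vpart n (z : 'cV[R]_n.+1) : R := z ord_max ord0.

Definition unit_cube n : set 'cV[R]_n := [set x | forall i, 0 < x i ord0 < 1].

Definition one_periodic n (f : 'cV[R]_n -> R) : Prop :=
  forall i x, f (x + basis_vec i) = f x.

End euclidean.

Section covering_outer_measures.
Context {R : realType} {T : pointedType}.
Implicit Types rho : set T -> \bar R.
Local Open Scope ereal_scope.

Definition covering_outer rho (X : set T) : \bar R :=
  ereal_inf [set \sum_(k <oo) rho (U k) | U in
    [set U : (set T)^nat | X `<=` \bigcup_k U k]].

Lemma covering_outerE rho (X : set T) :
  covering_outer rho X =
  @mu_ext _ (g_sigma_algebraType [set: set T]) R rho X.
Proof.
congr ereal_inf; apply/seteqP; split => [_ [U XU <-]|_ [U [_ XU] <-]].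
  by exists U => //; split => // k; exact: sub_gen_smallest.
by exists U.
Qed.

Variable rho : set T -> \bar R.
Hypotheses (rho0 : rho set0 = 0) (rho_ge0 : forall X, 0 <= rho X).

Lemma covering_outer0 : covering_outer rho set0 = 0.
Proof. by rewrite covering_outerE; exact: (@mu_ext0 _ (g_sigma_algebraType _) R rho rho0 rho_ge0). Qed.

Lemma covering_outer_ge0 X : 0 <= covering_outer rho X.
Proof. by rewrite covering_outerE; exact: (@mu_ext_ge0 _ (g_sigma_algebraType _) R rho rho_ge0). Qed.

Lemma le_covering_outer :
  {homo covering_outer rho : X Y / X `<=` Y >-> X <= Y}.
Proof. by move=> X Y XY; rewrite !covering_outerE; apply: le_mu_ext. Qed.

Lemma covering_outer_sigma_subadditive :
  sigma_subadditive (covering_outer rho).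
Proof.
move=> F; rewrite covering_outerE.
under eq_eseriesr do rewrite covering_outerE.
exact: (@mu_ext_sigma_subadditive _ (g_sigma_algebraType _) R rho rho_ge0).
Qed.

End covering_outer_measures.

Section lebesgue_measure.
Context {R : realType}.
Variable m : nat.
Local Open Scope ereal_scope.

Definition box (a b : 'cV[R]_m) : set 'cV[R]_m :=
  [set z | forall i, (a i ord0 <= z i ord0 < b i ord0)%R].

(* The volume of a nonempty box, +oo on nonempty sets that are not boxes. *)
Definition box_volume (U : set 'cV[R]_m) : \bar R :=
  if `[< U = set0 >] then 0
  else ereal_inf [set (\prod_i (p.2 i ord0 - p.1 i ord0))%:E | p in
    [set p : 'cV[R]_m * 'cV[R]_m | U = box p.1 p.2]].

Lemma box_volume0 : box_volume set0 = 0.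
Proof. by rewrite /box_volume; case: asboolP. Qed.

Lemma box_volume_ge0 U : 0 <= box_volume U.
Proof.
rewrite /box_volume; case: asboolP => // /eqP/set0P[z Uz].
apply: le_ereal_inf_tmp => _ [p /= Up <-]; rewrite lee_fin.
apply: prodr_ge0 => i _; move: Uz; rewrite Up => /(_ i)/andP[az zb].
by rewrite subr_ge0 (le_trans az) ?ltW.
Qed.

Definition lebesgue_outer : set 'cV[R]_m -> \bar R :=
  covering_outer box_volume.

HB.instance Definition _ := isOuterMeasure.Build R 'cV[R]_m lebesgue_outer
  (covering_outer0 box_volume0 box_volume_ge0)
  (covering_outer_ge0 box_volume_ge0)
  (@le_covering_outer _ _ box_volume)
  (covering_outer_sigma_subadditive box_volume_ge0).

Let mu : {outer_measure set 'cV[R]_m -> \bar R} := lebesgue_outer.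

(* Lebesgue measure on the Lebesgue (Caratheodory) measurable subsets of R^m. *)
Definition leb : {measure set (caratheodory_type mu) -> \bar R} := mu.

End lebesgue_measure.
Arguments leb {R} m.

Section hausdorff_measure.
Context {R : realType}.
Variables s m : nat.
Local Open Scope ereal_scope.

Definition diameter (U : set 'cV[R]_m) : \bar R :=
  ereal_sup [set (enorm (p.1 - p.2))%:E | p in U `*` U].

Definition unit_ball_volume : \bar R := leb s [set x | (enorm x <= 1)%R].

(* The s-dimensional Hausdorff measure is normalized so that a cover by sets
   U_k costs the sum of |B^s| (diam U_k / 2)^s, with B^s the unit ball of R^s.
   The case of the empty set is singled out since its [diameter] is -oo. *)
Definition hausdorff_gauge (delta : R) (U : set 'cV[R]_m) : \bar R :=
  if `[< U = set0 >] then 0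
  else if diameter U <= delta%:E
  then unit_ball_volume * ((fine (diameter U) / 2) ^+ s)%:E
  else +oo.

Lemma hausdorff_gauge0 delta : hausdorff_gauge delta set0 = 0.
Proof. by rewrite /hausdorff_gauge; case: asboolP. Qed.

Lemma hausdorff_gauge_ge0 delta U : 0 <= hausdorff_gauge delta U.
Proof.
rewrite /hausdorff_gauge; case: asboolP => // /eqP/set0P[z Uz].
case: ifP => // _; apply: mule_ge0; first exact: measure_ge0.
rewrite lee_fin exprn_ge0// divr_ge0// fine_ge0//.
apply: (@le_trans _ _ (enorm (z - z))%:E).
  by rewrite lee_fin sqrtr_ge0.
by apply: ereal_sup_ubound; exists (z, z).
Qed.

Definition hausdorff_outer (X : set 'cV[R]_m) : \bar R :=
  ereal_sup [set covering_outer (hausdorff_gauge delta) X | delta in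
    [set delta : R | (0 < delta)%R]].

Lemma hausdorff_outer_ge0 X : 0 <= hausdorff_outer X.
Proof.
apply: (@le_trans _ _ (covering_outer (hausdorff_gauge 1) X)).
  exact: covering_outer_ge0 (hausdorff_gauge_ge0 _) _.
by apply: ereal_sup_ubound; exists 1%R => //=.
Qed.

Lemma hausdorff_outer0 : hausdorff_outer set0 = 0.
Proof.
apply/eqP; rewrite eq_le hausdorff_outer_ge0 andbT.
apply: ge_ereal_sup => _ [delta _ <-].
by rewrite covering_outer0//; [exact: hausdorff_gauge0|
  exact: hausdorff_gauge_ge0].
Qed.

Lemma le_hausdorff_outer : {homo hausdorff_outer : X Y / X `<=` Y >-> X <= Y}.
Proof.
move=> X Y XY; apply: ge_ereal_sup => _ [delta delta0 <-].
apply: (@le_trans _ _ (covering_outer (hausdorff_gauge delta) Y)).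
  exact: le_covering_outer.
by apply: ereal_sup_ubound; exists delta.
Qed.

Lemma hausdorff_outer_sigma_subadditive : sigma_subadditive hausdorff_outer.
Proof.
move=> F; apply: ge_ereal_sup => _ [delta delta0 <-].
apply: le_trans (covering_outer_sigma_subadditive
  (hausdorff_gauge_ge0 delta) F) _.
apply: lee_nneseries => [k _ _|k _].
  exact: covering_outer_ge0 (hausdorff_gauge_ge0 _) _.
by apply: ereal_sup_ubound; exists delta.
Qed.

HB.instance Definition _ := isOuterMeasure.Build R 'cV[R]_m hausdorff_outer
  hausdorff_outer0 hausdorff_outer_ge0 le_hausdorff_outer
  hausdorff_outer_sigma_subadditive.

Let mu : {outer_measure set 'cV[R]_m -> \bar R} := hausdorff_outer.

Definition hausdorff : {measure set (caratheodory_type mu) -> \bar R} := mu.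

End hausdorff_measure.
Arguments hausdorff {R} s m.

Section derivatives.
Context {R : realType}.

(* Class C^k on an open set U. *)
Fixpoint classC (k : nat) (V : normedModType R) (U : set V) (f : V -> R) :
    Prop :=
  if k is k'.+1 then
    (forall z, U z -> differentiable f z) /\
    (forall v, classC k' U (fun z => 'D_v f z))
  else forall z, U z -> {for z, continuous f}.

Definition grad m (f : 'cV[R]_m -> R) (z : 'cV[R]_m) : 'cV[R]_m :=
  \col_j 'D_(basis_vec j) f z.

Definition jac m p (f : 'cV[R]_m -> 'cV[R]_p) (z : 'cV[R]_m) : 'M[R]_(p, m) :=
  \matrix_(i, j) 'D_(basis_vec j) (fun x => f x i ord0) z.

Definition mxdiv m p (S : 'cV[R]_m -> 'M[R]_(p, m)) (z : 'cV[R]_m) :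
    'cV[R]_p :=
  \col_i \sum_j 'D_(basis_vec j) (fun x => S x i j) z.

Definition DW p (W : 'M[R]_p -> R) (xi : 'M[R]_p) : 'M[R]_p :=
  \matrix_(i, j) 'D_(delta_mx i j) W xi.

Definition D2W p (W : 'M[R]_p -> R) (xi B : 'M[R]_p) : 'M[R]_p :=
  \matrix_(i, j) 'D_B (fun xi' => DW W xi' i j) xi.

End derivatives.

Section norms.
Context {R : realType}.
Variable m : nat.

Definition sup_norm (f : 'cV[R]_m -> R) : \bar R :=
  ereal_sup [set (`|f x|)%:E | x in [set: 'cV[R]_m]].

Definition Linfty_norm (Om : set 'cV[R]_m) q r
    (F : 'cV[R]_m -> 'M[R]_(q, r)) : \bar R :=
  ess_sup (leb m) ((fun z => (enorm (F z))%:E) \_ Om).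

End norms.

Section sobolev.
Context {R : realType}.
Variables m p : nat.
Implicit Types (Om : set 'cV[R]_m) (w : 'cV[R]_m -> 'cV[R]_p)
  (G : 'cV[R]_m -> 'M[R]_(p, m)).

Definition test_function Om (phi : 'cV[R]_m -> R) : Prop :=
  (forall k, classC k [set: 'cV[R]_m] phi) /\
  exists K, [/\ compact K, K `<=` Om & forall z, ~ K z -> phi z = 0].

Definition loc_integrable Om (f : 'cV[R]_m -> R) : Prop :=
  forall K, compact K -> K `<=` Om -> (leb m).-integrable K (EFin \o f).

Definition weak_gradient Om w G : Prop :=
  [/\ forall i, loc_integrable Om (fun z => w z i ord0),
      forall i j, loc_integrable Om (fun z => G z i j) &
      forall phi, test_function Om phi -> forall i j,
        \int[leb m]_(z in Om) (w z i ord0 * 'D_(basis_vec j) phi z) =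
        - \int[leb m]_(z in Om) (G z i j * phi z)].

(* Weak gradients are unique up to a null set; [nabla] selects one. *)
Definition nabla Om w : 'cV[R]_m -> 'M[R]_(p, m) :=
  xget (fun=> 0) [set G | weak_gradient Om w G].

Definition ae_bounded Om q r (f : 'cV[R]_m -> 'M[R]_(q, r)) : Prop :=
  exists C : R, {ae leb m, forall z, Om z -> enorm (f z) <= C}.

(* Elements are represented by their continuous version, extended
   continuously to the closure of the domain. *)
Definition W1infty Om w : Prop :=
  [/\ {within closure Om, continuous w},
      ae_bounded Om w &
      exists G, weak_gradient Om w G /\ ae_bounded Om G].

Definition H1norm2 Om w : \bar R :=
  (\int[leb m]_(z in Om) (enorm (w z) ^+ 2)%:E +
   \int[leb m]_(z in Om) (enorm (nabla Om w z) ^+ 2)%:E)%E.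

Definition H1_space Om w : Prop :=
  [/\ forall i, measurable_fun (Om : set (caratheodory_type _))
        (fun z : caratheodory_type (@lebesgue_outer R m) => w z i ord0),
      exists G, weak_gradient Om w G &
      (H1norm2 Om w < +oo)%E].

End sobolev.

Section film.
Context {R : realType}.
Variable n : nat.
Implicit Types (g : 'cV[R]_n -> R) (v w : 'cV[R]_n.+1 -> 'cV[R]_n.+1)
  (A : 'M[R]_n) (W : 'M[R]_n.+1 -> R) (psi : 'cV[R]_n.+1 -> R).

Definition AP g : Prop :=
  [/\ one_periodic g, lipschitz g & forall x, 0 < g x].

Definition Omega g : set 'cV[R]_n.+1 :=
  [set z | unit_cube (hpart z) /\ 0 < vpart z < g (hpart z)].

Definition Omega_sharp g : set 'cV[R]_n.+1 :=
  [set z | 0 < vpart z < g (hpart z)].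

Definition Gamma g : set 'cV[R]_n.+1 :=
  [set pt x (g x) | x in @unit_cube R n].

(* [grad g] is meaningful at differentiability points of the Lipschitz
   function g, hence almost everywhere. *)
Definition normal g (z : 'cV[R]_n.+1) : 'cV[R]_n.+1 :=
  let G := grad g (hpart z) in
  (Num.sqrt (1 + enorm G ^+ 2))^-1 *: pt (- G) 1.

Definition calV g w : Prop :=
  [/\ W1infty (Omega_sharp g) w,
      forall x, w (pt x 0) = 0 &
      forall i x y, 0 < y < g x ->
        w (pt (x + basis_vec i) y) = w (pt x y)].

(* The completion of [calV g] for the H^1 norm, realized as a closure in the
   Hilbert space H^1(Omega g). *)
Definition calVtilde g w : Prop :=
  H1_space (Omega g) w /\
  forall eps : R, 0 < eps ->
    exists u, calV g u /\ (H1norm2 (Omega g) (w \- u)%R < eps%:E)%E.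

Definition datum A (z : 'cV[R]_n.+1) : 'cV[R]_n.+1 := pt (A *m hpart z) 0.

Definition calX A g v : Prop :=
  [/\ AP g,
      calV g (v \- datum A) &
      {ae leb n.+1, forall z, Omega g z ->
        0 < \det (nabla (Omega_sharp g) v z)}].

Definition energy W psi g v : \bar R :=
  (\int[leb n.+1]_(z in Omega g) (W (nabla (Omega_sharp g) v z))%:E +
   \int[hausdorff n n.+1]_(z in Gamma g) (psi (normal g z))%:E)%E.

Definition wulff psi : set 'cV[R]_n.+1 :=
  [set z | forall nu, enorm nu = 1 -> inner z nu <= psi nu].

(* The configuration is affine, so its gradient is the classical one, which
   makes sense on the null set Gamma. *)
Definition flat A W (d : R) v : Prop :=
  [/\ calX A (cst d) v,
      exists2 M : 'M[R]_n.+1, 0 < \det M & forall z, v z = M *m z,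
      forall z, Gamma (cst d) z -> DW W (jac v z) *m basis_vec ord_max = 0,
      forall z, Omega (cst d) z -> mxdiv (fun x => DW W (jac v x)) z = 0 &
      exists2 c0 : R, 0 < c0 & forall w, calVtilde (cst d) w ->
        (c0%:E * H1norm2 (Omega (cst d)) w <=
         \int[leb n.+1]_(z in Omega (cst d))
           (inner (D2W W (jac v z) (nabla (Omega (cst d)) w z))
                  (nabla (Omega (cst d)) w z))%:E)%E].

Definition calX' A (d eta : R) g v : Prop :=
  [/\ AP g /\ Omega g `<=` Omega (cst (d + eta)),
      W1infty (Omega_sharp (cst (d + eta))) (v \- datum A),
      calX A g v &
      {ae leb n.+1, forall z, Omega (cst (d + eta)) z ->
        0 < \det (nabla (Omega_sharp (cst (d + eta))) v z)}].

End film.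

(* Main.v *)
Require Import Defs.
From HB Require Import structures.
From mathcomp Require Import all_boot all_order all_algebra.
From mathcomp Require Import all_classical all_reals all_analysis.
From mathcomp Require Import ess_sup_inf measurable_realfun.
From mathcomp Require Import ring lra.
Set Implicit Arguments.
Unset Strict Implicit.
Unset Printing Implicit Defensive.
Import Order.TTheory GRing.Theory Num.Theory.
Import numFieldNormedType.Exports.
Local Open Scope classical_set_scope.
Local Open Scope ring_scope.

(** The flat film minimizes because the surface energy of a competitor grows
linearly with the variation of its profile, whereas the elastic energy can
decrease only by a small multiple of that variation.

Surface energy.  Since the Wulff shape has a horizontal facet of radius a at
height b, testing the definition of the Wulff shape with the points of the facet
gives psi (-p, 1) >= b + a |p| ([psi_slope]), with equality at p = 0
([psi_vertical]).  By the area formula for Lipschitz graphs, as an inequality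
([surface_lower]), the surface energy of the graph of g is at least
c (b + (a / n) V) ([surface_variation]), where V is the sum over i of the
integrals of |D_i g| over the cell and c > 0 is the Hausdorff measure of a flat
unit cell; for the flat film it is at most c b ([flat_surface_le]).

Elastic energy.  Let w be the difference of the two deformations.  Its weak
gradient is bounded by delta, hence w is Lipschitz with a constant of order delta
up to the boundary of the cell ([box_gradient_lip]).  Expand the stored energy to
second order at the gradient M of the flat deformation ([taylor_lower]).  The
quadratic form is coercive on periodic maps of the flat body that vanish at the
bottom, but w is periodic only below the profile.  So w is restricted to the part
of the cell below the profile, below its traces on the walls and below height d,
and extended from there, with all its integer translates, by the formula of
McShane ([film_extension]); because the profile depends on at most two variables,
two points are compared by crossing at most two walls, and the Lipschitz constant
grows only by a factor three.  The extension u coincides with w except on a set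
of measure at most 3 V ([leb_uncommon]), by a Poincare inequality on the cell and
since the two bodies have the same volume.  There all terms are of order delta.
The first-order term DW(M) : D u contains only lateral derivatives, as DW(M)
annihilates the vertical direction, and the integral of a lateral derivative of a
periodic map over the body below the graph is at most twice the supremum of the
map times V ([integral_derive_le]).  Altogether the elastic energy decreases by
at most C delta V ([elastic_lower]), with C depending only on the flat
configuration and on the height of the reference strip, and C delta <= c a / n
for small delta.

The rest of the file provides the analysis in R^m behind these steps: Lebesgue
measure of boxes and of bodies below graphs, test functions, almost everywhere
differentiability of Lipschitz functions, uniqueness and locality of weak
gradients, and Hausdorff measure of flat pieces through the uniqueness of
translation-invariant measures ([haar]).  Energies are integrals of functions
that may fail to be measurable; they are compared by [le_integral_ae], which
holds for arbitrary functions. *)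

(** * Boxes and the Lebesgue measure of boxes *)

Section boxes.
Context {R : realType}.
Implicit Types m : nat.

Lemma cvP m (x y : 'cV[R]_m) : (forall i, x i ord0 = y i ord0) -> x = y.
Proof. by move=> h; apply/matrixP => i j; rewrite (ord1 j). Qed.

Definition boxes m : set (set 'cV[R]_m) := [set U | exists a b, U = box a b].

Lemma boxI m (a b c e : 'cV[R]_m) : box a b `&` box c e =
  box (\col_i Num.max (a i ord0) (c i ord0)) (\col_i Num.min (b i ord0) (e i ord0)).
Proof.
apply/seteqP; split => z.
  move=> [h1 h2] i; rewrite !mxE ge_max lt_min.
  by have /andP[-> ->] := h1 i; have /andP[-> ->] := h2 i.
by move=> h; split => i; have := h i; rewrite !mxE ge_max lt_min
  => /andP[/andP[h1 h2] /andP[h3 h4]]; apply/andP.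
Qed.

Lemma setI_closed_boxes m : setI_closed (@boxes m).
Proof. by move=> _ _ [a [b ->]] [c [e ->]]; rewrite boxI; eexists; eexists. Qed.

Lemma box_nonempty m (a b : 'cV[R]_m) (z : 'cV[R]_m) : box a b z ->
  forall i, a i ord0 < b i ord0.
Proof. by move=> h i; have /andP[h1 h2] := h i; exact: le_lt_trans h2. Qed.

Lemma box_inj_l m (a b c e : 'cV[R]_m) z : box a b z ->
  box a b `<=` box c e -> forall i, c i ord0 <= a i ord0.
Proof.
move=> abz sub i; have ab := box_nonempty abz.
have /sub/(_ i)/andP[//] : box a b a by move=> j; rewrite lexx ab.
Qed.

Lemma box_inj_r m (a b c e : 'cV[R]_m) z : box a b z ->
  box a b `<=` box c e -> forall i, b i ord0 <= e i ord0.
Proof.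
move=> abz sub i; have ab := box_nonempty abz.
rewrite leNgt; apply/negP => ei.
pose y : 'cV[R]_m := \col_j (if j == i then Num.max (a i ord0) (e i ord0) else a j ord0).
have /sub/(_ i) : box a b y.
  move=> j; rewrite mxE; case: eqP => [->|_]; last by rewrite lexx ab.
  by rewrite le_max lexx gt_max ab ei.
by rewrite mxE eqxx gt_max => /andP[_ /andP[_]]; rewrite ltxx.
Qed.

Lemma box_volumeE m (a b : 'cV[R]_m) : (forall i, a i ord0 <= b i ord0) ->
  box_volume (box a b) = (\prod_i (b i ord0 - a i ord0))%:E.
Proof.
move=> ab; rewrite /box_volume; case: asboolP => [e|ne].
  have [i /eqP ai] : exists i, a i ord0 == b i ord0.
    apply/not_existsP => h.
    suff : box a b a by rewrite e.
    by move=> i; rewrite lexx/= lt_neqAle ab andbT; apply/negP.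
  by rewrite (bigD1 i)//= ai subrr mul0r.
have /eqP/set0P[z abz] := ne.
rewrite (_ : [set _ | _ in _] = [set (\prod_i (b i ord0 - a i ord0))%:E]) ?ereal_inf1//.
apply/seteqP; split => [_ [[c e] /= E <-]|_ ->]; last by exists (a, b).
have cez : box c e z by rewrite -E.
have sub1 : box a b `<=` box c e by rewrite E.
have sub2 : box c e `<=` box a b by rewrite E.
congr (_%:E); apply: eq_bigr => i _; congr (_ - _); apply/eqP; rewrite eq_le.
  by apply/andP; split; [exact: (box_inj_r cez sub2)|exact: (box_inj_r abz sub1)].
by apply/andP; split; [exact: (box_inj_l abz sub1)|exact: (box_inj_l cez sub2)].
Qed.

Lemma box_volume_fin m (U : set 'cV[R]_m) : (box_volume U < +oo)%E -> U !=set0 ->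
  exists a b : 'cV[R]_m, (forall i, a i ord0 < b i ord0) /\ U = box a b.
Proof.
rewrite /box_volume; case: asboolP => [->|_] h [z Uz]; first by case: Uz.
have [[_ [[a b]/= Uab _]]|/set0P/negP/negPn/eqP E] :=
    pselect ([set (\prod_i (p.2 i ord0 - p.1 i ord0))%:E | p in
    [set p : 'cV[R]_m * 'cV[R]_m | U = box p.1 p.2]] !=set0).
  by exists a, b; split => //; apply: (@box_nonempty _ _ _ z); rewrite -Uab.
by move: h; rewrite E ereal_inf0 ltxx.
Qed.

Definition halfspace m (i : 'I_m) (c : R) : set 'cV[R]_m :=
  [set z | z i ord0 < c].

(** A box is cut into two boxes whose volumes add up. *)
Lemma box_volume_half m (U : set 'cV[R]_m) i (c : R) :
  (box_volume (U `&` halfspace i c) +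
   box_volume (U `&` ~` halfspace i c) <= box_volume U)%E.
Proof.
set H := halfspace i c.
have [UH|/set0P[z1 [Uz1 Hz1]]] := eqVneq (U `&` H) set0.
  rewrite UH box_volume0 add0e (_ : U `&` ~` H = U)//.
  apply/seteqP; split => [z []//|z Uz]; split => // Hz.
  by have : (U `&` H) z by []; rewrite UH.
have [UH|/set0P[z2 [Uz2 Hz2]]] := eqVneq (U `&` ~` H) set0.
  rewrite UH box_volume0 adde0 (_ : U `&` H = U)//.
  apply/seteqP; split => [z []//|z Uz]; split => //; apply: contrapT => Hz.
  by have : (U `&` ~` H) z by []; rewrite UH.
have [Uoo|] := ltP (box_volume U) +oo%E; last by rewrite leye_eq => /eqP ->; rewrite leey.
have [a [b [ab Uab]]] := box_volume_fin Uoo (ex_intro _ z1 Uz1).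
pose b' := \col_j (if j == i then c else b j ord0).
pose a' := \col_j (if j == i then c else a j ord0).
have /andP[az1 zb1] : a i ord0 <= z1 i ord0 < b i ord0 by move: Uz1; rewrite Uab.
have /andP[az2 zb2] : a i ord0 <= z2 i ord0 < b i ord0 by move: Uz2; rewrite Uab.
have cz2 : c <= z2 i ord0 by rewrite leNgt; apply/negP.
have UH1 : U `&` H = box a b'.
  rewrite Uab; apply/seteqP; split => z.
    move=> [h1 h2] j; rewrite !mxE; case: eqP => [->|]; rewrite ?h1//.
    by have /andP[-> _] := h1 i.
  move=> h; split => [j|]; last by have := h i; rewrite !mxE eqxx => /andP[].
  have := h j; rewrite !mxE; case: eqP => [->/andP[-> h2]/=|//].
  by rewrite (lt_trans h2)// (le_lt_trans cz2).
have UH2 : U `&` ~` H = box a' b.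
  rewrite Uab; apply/seteqP; split => z.
    move=> [h1 h2] j; rewrite !mxE; case: eqP => [->|]; rewrite ?h1//.
    by have /andP[_ ->] := h1 i; rewrite andbT leNgt; apply/negP.
  move=> h; split => [j|]; last first.
    by have := h i; rewrite !mxE eqxx => /andP[h1 _]; apply/negP; rewrite -leNgt.
  have := h j; rewrite !mxE; case: eqP => [->/andP[h1 ->]/=|//].
  by rewrite andbT (le_trans _ h1)// (le_trans az1)// ltW.
rewrite UH1 UH2 Uab !box_volumeE; last 3 first.
- by move=> j; rewrite ltW.
- move=> j; rewrite !mxE; case: eqP => [->|]; last by rewrite ltW.
  by rewrite (le_trans cz2)// ltW.
- move=> j; rewrite !mxE; case: eqP => [->|]; last by rewrite ltW.
  by rewrite (le_trans az1)// ltW.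
rewrite -EFinD lee_fin (bigD1 i)//= [X in _ + X <= _](bigD1 i)//= [leRHS](bigD1 i)//=.
rewrite !mxE eqxx.
rewrite (eq_bigr (fun j => b j ord0 - a j ord0)); last first.
  by move=> j ji; rewrite !mxE (negbTE ji).
rewrite [X in _ + _ * X <= _](eq_bigr (fun j => b j ord0 - a j ord0)); last first.
  by move=> j ji; rewrite !mxE (negbTE ji).
by rewrite -mulrDl (_ : c - _ + _ = b i ord0 - a i ord0)//; ring.
Qed.

(** Cutting every box of a cover along a hyperplane does not change the cost of
the cover; hence half-spaces split the outer measure additively. *)
Lemma cara_halfspace m (i : 'I_m) (c : R) :
  (@lebesgue_outer R m).-caratheodory (halfspace i c).
Proof.
apply: le_caratheodory_measurable => X.
apply: le_ereal_inf_tmp => _ [U XU <-].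
set H := halfspace i c.
apply: (@le_trans _ _ (\sum_(k <oo) (box_volume (U k `&` H) + box_volume (U k `&` ~` H)))%E).
  rewrite nneseriesD; [|by move=> *; exact: box_volume_ge0..].
  apply: leeD; apply: ereal_inf_lbound.
    exists (fun k => U k `&` H) => //= z [Xz Hz].
    by have [k _ Uk] := XU _ Xz; exists k.
  exists (fun k => U k `&` ~` H) => //= z [Xz Hz].
  by have [k _ Uk] := XU _ Xz; exists k.
apply: lee_nneseries => [k _ _|k _]; last exact: box_volume_half.
by rewrite adde_ge0// box_volume_ge0.
Qed.

End boxes.

Notation cara R m := (caratheodory_type (@lebesgue_outer R m)).

(** Generating by half-open boxes matches the covers that define the Lebesgue
measure; the open sets generate the same sigma-algebra, see [open_bor]. *)
Notation bor R m := (g_sigma_algebraType (@boxes R m)).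

Section borel.
Context {R : realType}.
Implicit Types m : nat.

Lemma measurable_halfspace m (i : 'I_m) (c : R) :
  measurable ([set z | z i ord0 < c] : set (cara R m)).
Proof. exact: cara_halfspace. Qed.

Lemma boxE m (a b : 'cV[R]_m) : box a b = \bigcap_(i in [set: 'I_m])
  (~` [set z | z i ord0 < a i ord0] `&` [set z | z i ord0 < b i ord0]).
Proof.
apply/seteqP; split => z /=.
  move=> h i _ /=; have /andP[h1 h2] := h i; split => //.
  by apply/negP; rewrite -leNgt.
move=> h i; have [/= /negP] := h i I.
by rewrite -leNgt => -> ->.
Qed.

Lemma measurable_box_gen d (X : measurableType d) m (a b : 'cV[R]_m) (f : X -> 'cV[R]_m) :
  (forall i, measurable_fun setT (fun x => f x i ord0)) ->
  measurable (f @^-1` box a b).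
Proof.
move=> mf; rewrite boxE preimage_bigcap; apply: fin_bigcap_measurable => // i _.
rewrite preimage_setI preimage_setC; apply: measurableI.
  apply: measurableC.
  rewrite [X in measurable X](_ : _ = setT `&` (fun x => f x i ord0) @^-1` `]-oo, (a i ord0)[%classic); last first.
    by apply/seteqP; split => x /=; rewrite in_itv/=; [|case].
  exact: (mf i).
rewrite [X in measurable X](_ : _ = setT `&` (fun x => f x i ord0) @^-1` `]-oo, (b i ord0)[%classic); last first.
  by apply/seteqP; split => x /=; rewrite in_itv/=; [|case].
exact: (mf i).
Qed.

Lemma measurable_coordP d (X : measurableType d) (D : set X) (f : X -> R) :
  (forall c, measurable (D `&` [set x | f x < c])) -> measurable_fun D f.
Proof.
move=> h; apply: (measurability _ (RGenInftyO.measurableE R)) => // _ [_ [c ->] <-].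
by rewrite [X in D `&` X](_ : _ = [set x | f x < c]).
Qed.

Lemma measurable_coord_cara m (i : 'I_m) :
  measurable_fun setT (fun z : cara R m => (z i ord0 : R)).
Proof. by apply: measurable_coordP => c; rewrite setTI; exact: measurable_halfspace. Qed.

Lemma box_bor m (a b : 'cV[R]_m) : measurable (box a b : set (bor R m)).
Proof. by apply: sub_sigma_algebra; exists a, b. Qed.

Lemma measurable_coord_bor m (i : 'I_m) :
  measurable_fun setT (fun z : bor R m => (z i ord0 : R)).
Proof.
apply: measurable_coordP => c; rewrite setTI.
pose b k : 'cV[R]_m := \col_j (if j == i then c else k%:R).
rewrite (_ : [set _ | _] = \bigcup_k box (- const_mx k%:R) (b k)); last first.
  apply/seteqP; split => [z /= zc|z [k _ /(_ i)]]; last by rewrite !mxE eqxx => /andP[].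
  exists (\max_j (Num.Def.archi_bound `|z j ord0|)) => //= j.
  have := @leq_bigmax _ (fun j => Num.Def.archi_bound `|z j ord0|) j => /=.
  set K := (\max_j _)%N; set kj := Num.Def.archi_bound _ => kj_le.
  have /andP[h1 h2] : - K%:R < z j ord0 < K%:R.
    rewrite -ltr_norml; apply: (@lt_le_trans _ _ kj%:R); last by rewrite ler_nat.
    exact: archi_boundP.
  by rewrite !mxE (ltW h1)/=; case: eqP => [->|].
by apply: bigcup_measurable => k _; exact: box_bor.
Qed.

Lemma measurable_borE m : (measurable : set (set (bor R m))) = <<s @boxes R m >>.
Proof. by []. Qed.

Lemma measurable_bor d (X : measurableType d) m (f : X -> bor R m) :
  (forall i, measurable_fun setT (fun x => f x i ord0)) -> measurable_fun setT f.
Proof.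
move=> mf; apply: (measurability _ (@measurable_borE m)) => _ [_ [a [b ->]] <-].
by rewrite setTI; exact: measurable_box_gen.
Qed.

Lemma measurable_cara_bor m : measurable_fun setT (id : cara R m -> bor R m).
Proof. by apply: measurable_bor => i; exact: measurable_coord_cara. Qed.

Lemma bor_cara m (E : set (bor R m)) : measurable E -> measurable (E : set (cara R m)).
Proof. by move=> mE; rewrite -[E]setTI; exact: measurable_cara_bor. Qed.

Lemma box_cara m (a b : 'cV[R]_m) : measurable (box a b : set (cara R m)).
Proof. by apply: bor_cara; exact: box_bor. Qed.

Lemma hpartE n (z : 'cV[R]_n.+1) i : hpart z i ord0 = z (lift ord_max i) ord0.
Proof. by rewrite mxE. Qed.

Lemma pt_lift n (x : 'cV[R]_n) y i : pt x y (lift ord_max i) ord0 = x i ord0.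
Proof. by rewrite mxE liftK. Qed.

Lemma pt_max n (x : 'cV[R]_n) y : pt x y ord_max ord0 = y.
Proof. by rewrite mxE unlift_none. Qed.

Lemma hpart_pt n (x : 'cV[R]_n) y : hpart (pt x y) = x.
Proof. by apply: cvP => i; rewrite hpartE pt_lift. Qed.

Lemma vpart_pt n (x : 'cV[R]_n) y : vpart (pt x y) = y.
Proof. exact: pt_max. Qed.

Lemma pt_hv n (z : 'cV[R]_n.+1) : pt (hpart z) (vpart z) = z.
Proof.
by apply: cvP => i; case: (unliftP ord_max i) => [j ->|->]; [by rewrite pt_lift hpartE|rewrite pt_max].
Qed.

Lemma box_pt n (a b : 'cV[R]_n.+1) (x : 'cV[R]_n) y : box a b (pt x y) <->
  box (hpart a) (hpart b) x /\ vpart a <= y < vpart b.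
Proof.
split => [h|[h1 h2] i].
  split => [i|]; first by have := h (lift ord_max i); rewrite pt_lift !hpartE.
  by have := h ord_max; rewrite pt_max.
case: (unliftP ord_max i) => [j ->|->]; last by rewrite pt_max.
by rewrite pt_lift; have := h1 j; rewrite !hpartE.
Qed.

Lemma measurable_pt d (X : measurableType d) n (f : X -> 'cV[R]_n) (g : X -> R) :
  (forall i, measurable_fun setT (fun x => f x i ord0)) -> measurable_fun setT g ->
  measurable_fun setT (fun x => pt (f x) (g x) : bor R n.+1).
Proof.
move=> mf mg; apply: measurable_bor => i.
case: (unliftP ord_max i) => [j ->|->].
  by rewrite (_ : (fun _ => _) = fun x => f x j ord0)//; apply/funext => x; rewrite pt_lift.
by rewrite (_ : (fun _ => _) = g)//; apply/funext => x; rewrite pt_max.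
Qed.

Lemma leb_box_le m (a b : 'cV[R]_m) : (leb m (box a b) <= box_volume (box a b))%E.
Proof.
apply: ereal_inf_lbound; exists (fun k => if k == 0%N then box a b else set0).
  by move=> z ?; exists 0%N.
rewrite (nneseries_split 0%N 1%N); last by move=> k _; exact: box_volume_ge0.
rewrite big_nat1/= eseries0 ?adde0//.
by move=> k /= k1 _; case: eqP k1 => [->//|_ _]; exact: box_volume0.
Qed.

Lemma leb_box_lt_pinfty m (a b : 'cV[R]_m) : (leb m (box a b) < +oo)%E.
Proof.
have [[z abz]|/set0P/negP/negPn/eqP ->] := pselect (box a b !=set0); last by rewrite measure0.
apply: le_lt_trans (leb_box_le _ _) _; rewrite box_volumeE ?ltry// => i.
by rewrite ltW// (box_nonempty abz).
Qed.

End borel.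


Section product.
Context {R : realType}.
Variable n : nat.
Local Open Scope ereal_scope.

Lemma measurable_ptp :
  measurable_fun setT (fun p : cara R n * measurableTypeR R => pt (p.1 : 'cV[R]_n) p.2 : bor R n.+1).
Proof.
apply: measurable_pt => [i|]; last exact: measurable_snd.
exact: (measurableT_comp (@measurable_coord_cara R n i) measurable_fst).
Qed.

(** Its values on boxes follow from those in one dimension less, which gives the
volume of boxes by induction. *)
Definition sliced : {measure set (bor R n.+1) -> \bar R} :=
  measure_function_pushforward__canonical__measure_function_Measure
    (leb n \x lebesgue_measure)%E measurable_ptp.

Lemma slicedE (E : set (bor R n.+1)) :
  sliced E = \int[leb n]_x lebesgue_measure [set y : R | E (pt x y)].
Proof.
by apply: eq_integral => x _ /=; congr (lebesgue_measure _);
   apply/seteqP; split => y; rewrite /xsection/= inE.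
Qed.

Lemma sliced_box (a b : 'cV[R]_n.+1) : (forall i, a i ord0 <= b i ord0)%R ->
  sliced (box a b) = leb n (box (hpart a) (hpart b)) * (vpart b - vpart a)%:E.
Proof.
move=> ab; rewrite /sliced/= /pushforward.
rewrite (_ : _ @^-1` _ = (box (hpart a) (hpart b) : set (cara R n)) `*` `[vpart a, vpart b[%classic).
  rewrite (product_measure1E (leb n) lebesgue_measure)//; last exact: box_cara.
  transitivity (leb n (box (hpart a) (hpart b)) * (if (vpart a)%:E < (vpart b)%:E
      then (vpart b)%:E - (vpart a)%:E else 0)).
    by congr (_ * _); exact: lebesgue_measure_itv.
  rewrite lte_fin; case: ltP => // h.
  by congr (_ * _%:E); apply/esym/eqP; rewrite subr_eq0 eq_le h ab.
apply/seteqP; split => -[x y] /=.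
  by move=> /box_pt[h1 h2]; split => //; rewrite in_itv.
by rewrite in_itv/= => -[h1 h2]; apply/box_pt.
Qed.

End product.

Section lebesgue_box.
Context {R : realType}.
Local Open Scope ereal_scope.

Lemma nneseries_fin_lt (u : (\bar R)^nat) : (forall k, 0 <= u k) ->
  \sum_(k <oo) u k < +oo -> forall k, u k < +oo.
Proof.
move=> u0 soo k; apply: le_lt_trans soo.
rewrite (nneseries_split 0%N k.+1); last by move=> *; exact: u0.
rewrite add0n big_nat_recr//= -addeA addeCA; apply: leeDl.
by apply: adde_ge0; [apply: sume_ge0|apply: nneseries_ge0].
Qed.

Definition leb_bor m : {measure set (bor R m) -> \bar R} :=
  measure_function_pushforward__canonical__measure_function_Measure
    (leb m) (@measurable_cara_bor R m).

Lemma leb_borE m (E : set (bor R m)) : leb_bor m E = leb m E.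
Proof. by []. Qed.

(** Both measures are compared on an arbitrary cover by boxes. *)
Lemma measure_le_leb m (mu : {measure set (bor R m) -> \bar R}) (c : R) : (0 < c)%R ->
  (forall a b : 'cV[R]_m, (forall i, a i ord0 <= b i ord0)%R ->
     mu (box a b) <= (c * \prod_i (b i ord0 - a i ord0))%:E) ->
  forall E : set (bor R m), measurable E -> mu E <= c%:E * leb m E.
Proof.
move=> c0 mubox E mE; rewrite -ereal_inf_pZl//.
apply: le_ereal_inf_tmp => _ [_ [U EU <-] <-].
have U0 k : 0 <= box_volume (U k) by exact: box_volume_ge0.
have [soo|] := ltP (\sum_(k <oo) box_volume (U k)) +oo; last first.
  by rewrite leye_eq => /eqP ->; rewrite gt0_muley ?lte_fin// leey.
have Ubox k : U k = set0 \/ exists a b : 'cV[R]_m,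
    (forall i, a i ord0 < b i ord0)%R /\ U k = box a b.
  have [|/set0P/negP/negPn/eqP] := pselect (U k !=set0); last by left.
  by right; apply: box_volume_fin => //; exact: (nneseries_fin_lt U0).
rewrite -nneseriesZl//.
apply: (@le_trans _ _ (\sum_(k <oo) mu (U k))).
  apply: measure_sigma_subadditive => // k.
  by have [->|[a [b [_ ->]]]] := Ubox k; [exact: measurable0|exact: box_bor].
apply: lee_nneseries => [k _ _|k _]; first exact: measure_ge0.
have [->|[a [b [ab ->]]]] := Ubox k; first by rewrite measure0 box_volume0 mule0.
by rewrite box_volumeE ?mubox// => i; rewrite ltW.
Qed.

Lemma big_ord_lift_max n (F : 'I_n.+1 -> R) :
  (\prod_i F i = (\prod_i F (lift ord_max i)) * F ord_max)%R.
Proof.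
rewrite big_ord_recr/=; congr (_ * _)%R; apply: eq_bigr => i _; congr (F _).
by apply/val_inj => /=; rewrite /bump leqNgt ltn_ord.
Qed.

(** Slicing gives the exact value by induction on the dimension: the sliced
measure is a measure with the right values on boxes, hence a lower bound for
every cover. *)
Lemma leb_box m (a b : 'cV[R]_m) : (forall i, a i ord0 <= b i ord0)%R ->
  leb m (box a b) = (\prod_i (b i ord0 - a i ord0))%:E.
Proof.
elim: m a b => [a b _|n IH a b ab].
  rewrite big_ord0; apply/eqP; rewrite eq_le; apply/andP; split.
    by apply: le_trans (leb_box_le _ _) _; rewrite box_volumeE ?big_ord0// => -[].
  apply: le_ereal_inf_tmp => _ [U abU <-].
  have [k _ Uk] : (\bigcup_k U k) a by apply: abU => -[].
  have UT : U k = box a b by apply/seteqP; split => [z _ []//|z _]; rewrite (_ : z = a)//; apply: cvP => -[].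
  apply: (@le_trans _ _ (box_volume (U k))).
    by rewrite UT box_volumeE ?big_ord0// => -[].
  rewrite (nneseries_split 0%N k.+1); last by move=> *; exact: box_volume_ge0.
  rewrite add0n big_nat_recr//= -addeA addeCA; apply: leeDl.
  by apply: adde_ge0; [apply: sume_ge0|apply: nneseries_ge0] => *; exact: box_volume_ge0.
have sb (c e : 'cV[R]_n.+1) : (forall i, c i ord0 <= e i ord0)%R ->
    sliced n (box c e) = (\prod_i (e i ord0 - c i ord0))%:E.
  move=> ce; rewrite sliced_box// IH => [|i]; last by rewrite !hpartE.
  rewrite -EFinM big_ord_lift_max; congr (_ * _)%:E.
  by apply: eq_bigr => i _; rewrite !hpartE.
apply/eqP; rewrite eq_le; apply/andP; split.
  by apply: le_trans (leb_box_le _ _) _; rewrite box_volumeE.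
rewrite -sb// -[leRHS]mul1e; apply: (@measure_le_leb _ _ 1) => //; last exact: box_bor.
by move=> c e ce; rewrite sb// mul1r.
Qed.

Lemma bigcup_box m : \bigcup_k box (- const_mx k%:R : 'cV[R]_m) (const_mx k%:R) = setT.
Proof.
rewrite -subTset => z _.
exists (\max_j (Num.Def.archi_bound `|z j ord0|)) => //= j.
have := @leq_bigmax _ (fun j => Num.Def.archi_bound `|z j ord0|) j => /=.
set K := (\max_j _)%N; set kj := Num.Def.archi_bound _ => kj_le.
have /andP[h1 h2] : (- K%:R < z j ord0 < K%:R)%R.
  rewrite -ltr_norml; apply: (@lt_le_trans _ _ kj%:R); last by rewrite ler_nat.
  exact: archi_boundP.
by rewrite !mxE (ltW h1) h2.
Qed.

(** Boxes are stable under intersection and large boxes exhaust the space. *)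
Lemma measure_bor_unique m (mu nu : {measure set (bor R m) -> \bar R}) :
  (forall a b : 'cV[R]_m, (forall i, a i ord0 <= b i ord0)%R -> mu (box a b) = nu (box a b)) ->
  (forall k : nat, mu (box (- const_mx k%:R) (const_mx k%:R)) < +oo) ->
  forall E : set (bor R m), measurable E -> mu E = nu E.
Proof.
move=> munu fin; apply: (measure_unique _ _ (@measurable_borE R m) _ _ (@bigcup_box m)) => //.
- exact: setI_closed_boxes.
- by move=> k; eexists; eexists.
- move=> _ [a [b ->]].
  have [[z abz]|/set0P/negP/negPn/eqP ->] := pselect (box a b !=set0); last by rewrite !measure0.
  by apply: munu => i; rewrite ltW// (box_nonempty abz).
Qed.

Lemma leb_sliced n (E : set (bor R n.+1)) : measurable E -> leb n.+1 E = sliced n E.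
Proof.
move=> mE; rewrite -leb_borE; apply: measure_bor_unique => // [a b ab|k]; last exact: leb_box_lt_pinfty.
rewrite sliced_box// leb_borE !leb_box// => [|i]; last by rewrite !hpartE.
rewrite -EFinM big_ord_lift_max; congr (_ * _)%:E.
by apply: eq_bigr => i _; rewrite !hpartE.
Qed.

End lebesgue_box.

(** * Borel sets, translations and Borel hulls *)

Section opens.
Context {R : realType}.
Implicit Types m : nat.

Lemma cv_coord_norm m (z : 'cV[R]_m) i : `|z i ord0| <= `|z|.
Proof.
rewrite /Num.norm/= mx_normrE; apply: (le_trans _ (le_bigmax _ _ (i, ord0))) => //.
Qed.

Lemma cv_norm_le m (z : 'cV[R]_m) e : 0 <= e -> (forall i, `|z i ord0| <= e) -> `|z| <= e.
Proof.
move=> e0 h; rewrite [leLHS]/Num.norm/= mx_normrE; apply: bigmax_le => // -[i j] _ /=.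
by rewrite (ord1 j).
Qed.

Lemma cv_norm_lt m (z : 'cV[R]_m) e : 0 < e -> (forall i, `|z i ord0| < e) -> `|z| < e.
Proof.
move=> e0 h; rewrite [ltLHS]/Num.norm/= mx_normrE; apply: bigmax_lt => // -[i j] _ /=.
by rewrite (ord1 j).
Qed.

Lemma cv_nbhs_ball m (U : set 'cV[R]_m) (z : 'cV[R]_m) : nbhs z U ->
  exists2 e : R, 0 < e & forall y, `|z - y| < e -> U y.
Proof.
by move=> /nbhs_ballP[e e0 h]; exists e => // y zy; apply: h; rewrite mx_norm_ball.
Qed.

(** Every open set is the union of the boxes with rational corners that it
contains. *)
Lemma open_bor m (U : set 'cV[R]_m) : open U -> measurable (U : set (bor R m)).
Proof.
move=> oU.
pose F (p : 'cV[rat]_m * 'cV[rat]_m) : set (bor R m) :=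
  if `[< box (map_mx ratr p.1) (map_mx ratr p.2) `<=` U >]
  then box (map_mx ratr p.1) (map_mx ratr p.2) else set0.
have -> : U = \bigcup_p F p.
  apply/seteqP; split => [z Uz|z [p _]]; last by rewrite /F; case: asboolP => // h /h.
  have [e e0 zU] := cv_nbhs_ball (open_nbhs_nbhs (conj oU Uz)).
  have /choice[p hp] : forall i, exists q : rat, ratr q \in `]z i ord0 - e, z i ord0[.
    by move=> i; apply: rat_in_itvoo; rewrite gtrBl.
  have /choice[q hq] : forall i, exists q : rat, ratr q \in `]z i ord0, z i ord0 + e[.
    by move=> i; apply: rat_in_itvoo; rewrite ltrDl.
  exists (\col_i p i, \col_i q i) => //; rewrite /F/=.
  case: asboolP => [_ i|[]].
    have := hp i; have := hq i; rewrite !mxE !in_itv/= => /andP[-> _] /andP[_ h].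
    by rewrite ltW.
  move=> y hy; apply: zU; apply: cv_norm_lt => // i; rewrite !mxE ltr_distlC.
  have := hy i; have := hp i; have := hq i; rewrite !mxE !in_itv/=.
  move=> /andP[_ h1] /andP[h2 _] /andP[h3 h4].
  by rewrite (lt_le_trans h2 h3) (lt_trans h4 h1).
apply: countable_bigcupT_measurable => [|p]; first exact: countableP.
by rewrite /F; case: asboolP => _; [exact: box_bor|exact: measurable0].
Qed.

Lemma closed_bor m (U : set 'cV[R]_m) : closed U -> measurable (U : set (bor R m)).
Proof.
move=> cU; rewrite -[U]setCK; apply: measurableC; apply: open_bor.
by rewrite openC.
Qed.

Lemma open_cara m (U : set 'cV[R]_m) : open U -> measurable (U : set (cara R m)).
Proof. by move=> oU; apply: bor_cara; exact: open_bor. Qed.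

Lemma closed_cara m (U : set 'cV[R]_m) : closed U -> measurable (U : set (cara R m)).
Proof. by move=> oU; apply: bor_cara; exact: closed_bor. Qed.

Lemma continuous_bor m (f : 'cV[R]_m -> R) : continuous f ->
  measurable_fun setT (f : bor R m -> R).
Proof.
move=> /continuousP cf; apply: measurable_coordP => c; rewrite setTI.
apply: open_bor; rewrite (_ : [set _ | _] = f @^-1` [set y | y < c])//.
by apply: cf; exact: open_lt.
Qed.

Lemma bor_measurable_cara m d (Y : measurableType d) (f : bor R m -> Y) :
  measurable_fun setT f -> measurable_fun setT (f : cara R m -> Y).
Proof. by move=> mf; apply: (measurableT_comp mf); exact: measurable_cara_bor. Qed.

Lemma continuous_cara m (f : 'cV[R]_m -> R) : continuous f ->
  measurable_fun setT (f : cara R m -> R).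
Proof. by move=> cf; apply: bor_measurable_cara; exact: continuous_bor. Qed.

End opens.

Section translations.
Context {R : realType}.
Variable m : nat.
Implicit Types (v : 'cV[R]_m) (E : set 'cV[R]_m).
Local Open Scope ereal_scope.

Definition translate v : 'cV[R]_m -> 'cV[R]_m := fun z => (z + v)%R.

Lemma translate_box v (a b : 'cV[R]_m) :
  translate v @^-1` box a b = box (a - v)%R (b - v)%R.
Proof.
apply/seteqP; split => z h i; have := h i; rewrite !mxE.
  by rewrite lerBlDr ltrBrDr.
by rewrite lerBlDr ltrBrDr.
Qed.

Lemma box_volume_translate v U : box_volume (translate v @^-1` U) <= box_volume U.
Proof.
have [h|] := ltP (box_volume U) +oo; last by rewrite leye_eq => /eqP ->; rewrite leey.
have [/(box_volume_fin h)[a [b [ab ->]]]|/set0P/negP/negPn/eqP ->] := pselect (U !=set0); last first.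
  by rewrite preimage_set0.
rewrite translate_box !box_volumeE => [||i]; last 2 first.
- by move=> i; rewrite ltW.
- by rewrite !mxE lerD2r ltW.
rewrite lee_fin (eq_bigr (fun i => b i ord0 - a i ord0)%R)// => i _.
by rewrite !mxE; ring.
Qed.

Lemma lebesgue_outer_translate v E : lebesgue_outer (translate v @^-1` E) = lebesgue_outer E.
Proof.
have le w F : lebesgue_outer (translate w @^-1` F) <= lebesgue_outer F.
  apply: le_ereal_inf_tmp => _ [U FU <-].
  apply: (@le_trans _ _ (\sum_(k <oo) box_volume (translate w @^-1` U k))).
    apply: ereal_inf_lbound; exists (fun k => translate w @^-1` U k) => //= z /FU[k _ Uk].
    by exists k.
  by apply: lee_nneseries => [k _ _|k _]; [exact: box_volume_ge0|exact: box_volume_translate].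
apply/eqP; rewrite eq_le le/=; apply: le_trans (le (- v)%R _).
rewrite (_ : _ @^-1` _ = E)//.
by apply/seteqP; split => z /=; rewrite /translate subrK.
Qed.

Lemma measurable_translate v : measurable_fun setT (translate v : cara R m -> cara R m).
Proof.
move=> _ E mE; rewrite setTI.
suff : (@lebesgue_outer R m).-caratheodory (translate v @^-1` E) by [].
have {}mE : (@lebesgue_outer R m).-caratheodory E by [].
move=> X.
have XE : X = translate v @^-1` (translate (- v)%R @^-1` X).
  by apply/seteqP; split => z /=; rewrite /translate addrK.
rewrite [in LHS]XE lebesgue_outer_translate [LHS]mE.
rewrite -(lebesgue_outer_translate v) -[X in _ + X](lebesgue_outer_translate v).
by rewrite !preimage_setI -XE.
Qed.

Lemma pushforward_translate v : pushforward (leb m) (translate v : cara R m -> cara R m) = leb m.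
Proof. by apply/funext => E; rewrite /pushforward; exact: lebesgue_outer_translate. Qed.

Lemma ge0_integral_translate v (D : set (cara R m)) (f : cara R m -> \bar R) :
  measurable D -> measurable_fun D f -> (forall z, D z -> 0 <= f z) ->
  \int[leb m]_(z in translate v @^-1` D) f (z + v)%R = \int[leb m]_(z in D) f z.
Proof.
move=> mD mf f0.
have := @ge0_integral_pushforward _ _ _ _ _ _ (measurable_translate v) (leb m) D f mD mf.
move=> <-; last by move=> z; rewrite inE; exact: f0.
apply: (@eq_measure_integral _ _ _ D (leb m)
  (measure_function_pushforward__canonical__measure_function_Measure
    (leb m) (measurable_translate v))) => A mA AD.
exact: (congr1 (fun h => h A) (pushforward_translate v)).
Qed.

Lemma integral_translate v (D : set (cara R m)) (f : cara R m -> \bar R) :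
  measurable D -> measurable_fun setT f ->
  (leb m).-integrable (translate v @^-1` D) (f \o translate v) ->
  \int[leb m]_(z in translate v @^-1` D) f (z + v)%R = \int[leb m]_(z in D) f z.
Proof.
move=> mD mf intf.
rewrite -(@integral_pushforward _ _ _ _ _ _ (measurable_translate v) (leb m) D f mf intf mD).
apply: (@eq_measure_integral _ _ _ D (leb m)
  (measure_function_pushforward__canonical__measure_function_Measure
    (leb m) (measurable_translate v))) => A mA AD.
exact: (congr1 (fun h => h A) (pushforward_translate v)).
Qed.

End translations.

Section hull.
Context {R : realType}.
Variable m : nat.
Local Open Scope ereal_scope.

Lemma leb_cover (E : set 'cV[R]_m) (e : R) : leb m E < +oo -> (0 < e)%R ->
  exists2 B : set (bor R m), measurable B & E `<=` B /\ leb m B <= leb m E + e%:E.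
Proof.
move=> Eoo e0.
have Efin : leb m E \is a fin_num by rewrite ge0_fin_numE// outer_measure_ge0.
have := lb_ereal_inf_adherent e0 Efin => -[_ [U EU <-] Ue].
have U0 k : 0 <= box_volume (U k) by exact: box_volume_ge0.
have soo : \sum_(k <oo) box_volume (U k) < +oo.
  by apply: lt_trans Ue _; rewrite lte_add_pinfty// ltry.
have mU k : measurable (U k : set (bor R m)).
  have [|/set0P/negP/negPn/eqP ->] := pselect (U k !=set0); last exact: measurable0.
  by move/(box_volume_fin (nneseries_fin_lt U0 soo k)) => [a [b [_ ->]]]; exact: box_bor.
exists (\bigcup_k U k); first exact: bigcup_measurable.
split => //; apply: le_trans (ltW Ue).
by apply: ereal_inf_lbound; exists U.
Qed.

(** Intersect covers whose costs approach the outer measure. *)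
Lemma leb_hull (E : set 'cV[R]_m) : leb m E < +oo ->
  exists2 B : set (bor R m), measurable B & E `<=` B /\ leb m B = leb m E.
Proof.
move=> Eoo.
have Efin : leb m E \is a fin_num by rewrite ge0_fin_numE// outer_measure_ge0.
have /choice[B hB] : forall k, exists B : set (bor R m), [/\ measurable B, E `<=` B &
    leb m B <= leb m E + (k.+1%:R^-1)%:E].
  move=> k; have [|B mB [EB Be]] := leb_cover Eoo (e := k.+1%:R^-1); first by rewrite invr_gt0.
  by exists B.
exists (\bigcap_k B k); first by apply: bigcap_measurable => [|k _]; [exists 0%N|have [] := hB k].
have EB : E `<=` \bigcap_k B k by move=> z Ez k _; have [_ h _] := hB k; exact: h.
split => //; apply/eqP; rewrite eq_le; apply/andP; split; last exact: le_outer_measure.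
apply/lee_addgt0Pr => e e0.
have [k ke] : exists k : nat, (k.+1%:R^-1 <= e :> R)%R.
  exists (Num.Def.archi_bound e^-1); rewrite invf_ple ?posrE// ltW//.
  apply: lt_le_trans (archi_boundP _) _; first by rewrite invr_ge0 ltW.
  by rewrite ler_nat.
apply: (@le_trans _ _ (leb m (B k))); first by apply: le_outer_measure => z; apply.
have [_ _ h] := hB k; apply: le_trans h _.
by rewrite leeD2l// lee_fin.
Qed.

Lemma leb_null_hull (N : set 'cV[R]_m) : leb m N = 0 ->
  exists2 B : set (bor R m), measurable B & N `<=` B /\ leb m B = 0.
Proof. by move=> N0; have [|B mB] := leb_hull (E := N); rewrite N0 ?ltry//; exists B. Qed.

Lemma leb_negligibleP (N : set 'cV[R]_m) : (leb m).-negligible N <-> leb m N = 0.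
Proof.
split => [[B [mB B0 NB]]|N0].
  by apply/eqP; rewrite eq_le outer_measure_ge0 andbT -B0; exact: le_outer_measure.
have [B mB [NB B0]] := leb_null_hull N0.
by exists B; split => //; exact: bor_cara.
Qed.

Lemma leb_null_cara (N : set 'cV[R]_m) : leb m N = 0 -> measurable (N : set (cara R m)).
Proof. by move=> N0; apply: measure_is_complete_caratheodory; exact/leb_negligibleP. Qed.

End hull.

(** * Integrals of arbitrary functions, and averaging over translations *)

Section integral_ae.
Local Open Scope ereal_scope.
Context d (T : measurableType d) (R : realType) (mu : {measure set T -> \bar R}).
Import HBNNSimple.
Implicit Types (D : set T) (f g : T -> \bar R).

Let nnint f := ereal_sup [set sintegral mu h |
  h in [set h : {nnsfun T >-> R} | forall x, (h x)%:E <= f x]].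

Let le_nnint_ae f g : (forall x, 0 <= g x) ->
  {ae mu, forall x, f x <= g x} -> nnint f <= nnint g.
Proof.
move=> g0 [N [mN N0 Nfg]]; apply: ge_ereal_sup => _ [h /= hf <-].
pose k := proj_nnsfun h (measurableC mN).
have -> : sintegral mu h = sintegral mu k.
  rewrite -!integralT_nnsfun; apply: ae_eq_integral => //.
  - by apply/measurable_EFinP; exact: measurable_funPT.
  - by apply/measurable_EFinP; exact: measurable_funPT.
  - exists N; split => // x /=; apply: contra_notP => Nx _.
    by rewrite /k/= mindicE mem_set// mulr1.
apply: ereal_sup_ubound; exists k => // x.
rewrite /k/= mindicE; have [Nx|Nx] := pselect (N x).
  by rewrite memNset ?mulr0//; apply/negP; rewrite negbK; exact/mem_set.
rewrite mem_set// mulr1; apply: le_trans (hf x) _.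
by apply: contrapT => /Nfg.
Qed.

(** The integral of a function is a difference of two suprema over simple
functions, so it is monotone almost everywhere without any measurability. *)
Lemma le_integral_ae D f g : {ae mu, forall x, D x -> f x <= g x} ->
  \int[mu]_(x in D) f x <= \int[mu]_(x in D) g x.
Proof.
move=> [N [mN N0 Nfg]]; rewrite /integral; apply: leeB.
  apply: le_nnint_ae => [x|]; first by rewrite ?funepos_ge0 ?funeneg_ge0.
  exists N; split => // x /= h; apply: Nfg => /= h'; apply: h.
  rewrite !funeposE /patch; case: ifPn => // /set_mem/h' fg.
  by rewrite ge_max !le_max fg lexx orbT.
apply: le_nnint_ae => [x|]; first by rewrite ?funepos_ge0 ?funeneg_ge0.
exists N; split => // x /= h; apply: Nfg => /= h'; apply: h.
rewrite !funenegE /patch; case: ifPn => // /set_mem/h' fg.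
by rewrite ge_max !le_max leeN2 fg lexx orbT.
Qed.

Lemma eq_integral_ae D f g : {ae mu, forall x, D x -> f x = g x} ->
  \int[mu]_(x in D) f x = \int[mu]_(x in D) g x.
Proof.
move=> h; apply/eqP; rewrite eq_le.
by apply/andP; split; apply: le_integral_ae; apply: filterS h => x /[apply] ->.
Qed.

End integral_ae.

Section lebesgue_sigma_finite.
Context {R : realType}.
Variable m : nat.

Lemma sigma_finite_leb : sigma_finite setT (leb m : set (cara R m) -> \bar R).
Proof.
exists (fun k => box (- const_mx k%:R) (const_mx k%:R)); first by rewrite bigcup_box.
by move=> k; split; [exact: box_cara|exact: leb_box_lt_pinfty].
Qed.

(** A copy of the Lebesgue measure that can carry the sigma-finiteness needed to
exchange integrals. *)
Definition leb_sf : set (cara R m) -> \bar R := leb m.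

HB.instance Definition _ := isMeasure.Build _ _ _ leb_sf (measure0 (leb m))
  (measure_ge0 (leb m)) (@measure_semi_sigma_additive _ _ _ (leb m)).

HB.instance Definition _ := @Measure_isSigmaFinite.Build _ _ _ leb_sf sigma_finite_leb.

End lebesgue_sigma_finite.
Arguments leb_sf {R} m.

Section averaging.
Context {R : realType}.
Variable m : nat.
Local Open Scope ereal_scope.

(** Average the measures of the translates along the direction and exchange the
integrals. *)
Lemma leb0_lines (v : 'cV[R]_m) (N : set (bor R m)) : measurable N ->
  (forall x : 'cV[R]_m, lebesgue_measure [set t : R | N (x + t *: v)%R] = 0) ->
  leb m N = 0.
Proof.
move=> mN N0.
pose phi (p : cara R m * measurableTypeR R) : bor R m := (p.1 + p.2 *: v)%R.
have mphi : measurable_fun setT phi.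
  apply: measurable_bor => i.
  rewrite (_ : (fun _ => _) = fun p : cara R m * measurableTypeR R =>
    (p.1 : 'cV[R]_m) i ord0 + p.2 * v i ord0)%R; last by apply/funext => p; rewrite !mxE.
  apply: measurable_funD.
    exact: (measurableT_comp (@measurable_coord_cara R m i) measurable_fst).
  by apply: measurable_funM; [exact: measurable_snd|exact: measurable_cst].
pose A := phi @^-1` N.
have mA : measurable A by rewrite -[A]setTI; exact: mphi.
have A1 : (leb_sf m \x lebesgue_measure) A = 0.
  rewrite [LHS]/product_measure1; apply: integral0_eq => x _ /=.
  rewrite -(N0 x); congr (lebesgue_measure _).
  by apply/seteqP; split => t; rewrite /xsection/= inE.
have := @product_measure_unique _ _ _ _ R (leb_sf m) lebesgue_measure
  (leb_sf m \x^ lebesgue_measure) (product_measure2E _ _) A mA.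
rewrite A1 => E1.
have E2 : (leb_sf m \x^ lebesgue_measure) A = \int[lebesgue_measure]_t (cst (leb m N) t).
  apply: eq_integral => t _ /=; rewrite -(lebesgue_outer_translate (t *: v)).
  by congr (lebesgue_outer _); apply/seteqP; split => x; rewrite /ysection/= inE.
have := etrans E1 E2.
rewrite integral_cst//= => /esym/eqP; rewrite mule_eq0 => /orP[/eqP//|/eqP R0].
have : lebesgue_measure (`]0%R, 1%R[%classic : set R) <= lebesgue_measure (setT : set R).
  by apply: le_measure => //; rewrite inE.
by rewrite R0 lebesgue_measure_itv/= lte01 oppr0 adde0 leNgt lte01.
Qed.

End averaging.

Section subgraph.
Context {R : realType}.
Variable n : nat.
Local Open Scope ereal_scope.

Lemma measurable_between (D : set (bor R n)) (f g : 'cV[R]_n -> R) :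
  measurable D -> continuous f -> continuous g ->
  measurable ([set z | D (hpart z) /\ (f (hpart z) < vpart z < g (hpart z))%R] : set (bor R n.+1)).
Proof.
move=> mD cf cg.
have mh : measurable_fun setT (fun z : bor R n.+1 => hpart z : bor R n).
  apply: measurable_bor => i; rewrite (_ : (fun _ => _) = fun z : bor R n.+1 => z (lift ord_max i) ord0).
    exact: measurable_coord_bor.
  by apply/funext => z; rewrite hpartE.
have mv : measurable_fun setT (fun z : bor R n.+1 => vpart z : R) by exact: measurable_coord_bor.
have mf := measurableT_comp (continuous_bor cf) mh.
have mg := measurableT_comp (continuous_bor cg) mh.
rewrite (_ : [set _ | _] = (setT `&` (fun z : bor R n.+1 => hpart z : bor R n) @^-1` D) `&`
   ((setT `&` (fun z : bor R n.+1 => (f (hpart z) < vpart z)%R) @^-1` [set true]) `&`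
   (setT `&` (fun z : bor R n.+1 => (vpart z < g (hpart z))%R) @^-1` [set true]))); last first.
  apply/seteqP; split => z /=; last by move=> [[_ Dz] [[_ ->] [_ ->]]].
  by move=> [Dz /andP[-> ->]].
apply: measurableI; first exact: mh.
by apply: measurableI; exact: measurable_fun_ltr.
Qed.

(** Vertical sections are intervals. *)
Lemma leb_between (D : set (bor R n)) (f g : 'cV[R]_n -> R) :
  measurable D -> continuous f -> continuous g ->
  leb n.+1 [set z | D (hpart z) /\ (f (hpart z) < vpart z < g (hpart z))%R] =
  \int[leb n]_(x in D) (Num.max (g x - f x) 0)%:E.
Proof.
move=> mD cf cg; rewrite leb_sliced; last exact: measurable_between.
rewrite slicedE [RHS]integral_mkcond; apply: eq_integral => x _ /=.
rewrite /patch; case: ifPn => [/set_mem Dx|nDx].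
  transitivity ((if (f x)%:E < (g x)%:E then (g x)%:E - (f x)%:E else 0) : \bar R).
    rewrite -[RHS](lebesgue_measure_itv `]f x, g x[); congr (lebesgue_measure _).
    apply/seteqP; split => y /=; rewrite hpart_pt vpart_pt in_itv/=; first by case.
    by [].
  rewrite lte_fin maxC /Num.max subr_gt0; case: ltP => //.
rewrite (_ : [set _ | _] = set0) ?measure0//.
apply/seteqP; split => y //=; rewrite hpart_pt => -[Dx _].
by move: nDx; rewrite mem_set.
Qed.

End subgraph.

(** * Smooth test functions *)

Section flat_exponential.
Context {R : realType}.
Implicit Types (p : {poly R}) (x y : R).

(** The functions p(1/x) exp(-1/x), extended by zero; the family is closed
under differentiation, which makes all of its members smooth. *)
Definition fexp p x : R := if 0 < x then p.[x^-1] * expR (- x^-1) else 0.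

Lemma poly_expR_bounded p k : exists2 C : R, 0 <= C &
  forall y, 0 <= y -> `|p.[y]| * y ^+ k * expR (- y) <= C.
Proof.
have mono j y : 0 <= y -> y ^+ j * expR (- y) <= j`!%:R.
  move=> y0; rewrite expRN ler_pdivrMr ?expR_gt0//; case: j => [|j].
    by rewrite expr0 fact0 mul1r; apply: le_trans (expR_ge1Dx y); rewrite lerDl.
  rewrite -ler_pdivrMl ?ltr0n ?fact_gt0// mulrC.
  by apply: le_trans (expR_ge1Dxn j y0); rewrite lerDr.
elim/poly_ind: p k => [|p c IH] k.
  by exists 0 => // y _; rewrite horner0 normr0 !mul0r.
have [C C0 hC] := IH k.+1; exists (C + `|c| * k`!%:R) => [|y y0]; first by rewrite addr_ge0// mulr_ge0.
rewrite !hornerE; apply: (@le_trans _ _ ((`|p.[y] * y| + `|c|) * y ^+ k * expR (- y))).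
  by rewrite ler_wpM2r ?expR_ge0// ler_wpM2r ?exprn_ge0// ler_normD.
rewrite normrM (ger0_norm y0) !mulrDl; apply: lerD.
  by rewrite -[_ * _ * y ^+ k]mulrA -exprS hC.
by rewrite -mulrA ler_wpM2l// mono.
Qed.

(** The exponential beats all powers; the quadratic rate is what gives a zero
derivative at the origin. *)
Lemma fexp_small p : exists2 C : R, 0 <= C & forall x, `|fexp p x| <= C * `|x| ^+ 2.
Proof.
have [C C0 hC] := poly_expR_bounded p 2; exists C => // x.
rewrite /fexp; case: ifPn => [x0|_]; last by rewrite normr0 mulr_ge0// exprn_ge0.
have y0 : 0 <= x^-1 by rewrite invr_ge0 ltW.
have := hC _ y0; rewrite normrM (gtr0_norm (expR_gt0 _)) (gtr0_norm x0).
by rewrite exprVn mulrAC ler_pdivrMr ?exprn_gt0.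
Qed.

Lemma is_derive_fexp p x : is_derive x 1 (fexp p) (fexp ('X^2 * (p - p^`())) x).
Proof.
have [x0|x0|<-] := ltgtP 0 x.
- have xne : x != 0 by rewrite gt_eqF.
  apply: (@near_eq_is_derive _ _ _ (fun y => p.[y^-1] * expR (- y^-1))).
    near=> y; rewrite /fexp ifT//; near: y; exact: lt_nbhsr.
  have dV : is_derive x 1 (fun y : R => y^-1) (- x ^- 2 *: 1) by apply: is_deriveV.
  have d1 := is_derive1_comp (is_derive_poly p x^-1) dV.
  have dN : is_derive x 1 (fun y : R => - y^-1) (- (- x ^- 2 *: 1)) by exact: is_deriveN.
  have d2 := @is_derive1_comp R expR (fun y => - y^-1) x _ _ (is_derive_expR (- x^-1)) dN.
  apply: (is_derive_eq (is_deriveM d1 d2)).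
  rewrite /fexp x0 /= !hornerE /=  /GRing.scale /=.
  by rewrite exprVn; ring.
- apply: (@near_eq_is_derive _ _ _ (fun y => 0)).
    near=> y; rewrite /fexp ifF//; apply/negbTE; rewrite -leNgt ltW//; near: y.
    exact: lt_nbhsl.
  rewrite /fexp ltNge ltW//=; exact: is_derive_cst.
- rewrite [fexp ('X^2 * _) 0]/fexp ltxx; have [C C0 hC] := fexp_small p.
  have cv : (fun h : R => h^-1 *: ((fexp p \o shift 0) (h *: 1) - fexp p 0)) @ 0^' --> (0 : R).
    apply/cvgr0Pnorm_lt => e e0; near=> h.
    have h0 : h != 0 by near: h; exact: nbhs_dnbhs_neq.
    rewrite /= addr0 [fexp p 0]/fexp ltxx subr0 /GRing.scale/= mulr1 normrM normfV.
    rewrite mulrC ltr_pdivrMr ?normr_gt0//; apply: le_lt_trans (hC _) _.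
    rewrite expr2 mulrA ltr_pM2r ?normr_gt0//.
    apply: (@le_lt_trans _ _ ((C + 1) * `|h|)); first by rewrite ler_wpM2r// lerDl.
    rewrite -ltr_pdivlMl ?ltr_wpDl//; near: h.
    apply: dnbhs0_lt; by rewrite mulr_gt0// invr_gt0 ltr_wpDl.
  split; [exact: cvgP cv|exact: cvg_lim cv].
Unshelve. all: by end_near. Qed.

Lemma fexp1_ge0 x : 0 <= fexp 1 x.
Proof. by rewrite /fexp; case: ifP => // _; rewrite hornerE mul1r expR_ge0. Qed.

Lemma fexp1_le1 x : fexp 1 x <= 1.
Proof.
rewrite /fexp; case: ifPn => // x0; rewrite hornerE mul1r -expR0 ler_expR oppr_le0.
by rewrite invr_ge0 ltW.
Qed.

Lemma fexp1_gt0 x : (0 < fexp 1 x) = (0 < x).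
Proof. by rewrite /fexp; case: ifPn => x0; rewrite ?ltxx// hornerE mul1r expR_gt0. Qed.

End flat_exponential.

Section classC_closure.
Context {R : realType} {V : normedModType R}.
Implicit Types (f g : V -> R) (k : nat).

Lemma classCW k f : classC k.+1 [set: V] f -> classC k [set: V] f.
Proof.
elim: k f => [f [df _] z _|k IH f [df Df]].
  by apply: differentiable_continuous; exact: df.
by split => // v; exact: IH.
Qed.

Lemma classC_cst k (c : R) : classC k [set: V] (fun=> c).
Proof.
elim: k c => [c z _|k IH c]; first exact: cst_continuous.
split => [z _|v]; first exact: differentiable_cst.
by rewrite (_ : 'D_v _ = fun=> 0)//; apply/funext => z; rewrite derive_cst.
Qed.

Lemma classCD k f g : classC k [set: V] f -> classC k [set: V] g ->
  classC k [set: V] (fun z => f z + g z).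
Proof.
elim: k f g => [f g cf cg z _|k IH f g cf cg].
  by apply: continuousD; [exact: cf|exact: cg].
have df := cf.1; have Df v : classC k [set: V] ('D_v f) := cf.2 v.
have dg := cg.1; have Dg v : classC k [set: V] ('D_v g) := cg.2 v.
split => [z _|v]; first by apply: differentiableD; [exact: df|exact: dg].
rewrite (_ : 'D_v _ = fun z => 'D_v f z + 'D_v g z); first exact: IH.
apply/funext => z; apply: deriveD; apply: diff_derivable; [exact: df|exact: dg].
Qed.

Lemma classCM k f g : classC k [set: V] f -> classC k [set: V] g ->
  classC k [set: V] (fun z => f z * g z).
Proof.
elim: k f g => [f g cf cg z _|k IH f g cf cg].
  by apply: continuousM; [exact: cf|exact: cg].
have df := cf.1; have Df v : classC k [set: V] ('D_v f) := cf.2 v.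
have dg := cg.1; have Dg v : classC k [set: V] ('D_v g) := cg.2 v.
split => [z _|v]; first by apply: differentiableM; [exact: df|exact: dg].
rewrite (_ : 'D_v _ = fun z => f z * 'D_v g z + g z * 'D_v f z).
  by apply: classCD; apply: IH; [exact: classCW|exact: Dg|exact: classCW|exact: Df].
apply/funext => z; apply: deriveM; apply: diff_derivable; [exact: df|exact: dg].
Qed.

End classC_closure.

Section test_functions.
Context {R : realType}.
Variable m : nat.
Implicit Types (a b z : 'cV[R]_m).

Lemma affine_coord_derive (h : R -> R) (dh : R -> R) (c e : R) (i : 'I_m) :
  (forall x : R, is_derive x (1 : R) h (dh x)) ->
  (forall z, differentiable (fun z : 'cV[R]_m => h (c * z i ord0 + e)) z) /\
  forall v z, 'D_v (fun z : 'cV[R]_m => h (c * z i ord0 + e)) z =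
    c * v i ord0 * dh (c * z i ord0 + e).
Proof.
move=> hd; split => [z|v z].
  apply: (@differentiable_comp _ _ _ _ (fun z : 'cV[R]_m => c * z i ord0 + e) h).
    apply: differentiableD; last exact: differentiable_cst.
    apply: differentiableM; [exact: differentiable_cst|exact: differentiable_coord].
  by apply/derivable1_diffP; have [] := hd (c * z i ord0 + e).
have dx := hd (c * z i ord0 + e).
have dfx : differentiable h (c * z i ord0 + e) by apply/derivable1_diffP; case: dx.
transitivity ('D_(c * v i ord0) h (c * z i ord0 + e)).
  have E : (fun t : R => t^-1 *: (((fun z0 : 'cV[R]_m => h (c * z0 i ord0 + e)) \o shift z)
        (t *: v) - h (c * z i ord0 + e))) =
      (fun t : R => t^-1 *: ((h \o shift (c * z i ord0 + e)) (t *: (c * v i ord0)) -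
        h (c * z i ord0 + e))).
    apply/funext => t /=.
    by congr (t^-1 *: (h _ - _)); rewrite !mxE /GRing.scale/=; ring.
  by rewrite /derive E.
rewrite deriveE// -[X in 'd _ _ X]mulr1 -[_ * 1]/(_ *: (1 : R)) linearZ/= -deriveE//.
by rewrite derive_val.
Qed.

Lemma classC_fexp k (p : {poly R}) (c e : R) (i : 'I_m) :
  classC k [set: 'cV[R]_m] (fun z => fexp p (c * z i ord0 + e)).
Proof.
elim: k p => [p z _|k IH p].
  have [d _] := affine_coord_derive c e i (is_derive_fexp p).
  exact: differentiable_continuous.
have [d D] := affine_coord_derive c e i (is_derive_fexp p).
split => [z _|v]; first exact: d.
rewrite (_ : 'D_v _ = fun z => c * v i ord0 * fexp ('X^2 * (p - p^`())) (c * z i ord0 + e)).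
  by apply: classCM => //; exact: classC_cst.
by apply/funext => z; rewrite D.
Qed.

(** Positive exactly on the open box with corners a and b, and increasing to
its indicator as the steepness s grows. *)
Definition cutoff a b (s : R) z : R :=
  \prod_i (fexp 1 (s * z i ord0 + - (s * a i ord0)) *
           fexp 1 (- s * z i ord0 + s * b i ord0)).

Lemma classC_cutoff k a b s : classC k [set: 'cV[R]_m] (cutoff a b s).
Proof.
rewrite /cutoff; elim: (index_enum _) => [|i r IH].
  rewrite (_ : (fun z => _) = fun=> 1); first exact: classC_cst.
  by apply/funext => z; rewrite big_nil.
rewrite (_ : (fun z => _) = fun z : 'cV[R]_m =>
  (fexp 1 (s * z i ord0 + - (s * a i ord0)) * fexp 1 (- s * z i ord0 + s * b i ord0)) *
  \prod_(j <- r) (fexp 1 (s * z j ord0 + - (s * a j ord0)) *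
           fexp 1 (- s * z j ord0 + s * b j ord0))); last first.
  by apply/funext => z; rewrite big_cons.
by apply: classCM => //; apply: classCM; exact: classC_fexp.
Qed.

Lemma cutoff_ge0 a b s z : 0 <= cutoff a b s z.
Proof. by apply: prodr_ge0 => i _; rewrite mulr_ge0// fexp1_ge0. Qed.

Lemma cutoff_le1 a b s z : cutoff a b s z <= 1.
Proof.
apply: prodr_ile1 => i _; rewrite mulr_ge0 ?fexp1_ge0//=.
by rewrite mulr_ile1 ?fexp1_ge0 ?fexp1_le1.
Qed.

Lemma cutoff_gt0 a b s z : 0 < s ->
  (0 < cutoff a b s z) <-> forall i, a i ord0 < z i ord0 < b i ord0.
Proof.
move=> s0; split => [h i|h].
  move: h; rewrite lt0r => /andP[/prodf_neq0 /(_ i isT) + _].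
  rewrite mulf_eq0 negb_or => /andP[h1 h2].
  have : 0 < fexp 1 (s * z i ord0 + - (s * a i ord0)) by rewrite lt0r h1 fexp1_ge0.
  have : 0 < fexp 1 (- s * z i ord0 + s * b i ord0) by rewrite lt0r h2 fexp1_ge0.
  rewrite !fexp1_gt0 subr_gt0 mulNr addrC subr_gt0 !ltr_pM2l// => -> ->.
  by [].
apply: prodr_gt0 => i _; have /andP[h1 h2] := h i.
by rewrite mulr_gt0// fexp1_gt0 ?subr_gt0 ?mulNr 1?addrC ?subr_gt0 ltr_pM2l.
Qed.

Definition cbox a b : set 'cV[R]_m := [set z | forall i, a i ord0 <= z i ord0 <= b i ord0].

Lemma closed_cbox a b : closed (cbox a b).
Proof.
rewrite (_ : cbox a b = \bigcap_(i in [set: 'I_m])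
   ((fun z : 'cV[R]_m => z i ord0) @^-1` [set x | a i ord0 <= x] `&`
    (fun z : 'cV[R]_m => z i ord0) @^-1` [set x | x <= b i ord0])); last first.
  apply/seteqP; split => z h i; last by have [/= -> ->] := h i I.
  by move=> _; have /andP[] := h i.
apply: closed_bigI => i _; apply: closedI; apply: closed_comp.
- by move=> z _; exact: coord_continuous.
- exact: closed_ge.
- by move=> z _; exact: coord_continuous.
- exact: closed_le.
Qed.

Lemma cvg_trmx_cont : continuous (fun x : 'rV[R]_m => x^T : 'cV[R]_m).
Proof.
move=> x A /cv_nbhs_ball[e e0 hA]; apply/nbhs_ballP; exists e => // y.
rewrite mx_norm_ball /= => xy; apply: hA.
apply: cv_norm_lt => // i; apply: le_lt_trans xy.
rewrite !mxE [leRHS]/Num.norm/= mx_normrE.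
by apply: (le_trans _ (le_bigmax _ _ (ord0, i))); rewrite //= !mxE.
Qed.

Lemma compact_cbox a b : compact (cbox a b).
Proof.
rewrite (_ : cbox a b = (fun x : 'rV[R]_m => x^T : 'cV[R]_m) @`
    ((fun x : 'rV[R]_m => x^T : 'cV[R]_m) @^-1` cbox a b)); last first.
  apply/seteqP; split => [z h|_ [x h <-]]; last exact: h.
  by exists z^T; rewrite /= trmxK.
apply: continuous_compact; first by apply: continuous_subspaceT; exact: cvg_trmx_cont.
apply: bounded_closed_compact; last first.
  by apply: closed_comp; [move=> z _; exact: cvg_trmx_cont|exact: closed_cbox].
exists (`|a| + `|b|); split; first exact: num_real.
move=> M hM x h; apply: le_trans (ltW hM).
rewrite [leLHS]/Num.norm/= mx_normrE; apply: bigmax_le; first by rewrite addr_ge0.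
move=> [i j] _ /=; rewrite (ord1 i); have := h j; rewrite mxE => /andP[h1 h2].
rewrite ler_norml; apply/andP; split.
  rewrite lerNl; apply: (@le_trans _ _ (- a j ord0)); first by rewrite lerN2.
  apply: (@le_trans _ _ `|a|); last by rewrite lerDl.
  by apply: le_trans (cv_coord_norm a j); rewrite -normrN ler_norm.
apply: (le_trans h2); apply: (@le_trans _ _ `|b|); last by rewrite lerDr.
by apply: le_trans (cv_coord_norm b j); rewrite ler_norm.
Qed.

Lemma test_cutoff (Om : set 'cV[R]_m) a b s : 0 < s -> cbox a b `<=` Om ->
  test_function Om (cutoff a b s).
Proof.
move=> s0 abOm; split; first by move=> k; exact: classC_cutoff.
exists (cbox a b); split => //; first exact: compact_cbox.
move=> z nz; apply/eqP; rewrite eq_le cutoff_ge0 andbT leNgt; apply/negP.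
move=> /(cutoff_gt0 a b z s0) h; apply: nz => i.
by have /andP[h1 h2] := h i; rewrite !ltW.
Qed.

Lemma cvg_fexp1 (u : R^nat) : u @ \oo --> +oo -> fexp 1 (u k) @[k --> \oo] --> (1 : R).
Proof.
move=> uoo; have ub (e : R) : \forall k \near \oo, e < u k by move/cvgryPgt : uoo; exact.
apply/cvgrPdist_lt => e e0; near=> k.
have u0 : 0 < u k by near: k; exact: ub.
rewrite /fexp u0 hornerE mul1r ger0_norm; last first.
  by rewrite subr_ge0 -expR0 ler_expR oppr_le0 invr_ge0 ltW.
apply: (@le_lt_trans _ _ (u k)^-1).
  by rewrite lerBlDr addrC -lerBlDr (le_trans _ (expR_ge1Dx _)).
rewrite invf_plt ?posrE//; near: k; exact: ub.
Unshelve. all: by end_near. Qed.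

(** Slightly enlarging the lower corner while steepening makes the limit the
indicator of the half-open box. *)
Lemma cvg_cutoff a b z :
  cutoff (a - const_mx k.+1%:R^-1) b (k.+1%:R ^+ 2) z @[k --> \oo] --> (\1_(box a b) z : R).
Proof.
have Soo : (fun k => k.+1%:R : R) @ \oo --> +oo.
  apply/cvgryPge => A; near=> k; apply: (@le_trans _ _ k%:R); last by rewrite ler_nat.
  by near: k; exact: nbhs_infty_ger.
rewrite indicE; have [h|nh] := pselect (box a b z); last first.
  rewrite memNset//= ; have [i ni] : exists i, ~~ (a i ord0 <= z i ord0 < b i ord0).
    by apply: contrapT => h; apply: nh => i; apply: contrapT => /negP hi; apply: h; exists i.
  apply: cvg_near_cst; near=> k.
  have s0 : 0 < (k.+1%:R : R) ^+ 2 by rewrite exprn_gt0.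
  apply/eqP; rewrite eq_le cutoff_ge0 andbT leNgt; apply/negP.
  move=> /(cutoff_gt0 _ _ _ s0)/(_ i); rewrite !mxE => /andP[h1 h2].
  move: ni; rewrite h2 andbT -ltNge => az.
  have : (a i ord0 - z i ord0)^-1 < k.+1%:R.
    by near: k; move/cvgryPgt : Soo; exact.
  rewrite invf_plt ?posrE ?subr_gt0// ltNge => /negP; apply.
  by rewrite ltW// ltrBlDr addrC -ltrBlDr.
rewrite mem_set//= (_ : 1%:R = \prod_(i < m) (1 : R)); last by rewrite big1.
apply: (cvg_big mul_continuous) => // i _.
have /andP[az zb] := h i; rewrite -[X in _ --> X]mulr1.
apply: cvgM; apply: cvg_fexp1; apply/cvgryPge => A; near=> k.
  have kA : A <= k.+1%:R by near: k; move/cvgryPge : Soo; exact.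
  apply: (le_trans kA); rewrite !mxE -mulrN -mulrDr opprB addrCA mulrDr.
  by rewrite expr2 -[_ * _ * _^-1]mulrA divff// mulr1 lerDl mulr_ge0 ?subr_ge0.
have kA : A / (b i ord0 - z i ord0) <= k.+1%:R by near: k; move/cvgryPge : Soo; exact.
rewrite mulNr addrC -mulrBr; move: kA; rewrite ler_pdivrMr ?subr_gt0// => /le_trans; apply.
by rewrite ler_pM2r ?subr_gt0// expr2 ler_peMr// ler1n.
Unshelve. all: by end_near. Qed.

End test_functions.

(** * Lipschitz functions of one variable *)

Section lipschitz_line.
Context {R : realType}.
Variables (f : R -> R) (K : R).
Hypothesis K0 : 0 < K.
Hypothesis fK : forall x y, `|f x - f y| <= K * `|x - y|.
Local Notation mu := (@lebesgue_measure R).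

(** A Lipschitz function is a monotone function minus a linear one; the
Stieltjes measure of the monotone part is dominated by the Lebesgue measure,
so that the Radon-Nikodym theorem writes the function as an integral. *)
Definition lip_up (x : R) : R := K * x + f x.
Definition lip_down (x : R) : R := K * x - f x.

Lemma lip_increment x y : x <= y -> - (K * (y - x)) <= f y - f x <= K * (y - x).
Proof. by move=> xy; rewrite -ler_norml; rewrite (le_trans (fK y x))// ger0_norm ?subr_ge0. Qed.

Lemma lip_continuous : continuous f.
Proof.
move=> x; apply/cvgrPdist_lt => e e0; near=> y.
apply: le_lt_trans (fK _ _) _; rewrite -ltr_pdivlMl//.
by near: y; apply: cvgr_dist_lt => //; rewrite mulr_gt0// invr_gt0.
Unshelve. all: by end_near. Qed.

Lemma lip_up_nd : nondecreasing lip_up.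
Proof. by move=> x y xy; have := lip_increment xy; rewrite /lip_up; lra. Qed.

Lemma lip_down_nd : nondecreasing lip_down.
Proof. by move=> x y xy; have := lip_increment xy; rewrite /lip_down; lra. Qed.

Lemma lip_up_rc : right_continuous lip_up.
Proof.
apply: right_continuousW => x; apply: cvgD; last exact: lip_continuous.
by apply: cvgM; [exact: cvg_cst|exact: cvg_id].
Qed.

Lemma lip_down_rc : right_continuous lip_down.
Proof.
apply: right_continuousW => x; apply: cvgB; last exact: lip_continuous.
by apply: cvgM; [exact: cvg_cst|exact: cvg_id].
Qed.

HB.instance Definition _ := isCumulative.Build R _ R lip_up lip_up_nd lip_up_rc.
HB.instance Definition _ := isCumulative.Build R _ R lip_down lip_down_nd lip_down_rc.

Lemma stieltjes_itv (g : cumulative R R) (a b : R) : a <= b ->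
  lebesgue_stieltjes_measure g `]a, b]%classic = (g b - g a)%:E.
Proof.
move=> ab; rewrite /lebesgue_stieltjes_measure/= /measure_extension measurable_mu_extE/=.
  exact: wlength_itv_bnd.
exact: is_ocitv.
Qed.

(** The increments of K x + f x and K x - f x add up to those of 2 K x, so the two
Stieltjes measures add up to a multiple of the Lebesgue measure. *)
Lemma lip_up_dominated (A : set R) : measurable A -> mu A = 0%E ->
  lebesgue_stieltjes_measure lip_up A = 0%E.
Proof.
move=> mA A0.
have c0 : 0 <= (2 * K)^-1 by rewrite invr_ge0 mulr_ge0// ltW.
pose nu := mscale (NngNum c0) (measure_add (lebesgue_stieltjes_measure lip_up)
  (lebesgue_stieltjes_measure lip_down)).
have nuE X : ocitv X -> lebesgue_stieltjes_measure idfun X = nu X.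
  move=> [[a b] _ <-]/=; have [ab|ba] := leP a b; last first.
    by rewrite set_itv_ge ?measure0// bnd_simp -leNgt ltW.
  have -> : nu `]a, b]%classic = (((2 * K)^-1)%:E * (lebesgue_stieltjes_measure lip_up `]a, b]%classic +
      lebesgue_stieltjes_measure lip_down `]a, b]%classic))%E :> \bar R.
    by rewrite -measure_addE.
  rewrite !stieltjes_itv//= -EFinD -EFinM; congr (_%:E).
  by rewrite /lip_up /lip_down; field; rewrite gt_eqF.
have E1 := lebesgue_stieltjes_measure_unique nuE mA.
have E2 : nu A = (((2 * K)^-1)%:E * (lebesgue_stieltjes_measure lip_up A +
      lebesgue_stieltjes_measure lip_down A))%E :> \bar R by rewrite -measure_addE.
have := etrans (etrans (esym A0) E1) E2 => /esym/eqP.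
rewrite mule_eq0 eqe invr_eq0 mulf_eq0 (gt_eqF K0) pnatr_eq0/= => /eqP h.
by apply/eqP; rewrite eq_le measure_ge0 andbT -h leeDl.
Qed.

Lemma lip_up_density (N : R) : 0 < N -> exists h : R -> R,
  mu.-integrable setT (EFin \o h) /\
  forall x, - N <= x <= N -> lip_up x = lip_up (- N) + \int[mu]_(t in `]-N, x]) h t.
Proof.
move=> N0; have mD : measurable (`]-N, N]%classic : set (measurableTypeR R)) by [].
have fin : (lebesgue_stieltjes_measure lip_up `](- N)%R, N]%classic < +oo)%E.
  by rewrite stieltjes_itv ?ltry// ge0_cp// ltW.
pose nu : {finite_measure set (measurableTypeR R) -> \bar R} := mfrestr mD fin.
have numu : nu `<< mu.
  apply/null_content_dominatesP => S mS S0; rewrite /nu/= /mfrestr/= /mrestr.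
  apply: lip_up_dominated; first exact: measurableI.
  by apply/eqP; rewrite eq_le measure_ge0 andbT -S0 le_measure// ?inE//; exact: measurableI.
have [h [h0 hfin inth hE]] := radon_nikodym_sigma_finite numu.
exists (fine \o h).
have fh : EFin \o (fine \o h) = h by apply/funext => x /=; rewrite fineK.
rewrite fh; split=> // x /andP[Nx xN].
have := hE `]-N, x]%classic; rewrite /nu/= /mfrestr/= /mrestr setIidl; last first.
  by apply: subset_itvl; rewrite bnd_simp.
rewrite stieltjes_itv// => /(_ (measurable_itv _)) /= E.
rewrite /Rintegral (_ : (fun t => _) = h) -?E /=; first by rewrite addrC subrK.
exact: fh.
Qed.

Lemma derivable_sub_linear (F I : R -> R) (c x : R) :
  derivable I x 1 -> (\forall y \near x, F y = c + I y) ->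
  derivable (fun y => F y - K * y) x 1.
Proof.
move=> dI FI.
have dlin : derivable (fun y : R => K * y) x 1.
  by apply: (@derivableM _ _ (cst K) id); [exact: derivable_cst|exact: derivable_id].
have dJ : derivable (cst c + I) x 1 := derivableD (derivable_cst c x 1) dI.
have dF : derivable F x 1 by apply: near_eq_derivable dJ; apply: filterS FI.
exact: (derivableB dF dlin).
Qed.

(** The integral of the density is differentiable almost everywhere, and
subtracting the linear part returns to the function. *)
Lemma lip_derivable_ae : {ae mu, forall x, derivable f x 1}.
Proof.
have aeN (N : nat) : {ae mu, forall x, - N.+1%:R < x < N.+1%:R -> derivable f x 1}.
  have [//|h [inth hE]] := @lip_up_density N.+1%:R.
  have loch : locally_integrable setT h.
    by apply: open_integrable_locally => //; exact: openT.
  have intN y : mu.-integrable `]- N.+1%:R, y]%classic (EFin \o h).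
    exact: integrableS inth.
  have := FTC1 intN loch.
  apply: filterS; first exact: (ae_filter_ringOfSetsType mu).
  move=> x /= + /andP[Nx xN].
  rewrite lte_fin => /(_ Nx)[dI _].
  have -> : f = (fun y => lip_up y - K * y) by apply/funext => y; rewrite /lip_up addrAC subrr add0r.
  apply: (derivable_sub_linear (c := lip_up (- N.+1%:R)) dI); near=> y.
  rewrite -hE//; apply/andP; split; apply/ltW; near: y; [exact: lt_nbhsr|exact: lt_nbhsl].
have [N [mN N0 hN]] := ae_foralln aeN; exists N; split => // x hx; apply: hN => h; apply: hx.
apply: (h (Num.Def.archi_bound `|x|)); rewrite -ltr_norml.
apply: lt_le_trans (archi_boundP _) _ => //; by rewrite ler_nat.
Unshelve. all: by end_near. Qed.

End lipschitz_line.

(** * Test functions and directional derivatives *)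

Section lipschitz_functions.
Context {R : realType} {V : normedModType R}.

Definition lip (K : R) (f : V -> R) : Prop := forall x y, `|f x - f y| <= K * `|x - y|.

Lemma lipW (K L : R) f : K <= L -> lip K f -> lip L f.
Proof. by move=> KL h x y; apply: le_trans (h x y) _; rewrite ler_wpM2r. Qed.

Lemma lip_cont (K : R) f : lip K f -> continuous f.
Proof.
move=> h x; apply/cvgrPdist_lt => e e0; near=> y.
have K1 : 0 < `|K| + 1 by rewrite ltr_wpDl.
have KK : K <= `|K| + 1 by rewrite (le_trans (ler_norm K))// lerDl.
apply: le_lt_trans (lipW KK h _ _) _; rewrite -ltr_pdivlMl//.
by near: y; apply: cvgr_dist_lt => //; rewrite mulr_gt0// invr_gt0.
Unshelve. all: by end_near. Qed.

End lipschitz_functions.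

Section test_function_facts.
Context {R : realType}.
Variable m : nat.
Variable phi : 'cV[R]_m -> R.
Implicit Types v z : 'cV[R]_m.

Lemma derive_lincomb (f : 'cV[R]_m -> R) v z : differentiable f z ->
  'D_v f z = \sum_j v j ord0 * 'D_(basis_vec j) f z.
Proof.
move=> df; rewrite deriveE//.
have -> : v = \sum_j v j ord0 *: basis_vec j.
  apply: cvP => i; rewrite summxE (bigD1 i)//= !mxE eqxx mulr1 big1 ?addr0// => j ji.
  by rewrite !mxE eq_sym (negbTE ji)/= mulr0.
rewrite linear_sum/=; apply: eq_bigr => j _; rewrite linearZ/= deriveE//; congr (_ * _).
rewrite summxE (bigD1 j)//= !mxE eqxx mulr1 big1 ?addr0// => i ij.
by rewrite !mxE eq_sym (negbTE ij)/= mulr0.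
Qed.

Hypothesis tphi : test_function setT phi.

Lemma test_differentiable z : differentiable phi z.
Proof. by have [/(_ 1%N)[d _] _] := tphi; exact: d. Qed.

Lemma test_continuous : continuous phi.
Proof. by move=> z; apply: differentiable_continuous; exact: test_differentiable. Qed.

Lemma test_derive_continuous v : continuous (fun z => 'D_v phi z).
Proof. by move=> z; have [/(_ 1%N)[_ D] _] := tphi; exact: D. Qed.

Lemma derive_support (K : set 'cV[R]_m) v z : compact K -> (forall z, ~ K z -> phi z = 0) ->
  ~ K z -> 'D_v phi z = 0.
Proof.
move=> cK K0 nKz.
have oK : open (~` K) by rewrite openC; apply: compact_closed => //; exact: norm_hausdorff.
rewrite (near_eq_derive (g := cst 0)) ?derive_cst//.
have : \forall y \near z, (~` K) y by exact: open_nbhs_nbhs.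
by apply: filterS => y /K0.
Qed.

Lemma test_box : exists2 k : nat, (forall z, ~ cbox (- const_mx k%:R) (const_mx k%:R) z -> phi z = 0) &
  (forall v z, ~ cbox (- const_mx k%:R) (const_mx k%:R) z -> 'D_v phi z = 0).
Proof.
have [_ [K [cK _ K0]]] := tphi.
have [M [_ hM]] := compact_bounded cK.
pose k := Num.Def.archi_bound (`|M| + 1).
have Kk z : K z -> cbox (- const_mx k%:R) (const_mx k%:R) z.
  move=> Kz i; rewrite !mxE -ler_norml; apply: le_trans (cv_coord_norm _ _) _.
  apply: le_trans (hM (`|M| + 1) _ _ Kz) _; first by rewrite (le_lt_trans (ler_norm M))// ltrDl.
  by apply/ltW/archi_boundP; rewrite addr_ge0.
exists k; first by move=> z h; apply: K0; apply: contra_not h; exact: Kk.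
by move=> v z h; apply: derive_support cK K0 _; apply: contra_not h; exact: Kk.
Qed.

Lemma compact_support_bounded (f : 'cV[R]_m -> R) (k : nat) : continuous f ->
  (forall z, ~ cbox (- const_mx k%:R) (const_mx k%:R) z -> f z = 0) ->
  exists2 C : R, 0 <= C & forall z, `|f z| <= C.
Proof.
move=> cf f0.
have ne : cbox (- const_mx k%:R : 'cV[R]_m) (const_mx k%:R) !=set0.
  by exists 0 => i; rewrite !mxE oppr_le0 ler0n.
have [|c _ hc] := @compact_EVT_max _ _ (fun z => `|f z|) _ ne (@compact_cbox R m _ _).
  by apply: continuous_subspaceT => z; apply: continuous_comp; [exact: cf|exact: norm_continuous].
exists `|f c| => // z.
have [h|/f0 ->] := pselect (cbox (- const_mx k%:R) (const_mx k%:R) z).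
  by apply: hc; rewrite inE.
by rewrite normr0.
Qed.

Lemma derive_line (V : normedModType R) (f : V -> R) (z v : V) (t : R) : differentiable f (z + t *: v) ->
  is_derive t 1 (fun s : R => f (z + s *: v)) ('D_v f (z + t *: v)).
Proof.
move=> df.
have E : (fun h : R => h^-1 *: (((fun s : R => f (z + s *: v)) \o shift t) (h *: 1) - f (z + t *: v))) =
    (fun h : R => h^-1 *: ((f \o shift (z + t *: v)) (h *: v) - f (z + t *: v))).
  apply/funext => h /=; congr (h^-1 *: (f _ - _)).
  by rewrite /GRing.scale/= mulr1 -/(_ *: _) scalerDl addrCA.
have dv := @diff_derivable _ _ _ _ _ v df.
split; first by rewrite /derivable E.
by rewrite /derive E.
Qed.

Lemma test_lip : exists2 C : R, 0 <= C & lip C phi.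
Proof.
have [k k0 kd] := test_box.
have /choice[C hC] : forall j, exists C : R, 0 <= C /\ forall z, `|'D_(basis_vec j) phi z| <= C.
  move=> j; have [C C0 hC] := compact_support_bounded (@test_derive_continuous (basis_vec j)) (kd _).
  by exists C.
exists (\sum_j C j) => [|x y]; first by apply: sumr_ge0 => j _; have [] := hC j.
pose g (s : R) := phi (y + s *: (x - y)).
have dg (s : R) : is_derive s 1 g ('D_(x - y) phi (y + s *: (x - y))).
  by apply: derive_line; exact: test_differentiable.
have [|c _] := @MVT R g _ 0 1 ltr01 (fun s _ => dg s).
  apply: continuous_subspaceT => s; apply: differentiable_continuous.
  by apply/derivable1_diffP; case: (dg s).
rewrite /g scale0r addr0 scale1r (addrC y) subrK subr0 mulr1 => ->.
rewrite derive_lincomb; last exact: test_differentiable.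
rewrite mulr_suml; apply: le_trans (ler_norm_sum _ _ _) _; apply: ler_sum => j _.
by rewrite normrM mulrC ler_pM// ?(hC j).2// cv_coord_norm.
Qed.

End test_function_facts.

Section directional.
Context {R : realType}.
Variable m : nat.
Implicit Types (v z : 'cV[R]_m) (f : 'cV[R]_m -> R).

Definition quot f v (t : R) z : R := t^-1 * (f (z + t *: v) - f z).

Lemma quotE f v z : (fun t : R => t^-1 *: ((f \o shift z) (t *: v) - f z)) = (fun t => quot f v t z).
Proof. by apply/funext => t; rewrite /quot (addrC z). Qed.

Lemma derivable_quotP f v z : derivable f z v <-> forall e : R, 0 < e ->
  exists2 d : R, 0 < d & forall s t, 0 < `|s| < d -> 0 < `|t| < d ->
    `|quot f v s z - quot f v t z| <= e.
Proof.
rewrite /derivable quotE; split.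
  move=> /cvg_ex[l /cvgrPdist_le hl] e e0.
  have /hl : 0 < e / 2 by rewrite divr_gt0.
  move=> /nbhs_ballP[d d0 hd]; exists d => // s t /andP[s0 sd] /andP[t0 td].
  have hs : `|l - quot f v s z| <= e / 2.
    by apply: hd; [rewrite /ball/= sub0r normrN|rewrite -normr_gt0].
  have ht : `|l - quot f v t z| <= e / 2.
    by apply: hd; [rewrite /ball/= sub0r normrN|rewrite -normr_gt0].
  rewrite (_ : quot f v s z - _ = - (l - quot f v s z) + (l - quot f v t z)); last by ring.
  by rewrite (le_trans (ler_normD _ _))// normrN; lra.
move=> h; apply/cauchy_cvgP; apply/cauchy_ballP => e e0.
have [|d d0 hd] := h (e / 2); first by rewrite divr_gt0.
rewrite near_map2; exists ([set t | 0 < `|t| < d], [set t | 0 < `|t| < d]) => /=.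
  split; apply/nbhs_ballP; exists d => //= t; rewrite /ball/= sub0r normrN => td t0;
    by rewrite td normr_gt0 t0.
move=> [s t] /= [hs ht]; rewrite /ball/=.
by apply: le_lt_trans (hd _ _ hs ht) _; rewrite ltr_pdivrMr// ltr_pMr// ltr1n.
Qed.

(** The Cauchy criterion for difference quotients is a countable combination of
conditions that are closed, the function being continuous. *)
Lemma bor_derivable K f v : lip K f -> measurable ([set z | derivable f z v] : set (bor R m)).
Proof.
move=> lf.
pose C (j k : nat) : set 'cV[R]_m := [set z | forall s t, 0 < `|s| < k.+1%:R^-1 ->
  0 < `|t| < k.+1%:R^-1 -> `|quot f v s z - quot f v t z| <= j.+1%:R^-1].
rewrite (_ : [set _ | _] = \bigcap_j \bigcup_k C j k).
  apply: bigcap_measurable => [|j _]; first by exists 0%N.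
  apply: bigcup_measurable => k _; apply: closed_bor.
  have cq s : continuous (quot f v s).
    move=> z; apply: (@continuousM _ _ (cst s^-1) (fun z => f (z + s *: v) - f z) z); first exact: cst_continuous.
    apply: (@continuousB _ _ _ (fun z => f (z + s *: v)) f z); last exact: (lip_cont lf).
    apply: (@continuous_comp _ _ _ (fun z : 'cV[R]_m => z + s *: v) f); last exact: (lip_cont lf).
    by apply: (@continuousD _ _ _ id (cst (s *: v))); [exact: cvg_id|exact: cst_continuous].
  rewrite (_ : C j k = \bigcap_(p in [set p : R * R | 0 < `|p.1| < k.+1%:R^-1 /\ 0 < `|p.2| < k.+1%:R^-1])
     ((fun z => `|quot f v p.1 z - quot f v p.2 z|) @^-1` [set x | x <= j.+1%:R^-1])); last first.
    by apply/seteqP; split => z h; [move=> [s t] [] /=; exact: h|move=> s t hs ht; exact: (h (s, t))].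
  apply: closed_bigI => p _; apply: closed_comp; last exact: closed_le.
  move=> z _; apply: (@continuous_comp _ _ _ (fun z => quot f v p.1 z - quot f v p.2 z) Num.norm).
    by apply: (@continuousB _ _ _ (quot f v p.1) (quot f v p.2)); exact: cq.
  exact: norm_continuous.
apply/seteqP; split => [z /derivable_quotP h j _|z h].
  have [|d d0 hd] := h j.+1%:R^-1; first by rewrite invr_gt0.
  exists (Num.Def.archi_bound d^-1) => // s t /andP[s0 sd] /andP[t0 td].
  have kd : (Num.Def.archi_bound d^-1).+1%:R^-1 <= d.
    rewrite invf_ple ?posrE// ltW//; apply: lt_le_trans (archi_boundP _) _; first by rewrite invr_ge0 ltW.
    by rewrite ler_nat.
  by apply: hd; rewrite ?s0 ?t0 (lt_le_trans _ kd).
apply/derivable_quotP => e e0.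
have [k _ hk] := h (Num.Def.archi_bound e^-1) I.
exists k.+1%:R^-1 => [|s t hs ht]; first by rewrite invr_gt0.
apply: le_trans (hk s t hs ht) _.
rewrite invf_ple ?posrE// ltW//; apply: lt_le_trans (archi_boundP _) _; first by rewrite invr_ge0 ltW.
by rewrite ler_nat.
Qed.

Lemma lip_quot K f v t z : 0 <= K -> lip K f -> `|quot f v t z| <= K * `|v|.
Proof.
move=> K0 lf; have [->|t0] := eqVneq t 0; first by rewrite /quot invr0 mul0r normr0 mulr_ge0.
rewrite /quot normrM normfV ler_pdivrMl ?normr_gt0//.
by apply: le_trans (lf _ _) _; rewrite addrAC subrr add0r normrZ mulrCA.
Qed.

Lemma quot_cvg f v z (t : R^nat) : derivable f z v -> t @ \oo --> 0 -> (forall k, t k != 0) ->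
  quot f v (t k) z @[k --> \oo] --> 'D_v f z.
Proof.
move=> df t0 tn.
have : (fun h => quot f v h z) @ 0^' --> 'D_v f z by rewrite /derive -quotE; exact: df.
move=> /(_ _ _) h; apply: (@cvg_comp _ _ _ t (fun h => quot f v h z) _ 0^'); last exact: h.
move=> A hA; have hA' : nbhs (0 : R) [set y | y != 0 -> A y] by exact: hA.
suff : \forall k \near \oo, A (t k) by [].
have h2 : \forall k \near \oo, t k != 0 -> A (t k) by exact: (t0 _ hA').
by near=> k; apply: (near h2 k) => //; exact: tn.
Unshelve. all: by end_near.
Qed.

Definition harmonic_seq : R^nat := fun k => k.+1%:R^-1.

Lemma harmonic_cvg0 : harmonic_seq @ \oo --> 0.
Proof. exact: cvg_harmonic. Qed.

Lemma harmonic_neq0 k : harmonic_seq k != 0.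
Proof. by rewrite /harmonic_seq invr_eq0 pnatr_eq0. Qed.

Lemma lip_derive_le K f v z : 0 <= K -> lip K f -> derivable f z v -> `|'D_v f z| <= K * `|v|.
Proof.
move=> K0 lf df; have cv : `|quot f v (harmonic_seq k) z| @[k --> \oo] --> `|'D_v f z|.
  by apply: cvg_norm; exact: (quot_cvg df harmonic_cvg0 harmonic_neq0).
apply: (closed_cvg (fun x => x <= K * `|v|) _ _ _ cv); first exact: closed_le.
by apply: nearW => k; exact: lip_quot.
Qed.

(** On each line in the direction [v] the function is Lipschitz in one variable,
and [leb0_lines] gathers the lines. *)
Lemma lip_derivable_dir K f v : lip K f -> leb m [set z | ~ derivable f z v] = 0%E.
Proof.
move=> lf; apply: (@leb0_lines _ _ v).
  by rewrite -[X in measurable X]/(~` [set z | derivable f z v]); apply: measurableC; exact: bor_derivable lf.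
move=> x; pose g (t : R) := f (x + t *: v).
have K1 : 0 < `|K| * `|v| + 1 by rewrite ltr_wpDl// mulr_ge0.
have lg s t : `|g s - g t| <= (`|K| * `|v| + 1) * `|s - t|.
  apply: le_trans (lf _ _) _; rewrite opprD addrACA subrr add0r -scalerBl normrZ.
  rewrite mulrCA mulrDl mul1r mulrC; apply: (@le_trans _ _ (`|K| * `|v| * `|s - t|)).
    by rewrite ler_wpM2r// ler_wpM2r// ler_norm.
  by rewrite lerDl.
have := lip_derivable_ae K1 lg => -[N [mN N0 hN]].
apply/eqP; rewrite eq_le measure_ge0 andbT -N0; apply: le_mu_ext => t /= nd.
apply: hN => /= dg; apply: nd; move: dg; rewrite /derivable.
rewrite (_ : (fun h : R => h^-1 *: ((g \o shift t) (h *: 1) - g t)) =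
    (fun h : R => h^-1 *: ((f \o shift (x + t *: v)) (h *: v) - f (x + t *: v))))//.
apply/funext => h /=; congr (h^-1 *: (f _ - _)).
by rewrite /GRing.scale/= mulr1 -/(_ *: _) scalerDl addrCA.
Qed.

End directional.
Opaque lebesgue_outer covering_outer box_volume.

(** * Weak gradients *)

Section almost_everywhere_leb.
Context {R : realType}.
Variable m : nat.
Implicit Types P Q S : 'cV[R]_m -> Prop.

Lemma ae_mono P Q : (forall z, P z -> Q z) ->
  {ae leb m, forall z, P z} -> {ae leb m, forall z, Q z}.
Proof.
move=> h [N [mN N0 hN]]; exists N; split => // z nq; apply: hN => p; exact: nq (h _ p).
Qed.

Lemma ae_mono2 P Q S : (forall z, P z -> Q z -> S z) ->
  {ae leb m, forall z, P z} -> {ae leb m, forall z, Q z} -> {ae leb m, forall z, S z}.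
Proof.
move=> h [N [mN N0 hN]] [M [mM M0 hM]]; exists (N `|` M); split.
- exact: measurableU.
- by rewrite -N0; exact: measureU0.
- move=> z nS; have [p|np] := pselect (P z); last by left; exact: hN.
  by right; apply: hM => q; exact: nS (h _ p q).
Qed.

Lemma ae_all P : (forall z, P z) -> {ae leb m, forall z, P z}.
Proof. by move=> h; exists set0; split => // z; case. Qed.

Lemma ae_ord (k : nat) (P : 'I_k -> 'cV[R]_m -> Prop) :
  (forall i, {ae leb m, forall z, P i z}) -> {ae leb m, forall z, forall i, P i z}.
Proof.
elim: k P => [P _|k IH P h]; first by apply: ae_all => z [].
apply: (ae_mono2 _ (h ord0) (IH (fun i => P (lift ord0 i)) (fun i => h (lift ord0 i)))).
by move=> z h0 hS i; case: (unliftP ord0 i) => [j ->|->].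
Qed.

End almost_everywhere_leb.

Section integration_by_parts.
Context {R : realType}.
Variable m : nat.
Implicit Types (v z : 'cV[R]_m) (f h phi psi : 'cV[R]_m -> R).
Local Notation ncbox k := (cbox (- const_mx k%:R : 'cV[R]_m) (const_mx k%:R)).

Lemma leb_measurable_null (N : set (cara R m)) (f : 'cV[R]_m -> R) : leb m N = 0%E ->
  measurable_fun N (f : cara R m -> R).
Proof.
move=> N0 _ Y mY; apply: leb_null_cara; apply/eqP; rewrite eq_le outer_measure_ge0 andbT -N0.
exact: le_outer_measure.
Qed.

Lemma lip_ae_derivable K f v : lip K f -> {ae leb m, forall z, derivable f z v}.
Proof.
by move=> lf; apply/leb_negligibleP; exact: lip_derivable_dir lf.
Qed.

Lemma measurable_quot K f v t : lip K f -> measurable_fun setT (quot f v t : cara R m -> R).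
Proof.
move=> lf; apply: continuous_cara => z.
apply: (@continuousM _ _ (cst t^-1) (fun z => f (z + t *: v) - f z) z); first exact: cst_continuous.
apply: (@continuousB _ _ _ (fun z => f (z + t *: v)) f z); last exact: (lip_cont lf).
apply: (@continuous_comp _ _ _ (fun z : 'cV[R]_m => z + t *: v) f); last exact: (lip_cont lf).
by apply: (@continuousD _ _ _ id (cst (t *: v))); [exact: cvg_id|exact: cst_continuous].
Qed.

Lemma measurable_derive K f v : lip K f -> measurable_fun setT ((fun z => 'D_v f z) : cara R m -> R).
Proof.
move=> lf; pose A : set (cara R m) := [set z | derivable f z v].
have mA : measurable A by apply: bor_cara; exact: bor_derivable lf.
have mAC : measurable (~` A) by exact: measurableC.
rewrite -(setUv A); apply: (measurable_funU _ mA mAC).2.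
split; last by apply: leb_measurable_null; exact: lip_derivable_dir lf.
apply: (@measurable_fun_cvg _ _ R A (fun k => quot f v (harmonic_seq k)) (fun z => 'D_v f z)).
  by move=> k; apply: measurable_funTS; exact: measurable_quot lf.
by move=> z Az; apply: quot_cvg => //; [exact: harmonic_cvg0|exact: harmonic_neq0].
Qed.

Lemma derive_junk f v z : ~ derivable f z v -> 'D_v f z = 0.
Proof. by move=> h; rewrite /derive; exact: dvgP. Qed.

Lemma lip_derive_bound K f v z : 0 <= K -> lip K f -> `|'D_v f z| <= K * `|v|.
Proof.
move=> K0 lf; have [h|/derive_junk ->] := pselect (derivable f z v); first exact: lip_derive_le.
by rewrite normr0 mulr_ge0.
Qed.

Lemma cbox_cara (a b : 'cV[R]_m) : measurable (cbox a b : set (cara R m)).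
Proof. by apply: closed_cara; exact: closed_cbox. Qed.

Lemma leb_cbox_fin (a b : 'cV[R]_m) : (leb m (cbox a b) < +oo)%E.
Proof.
apply: le_lt_trans (leb_box_lt_pinfty a (b + const_mx 1)); apply: le_outer_measure => z h i.
by have /andP[-> h2] := h i; rewrite !mxE (le_lt_trans h2)// ltrDl.
Qed.

Lemma integrable_compact_support h k C : measurable_fun setT (h : cara R m -> R) ->
  (forall z, `|h z| <= C) -> (forall z, ~ ncbox k z -> h z = 0) ->
  (leb m).-integrable setT (EFin \o h).
Proof.
move=> mh hC h0.
have -> : EFin \o h = (EFin \o h) \_ (ncbox k : set (cara R m)).
  apply/funext => z; rewrite /patch; case: ifPn => // /negP nz /=.
  by rewrite h0// => kz; apply: nz; rewrite inE.
rewrite -integrable_mkcond; last exact: cbox_cara.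
apply: measurable_bounded_integrable; [exact: cbox_cara|exact: leb_cbox_fin|exact: measurable_funTS|].
exists C; split; first exact: num_real.
by move=> M CM z _ /=; exact: le_trans (hC z) (ltW CM).
Qed.

Lemma integral_translateT h v : continuous h ->
  (leb m).-integrable setT (EFin \o (fun z => h (z + v))) ->
  (\int[leb m]_z (h (z + v))%:E = \int[leb m]_z (h z)%:E)%E.
Proof.
move=> ch inth.
have mh : measurable_fun setT (EFin \o h : cara R m -> \bar R).
  by apply/measurable_EFinP; exact: continuous_cara.
exact: (@integral_translate R m v setT (EFin \o h) measurableT mh inth).
Qed.

(** The difference quotients of a compactly supported function integrate to
zero by translation invariance, and they are dominated. *)
Lemma integral_derive0 K h k v : 0 <= K -> lip K h -> (forall z, ~ ncbox k z -> h z = 0) ->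
  (\int[leb m]_z ('D_v h z)%:E = 0)%E.
Proof.
move=> K0 lh h0.
pose M := (k + Num.Def.archi_bound `|v|)%N.
have ch : continuous h := lip_cont lh.
have [C C0 hC] := compact_support_bounded ch h0.
have inth : (leb m).-integrable setT (EFin \o h).
  by apply: (integrable_compact_support (k := k) _ hC) => //; exact: continuous_cara.
have q0 j z : ~ ncbox M z -> quot h v (harmonic_seq j) z = 0.
  move=> nz.
  have far y : `|z - y| <= `|v| -> h y = 0.
    move=> zy; apply: h0 => ky; apply: nz => i; have := ky i; rewrite !mxE -!ler_norml => hy.
    rewrite (_ : z i ord0 = (z - y) i ord0 + y i ord0); last by rewrite !mxE subrK.
    apply: le_trans (ler_normD _ _) _; rewrite /M natrD addrC; apply: lerD => //.
    apply: le_trans (cv_coord_norm _ _) _; apply: (le_trans zy).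
    by apply/ltW/archi_boundP.
  rewrite /quot !far ?subrr ?mulr0 ?normr0//.
  rewrite opprD addrA subrr add0r normrN normrZ ger0_norm ?invr_ge0//.
  by rewrite ler_piMl// invf_le1 ?ler1n.
have intq j : (\int[leb m]_z (quot h v (harmonic_seq j) z)%:E = 0)%E.
  pose t : R := harmonic_seq j.
  have inth' : (leb m).-integrable setT (EFin \o (fun z => h (z + t *: v))).
    apply: (integrable_compact_support (k := M) (C := C)) => [|z|z nz]; [|exact: hC|].
      apply: continuous_cara => z.
      apply: (@continuous_comp _ _ _ (fun z : 'cV[R]_m => z + t *: v) h); last exact: ch.
      by apply: (@continuousD _ _ _ id (cst (t *: v))); [exact: cvg_id|exact: cst_continuous].
    apply: h0 => kz; apply: nz => i; have := kz i; rewrite !mxE -!ler_norml => hy.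
    rewrite (_ : z i ord0 = (z i ord0 + t * v i ord0) - t * v i ord0); last by ring.
    apply: le_trans (ler_normB _ _) _; rewrite /M natrD; apply: lerD => //.
    apply: (@le_trans _ _ `|v|); last by apply/ltW/archi_boundP.
    rewrite normrM (le_trans _ (cv_coord_norm v i))// ler_piMl// ger0_norm ?invr_ge0//.
    by rewrite invf_le1 ?ler1n.
  under eq_integral do rewrite /quot EFinM EFinB.
  rewrite integralZl//; last exact: integrableB.
  rewrite integralB//.
  rewrite (integral_translateT ch inth') subee ?mule0//.
  exact: (integrable_fin_num measurableT inth).
have intg : (leb m).-integrable setT (EFin \o (fun z => K * `|v| * \1_(ncbox M) z)).
  apply: (integrable_compact_support (k := M) (C := K * `|v|)) => [|z|z nz].
  - by apply: measurable_funM; [exact: measurable_cst|apply: measurable_indic; exact: cbox_cara].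
  - rewrite normrM ger0_norm ?mulr_ge0// ler_piMr ?mulr_ge0//.
    by rewrite indicE; case: (z \in _); rewrite ?normr1 ?normr0.
  - by rewrite indicE memNset// mulr0.
have [||||_ _ cv] := @dominated_convergence _ _ _ (leb m) setT measurableT
  (fun j z => (quot h v (harmonic_seq j) z)%:E) (fun z => ('D_v h z)%:E) _ _ _ _ intg.
- by move=> j; apply/measurable_EFinP; exact: measurable_quot lh.
- by apply/measurable_EFinP; exact: measurable_derive lh.
- apply: ae_mono (lip_ae_derivable v lh) => z dz _.
  apply: cvg_EFin; first by apply: nearW.
  by apply: quot_cvg => //; [exact: harmonic_cvg0|exact: harmonic_neq0].
- apply: ae_all => z j _; rewrite lee_fin.
  have [Mz|nz] := pselect (ncbox M z); last by rewrite q0// normr0 !mulr_ge0.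
  by rewrite indicE mem_set// mulr1; exact: lip_quot.
have : (fun=> 0%E : \bar R) @ \oo --> (\int[leb m]_z ('D_v h z)%:E)%E.
  by move: cv; under eq_fun do rewrite intq.
by move=> /(cvg_lim (@ereal_hausdorff R)) <-; apply: lim_cst; exact: ereal_hausdorff.
Qed.

Lemma lipM_test K f phi : 0 <= K -> lip K f -> test_function setT phi ->
  exists2 L : R, 0 <= L & lip L (fun z => f z * phi z).
Proof.
move=> K0 lf tphi; have [k k0 _] := test_box tphi.
have [C C0 lphi] := test_lip tphi.
have [B B0 hB] := compact_support_bounded (test_continuous tphi) k0.
pose F := `|f 0| + K * k%:R.
have F0 : 0 <= F by rewrite addr_ge0// mulr_ge0.
have hF z : ncbox k z -> `|f z| <= F.
  move=> kz; rewrite -[f z](subrK (f 0)) addrC; apply: le_trans (ler_normD _ _) _.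
  rewrite lerD2l; apply: le_trans (lf _ _) _; rewrite subr0 ler_wpM2l//.
  by apply: cv_norm_le => // i; have := kz i; rewrite !mxE ler_norml.
exists (K * B + F * C) => [|x y]; first by rewrite addr_ge0// mulr_ge0.
have key z z' : ncbox k z -> `|f z * phi z - f z' * phi z'| <= (K * B + F * C) * `|z - z'|.
  move=> kz; rewrite (_ : _ - _ = (f z - f z') * phi z' + f z * (phi z - phi z')); last by ring.
  apply: le_trans (ler_normD _ _) _; rewrite !normrM mulrDl; apply: lerD.
    by rewrite mulrAC; apply: ler_pM.
  by rewrite -mulrA; apply: ler_pM => //; exact: hF.
have [kx|nx] := pselect (ncbox k x); first exact: key.
have [ky|ny] := pselect (ncbox k y); first by rewrite distrC [`|x - y|]distrC; exact: key.
by rewrite !k0// !mulr0 subrr normr0 mulr_ge0// addr_ge0// mulr_ge0.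
Qed.

(** The product with a test function is Lipschitz with compact support, so its
derivative has a vanishing integral. *)
Lemma ibp K f phi v : 0 <= K -> lip K f -> test_function setT phi ->
  \int[leb m]_z (f z * 'D_v phi z) = - \int[leb m]_z ('D_v f z * phi z).
Proof.
move=> K0 lf tphi.
have [L L0 lh] := lipM_test K0 lf tphi.
have [k k0 kd] := test_box tphi.
have h0 z : ~ ncbox k z -> f z * phi z = 0 by move=> /k0 ->; rewrite mulr0.
have := integral_derive0 v L0 lh h0.
have [B B0 hB] := compact_support_bounded (test_continuous tphi) k0.
have cD := @test_derive_continuous _ _ _ tphi v.
have cfD : continuous (fun z => f z * 'D_v phi z).
  by move=> z; apply: (@continuousM _ _ f (fun z => 'D_v phi z)); [exact: (lip_cont lf)|exact: cD].
have fD0 z : ~ ncbox k z -> f z * 'D_v phi z = 0 by move=> nz; rewrite kd// mulr0.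
have [C C0 hC] := compact_support_bounded cfD fD0.
have i1 : (leb m).-integrable setT (EFin \o (fun z => f z * 'D_v phi z)).
  apply: (integrable_compact_support (k := k) _ hC); first exact: continuous_cara.
  by move=> z nz; rewrite kd// mulr0.
have i2 : (leb m).-integrable setT (EFin \o (fun z => 'D_v f z * phi z)).
  apply: (integrable_compact_support (k := k) (C := K * `|v| * B)) => [|z|z nz].
  - apply: measurable_funM; first exact: measurable_derive lf.
    by apply: continuous_cara; exact: test_continuous.
  - by rewrite normrM; apply: ler_pM => //; exact: lip_derive_bound.
  - by rewrite k0// mulr0.
have -> : (\int[leb m]_z ('D_v (fun z => f z * phi z) z)%:E =
   \int[leb m]_z ((f z * 'D_v phi z)%:E + ('D_v f z * phi z)%:E))%E.
  apply: eq_integral_ae; apply: ae_mono (lip_ae_derivable v lf) => z dz _.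
  rewrite -EFinD (_ : (fun z => _) = f * phi)// deriveM//; last first.
    by apply: diff_derivable; exact: test_differentiable.
  by congr (_%:E); rewrite /GRing.scale/= [phi z * _]mulrC.
rewrite (integralD measurableT i1 i2) => E; apply/eqP; rewrite -subr_eq0 opprK; apply/eqP.
rewrite /Rintegral -fineD; last 2 first.
- exact: (integrable_fin_num measurableT i1).
- exact: (integrable_fin_num measurableT i2).
by rewrite E.
Qed.

End integration_by_parts.

Section weak_gradients.
Context {R : realType}.
Variables m p : nat.
Implicit Types (v z : 'cV[R]_m) (Om : set 'cV[R]_m) (w : 'cV[R]_m -> 'cV[R]_p)
  (G : 'cV[R]_m -> 'M[R]_(p, m)) (h phi psi : 'cV[R]_m -> R).

Lemma compact_leb_fin (K : set 'cV[R]_m) : compact K -> (leb m K < +oo)%E.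
Proof.
move=> cK; have [M [_ hM]] := compact_bounded cK.
pose k := Num.Def.archi_bound (`|M| + 1).
apply: le_lt_trans (leb_cbox_fin (- const_mx k%:R) (const_mx k%:R)).
apply: le_outer_measure => z Kz i; rewrite !mxE -ler_norml; apply: le_trans (cv_coord_norm _ _) _.
apply: le_trans (hM (`|M| + 1) _ _ Kz) _; first by rewrite (le_lt_trans (ler_norm M))// ltrDl.
by apply/ltW/archi_boundP; rewrite addr_ge0.
Qed.

Lemma compact_cara (K : set 'cV[R]_m) : compact K -> measurable (K : set (cara R m)).
Proof. by move=> cK; apply: closed_cara; apply: compact_closed => //; exact: norm_hausdorff. Qed.

Lemma loc_integrable_bounded Om h C : measurable_fun setT (h : cara R m -> R) ->
  (forall z, `|h z| <= C) -> loc_integrable Om h.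
Proof.
move=> mh hC K cK _; apply: measurable_bounded_integrable.
- exact: compact_cara.
- exact: compact_leb_fin.
- exact: measurable_funTS.
- exists C; split; first exact: num_real.
  by move=> M CM z _ /=; exact: le_trans (hC z) (ltW CM).
Qed.

Lemma loc_integrable_continuous Om h : continuous h -> loc_integrable Om h.
Proof.
move=> ch K cK _; apply: measurable_bounded_integrable.
- exact: compact_cara.
- exact: compact_leb_fin.
- by apply: measurable_funTS; exact: continuous_cara.
- have : compact (h @` K) by apply: continuous_compact => //; exact: continuous_subspaceT.
  by move/compact_bounded => [M [Mr hM]]; exists M; split => // N MN z Kz /=; apply: (hM N MN); exists z.
Qed.

Lemma loc_integrable_test Om h psi K : loc_integrable Om h -> continuous psi ->
  compact K -> K `<=` Om -> (forall z, ~ K z -> psi z = 0) ->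
  (leb m).-integrable setT (EFin \o (fun z => h z * psi z)).
Proof.
move=> lh cpsi cK KOm psi0.
have -> : EFin \o (fun z => h z * psi z) = (EFin \o (fun z => h z * psi z)) \_ (K : set (cara R m)).
  apply/funext => z; rewrite /patch; case: ifPn => // /negP nz /=.
  by rewrite psi0 ?mulr0// => kz; apply: nz; rewrite inE.
rewrite -integrable_mkcond; last exact: compact_cara.
have mK := compact_cara cK.
have ih := lh K cK KOm.
have : compact (psi @` K) by apply: continuous_compact => //; exact: continuous_subspaceT.
move/compact_bounded => [M [Mr hM]].
have mpsi : measurable_fun (K : set (cara R m)) (psi : cara R m -> R).
  by apply: measurable_funTS; exact: continuous_cara.
have mh : measurable_fun (K : set (cara R m)) (h : cara R m -> R).
  by apply/measurable_EFinP; exact: measurable_int ih.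
pose B := `|M| + 1.
have iB : (leb m).-integrable (K : set (cara R m)) (fun z => B%:E * `|(h z)%:E|)%E.
  by apply: integrableZl => //; exact: integrable_abse.
apply: (le_integrable mK _ _ iB); first by apply/measurable_EFinP; exact: measurable_funM.
move=> z Kz /=; rewrite lee_fin normrM mulrC normrM normr_id [`|B|]ger0_norm ?addr_ge0//.
have hB : `|psi z| <= B.
  by apply: (hM B); [rewrite (le_lt_trans (ler_norm M))// ltrDl|exists z].
exact: ler_wpM2r.
Qed.

Lemma Rintegral_supp Om h : (forall z, ~ Om z -> h z = 0) ->
  \int[leb m]_(z in Om) h z = \int[leb m]_z h z.
Proof.
move=> h0; rewrite Rintegral_mkcond; congr (Rintegral _ _ _); apply/funext => z.
by rewrite /patch; case: ifPn => // /negP nz; rewrite h0// => Oz; apply: nz; rewrite inE.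
Qed.

Lemma test_function_T Om phi : test_function Om phi -> test_function setT phi.
Proof. by move=> [cphi [K [cK _ K0]]]; split => //; exists K. Qed.

Lemma test_function_sub Om Om' phi : Om' `<=` Om -> test_function Om' phi -> test_function Om phi.
Proof. by move=> sub [cphi [K [cK KO K0]]]; split => //; exists K; split => // z /KO /sub. Qed.

Lemma test_offE Om phi : test_function Om phi ->
  (forall z, ~ Om z -> phi z = 0) /\ (forall v z, ~ Om z -> 'D_v phi z = 0).
Proof.
move=> [cphi [K [cK KO K0]]]; split => [z nz|v z nz]; first by apply: K0 => /KO.
by apply: (derive_support _ cK K0) => /KO.
Qed.

Lemma weak_gradientTP Om w G : weak_gradient Om w G <->
  [/\ forall i, loc_integrable Om (fun z => w z i ord0),
      forall i j, loc_integrable Om (fun z => G z i j) &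
      forall phi, test_function Om phi -> forall i j,
        \int[leb m]_z (w z i ord0 * 'D_(basis_vec j) phi z) =
        - \int[leb m]_z (G z i j * phi z)].
Proof.
have E phi i j : test_function Om phi ->
    \int[leb m]_(z in Om) (w z i ord0 * 'D_(basis_vec j) phi z) =
    \int[leb m]_z (w z i ord0 * 'D_(basis_vec j) phi z) /\
    \int[leb m]_(z in Om) (G z i j * phi z) = \int[leb m]_z (G z i j * phi z).
  move=> /test_offE[p0 d0]; split; apply: Rintegral_supp => z nz.
    by rewrite d0// mulr0.
  by rewrite p0// mulr0.
split => -[l1 l2 h]; split => // phi tphi i j; have [E1 E2] := E phi i j tphi.
  by rewrite -E1 -E2; exact: h.
by rewrite E1 E2; exact: h.
Qed.

Lemma weak_gradient_sub Om Om' w G : Om' `<=` Om -> weak_gradient Om w G -> weak_gradient Om' w G.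
Proof.
move=> sub /weak_gradientTP[l1 l2 h]; apply/weak_gradientTP; split.
- by move=> i K cK KO; apply: l1 => // z /KO /sub.
- by move=> i j K cK KO; apply: l2 => // z /KO /sub.
- by move=> phi tphi i j; apply: h; exact: test_function_sub tphi.
Qed.

Lemma loc_integrable_ext Om (f g : 'cV[R]_m -> R) : (forall z, Om z -> f z = g z) ->
  loc_integrable Om f -> loc_integrable Om g.
Proof.
move=> fg lf K cK KO; have := lf K cK KO; apply: eq_integrable; first exact: compact_cara.
by move=> z; rewrite inE => /KO /fg /= ->.
Qed.

Lemma loc_integrableD Om (f g : 'cV[R]_m -> R) : loc_integrable Om f -> loc_integrable Om g ->
  loc_integrable Om (fun z => f z + g z).
Proof.
move=> lf lg K cK KO; exact: (integrableD (compact_cara cK) (lf K cK KO) (lg K cK KO)).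
Qed.

Lemma loc_integrableN Om (f : 'cV[R]_m -> R) : loc_integrable Om f ->
  loc_integrable Om (fun z => - f z).
Proof. by move=> lf K cK KO; exact: (integrableN (lf K cK KO)). Qed.

Lemma weak_gradient_ext Om w w' G : (forall z, Om z -> w z = w' z) ->
  weak_gradient Om w G -> weak_gradient Om w' G.
Proof.
move=> ww' [l1 l2 h]; split => //.
  by move=> i; apply: loc_integrable_ext (l1 i) => z /ww' ->.
move=> phi tphi i j; rewrite -h//; apply: eq_Rintegral => z; rewrite inE => /ww' ->.
by [].
Qed.

Lemma weak_gradientD Om w w' G G' : weak_gradient Om w G -> weak_gradient Om w' G' ->
  weak_gradient Om (fun z => w z + w' z) (fun z => G z + G' z).
Proof.
move=> /weak_gradientTP[l1 l2 h] /weak_gradientTP[l1' l2' h'].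
apply/weak_gradientTP; split.
- move=> i; apply: (loc_integrable_ext _ (loc_integrableD (l1 i) (l1' i))) => z _.
  by rewrite mxE.
- move=> i j; apply: (loc_integrable_ext _ (loc_integrableD (l2 i j) (l2' i j))) => z _.
  by rewrite mxE.
- move=> phi tphi i j; have [_ [K [cK KO K0]]] := tphi.
  have tT := test_function_T tphi.
  have cp := test_continuous tT.
  have cd := @test_derive_continuous _ _ _ tT (basis_vec j).
  have d0 z : ~ K z -> 'D_(basis_vec j) phi z = 0 by exact: derive_support cK K0.
  under eq_Rintegral do rewrite mxE mulrDl.
  rewrite RintegralD//; last 2 first.
  + exact: (loc_integrable_test (l1 i) cd cK KO d0).
  + exact: (loc_integrable_test (l1' i) cd cK KO d0).
  rewrite h// h'// -opprD; congr (- _).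
  under [RHS]eq_Rintegral do rewrite mxE mulrDl.
  rewrite RintegralD//.
  + exact: (loc_integrable_test (l2 i j) cp cK KO K0).
  + exact: (loc_integrable_test (l2' i j) cp cK KO K0).
Qed.

Lemma weak_gradientN Om w G : weak_gradient Om w G ->
  weak_gradient Om (fun z => - w z) (fun z => - G z).
Proof.
move=> /weak_gradientTP[l1 l2 h]; apply/weak_gradientTP; split.
- by move=> i; apply: (loc_integrable_ext _ (loc_integrableN (l1 i))) => z _; rewrite mxE.
- by move=> i j; apply: (loc_integrable_ext _ (loc_integrableN (l2 i j))) => z _; rewrite mxE.
- move=> phi tphi i j; have [_ [K [cK KO K0]]] := tphi.
  have tT := test_function_T tphi.
  have cp := test_continuous tT.
  have cd := @test_derive_continuous _ _ _ tT (basis_vec j).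
  have d0 z : ~ K z -> 'D_(basis_vec j) phi z = 0 by exact: derive_support cK K0.
  under eq_Rintegral do rewrite mxE -mulrN1 mulrAC -mulrC.
  rewrite RintegralZl//; last exact: (loc_integrable_test (l1 i) cd cK KO d0).
  under [in RHS]eq_Rintegral do rewrite mxE -mulrN1 mulrAC -mulrC.
  rewrite RintegralZl//; last exact: (loc_integrable_test (l2 i j) cp cK KO K0).
  by rewrite h// !mulN1r.
Qed.

Lemma weak_gradientB Om w w' G G' : weak_gradient Om w G -> weak_gradient Om w' G' ->
  weak_gradient Om (fun z => w z - w' z) (fun z => G z - G' z).
Proof. by move=> h h'; exact: weak_gradientD (weak_gradientN h'). Qed.

(** The defining identity is integration by parts, [ibp]. *)
Lemma lip_weak_gradient Om w K : 0 <= K ->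
  (forall i, lip K (fun z => w z i ord0)) -> weak_gradient Om w (jac w).
Proof.
move=> K0 lw; apply/weak_gradientTP; split.
- by move=> i; apply: loc_integrable_continuous; exact: (lip_cont (lw i)).
- move=> i j; apply: (@loc_integrable_bounded _ _ (K * `|basis_vec j : 'cV[R]_m|)) => [|z].
    rewrite (_ : (fun z => jac w z i j) = fun z => 'D_(basis_vec j) (fun x => w x i ord0) z).
      exact: measurable_derive (lw i).
    by apply/funext => z; rewrite mxE.
  by rewrite mxE; exact: lip_derive_bound.
- move=> phi /test_function_T tphi i j; rewrite (ibp _ K0 (lw i) tphi).
  by congr (- _); apply: eq_Rintegral => z _; rewrite mxE.
Qed.

End weak_gradients.

(** * Uniqueness and locality of weak gradients *)

Section du_bois_reymond.
Context {R : realType}.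
Variable m : nat.
Implicit Types (a b c e z : 'cV[R]_m) (Om : set 'cV[R]_m) (h phi : 'cV[R]_m -> R).

Lemma cvg_shift_cutoff c e z k0 :
  cutoff (c - const_mx (k + k0).+1%:R^-1) e ((k + k0).+1%:R ^+ 2) z @[k --> \oo]
    --> (\1_(box c e) z : R).
Proof.
have := @cvg_cutoff R m c e z.
by rewrite -(cvg_shiftn k0).
Qed.

Variables (Om : set 'cV[R]_m) (h : 'cV[R]_m -> R).
Hypothesis lh : loc_integrable Om h.
Hypothesis h0 : forall phi, test_function Om phi -> \int[leb m]_z (h z * phi z) = 0.

Section one_box.
Variables (a b : 'cV[R]_m) (k0 : nat).
Hypothesis subOm : cbox (a - const_mx k0.+1%:R^-1) b `<=` Om.
Let C := cbox (a - const_mx k0.+1%:R^-1) b.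

Lemma boxC : box a b `<=` C.
Proof.
move=> z abz i; have /andP[h1 h2] := abz i; rewrite !mxE (ltW h2) andbT.
by rewrite (le_trans _ h1)// gerBl invr_ge0.
Qed.

(** The cutoffs of a box converge boundedly to its indicator. *)
Lemma du_bois_subbox c e : (forall i, a i ord0 <= c i ord0) -> (forall i, e i ord0 <= b i ord0) ->
  (\int[leb m]_(z in box c e) (h z)%:E = 0)%E.
Proof.
move=> ac eb.
have mC : measurable (C : set (cara R m)) by exact: cbox_cara.
have ihC : (leb m).-integrable (C : set (cara R m)) (EFin \o h).
  by apply: lh => //; exact: compact_cbox.
have mh : measurable_fun (C : set (cara R m)) (h : cara R m -> R).
  by apply/measurable_EFinP; exact: measurable_int ihC.
pose phi k := cutoff (c - const_mx (k + k0).+1%:R^-1) e ((k + k0).+1%:R ^+ 2).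
have s0 k : 0 < (k + k0).+1%:R ^+ 2 :> R by rewrite exprn_gt0.
have subC k : cbox (c - const_mx (k + k0).+1%:R^-1) e `<=` C.
  move=> z hz i; have := hz i; rewrite !mxE => /andP[h1 h2].
  rewrite (le_trans h2 (eb i)) andbT (le_trans _ h1)// lerB// ?ac//.
  by rewrite lef_pV2 ?posrE// ler_nat ltnS leq_addl.
have tphi k : test_function Om (phi k) by apply: test_cutoff => //; exact: subset_trans (subC k) subOm.
have cphi k : continuous (phi k) by apply: test_continuous; exact: test_function_T (tphi k).
have phi0 k z : ~ C z -> phi k z = 0.
  move=> nC; apply/eqP; rewrite eq_le cutoff_ge0 andbT leNgt; apply/negP.
  move=> /(cutoff_gt0 _ _ _ (s0 k)) hz; apply: nC; apply: (subC k) => i.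
  by have /andP[h1 h2] := hz i; rewrite !ltW.
have int0 k : (\int[leb m]_(z in C) (h z * phi k z)%:E = 0)%E.
  have ih := loc_integrable_test lh (cphi k) (@compact_cbox R m _ _) subOm (phi0 k).
  have E : (\int[leb m]_z (h z * phi k z)%:E = 0)%E.
    have := h0 (tphi k); rewrite /Rintegral => E.
    by rewrite -[LHS]fineK ?E//; exact: (integrable_fin_num measurableT ih).
  rewrite -E [LHS]integral_mkcond; apply: eq_integral => z _.
  rewrite /patch; case: ifPn => // /negP nz.
  by rewrite phi0 ?mulr0// => Cz; apply: nz; rewrite inE.
have [||||_ _ cv] := @dominated_convergence _ _ _ (leb m) C mC
  (fun k z => (h z * phi k z)%:E) (fun z => (h z * \1_(box c e) z)%:E)
  (fun z => `|(h z)%:E|)%E _ _ _ (integrable_abse ihC).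
- move=> k; apply/measurable_EFinP; apply: measurable_funM => //.
  by apply: measurable_funTS; exact: continuous_cara.
- apply/measurable_EFinP; apply: measurable_funM => //.
  by apply: measurable_funTS; apply: measurable_indic; exact: box_cara.
- apply: ae_all => z _; apply: cvg_EFin; first by apply: nearW.
  by apply: cvgM; [exact: cvg_cst|exact: cvg_shift_cutoff].
- apply: ae_all => z k _; rewrite lee_fin normrM ler_piMr//.
  by rewrite ger0_norm ?cutoff_ge0// cutoff_le1.
have E0 : (\int[leb m]_(z in C) (h z * \1_(box c e) z)%:E = 0)%E.
  have : (fun=> 0%E : \bar R) @ \oo --> (\int[leb m]_(z in C) (h z * \1_(box c e) z)%:E)%E.
    by move: cv; under eq_fun do rewrite int0.
  by move=> /(cvg_lim (@ereal_hausdorff R)) <-; apply: lim_cst; exact: ereal_hausdorff.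
rewrite -E0 [LHS]integral_mkcond [RHS]integral_mkcond; apply: eq_integral => z _.
rewrite /patch indicE; case: ifPn => [bz|nb]; last by rewrite mulr0 if_same.
rewrite ifT ?mulr1// inE; apply: boxC => i; have := set_mem bz i => /andP[h1 h2].
by rewrite (le_trans (ac i) h1) (lt_le_trans h2 (eb i)).
Qed.

(** The sets over which the integral vanishes form a Dynkin system containing the
boxes, and every measurable set differs from a Borel set by a null set. *)
Lemma du_bois_box : {ae leb m, forall z, box a b z -> h z = 0}.
Proof.
pose B : set (cara R m) := box a b.
have mB : measurable B by exact: box_cara.
have mC : measurable (C : set (cara R m)) by exact: cbox_cara.
have ihB : (leb m).-integrable B (EFin \o h).
  apply: (integrableS mC mB); first exact: boxC.
  by apply: lh => //; exact: compact_cbox.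
have bor0 (E : set (bor R m)) : measurable E -> (\int[leb m]_(z in B `&` E) (h z)%:E = 0)%E.
  pose H := [set E : set 'cV[R]_m | measurable (E : set (cara R m)) /\
    (\int[leb m]_(z in B `&` E) (h z)%:E = 0)%E].
  have dH : dynkin H.
    split.
    - split; first exact: measurableT.
      by rewrite setIT; apply: du_bois_subbox.
    - move=> A [mA A0]; split; first exact: measurableC.
      have : (\int[leb m]_(z in B) (h z)%:E = 0)%E by apply: du_bois_subbox.
      have BE : B = (B `&` A) `|` (B `&` ~` A) by rewrite -setIUr setUv setIT.
      rewrite [in LHS]BE integral_setU_EFin.
      + by rewrite A0 add0e.
      + exact: measurableI.
      + by apply: measurableI => //; exact: measurableC.
      + by rewrite -BE; apply/measurable_EFinP; exact: measurable_int ihB.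
      + by apply/disj_set2P; rewrite setIACA setICr setI0.
    - move=> F tF HF; split; first by apply: bigcupT_measurable => k; have [] := HF k.
      rewrite setI_bigcupr integral_bigcup.
      + by apply: eseries0 => k _ _; have [] := HF k.
      + exact: trivIset_setIl.
      + by move=> k; apply: measurableI => //; have [] := HF k.
      + apply: (integrableS mB) => //.
          by apply: bigcupT_measurable => k; apply: measurableI => //; have [] := HF k.
        by move=> z [k _ []].
  move=> mE; suff [] : H E by [].
  have bE : <<d @boxes R m >> E by rewrite setI_closed_g_dynkin_g_sigma_algebra//; exact: setI_closed_boxes.
  apply: bE; split => // _ [c [e ->]]; split; first exact: box_cara.
  rewrite boxI; apply: du_bois_subbox => i; rewrite !mxE ?le_max ?ge_min lexx//.
suff : ae_eq (leb m) B (EFin \o h) (cst 0%E).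
  by apply: ae_mono => z /[apply] /= -[].
apply: integral_ae_eq => // E EB mE.
have Eoo : (leb m E < +oo)%E by apply: le_lt_trans (leb_box_lt_pinfty a b); exact: le_outer_measure.
have [D mD [ED De]] := leb_hull Eoo.
rewrite integral0 -(bor0 D mD) [LHS]integral_mkcond [RHS]integral_mkcond.
apply: eq_integral_ae; exists (D `\` E).
have mDc : measurable (D : set (cara R m)) by exact: bor_cara.
split; first exact: measurableD.
  have Doo : (leb m D < +oo)%E by rewrite De.
  have DE : leb m (D `\` E) = (leb m D - leb m (D `&` E))%E by apply: measureD.
  have Doo' : leb m E \is a fin_num by rewrite ge0_fin_numE ?outer_measure_ge0.
  by rewrite DE setIidr// De subee.
move=> z /= nz; apply: contrapT => nDE; apply: nz => _.
rewrite /patch; case: ifPn => [Ez|nE].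
  by rewrite ifT// inE; split; [apply: EB|apply: ED]; exact: set_mem Ez.
rewrite ifF//; apply/negP; rewrite inE => -[_ Dz]; apply: nDE; split => // Ez.
by move: nE; rewrite mem_set.
Qed.

End one_box.

(** Cutoffs approximate boxes, boxes generate the measurable sets, and countably
many boxes cover an open set. *)
Lemma du_bois_reymond : open Om -> {ae leb m, forall z, Om z -> h z = 0}.
Proof.
move=> oOm.
pose T := ('cV[rat]_m * 'cV[rat]_m * nat)%type.
pose lo (t : T) : 'cV[R]_m := map_mx ratr t.1.1.
pose hi (t : T) : 'cV[R]_m := map_mx ratr t.1.2.
pose P (k : nat) z := if unpickle k is Some t then
  cbox (lo t - const_mx t.2.+1%:R^-1) (hi t) `<=` Om -> box (lo t) (hi t) z -> h z = 0 else True.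
have aeP k : {ae leb m, forall z, P k z}.
  rewrite /P; case: (unpickle k) => [t|]; last exact: ae_all.
  have [sub|nsub] := pselect (cbox (lo t - const_mx t.2.+1%:R^-1) (hi t) `<=` Om); last exact: ae_all.
  by apply: ae_mono (du_bois_box sub) => z.
have := ae_foralln aeP; apply: ae_mono => z Pz Oz.
have [r r0 zU] := cv_nbhs_ball (open_nbhs_nbhs (conj oOm Oz)).
have r4 : 0 < r / 2 by rewrite divr_gt0.
have /choice[p hp] : forall i, exists q : rat, ratr q \in `]z i ord0 - r / 2, z i ord0[.
  by move=> i; apply: rat_in_itvoo; rewrite gtrBl.
have /choice[q hq] : forall i, exists q : rat, ratr q \in `]z i ord0, z i ord0 + r / 2[.
  by move=> i; apply: rat_in_itvoo; rewrite ltrDl.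
pose k0 := Num.Def.archi_bound (r / 2)^-1.
have k0r : k0.+1%:R^-1 <= r / 2 :> R.
  rewrite invf_ple ?posrE// ltW//; apply: lt_le_trans (archi_boundP _) _; first by rewrite invr_ge0 ltW.
  by rewrite ler_nat.
pose t : T := (\col_i p i, \col_i q i, k0).
have := Pz (pickle t); rewrite /P pickleK; apply.
  move=> y hy; apply: zU; apply: cv_norm_lt => // i; rewrite !mxE ltr_distlC.
  have := hy i; have := hp i; have := hq i; rewrite !mxE !in_itv/=.
  move=> /andP[h1 h2] /andP[h3 h4] /andP[h5 h6]; apply/andP.
  by move: k0r h5; set x : R := k0.+1%:R^-1; move: x => x k0r h5; split; lra.
move=> i; have := hp i; have := hq i; rewrite !mxE !in_itv/= => /andP[h1 _] /andP[_ h2].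
by rewrite h1 ltW.
Qed.

End du_bois_reymond.

Section weak_gradient_unique.
Context {R : realType}.
Variables m p : nat.
Implicit Types (Om : set 'cV[R]_m) (w : 'cV[R]_m -> 'cV[R]_p) (G : 'cV[R]_m -> 'M[R]_(p, m)).

Lemma weak_gradient_unique Om w G1 G2 : open Om ->
  weak_gradient Om w G1 -> weak_gradient Om w G2 ->
  {ae leb m, forall z, Om z -> G1 z = G2 z}.
Proof.
move=> oOm /weak_gradientTP[_ l1 e1] /weak_gradientTP[_ l2 e2].
suff : {ae leb m, forall z, forall i, forall j, Om z -> G1 z i j - G2 z i j = 0}.
  by apply: ae_mono => z hz Oz; apply/matrixP => i j; apply/eqP; rewrite -subr_eq0; apply/eqP; exact: hz.
apply: ae_ord => i; apply: ae_ord => j.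
apply: (@du_bois_reymond _ _ Om (fun z => G1 z i j - G2 z i j)) => // [|phi tphi].
  by apply: loc_integrableD => //; exact: loc_integrableN.
have [_ [K [cK KO K0]]] := tphi.
have cp := test_continuous (test_function_T tphi).
under eq_Rintegral do rewrite mulrBl.
rewrite RintegralB//; last 2 first.
- exact: (loc_integrable_test (l1 i j) cp cK KO K0).
- exact: (loc_integrable_test (l2 i j) cp cK KO K0).
by apply/eqP; rewrite subr_eq0 -eqr_opp -e1// -e2.
Qed.

Lemma nablaP Om w G : open Om -> weak_gradient Om w G ->
  weak_gradient Om w (nabla Om w) /\ {ae leb m, forall z, Om z -> nabla Om w z = G z}.
Proof.
move=> oOm wG; have wn : weak_gradient Om w (nabla Om w) by apply: (xgetPex _ (ex_intro _ G wG)).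
by split => //; exact: weak_gradient_unique wn wG.
Qed.

(** Test functions supported in the smaller set cannot tell the two maps apart,
and weak gradients are unique there. *)
Lemma weak_gradient_local Om1 Om2 U w1 w2 G1 G2 : open U -> U `<=` Om1 -> U `<=` Om2 ->
  (forall z, U z -> w1 z = w2 z) -> weak_gradient Om1 w1 G1 -> weak_gradient Om2 w2 G2 ->
  {ae leb m, forall z, U z -> G1 z = G2 z}.
Proof.
move=> oU U1 U2 w12 h1 h2; apply: (weak_gradient_unique oU (w := w2)).
  by apply: (weak_gradient_ext w12); exact: weak_gradient_sub h1.
exact: weak_gradient_sub h2.
Qed.

End weak_gradient_unique.

(** * Total differentiability of Lipschitz functions *)

Section euclidean_facts.
Context {R : realType}.
Variables m p : nat.
Implicit Types (A B C : 'M[R]_(m, p)) (c : R).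

Lemma innerE A B : inner A B = \sum_i \sum_j A i j * B i j.
Proof.
rewrite /inner /mxtrace exchange_big; apply: eq_bigr => j _.
by rewrite mxE; apply: eq_bigr => i _; rewrite mxE.
Qed.

Lemma innerC A B : inner A B = inner B A.
Proof. by rewrite !innerE; do 2!(apply: eq_bigr => ? _); rewrite mulrC. Qed.

Lemma innerDl A B C : inner (A + B) C = inner A C + inner B C.
Proof.
by rewrite !innerE -big_split; apply: eq_bigr => i _; rewrite -big_split; apply: eq_bigr => j _; rewrite mxE mulrDl.
Qed.

Lemma innerZl c A B : inner (c *: A) B = c * inner A B.
Proof.
by rewrite !innerE mulr_sumr; apply: eq_bigr => i _; rewrite mulr_sumr; apply: eq_bigr => j _; rewrite mxE mulrA.
Qed.

Lemma innerNl A B : inner (- A) B = - inner A B.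
Proof. by rewrite -scaleN1r innerZl mulN1r. Qed.

Lemma innerBl A B C : inner (A - B) C = inner A C - inner B C.
Proof. by rewrite innerDl innerNl. Qed.

Lemma innerDr A B C : inner C (A + B) = inner C A + inner C B.
Proof. by rewrite innerC innerDl !(innerC C). Qed.

Lemma innerZr c A B : inner B (c *: A) = c * inner B A.
Proof. by rewrite innerC innerZl (innerC B). Qed.

Lemma innerNr A B : inner B (- A) = - inner B A.
Proof. by rewrite innerC innerNl (innerC B). Qed.

Lemma innerBr A B C : inner C (A - B) = inner C A - inner C B.
Proof. by rewrite innerDr innerNr. Qed.

Lemma inner0r A : inner A 0 = 0.
Proof. by rewrite -(scale0r A) innerZr mul0r. Qed.

Lemma inner_ge0 A : 0 <= inner A A.
Proof. by rewrite innerE; do 2!(apply: sumr_ge0 => ? _); rewrite -expr2 sqr_ge0. Qed.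

Lemma enorm_ge0 A : 0 <= enorm A. Proof. exact: sqrtr_ge0. Qed.

Lemma enorm_sqr A : enorm A ^+ 2 = inner A A.
Proof. by rewrite sqr_sqrtr// inner_ge0. Qed.

Lemma enormZ c A : enorm (c *: A) = `|c| * enorm A.
Proof. by rewrite /enorm innerZl innerZr mulrA -expr2 sqrtrM ?sqr_ge0// sqrtr_sqr. Qed.

Lemma enormN A : enorm (- A) = enorm A.
Proof. by rewrite -scaleN1r enormZ normrN1 mul1r. Qed.

Lemma enorm0 : enorm (0 : 'M[R]_(m, p)) = 0.
Proof. by rewrite /enorm inner0r sqrtr0. Qed.

Lemma coord_le_enorm A i j : `|A i j| <= enorm A.
Proof.
rewrite -(ler_pXn2r (ltn0Sn 1)) ?nnegrE ?enorm_ge0// enorm_sqr innerE.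
rewrite (bigD1 i)//= (bigD1 j)//= -normrX ger0_norm ?sqr_ge0// -expr2 -addrA lerDl.
by rewrite addr_ge0//; do ?(apply: sumr_ge0 => ? _); rewrite -expr2 sqr_ge0.
Qed.

Lemma enorm_sqr_le A c : (forall i j, `|A i j| <= c) -> enorm A ^+ 2 <= (m * p)%:R * c ^+ 2.
Proof.
move=> h; rewrite enorm_sqr innerE.
apply: (@le_trans _ _ (\sum_(i < m) \sum_(j < p) c ^+ 2)).
  apply: ler_sum => i _; apply: ler_sum => j _; rewrite -expr2 -real_normK ?num_real//.
  by rewrite ler_pXn2r ?nnegrE// (le_trans _ (h i j)).
by rewrite !sumr_const !card_ord -!mulrnA mulr_natl mulnC.
Qed.

Lemma cauchy_schwarz A B : `|inner A B| <= enorm A * enorm B.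
Proof.
rewrite -(ler_pXn2r (ltn0Sn 1)) ?nnegrE ?mulr_ge0 ?enorm_ge0// exprMn real_normK ?num_real// !enorm_sqr.
have [B0|Bn0] := eqVneq (inner B B) 0.
  suff -> : B = 0 by rewrite !inner0r mulr0 expr0n.
  apply/matrixP => i j; apply/eqP; rewrite mxE -normr_le0.
  by rewrite (le_trans (coord_le_enorm B i j))// /enorm B0 sqrtr0.
have Bp : 0 < inner B B by rewrite lt_def Bn0 inner_ge0.
have := inner_ge0 (inner B B *: A - inner A B *: B).
rewrite innerBl !innerBr !innerZl !innerZr (innerC B A).
rewrite (_ : _ - _ - _ = inner B B * (inner A A * inner B B - inner A B ^+ 2)); last by ring.
by rewrite pmulr_rge0// subr_ge0.
Qed.

Lemma enormD A B : enorm (A + B) <= enorm A + enorm B.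
Proof.
rewrite -(ler_pXn2r (ltn0Sn 1)) ?nnegrE ?addr_ge0 ?enorm_ge0// sqrrD !enorm_sqr.
rewrite innerDl !innerDr (innerC B A) mulr2n.
have := le_trans (ler_norm _) (cauchy_schwarz A B); lra.
Qed.

End euclidean_facts.

Section column_norms.
Context {R : realType}.
Variable m : nat.
Implicit Types (p h z : 'cV[R]_m).

Lemma inner_cv p h : inner p h = \sum_i p i ord0 * h i ord0.
Proof. by rewrite innerE; apply: eq_bigr => i _; rewrite big_ord1. Qed.

Lemma norm_le_enorm z : `|z| <= enorm z.
Proof. by apply: cv_norm_le => [|i]; [exact: enorm_ge0|exact: coord_le_enorm]. Qed.

Lemma enorm_le_norm z : enorm z <= m%:R * `|z|.
Proof.
rewrite -(ler_pXn2r (ltn0Sn 1)) ?nnegrE ?mulr_ge0 ?enorm_ge0//.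
apply: (@le_trans _ _ ((m * 1)%:R * `|z| ^+ 2)).
  by apply: enorm_sqr_le => i j; rewrite (ord1 j) cv_coord_norm.
rewrite exprMn muln1 ler_wpM2r ?sqr_ge0//.
by rewrite -natrX ler_nat; case: (m) => // k; rewrite expnS expn1 leq_pmulr.
Qed.

Lemma inner_le_norm p h : `|inner p h| <= m%:R * `|p| * `|h|.
Proof.
rewrite inner_cv; apply: (le_trans (ler_norm_sum _ _ _)).
apply: (@le_trans _ _ (\sum_(i < m) `|p| * `|h|)); last first.
  by rewrite sumr_const card_ord -mulrA mulr_natl.
by apply: ler_sum => i _; rewrite normrM ler_pM ?cv_coord_norm.
Qed.

End column_norms.

Section rademacher.
Context {R : realType}.
Variable m : nat.
Implicit Types (z h v p : 'cV[R]_m) (g : 'cV[R]_m -> R).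


Lemma loc_integrableZ Om (f : 'cV[R]_m -> R) c : loc_integrable Om f ->
  loc_integrable Om (fun z => c * f z).
Proof.
move=> lf K cK KO; rewrite (_ : EFin \o _ = fun z => (c%:E * (f z)%:E)%E); last first.
  by apply/funext => z /=; rewrite EFinM.
by apply: integrableZl; [exact: compact_cara|exact: lf].
Qed.

Lemma lip_derive_lin K g c v w : 0 <= K -> lip K g ->
  {ae leb m, forall z, 'D_(c *: v + w) g z = c * 'D_v g z + 'D_w g z}.
Proof.
move=> K0 lg.
have ld u : loc_integrable setT (fun z => 'D_u g z).
  by apply: (@loc_integrable_bounded _ _ _ _ (K * `|u|)); [exact: measurable_derive lg|
    move=> z; exact: lip_derive_bound lg].
suff : {ae leb m, forall z, setT z -> 'D_(c *: v + w) g z - (c * 'D_v g z + 'D_w g z) = 0}.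
  by apply: ae_mono => z /(_ I) /eqP; rewrite subr_eq0 => /eqP.
have lc : loc_integrable setT (fun z => c * 'D_v g z) by exact: loc_integrableZ (ld v).
have lcd := loc_integrableD lc (ld w).
apply: (du_bois_reymond (loc_integrableD (ld _) (loc_integrableN lcd))); last exact: openT.
move=> phi tphi; have [_ [S [cS ST S0]]] := tphi.
have cp := test_continuous tphi.
have i1 u := loc_integrable_test (ld u) cp cS ST S0.
have i2 := loc_integrable_test lc cp cS ST S0.
have i3 := loc_integrable_test lcd cp cS ST S0.
have lgc : loc_integrable setT g by apply: loc_integrable_continuous; exact: lip_cont lg.
have i4 u : (leb m).-integrable setT (EFin \o (fun z => g z * 'D_u phi z)).
  apply: (loc_integrable_test lgc _ cS ST) => [|z nS]; first exact: test_derive_continuous tphi _.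
  exact: derive_support cS S0 nS.
under eq_Rintegral do rewrite mulrBl.
rewrite RintegralB//.
under [X in _ - X]eq_Rintegral do rewrite mulrDl -mulrA.
have i5 : (leb m).-integrable setT (EFin \o (fun z => c * ('D_v g z * phi z))).
  by move: i2; congr (_.-integrable _ _); apply/funext => z /=; rewrite mulrA.
rewrite RintegralD// RintegralZl//.
have ib u : \int[leb m]_z ('D_u g z * phi z) = - \int[leb m]_z (g z * 'D_u phi z).
  by rewrite (ibp _ K0 lg tphi) opprK.
rewrite !ib.
under eq_Rintegral do rewrite (derive_lincomb _ (test_differentiable tphi _)).
have -> : \int[leb m]_z (g z * (\sum_j (c *: v + w) j ord0 * 'D_(basis_vec j) phi z)) =
  c * \int[leb m]_z (g z * 'D_v phi z) + \int[leb m]_z (g z * 'D_w phi z).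
  rewrite -RintegralZl// -RintegralD//; last first.
    rewrite (_ : EFin \o _ = fun z => (c%:E * (g z * 'D_v phi z)%:E)%E).
      by apply: integrableZl; [exact: measurableT|exact: i4].
    by apply/funext => z /=; rewrite EFinM.
  apply: eq_Rintegral => z _.
  rewrite !(derive_lincomb _ (test_differentiable tphi _)) mulrCA -mulrDr; congr (_ * _).
  rewrite mulr_sumr -big_split/=.
  by apply: eq_bigr => j _; rewrite !mxE mulrDl mulrA.
by rewrite mulrN -opprD -opprD subrr oppr0.
Qed.

(** Two directional derivatives that exist almost everywhere add up because
their action on test functions does. *)
Lemma lip_derive_linear K g v : 0 <= K -> lip K g ->
  {ae leb m, forall z, 'D_v g z = inner (grad g z) v}.
Proof.
move=> K0 lg.
suff h (s : seq 'I_m) : {ae leb m, forall z,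
    'D_(\sum_(j <- s) v j ord0 *: basis_vec j) g z = \sum_(j <- s) v j ord0 * 'D_(basis_vec j) g z}.
  have := h (index_enum 'I_m); rewrite (_ : \sum_(j <- _) v j ord0 *: basis_vec j = v).
    by apply: ae_mono => z ->; rewrite inner_cv; apply: eq_bigr => j _; rewrite mxE mulrC.
  apply: cvP => i; rewrite summxE (bigD1 i)//= !mxE eqxx mulr1 big1 ?addr0// => j ji.
  by rewrite !mxE eq_sym (negbTE ji)/= mulr0.
elim: s => [|j s IH].
  by apply: ae_all => z; rewrite !big_nil derive0.
apply: ae_mono2 IH (lip_derive_lin (v j ord0) (basis_vec j) (\sum_(j <- s) v j ord0 *: basis_vec j) K0 lg) => z IH h.
by rewrite !big_cons h IH.
Qed.

Definition frechet g p z := forall e, 0 < e -> exists2 r, 0 < r &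
  forall h, `|h| < r -> `|g (z + h) - g z - inner p h| <= e * `|h|.

(** The directions in a finite net of the unit sphere have a common radius, and
the Lipschitz bound takes care of the other directions. *)
Lemma frechet_of_rational_directions K g z : 0 <= K -> lip K g ->
  (forall v : 'cV[rat]_m, derivable g z (map_mx ratr v) /\
    'D_(map_mx ratr v) g z = inner (grad g z) (map_mx ratr v)) ->
  frechet g (grad g z) z.
Proof.
move=> K0 lg hz e e0; set p := grad g z.
pose L := K + m%:R * `|p|.
have L0 : 0 <= L by rewrite addr_ge0// mulr_ge0.
pose M := Num.Def.archi_bound (L / (e / 2)).
have e20 : 0 < e / 2 by rewrite divr_gt0.
have LM : L / M.+1%:R <= e / 2.
  rewrite ler_pdivrMr// mulrC -ler_pdivrMr// ltW//.
  apply: lt_le_trans (archi_boundP _) _; first by rewrite divr_ge0// ltW.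
  by rewrite ler_nat.
pose net (f : {ffun 'I_m -> 'I_(M.+1.*2.+1)}) : 'cV[rat]_m := \col_i ((f i)%:R / M.+1%:R - 1).
have [r r0 hr] : exists2 r, 0 < r & forall f t, 0 < t -> t < r ->
    `|g (z + t *: map_mx ratr (net f)) - g z - t * inner p (map_mx ratr (net f))| <= e / 2 * t.
  have : \forall t \near 0^'+, forall f,
    `|g (z + t *: map_mx ratr (net f)) - g z - t * inner p (map_mx ratr (net f))| <= e / 2 * t.
    apply: filter_forall => f; have [df Df] := hz (net f).
    have := df; rewrite /derivable quotE => /cvg_ex[l hl].
    have lE : l = inner p (map_mx ratr (net f)).
      by rewrite -Df /derive quotE; apply/esym/cvg_lim.
    move: hl => /cvgrPdist_le /(_ _ e20); rewrite lE => -[r /= r0 hr].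
    exists r => //= t tr t0.
    have := hr t tr; rewrite gt_eqF// => /(_ isT).
    have -> : g (z + t *: map_mx ratr (net f)) - g z - t * inner p (map_mx ratr (net f)) =
      - t * (inner p (map_mx ratr (net f)) - quot g (map_mx ratr (net f)) t z).
      by rewrite /quot; field; rewrite gt_eqF.
    by move=> hq; rewrite normrM normrN (gtr0_norm t0) [leLHS]mulrC ler_wpM2r// ltW.
  move=> [r /= r0 hr]; exists r => // f t t0 tr; apply: hr => //=.
  by rewrite distrC subr0 gtr0_norm.
exists r => // h hr'.
have [->|hn0] := eqVneq h 0; first by rewrite addr0 subrr inner0r subrr !normr0 mulr0.
pose t := `|h|; have t0 : 0 < t by rewrite normr_gt0.
have hu i : 0 <= (h i ord0 / t + 1) * M.+1%:R <= M.+1.*2%:R.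
  have := cv_coord_norm h i; rewrite -/t ler_norml => /andP[h1 h2].
  have a1 : - 1 <= h i ord0 / t by rewrite ler_pdivlMr// mulN1r.
  have a2 : h i ord0 / t <= 1 by rewrite ler_pdivrMr// mul1r.
  rewrite -muln2 natrM mulrC mulr_ge0 ?ler_wpM2l//; lra.
have hN i : (Num.truncn ((h i ord0 / t + 1) * M.+1%:R) < M.+1.*2.+1)%N.
  have /andP[h1 h2] := hu i; rewrite ltnS -(ler_nat R) (le_trans _ h2)//.
  by have /andP[] := truncn_itv h1.
pose f := [ffun i => Ordinal (hN i)].
pose v : 'cV[R]_m := map_mx ratr (net f).
have hv : `|h - t *: v| <= t / M.+1%:R.
  apply: cv_norm_le => [|i]; first by rewrite divr_ge0// ltW.
  rewrite !mxE ffunE /= rmorphB rmorphM/= rmorph1 fmorphV !rmorph_nat.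
  have /andP[h1 _] := hu i.
  have /andP[h3 h4] := truncn_itv h1.
  set k := Num.truncn _ in h3 h4 *.
  have Mp : 0 < M.+1%:R :> R by [].
  have -> : h i ord0 - t * (k%:R / M.+1%:R - 1) = t / M.+1%:R * ((h i ord0 / t + 1) * M.+1%:R - k%:R).
    by field; rewrite !gt_eqF.
  rewrite ger0_norm; last by rewrite mulr_ge0 ?subr_ge0// divr_ge0// ltW.
  rewrite ler_piMr//; first by rewrite divr_ge0// ltW.
  by rewrite lerBlDl ltW// natr1.
have -> : g (z + h) - g z - inner p h = (g (z + t *: v) - g z - t * inner p v) +
   ((g (z + h) - g (z + t *: v)) - inner p (h - t *: v)).
  by rewrite innerBr innerZr; ring.
apply: (le_trans (ler_normD _ _)); rewrite [e]splitr mulrDl lerD//.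
  exact: hr.
apply: (le_trans (ler_normB _ _)).
apply: (@le_trans _ _ (K * `|h - t *: v| + m%:R * `|p| * `|h - t *: v|)).
  rewrite lerD ?inner_le_norm//; have := lg (z + h) (z + t *: v).
  by rewrite opprD addrACA subrr add0r.
rewrite -mulrDl; apply: (le_trans (ler_wpM2l L0 hv)).
by rewrite mulrCA mulrC ler_wpM2r// ltW.
Qed.

(** Countably many rational directions share one exceptional null set. *)
Lemma rademacher K g : 0 <= K -> lip K g -> {ae leb m, forall z, frechet g (grad g z) z}.
Proof.
move=> K0 lg.
pose P (k : nat) z := if @unpickle 'cV[rat]_m k is Some v then derivable g z (map_mx ratr v) /\
    'D_(map_mx ratr v) g z = inner (grad g z) (map_mx ratr v) else True.
have aeP k : {ae leb m, forall z, P k z}.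
  rewrite /P; case: (unpickle k) => [v|]; last exact: ae_all.
  by apply: ae_mono2 (lip_ae_derivable (map_mx ratr v) lg) (lip_derive_linear (map_mx ratr v) K0 lg).
apply: ae_mono (ae_foralln aeP) => z hz; apply: (frechet_of_rational_directions K0 lg) => v.
by have := hz (pickle v); rewrite /P pickleK.
Qed.

End rademacher.

Section Rintegral_facts.
Context d (T : measurableType d) {R : realType} (mu : {measure set T -> \bar R}).
Variables (D : set T) (mD : measurable D).
Implicit Types f : T -> R.

Lemma Rintegral_sum (I : Type) (s : seq I) (f : I -> T -> R) :
  (forall i, mu.-integrable D (EFin \o f i)) ->
  mu.-integrable D (EFin \o (fun x => \sum_(i <- s) f i x)) /\
  \int[mu]_(x in D) (\sum_(i <- s) f i x) = \sum_(i <- s) \int[mu]_(x in D) f i x.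
Proof.
move=> hf; elim: s => [|i s [IH1 IH2]].
  rewrite (_ : (fun x => _) = cst 0); last by apply/funext => x; rewrite big_nil.
  split; first exact: integrable0.
  by rewrite big_nil /Rintegral integral0_eq.
rewrite (_ : (fun x => _) = fun x => f i x + \sum_(i <- s) f i x); last first.
  by apply/funext => x; rewrite big_cons.
split; last by rewrite RintegralD// IH2 big_cons.
by move: (integrableD mD (hf i) IH1); congr (_.-integrable _ _).
Qed.

Lemma le_Rintegral_ae f1 f2 : mu.-integrable D (EFin \o f1) -> mu.-integrable D (EFin \o f2) ->
  {ae mu, forall x, D x -> f1 x <= f2 x} ->
  \int[mu]_(x in D) f1 x <= \int[mu]_(x in D) f2 x.
Proof.
move=> i1 i2 h; apply: fine_le; [exact: integrable_fin_num|exact: integrable_fin_num|].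
by apply: le_integral_ae; case: h => N [mN N0 hN]; exists N; split => //; apply: subset_trans hN => x /= nx hx; apply: nx => /hx; rewrite lee_fin.
Qed.

End Rintegral_facts.

(** * Lipschitz bounds from bounded weak gradients *)

Section mollify.
Context {R : realType}.
Variable m : nat.
Implicit Types (x y z u v p q : 'cV[R]_m) (U : set 'cV[R]_m).

Variable r : R.
Hypothesis r0 : 0 < r.

Definition mollifier : 'cV[R]_m -> R := cutoff (const_mx (- r)) (const_mx r) 1.
Definition molli x : 'cV[R]_m -> R := fun z => mollifier (z - x).
Definition rbox x : set 'cV[R]_m := cbox (x - const_mx r) (x + const_mx r).

Lemma molliE x : molli x = cutoff (x - const_mx r) (x + const_mx r) 1.
Proof.
apply/funext => z; rewrite /molli /mollifier /cutoff; apply: eq_bigr => i _.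
by congr (fexp 1 _ * fexp 1 _); rewrite !mxE; ring.
Qed.

Lemma molli_ge0 x z : 0 <= molli x z. Proof. exact: cutoff_ge0. Qed.

Lemma molli_out x z : ~ rbox x z -> molli x z = 0.
Proof.
move=> nz; apply/eqP; rewrite eq_le molli_ge0 andbT leNgt molliE; apply/negP.
move=> /(cutoff_gt0 _ _ _ (@ltr01 R)) hz; apply: nz => i.
by have /andP[h1 h2] := hz i; rewrite !ltW.
Qed.

Lemma test_mollifier : test_function setT mollifier.
Proof. by apply: test_cutoff => //; exact: subsetT. Qed.

Lemma test_molli U x : rbox x `<=` U -> test_function U (molli x).
Proof. by move=> h; rewrite molliE; exact: test_cutoff. Qed.

Lemma derive_molli u x z : 'D_u (molli x) z = 'D_u mollifier (z - x).
Proof.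
rewrite /derive (_ : (fun h : R => h^-1 *: ((molli x \o shift z) (h *: u) - molli x z)) =
  (fun h : R => h^-1 *: ((mollifier \o shift (z - x)) (h *: u) - mollifier (z - x))))//.
by apply/funext => h /=; rewrite /molli addrA.
Qed.

(** A first-order expansion of the kernel, uniform in the point, replaces
differentiation under the integral sign. *)
Lemma mollifier_taylor v : exists2 C : R, 0 <= C & forall x z (t : R), 0 < t ->
  `|molli (x + t *: v) z - molli x z - t * 'D_(- v) (molli x) z| <= C * t ^+ 2.
Proof.
have [_ [K [cK KT K0]]] := test_mollifier.
have tD : test_function setT (fun z => 'D_(- v) mollifier z).
  split; first by move=> k; exact: (test_mollifier.1 k.+1).2.
  by exists K; split => // z; exact: derive_support.
have [C C0 lC] := test_lip tD.
exists (C * `|v|); first by rewrite mulr_ge0.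
move=> x z t t0; rewrite derive_molli; set y := z - x.
have -> : molli (x + t *: v) z = mollifier (y + t *: - v).
  by rewrite /molli scalerN opprD addrA.
pose f (s : R) := mollifier (y + s *: - v).
have df (s : R) : is_derive s 1 f ('D_(- v) mollifier (y + s *: - v)).
  by apply: derive_line; exact: (test_differentiable test_mollifier).
have [] := @MVT R f (fun s => 'D_(- v) mollifier (y + s *: - v)) 0 t t0.
  apply: continuous_subspaceT => s; apply: differentiable_continuous.
  by apply/derivable1_diffP; have [] := df s.
move=> s; rewrite in_itv/= => /andP[s0 st].
rewrite {1 2}/f scale0r addr0 subr0 => fE.
have -> : mollifier (y + t *: - v) - molli x z - t * 'D_(- v) mollifier y =
    t * ('D_(- v) mollifier (y + s *: - v) - 'D_(- v) mollifier y).
  by rewrite -[molli x z]/(mollifier y) fE mulrBr [X in X - _]mulrC.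
rewrite normrM gtr0_norm//.
have := lC (y + s *: - v) y; rewrite [X in `|X| <= _ -> _]/= [_ + _ - y]addrC addKr.
rewrite normrZ normrN (gtr0_norm s0) => h.
apply: (@le_trans _ _ (t * (C * (s * `|v|)))); first by rewrite ler_wpM2l// ltW.
rewrite (_ : C * _ * _ = t * (C * (t * `|v|))); last by ring.
by rewrite !ler_wpM2l ?(ltW t0)// ler_wpM2r// ltW.
Qed.

Lemma mollifier_int x : (leb m).-integrable setT (EFin \o molli x) /\
  \int[leb m]_z molli x z = \int[leb m]_z mollifier z.
Proof.
have cm y : continuous (molli y).
  by apply: test_continuous; apply: test_molli; exact: subsetT.
have l1 : loc_integrable [set: 'cV[R]_m] (fun=> 1 : R) by apply: loc_integrable_continuous; exact: cst_continuous.
have im y : (leb m).-integrable setT (EFin \o molli y).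
  have := loc_integrable_test l1 (cm y) (@compact_cbox R m _ _) (@subsetT _ _) (@molli_out y).
  by congr (_.-integrable _ _); apply/funext => z /=; rewrite mul1r.
have m0 : molli 0 = mollifier by apply/funext => z; rewrite /molli subr0.
split; [exact: im|rewrite /Rintegral].
by rewrite -(@integral_translateT R m mollifier (- x) (test_continuous test_mollifier) (im x)).
Qed.

Lemma mollifier_mass : 0 < \int[leb m]_z mollifier z.
Proof.
have m0 : 0 < mollifier 0.
  by apply/(cutoff_gt0 _ _ _ (@ltr01 R)) => i; rewrite !mxE oppr_lt0 r0.
have cm : continuous mollifier by apply: test_continuous; exact: test_mollifier.
have im : (leb m).-integrable setT (EFin \o mollifier).
  by have [h _] := mollifier_int 0; move: h; congr (_.-integrable _ _); apply/funext => z /=; rewrite /molli subr0.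
have /cv_nbhs_ball[e e0 he] : nbhs (0 : 'cV[R]_m) [set z | mollifier 0 / 2 < mollifier z].
  have /cvgrPdist_lt /(_ (mollifier 0 / 2)) := cm 0.
  rewrite divr_gt0// => /(_ isT); apply: filterS => z.
  by move=> /=; rewrite ltr_distlC => /andP[]; lra.
pose B : set (cara R m) := box (const_mx (- (e / 2))) (const_mx (e / 2)).
have mB : measurable B by exact: box_cara.
have e2 : 0 < e / 2 by rewrite divr_gt0.
have vB : leb m B = (\prod_(i < m) e)%:E.
  rewrite leb_box => [|i]; last by rewrite !mxE lerNl (le_trans _ (ltW e2))// oppr_le0 ltW.
  by congr EFin; apply: eq_bigr => i _; rewrite !mxE opprK -splitr.
rewrite fine_gt0//; apply/andP; split; last first.
  by have := integrable_fin_num measurableT im; rewrite ge0_fin_numE// integral_ge0// => z _; rewrite lee_fin cutoff_ge0.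
apply: (@lt_le_trans _ _ (\int[leb m]_(z in B) (mollifier 0 / 2)%:E)%E).
  by rewrite (integral_cst _ mB) vB -EFinM lte_fin mulr_gt0// ?divr_gt0// prodr_gt0.
apply: (@le_trans _ _ (\int[leb m]_(z in B) (mollifier z)%:E)%E); last first.
  apply: ge0_subset_integral; [exact: mB|exact: measurableT| | |exact: subsetT].
  - by apply/measurable_EFinP; exact: continuous_cara.
  - by move=> z _; rewrite lee_fin cutoff_ge0.
apply: le_integral_ae; apply: ae_all => z Bz; rewrite lee_fin ltW//; apply: he.
rewrite sub0r normrN; apply: cv_norm_lt => // i; have /andP[] := Bz i; rewrite !mxE ltr_norml => h1 h2.
by apply/andP; split; move: h1 h2 e0; lra.
Qed.

End mollify.

Lemma dist_of_scaled_dist {R : realFieldType} (I Fp Fq fp fq X e : R) : 0 < I ->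
  `|Fp - fp * I| <= e / 2 * I -> `|Fq - fq * I| <= e / 2 * I -> `|Fq - Fp| <= X * I ->
  `|fq - fp| <= X + e.
Proof.
move=> I0; rewrite !ler_norml => /andP[h1 h2] /andP[h3 h4] /andP[h5 h6].
by apply/andP; split; rewrite -(ler_pM2r I0); lra.
Qed.

Section box_gradient.
Context {R : realType}.
Variable m : nat.
Variables (a b : 'cV[R]_m) (U : set 'cV[R]_m) (f : 'cV[R]_m -> R) (G : 'I_m -> 'cV[R]_m -> R) (L : R).
Hypothesis abU : cbox a b `<=` U.
Hypothesis lf : loc_integrable U f.
Hypothesis lG : forall j, loc_integrable U (G j).
Hypothesis fG : forall phi, test_function U phi -> forall j,
  \int[leb m]_z (f z * 'D_(basis_vec j) phi z) = - \int[leb m]_z (G j z * phi z).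
Hypothesis L0 : 0 <= L.
Hypothesis GL : forall j, {ae leb m, forall z, U z -> `|G j z| <= L}.
Implicit Types (x y z u v p q : 'cV[R]_m) (r : R).

Section one_radius.
Variable r : R.
Hypothesis r0 : 0 < r.
Let I := \int[leb m]_z mollifier r z.
Let F x := \int[leb m]_z (f z * molli r x z).

Let molli_cont x : continuous (molli r x).
Proof. by apply: test_continuous; apply: test_molli => //; exact: subsetT. Qed.

Let int_f x : rbox r x `<=` cbox a b -> (leb m).-integrable setT (EFin \o (fun z => f z * molli r x z)).
Proof.
move=> xab; apply: (loc_integrable_test lf _ (@compact_cbox R m _ _) (subset_trans xab abU)).
  exact: molli_cont.
exact: molli_out.
Qed.

Let out_D u x z : ~ rbox r x z -> 'D_u (molli r x) z = 0.
Proof. by apply: derive_support; [exact: compact_cbox|exact: molli_out]. Qed.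

Let cont_D u x : continuous (fun z => 'D_u (molli r x) z).
Proof. by apply: test_derive_continuous; apply: test_molli => //; exact: subsetT. Qed.

Let int_D u x : rbox r x `<=` cbox a b -> (leb m).-integrable setT (EFin \o (fun z => f z * 'D_u (molli r x) z)).
Proof.
move=> xab; apply: (loc_integrable_test lf _ (@compact_cbox R m _ _) (subset_trans xab abU)).
  exact: cont_D.
exact: out_D.
Qed.

Lemma mollify_first_order u x : rbox r x `<=` cbox a b ->
  `|\int[leb m]_z (f z * 'D_u (molli r x) z)| <= m%:R * L * `|u| * I.
Proof.
move=> xab; have xU := subset_trans xab abU.
have tx : test_function U (molli r x) by exact: test_molli.
have txT := test_function_T tx.
have -> : \int[leb m]_z (f z * 'D_u (molli r x) z) = \sum_j u j ord0 * - \int[leb m]_z (G j z * molli r x z).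
  transitivity (\int[leb m]_z (\sum_j u j ord0 * (f z * 'D_(basis_vec j) (molli r x) z))).
    apply: eq_Rintegral => z _; rewrite (derive_lincomb _ (test_differentiable txT _)) mulr_sumr.
    by apply: eq_bigr => j _; rewrite mulrCA.
  have intj j : (leb m).-integrable setT (EFin \o (fun z => u j ord0 * (f z * 'D_(basis_vec j) (molli r x) z))).
    rewrite (_ : EFin \o _ = fun z => ((u j ord0)%:E * (f z * 'D_(basis_vec j) (molli r x) z)%:E)%E).
      by apply: integrableZl; [exact: measurableT|exact: int_D].
    by apply/funext => z /=; rewrite EFinM.
  rewrite (Rintegral_sum measurableT _ intj).2; apply: eq_bigr => j _.
  by rewrite RintegralZl ?fG//; exact: int_D.
apply: (le_trans (ler_norm_sum _ _ _)).
apply: (@le_trans _ _ (\sum_(j < m) `|u| * (L * I))); last first.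
  by rewrite sumr_const card_ord -mulr_natl le_eqVlt; apply/orP; left; apply/eqP; ring.
apply: ler_sum => j _; rewrite normrM normrN ler_pM ?cv_coord_norm//.
have iG : (leb m).-integrable setT (EFin \o (fun z => G j z * molli r x z)).
  by apply: (loc_integrable_test (lG j) _ (@compact_cbox R m _ _) xU); [exact: molli_cont|exact: molli_out].
apply: (le_trans (le_normr_Rintegral measurableT iG)).
have [im E] := mollifier_int r x.
rewrite /I -E -RintegralZl//; apply: le_Rintegral_ae.
- exact: measurableT.
- by move: (integrable_norm iG); congr (_.-integrable _ _); apply/funext.
- by move: (integrableZl measurableT L im); congr (_.-integrable _ _); apply/funext => z /=; rewrite EFinM.
- apply: ae_mono (GL j) => z hz _; rewrite normrM (ger0_norm (molli_ge0 _ _ _)).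
  have [xz|nxz] := pselect (rbox r x z); first by rewrite ler_wpM2r ?molli_ge0//; apply: hz; exact: xU.
  by rewrite molli_out// !mulr0.
Qed.

Lemma mollify_step v : exists2 C : R, 0 <= C & forall x (t : R), 0 < t ->
  rbox r x `<=` cbox a b -> rbox r (x + t *: v) `<=` cbox a b ->
  `|F (x + t *: v) - F x| <= t * (m%:R * L * `|v| * I) + C * t ^+ 2.
Proof.
have [C C0 hC] := mollifier_taylor r v.
have mab : measurable (cbox a b : set (cara R m)) by exact: cbox_cara.
have if1 : (leb m).-integrable (cbox a b) (EFin \o f) by apply: lf => //; exact: compact_cbox.
have if2 : (leb m).-integrable (cbox a b) (EFin \o (fun z => `|f z|)).
  by move: (integrable_norm if1); congr (_.-integrable _ _); apply/funext.
exists (C * \int[leb m]_(z in cbox a b) `|f z|); first by rewrite mulr_ge0// Rintegral_ge0.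
move=> x t t0 xab xtab.
pose E z := f z * molli r (x + t *: v) z - f z * molli r x z - t * (f z * 'D_(- v) (molli r x) z).
have i1 := int_f xtab; have i2 := int_f xab; have i3 := int_D (- v) xab.
have i12 : (leb m).-integrable setT (EFin \o (fun z => f z * molli r (x + t *: v) z - f z * molli r x z)).
  by move: (integrableB measurableT i1 i2); congr (_.-integrable _ _).
have i4 : (leb m).-integrable setT (EFin \o (fun z => t * (f z * 'D_(- v) (molli r x) z))).
  by move: (integrableZl measurableT t i3); congr (_.-integrable _ _); apply/funext => z /=; rewrite EFinM.
have iE : (leb m).-integrable setT (EFin \o E).
  by move: (integrableB measurableT i12 i4); congr (_.-integrable _ _).
have EE : \int[leb m]_z E z = F (x + t *: v) - F x - t * \int[leb m]_z (f z * 'D_(- v) (molli r x) z).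
  by rewrite /E RintegralB// RintegralB// RintegralZl.
have EB : `|\int[leb m]_z E z| <= C * (\int[leb m]_(z in cbox a b) `|f z|) * t ^+ 2.
  rewrite -(@Rintegral_supp _ _ (cbox a b)); last first.
    move=> z nz; have n1 : ~ rbox r x z by move=> /xab.
    have n2 : ~ rbox r (x + t *: v) z by move=> /xtab.
    by rewrite /E (molli_out n1) (molli_out n2) (out_D _ n1) !mulr0 !subr0.
  have iEab : (leb m).-integrable (cbox a b) (EFin \o E).
    by apply: integrableS iE; [exact: measurableT|exact: mab|exact: subsetT].
  apply: (le_trans (le_normr_Rintegral mab iEab)).
  rewrite mulrAC -RintegralZl//; apply: le_Rintegral => //.
  - by move: (integrable_norm iEab); congr (_.-integrable _ _); apply/funext.
  - by move: (integrableZl mab (C * t ^+ 2) if2); congr (_.-integrable _ _); apply/funext => z /=; rewrite EFinM.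
  - move=> z _; rewrite /E (_ : _ - _ - _ = f z * (molli r (x + t *: v) z - molli r x z - t * 'D_(- v) (molli r x) z)).
      by rewrite normrM mulrC ler_wpM2r// hC.
    by rewrite !mulrBr mulrCA.
have h1 := mollify_first_order (- v) xab; rewrite normrN in h1.
have -> : F (x + t *: v) - F x = t * (\int[leb m]_z (f z * 'D_(- v) (molli r x) z)) + \int[leb m]_z E z.
  by rewrite EE [RHS]addrC subrK.
apply: (le_trans (ler_normD _ _)); rewrite lerD// normrM gtr0_norm//.
by rewrite ler_wpM2l// ltW.
Qed.

Lemma rbox_segment x v (s : R) : 0 <= s <= 1 -> rbox r x `<=` cbox a b -> rbox r (x + v) `<=` cbox a b ->
  rbox r (x + s *: v) `<=` cbox a b.
Proof.
move=> /andP[s0 s1] h1 h2 z hz i.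
have r0' := ltW r0.
have e1 y : rbox r y (y - const_mx r) by move=> j; rewrite !mxE lexx/=; lra.
have e2 y : rbox r y (y + const_mx r) by move=> j; rewrite !mxE lexx andbT/=; lra.
have /andP[a1 _] := h1 _ (e1 x) i; have /andP[_ b1] := h1 _ (e2 x) i.
have /andP[a2 _] := h2 _ (e1 (x + v)) i; have /andP[_ b2] := h2 _ (e2 (x + v)) i.
have := hz i; move: a1 b1 a2 b2; rewrite !mxE => a1 b1 a2 b2 /andP[c1 c2].
by apply/andP; split; nra.
Qed.

(** Cut the segment into N steps: the quadratic errors add up to a multiple of
1 / N. *)
Lemma mollify_lip x v : rbox r x `<=` cbox a b -> rbox r (x + v) `<=` cbox a b ->
  `|F (x + v) - F x| <= m%:R * L * `|v| * I.
Proof.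
move=> hx hv; have [C C0 hC] := mollify_step v.
apply/ler_addgt0Pr => e e0.
pose N := Num.Def.archi_bound (C / e).
have CN : C / N.+1%:R <= e.
  rewrite ler_pdivrMr// mulrC -ler_pdivrMr// ltW//.
  apply: lt_le_trans (archi_boundP _) _; first by rewrite divr_ge0// ltW.
  by rewrite ler_nat.
set B := m%:R * L * `|v| * I.
have t0 : 0 < N.+1%:R^-1 :> R by rewrite invr_gt0.
set t : R := N.+1%:R^-1 in t0.
have tN : N.+1%:R * t = 1 by rewrite mulfV.
suff h k : (k <= N.+1)%N -> `|F (x + (k%:R * t) *: v) - F x| <= k%:R * (t * B + C * t ^+ 2).
  have := h _ (leqnn _); rewrite tN scale1r mulrDr mulrA tN mul1r => /le_trans; apply.
  by rewrite lerD2l mulrCA expr2 (mulrA _ t) tN mul1r.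
elim: k => [_|k IH kN]; first by rewrite mul0r scale0r addr0 subrr normr0 mul0r.
have kt (j : nat) : (j <= N.+1)%N -> rbox r (x + (j%:R * t) *: v) `<=` cbox a b.
  move=> jN; apply: rbox_segment => //; rewrite mulr_ge0 ?(ltW t0)//=.
  by rewrite -[leRHS]tN ler_wpM2r ?(ltW t0)// ler_nat.
have := hC (x + (k%:R * t) *: v) t t0 (kt _ (ltnW kN)).
have -> : x + (k%:R * t) *: v + t *: v = x + (k.+1%:R * t) *: v.
  by rewrite -addrA -scalerDl -natr1 mulrDl mul1r.
move=> /(_ (kt _ kN)) h.
rewrite (_ : _ - _ = (F (x + (k.+1%:R * t) *: v) - F (x + (k%:R * t) *: v)) + (F (x + (k%:R * t) *: v) - F x)); last first.
  by rewrite addrA subrK.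
apply: (le_trans (ler_normD _ _)); rewrite -natr1 [in leRHS]mulrDl mul1r [leRHS]addrC.
by apply: lerD; [rewrite natr1; exact: h|apply: IH; exact: ltnW].
Qed.

Lemma mollify_near x e : rbox r x `<=` cbox a b -> (forall z, rbox r x z -> `|f z - f x| <= e) ->
  `|F x - f x * I| <= e * I.
Proof.
move=> xab hx; have [im E] := mollifier_int r x.
rewrite /I -E -!RintegralZl; [|exact: measurableT|exact: im|exact: measurableT|exact: im].
rewrite /F -RintegralB; [|exact: measurableT| |]; last 2 first.
- exact: int_f.
- by move: (integrableZl measurableT (f x) im); congr (_.-integrable _ _); apply/funext => z /=; rewrite EFinM.
have i1 : (leb m).-integrable setT (EFin \o (fun z => f z * molli r x z - f x * molli r x z)).
  move: (integrableB measurableT (int_f xab) (integrableZl measurableT (f x) im)).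
  by congr (_.-integrable _ _); apply/funext => z /=; rewrite EFinB EFinM.
apply: (le_trans (le_normr_Rintegral measurableT i1)).
apply: le_Rintegral.
- exact: measurableT.
- by move: (integrable_norm i1); congr (_.-integrable _ _); apply/funext.
- by move: (integrableZl measurableT e im); congr (_.-integrable _ _); apply/funext => z /=; rewrite EFinM.
- move=> z _; rewrite -mulrBl normrM (ger0_norm (molli_ge0 _ _ _)).
  have [xz|nxz] := pselect (rbox r x z); first by rewrite ler_wpM2r ?molli_ge0//; apply: hx.
  by rewrite molli_out// !mulr0.
Qed.

End one_radius.

(** The mollifications satisfy the bound with a constant independent of the
radius and are close to [f] at its continuity points. *)
Lemma box_gradient_lip p q : (forall i, a i ord0 < p i ord0 < b i ord0) -> (forall i, a i ord0 < q i ord0 < b i ord0) ->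
  {for p, continuous f} -> {for q, continuous f} -> `|f q - f p| <= m%:R * L * `|q - p|.
Proof.
move=> abp abq cp cq; apply/ler_addgt0Pr => e e0.
have e2 : 0 < e / 2 by rewrite divr_gt0.
have small x : (forall i, a i ord0 < x i ord0 < b i ord0) -> {for x, continuous f} ->
   exists2 s : R, 0 < s & forall r, 0 < r < s -> rbox r x `<=` cbox a b /\ forall z, rbox r x z -> `|f z - f x| <= e / 2.
  move=> abx cx.
  have [s1 s10 h1] : exists2 s : R, 0 < s & forall z, `|x - z| < s -> `|f z - f x| <= e / 2.
    have /cvgrPdist_le /(_ _ e2) /cv_nbhs_ball[s s0 hs] := cx.
    by exists s => // z /hs; rewrite distrC.
  have [s2 s20 h2] : exists2 s : R, 0 < s & forall i, a i ord0 <= x i ord0 - s /\ x i ord0 + s <= b i ord0.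
    have : \forall s \near 0^'+, forall i, a i ord0 <= x i ord0 - s /\ x i ord0 + s <= b i ord0.
      apply: filter_forall => i; have /andP[ax xb] := abx i.
      near=> s; split.
        by rewrite lerBrDr -lerBrDl; near: s; apply: nbhs_right_le; rewrite subr_gt0.
      by rewrite -lerBrDl; near: s; apply: nbhs_right_le; rewrite subr_gt0.
    by move=> H; have [s] := filter_ex (filterI H (nbhs_right_gt 0)); case=> hs s0; exists s.
  exists (Num.min s1 s2) => [|r /andP[r0]]; first by rewrite lt_min s10.
  rewrite lt_min => /andP[r1 r2]; split.
    move=> z hz i; have := hz i; rewrite !mxE => /andP[c1 c2]; have [d1 d2] := h2 i.
    by apply/andP; split; move: c1 c2 d1 d2 r2; lra.
  move=> z hz; apply: h1; apply: cv_norm_lt => // i; rewrite 2!mxE ltr_distlC.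
  by have := hz i; rewrite !mxE => /andP[c1 c2]; apply/andP; split; move: c1 c2 r1; lra.
have [sp sp0 hp] := small p abp cp; have [sq sq0 hq] := small q abq cq.
pose r := Num.min sp sq / 2.
have m0 : 0 < Num.min sp sq by rewrite lt_min sp0.
have r0 : 0 < r by rewrite divr_gt0.
have rm : r < Num.min sp sq by rewrite ltr_pdivrMr// mulr_natr mulr2n ltrDl.
have rp : 0 < r < sp by rewrite r0/= (lt_le_trans rm)// ge_min lexx.
have [p1 p2] := hp r rp.
have rq : 0 < r < sq by rewrite r0/= (lt_le_trans rm)// ge_min lexx orbT.
have [q1 q2] := hq r rq.
have h1 := mollify_near p1 p2; have h2 := mollify_near q1 q2.
have qE : p + (q - p) = q by rewrite addrC subrK.
have := mollify_lip r0 p1 (v := q - p); rewrite qE => /(_ q1) h3.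
exact: dist_of_scaled_dist (mollifier_mass m r0) h1 h2 h3.
Unshelve. all: by end_near. Qed.

End box_gradient.

(** * Hausdorff measure *)

Section metric_outer_measure.
Context {R : realType} {T : Type}.
Variables (mu : {outer_measure set T -> \bar R}) (phi : T -> R).
Local Open Scope ereal_scope.
Hypothesis additive_far : forall (A B : set T) (e : R), (0 < e)%R ->
  (forall x y, A x -> B y -> phi x + e <= phi y)%R -> mu A + mu B <= mu (A `|` B).
Variable c : R.
Variable X : set T.

Let layer (k : nat) : set T := [set x | X x /\ (c - k.+1%:R^-1 < phi x <= c - k.+2%:R^-1)%R].
Let inner_part (k : nat) : set T := [set x | X x /\ (phi x <= c - k.+1%:R^-1)%R].

Let inv_mono (j k : nat) : (j <= k)%N -> (k.+1%:R^-1 <= j.+1%:R^-1 :> R)%R.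
Proof. by move=> jk; rewrite lef_pV2 ?posrE// ler_nat ltnS. Qed.

Let layers_sum (s N : nat) : \sum_(0 <= k < N) mu (layer (k.*2 + s)) <= mu X.
Proof.
suff h : \sum_(0 <= k < N) mu (layer (k.*2 + s)) <=
    mu [set x | X x /\ exists2 k, (k < N)%N & layer (k.*2 + s) x].
  by apply: (le_trans h); apply: le_outer_measure => x [].
elim: N => [|N IH]; first by rewrite big_geq// outer_measure_ge0.
rewrite big_nat_recr//=; apply: (le_trans (leeD2r _ IH)).
apply: (@le_trans _ _ (mu ([set x | X x /\ exists2 k, (k < N)%N & layer (k.*2 + s) x] `|` layer (N.*2 + s)))); last first.
  apply: le_outer_measure => x [[Xx [k kN kx]]|lx]; first by split => //; exists k => //; exact: ltnW.
  by split; [case: lx|exists N].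
case: N {IH} => [|N].
  rewrite (_ : [set x | _] = set0); last by rewrite -subset0 => x [_ []].
  by rewrite outer_measure0 add0e set0U.
pose e : R := (((N.*2 + s).+2%:R^-1 - (N.*2 + s).+3%:R^-1))%R.
apply: (@additive_far _ _ e) => [|x y [Xx [k kN [_ /andP[_ kx]]]] [_ /andP[yN _]]].
  by rewrite subr_gt0 ltf_pV2 ?posrE// ltr_nat.
have h1 : ((N.*2 + s).+2%:R^-1 <= (k.*2 + s).+2%:R^-1 :> R)%R.
  by apply: (@inv_mono (k.*2 + s).+1 (N.*2 + s).+1); rewrite ltnS leq_add2r leq_double -ltnS.
have h2 : (c - (N.*2 + s).+3%:R^-1 < phi y)%R by move: yN; rewrite doubleS !addSn.
rewrite /e; move: h1 h2 kx.
set u := ((k.*2 + s).+2%:R^-1)%R; set v := ((N.*2 + s).+2%:R^-1)%R; set w := ((N.*2 + s).+3%:R^-1)%R.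
by move: u v w => u v w; lra.
Qed.

Let layers_fin : mu X < +oo -> \sum_(k <oo) mu (layer k) < +oo.
Proof.
move=> Xoo; apply: (@le_lt_trans _ _ (mu X + mu X)); last by rewrite lte_add_pinfty.
apply: lime_le; first by apply: is_cvg_nneseries => *; exact: outer_measure_ge0.
near=> N.
apply: (@le_trans _ _ (\sum_(0 <= k < N) (mu (layer (k.*2 + 0)) + mu (layer (k.*2 + 1))))).
  apply: (@le_trans _ _ (\sum_(0 <= k < N.*2) mu (layer k))).
    rewrite [leRHS](@big_cat_nat _ _ _ N)//=; last by rewrite -addnn leq_addr.
    by apply: leeDl; apply: sume_ge0 => *; exact: outer_measure_ge0.
  elim: (N) => [|M IH]; first by rewrite big_geq// big_geq.
  rewrite doubleS [leRHS]big_nat_recr//= big_nat_recr//= big_nat_recr//= -addeA.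
  by rewrite addn0 addn1; apply: leeD.
by rewrite big_split/=; apply: leeD; exact: layers_sum.
Unshelve. all: by end_near. Qed.

(** A set charges the layers that approach the level [c] summably, since every
second layer is at a positive distance from the others; hence points near the
level carry little measure. *)
Lemma additive_halfspace : mu (X `&` [set x | phi x < c]%R) + mu (X `&` ~` [set x | phi x < c]%R) <= mu X.
Proof.
have [Xoo|] := ltP (mu X) +oo; last by rewrite leye_eq => /eqP ->; rewrite leey.
have tail := nneseries_tail_cvg (layers_fin Xoo) (fun k _ => outer_measure_ge0 _ _).
have h K : mu (X `&` [set x | phi x < c]%R) + mu (X `&` ~` [set x | phi x < c]%R) <=
    mu X + \sum_(K <= k <oo) mu (layer k).
  have h1 : mu (X `&` [set x | phi x < c]%R) <= mu (inner_part K) + \sum_(K <= k <oo) mu (layer k).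
    apply: (@le_trans _ _ (mu (inner_part K `|` \bigcup_(k in ~` `I_K) layer k))); last first.
      by apply: (le_trans (outer_measureU2 _ _ _)); rewrite leeD2l// outer_measure_sigma_subadditive_tail.
    apply: le_outer_measure => x [Xx /= xc].
    have [xK|Kx] := leP (phi x) (c - K.+1%:R^-1)%R; first by left.
    right; have : exists k : nat, (phi x <= c - k.+1%:R^-1)%R.
      exists (Num.Def.archi_bound (c - phi x)^-1); rewrite lerBrDr -lerBrDl.
      rewrite invf_ple ?posrE ?subr_gt0// ltW//; apply: lt_le_trans (archi_boundP _) _.
        by rewrite invr_ge0 subr_ge0 ltW.
      by rewrite ler_nat.
    move=> ex; case: (ex_minnP ex) => -[|k] hk kmin.
      have := kmin 0%N; have := lt_le_trans Kx hk; rewrite ltrD2l ltrN2 => abs.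
      by have := inv_mono (leq0n K); rewrite leNgt abs.
    have kx : (c - k.+1%:R^-1 < phi x)%R by rewrite ltNge; apply/negP => /kmin; rewrite ltnn.
    exists k; last by split => //; rewrite kx hk.
    apply/negP; rewrite -leqNgt leqNgt; apply/negP => kK.
    by have := lt_le_trans Kx hk; rewrite ltrD2l ltrN2 => abs; have := inv_mono kK; rewrite leNgt abs.
  apply: (le_trans (leeD2r _ h1)); rewrite addeAC leeD2r//.
  apply: (@le_trans _ _ (mu (inner_part K `|` (X `&` ~` [set x | phi x < c]%R)))); last first.
    by apply: le_outer_measure => x [[]|[]].
  apply: (@additive_far _ _ (K.+1%:R^-1)%R) => [|x y [_ xK] [_ /= /negP]]; first by rewrite invr_gt0.
  by rewrite -leNgt; move: xK; set u := (K.+1%:R^-1)%R; move: u => u; lra.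
have cvh : mu X + \sum_(K <= k <oo) mu (layer k) @[K --> \oo] --> mu X + 0.
  by apply: cvgeD => //; [rewrite fin_num_adde_defl|exact: cvg_cst].
rewrite -[leRHS]adde0 -(cvg_lim (@ereal_hausdorff R) cvh); apply: lime_ge; first by apply/cvg_ex; eexists; exact: cvh.
by apply: nearW => K; exact: h.
Qed.

End metric_outer_measure.

Section hausdorff_facts.
Context {R : realType}.
Local Open Scope ereal_scope.

Section diameter.
Variables m : nat.
Implicit Types U V : set 'cV[R]_m.

Lemma diameter_ge U x y : U x -> U y -> (enorm (x - y))%:E <= diameter U.
Proof. by move=> Ux Uy; apply: ereal_sup_ubound; exists (x, y). Qed.

Lemma diameter_ge0 U : U !=set0 -> 0 <= diameter U.
Proof. by move=> [x Ux]; apply: le_trans (diameter_ge Ux Ux); rewrite lee_fin enorm_ge0. Qed.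

Lemma diameter_le U (D : R) : (forall x y, U x -> U y -> enorm (x - y) <= D)%R -> diameter U <= D%:E.
Proof. by move=> h; apply: ge_ereal_sup => _ [[x y] [/= Ux Uy] <-]; rewrite lee_fin h. Qed.

Lemma diameter_fin U (D : R) : U !=set0 -> diameter U <= D%:E -> diameter U = (fine (diameter U))%:E.
Proof.
move=> U0 UD; rewrite fineK// ge0_fin_numE ?diameter_ge0//.
by apply: le_lt_trans UD _; rewrite ltry.
Qed.

End diameter.

Variable s : nat.

Lemma gauge_le_set m (d : R) (U V : set 'cV[R]_m) : U `<=` V -> hausdorff_gauge s d U <= hausdorff_gauge s d V.
Proof.
move=> UV; rewrite {1}/hausdorff_gauge; case: asboolP => [_|/eqP/set0P U0]; first exact: hausdorff_gauge_ge0.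
have V0 : V !=set0 by case: U0 => x /UV; exists x.
rewrite /hausdorff_gauge; case: asboolP => [/eqP|_]; first by move/set0P: V0 => /negP.
case: (ifPn (diameter V <= d%:E)) => [Vd|]; last by rewrite leey.
have UVd : diameter U <= diameter V.
  by apply: ge_ereal_sup => _ [[x y] [/= Ux Uy] <-]; apply: diameter_ge; exact: UV.
rewrite (le_trans UVd Vd); apply: lee_wpmul2l; first exact: outer_measure_ge0.
have := UVd; rewrite (diameter_fin U0 (le_trans UVd Vd)) (diameter_fin V0 Vd) lee_fin => h.
have h0 : (0 <= fine (diameter U))%R by rewrite fine_ge0 ?diameter_ge0.
have h1 : (0 <= fine (diameter V))%R by rewrite fine_ge0 ?diameter_ge0.
by rewrite lee_fin /= lerXn2r ?nnegrE ?divr_ge0// ler_pM2r// invr_gt0.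
Qed.

(** A set of small diameter cannot meet both sets, so covers split. *)
Lemma hausdorff_far m i (A B : set 'cV[R]_m) (e : R) : (0 < e)%R ->
  (forall x y, A x -> B y -> x i ord0 + e <= y i ord0)%R ->
  hausdorff_outer s A + hausdorff_outer s B <= hausdorff_outer s (A `|` B).
Proof.
move=> e0 AB; set c := hausdorff_outer s (A `|` B).
pose cov d := covering_outer (@hausdorff_gauge R s m d).
have cov_ge0 d (X : set 'cV[R]_m) : 0 <= cov d X by exact: covering_outer_ge0 (hausdorff_gauge_ge0 _ _) _.
have cov_mono d d' (X : set 'cV[R]_m) : (d <= d')%R -> cov d' X <= cov d X.
  move=> dd'; apply: le_ereal_inf_tmp => _ [U XU <-]; apply: ereal_inf_le.
  exists (\sum_(k <oo) hausdorff_gauge s d' (U k)); first by exists U.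
  apply: lee_nneseries => [k _ _|k _]; first exact: hausdorff_gauge_ge0.
  rewrite /hausdorff_gauge; case: asboolP => // _; case: (ifPn (diameter (U k) <= d%:E)); last by rewrite leey.
  by move=> h; rewrite ifT// (le_trans h)// lee_fin.
have covD d : (0 < d < e)%R -> cov d A + cov d B <= cov d (A `|` B).
  move=> /andP[d0 de]; apply: le_ereal_inf_tmp => _ [U ABU <-].
  pose V (C : set 'cV[R]_m) k : set 'cV[R]_m := [set x | U k x /\ exists2 y, U k y & C y].
  have covV (C : set 'cV[R]_m) : C `<=` A `|` B -> cov d C <= \sum_(k <oo) hausdorff_gauge s d (V C k).
    move=> CAB; apply: ereal_inf_lbound; exists (V C) => // x Cx.
    by have [k _ Ux] := ABU x (CAB _ Cx); exists k => //; split => //; exists x.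
  apply: (le_trans (leeD (covV A _) (covV B _))) => //.
  rewrite -nneseriesD; [|by move=> *; exact: hausdorff_gauge_ge0..].
  apply: lee_nneseries => [k _ _|k _]; first by apply: adde_ge0; exact: hausdorff_gauge_ge0.
  have [[a [Ua Aa]]|nA] := pselect (exists a, U k a /\ A a); last first.
    rewrite (_ : V A k = set0); last by rewrite -subset0 => x [_ [y Uy Ay]]; apply: nA; exists y.
    by rewrite hausdorff_gauge0 add0e; apply: gauge_le_set => x [].
  have [[b [Ub Bb]]|nB] := pselect (exists b, U k b /\ B b); last first.
    rewrite (_ : V B k = set0); last by rewrite -subset0 => x [_ [y Uy Ay]]; apply: nB; exists y.
    by rewrite hausdorff_gauge0 adde0; apply: gauge_le_set => x [].
  rewrite [leRHS]/hausdorff_gauge; case: asboolP => [U0|_]; first by rewrite U0 in Ua.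
  rewrite ifF ?leey//; apply/negbTE; rewrite -ltNge.
  apply: (@lt_le_trans _ _ (enorm (b - a))%:E); last exact: diameter_ge.
  rewrite lte_fin (lt_le_trans de)//; apply: le_trans (coord_le_enorm _ i ord0).
  by rewrite (le_trans _ (ler_norm _))// !mxE; have := AB _ _ Aa Bb; lra.
have step d1 d2 : (0 < d1)%R -> (0 < d2)%R -> cov d1 A + cov d2 B <= c.
  move=> d10 d20; pose d := Num.min (e / 2)%R (Num.min d1 d2).
  have d0 : (0 < d)%R by rewrite !lt_min d10 d20 divr_gt0.
  have de : (d < e)%R by rewrite gt_min; apply/orP; left; rewrite ltr_pdivrMr// ltr_pMr// ltr1n.
  apply: (@le_trans _ _ (cov d A + cov d B)).
    by apply: leeD; apply: cov_mono; rewrite !ge_min lexx ?orbT.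
  apply: (le_trans (covD d _)); first by rewrite d0.
  by apply: ereal_sup_ubound; exists d.
have [coo|] := ltP c +oo; last by rewrite leye_eq => /eqP ->; rewrite leey.
have c0 : 0 <= c by exact: hausdorff_outer_ge0.
have cfin : c \is a fin_num by rewrite ge0_fin_numE.
have hA : hausdorff_outer s A <= c by apply: le_hausdorff_outer => x; left.
have Afin : hausdorff_outer s A \is a fin_num.
  by rewrite ge0_fin_numE ?hausdorff_outer_ge0// (le_lt_trans hA).
rewrite addeC -leeBrDr//; apply: ge_ereal_sup => _ [d2 d20 <-].
have Bfin : cov d2 B \is a fin_num.
  rewrite ge0_fin_numE//; apply: le_lt_trans coo; apply: le_trans (step 1%R d2 ltr01 d20).
  exact: leeDr.
rewrite leeBrDr// addeC -leeBrDr//; apply: ge_ereal_sup => _ [d1 d10 <-].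
by rewrite leeBrDr//; exact: step.
Qed.

(** Half-spaces are measurable by [additive_halfspace], since the measure is
additive on sets at a positive distance, and they generate the Borel sets. *)
Lemma hausdorff_bor m (E : set (bor R m)) : measurable E ->
  (measurable (E : set (caratheodory_type (@hausdorff_outer R s m)))).
Proof.
apply: smallest_sub; first exact: sigma_algebra_measurable.
have half i c : (measurable ([set z : 'cV[R]_m | z i ord0 < c]%R : set (caratheodory_type (@hausdorff_outer R s m)))).
  apply: le_caratheodory_measurable => X.
  apply: (@additive_halfspace _ _ (@hausdorff_outer R s m) (fun z : 'cV[R]_m => z i ord0)).
  by move=> A B e; exact: hausdorff_far.
move=> _ [a [b ->]].
rewrite boxE; apply: fin_bigcap_measurable => // i _.
by apply: measurableI; [apply: measurableC; exact: half|exact: half].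
Qed.

(** Fine covers are mapped to fine covers. *)
Lemma hausdorff_lipschitz m p (f : 'cV[R]_m -> 'cV[R]_p) (X : set 'cV[R]_m) (L d0 : R) :
  (0 < L)%R -> (0 < d0)%R ->
  (forall x y, X x -> X y -> enorm (x - y) < d0 -> enorm (f x - f y) <= L * enorm (x - y))%R ->
  hausdorff_outer s (f @` X) <= (L ^+ s)%:E * hausdorff_outer s X.
Proof.
move=> L0 d00 hf; apply: ge_ereal_sup => _ [d /= dpos <-].
have Ls : (0 < L ^+ s)%R by rewrite exprn_gt0.
pose e := Num.min (d / L)%R (d0 / 2)%R.
have e0 : (0 < e)%R by rewrite lt_min !divr_gt0.
have ed : (L * e <= d)%R by rewrite mulrC -ler_pdivlMr// ge_min lexx.
have ed0 : (e < d0)%R by rewrite gt_min; apply/orP; right; rewrite ltr_pdivrMr// ltr_pMr// ltr1n.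
apply: (@le_trans _ _ ((L ^+ s)%:E * covering_outer (hausdorff_gauge s e) X)); last first.
  by rewrite lee_pmul2l//; apply: ereal_sup_ubound; exists e.
rewrite -ereal_inf_pZl//; apply: le_ereal_inf_tmp => _ [_ [U XU <-] <-].
rewrite -nneseriesZl; last by move=> *; exact: hausdorff_gauge_ge0.
apply: ereal_inf_le; exists (\sum_(k <oo) hausdorff_gauge s d (f @` (U k `&` X))).
  exists (fun k => f @` (U k `&` X)) => // _ [x Xx <-].
  by have [k _ Ux] := XU _ Xx; exists k => //; exists x.
apply: lee_nneseries => [k _ _|k _]; first exact: hausdorff_gauge_ge0.
apply: (@le_trans _ _ ((L ^+ s)%:E * hausdorff_gauge s e (U k `&` X))); last first.
  by rewrite lee_pmul2l//; apply: gauge_le_set => x [].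
move: (U k `&` X) (@subIsetr _ (U k) X) => V VX.
rewrite {1}/hausdorff_gauge; case: asboolP => [_|fV0].
  by rewrite mule_ge0 ?hausdorff_gauge_ge0// lee_fin ltW.
have V0 : V !=set0.
  by apply/set0P/eqP => V0; apply: fV0; rewrite V0 image_set0.
rewrite /hausdorff_gauge; case: asboolP => [/eqP|_]; first by move/set0P: V0 => /negP.
case: (ifPn (diameter V <= e%:E)) => [Ve|_]; last by rewrite gt0_muley ?lte_fin// leey.
have VD := diameter_fin V0 Ve.
have D0 : (0 <= fine (diameter V))%R by rewrite fine_ge0 ?diameter_ge0.
have fVD : diameter (f @` V) <= (L * fine (diameter V))%:E.
  apply: diameter_le => _ _ [x Vx <-] [y Vy <-].
  have xyV : (enorm (x - y) <= fine (diameter V))%R by rewrite -lee_fin -VD diameter_ge.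
  apply: (@le_trans _ _ (L * enorm (x - y))%R); last by rewrite ler_wpM2l// ltW.
  apply: hf; [exact: VX|exact: VX|].
  by apply: le_lt_trans ed0; rewrite -lee_fin (le_trans _ Ve)// VD lee_fin.
have fV0' : f @` V !=set0 by case: V0 => x Vx; exists (f x); exists x.
have De : (fine (diameter V) <= e)%R by rewrite -lee_fin -VD.
have fVd : diameter (f @` V) <= d%:E.
  by rewrite (le_trans fVD)// lee_fin (le_trans _ ed)// ler_wpM2l// ltW.
rewrite fVd muleCA -EFinM; apply: lee_wpmul2l; first exact: outer_measure_ge0.
have h0 : (0 <= fine (diameter (f @` V)))%R by rewrite fine_ge0 ?diameter_ge0.
have h1 : (fine (diameter (f @` V)) <= L * fine (diameter V))%R.
  by rewrite -lee_fin -(diameter_fin fV0' fVd).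
rewrite lee_fin -exprMn; apply: lerXn2r; rewrite ?nnegrE ?divr_ge0 ?mulr_ge0 ?(ltW L0)//.
by rewrite mulrA ler_wpM2r// invr_ge0.
Qed.

End hausdorff_facts.

(** * Translation-invariant measures *)

Section haar.
Context {R : realType}.

(** Additivity with values in the half-line makes the function monotone and
linear on rational multiples, which squeezes the other ones. *)
Lemma additive_linear (f : R -> \bar R) : (forall t, 0 <= t -> (0 <= f t)%E) ->
  (forall s t, 0 <= s -> 0 <= t -> f (s + t) = (f s + f t)%E) -> (f 1%R < +oo)%E ->
  forall t, 0 <= t -> f t = (t%:E * f 1%R)%E.
Proof.
move=> f0 fD f1.
have mono s t : 0 <= s -> s <= t -> (f s <= f t)%E.
  move=> s0 st; rewrite -(subrK s t) addrC fD ?subr_ge0//; apply: leeDl; apply: f0.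
  by rewrite subr_ge0.
have f00 : f 0 = 0%E.
  have h0 : f 0 \is a fin_num by rewrite ge0_fin_numE ?f0// (le_lt_trans (mono 0 1 _ _) f1).
  have := fD 0 0 (lexx _) (lexx _); rewrite addr0 -[in LHS](fineK h0) -[in RHS](fineK h0) -EFinD => -[h].
  by rewrite -(fineK h0); congr EFin; lra.
have fn (k : nat) t : 0 <= t -> f (k%:R * t) = (k%:R%:E * f t)%E.
  move=> t0; elim: k => [|k IH]; first by rewrite mul0r mul0e f00.
  rewrite -natr1 mulrDl mul1r fD// ?mulr_ge0// IH EFinD ge0_muleDl// ?lee_fin//.
  by rewrite mul1e.
have fin t : 0 <= t -> f t \is a fin_num.
  move=> t0; rewrite ge0_fin_numE ?f0//; apply: (@le_lt_trans _ _ (f (Num.Def.archi_bound t)%:R)).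
    by apply: mono => //; rewrite ltW// archi_boundP.
  rewrite -[X in f X]mulr1 fn// lte_mul_pinfty// lee_fin//.
pose F t := fine (f t).
have FE t : 0 <= t -> f t = (F t)%:E by move=> /fin /fineK.
move=> t t0; rewrite (FE _ t0) (FE 1)// -EFinM; congr EFin.
have F1 : 0 <= F 1 by rewrite fine_ge0 ?f0.
have near k : `|k%:R * (F t - t * F 1)| <= F 1.
  have kt0 : 0 <= k%:R * t by rewrite mulr_ge0.
  have /andP[h1 h2] := truncn_itv kt0; set N := Num.truncn _ in h1 h2.
  have FN (j : nat) : F j%:R = j%:R * F 1.
    by apply: EFin_inj; rewrite -FE// -[X in f X]mulr1 fn// FE.
  have Fk : F (k%:R * t) = k%:R * F t by apply: EFin_inj; rewrite -FE// fn// FE.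
  have a1 : N%:R * F 1 <= k%:R * F t by rewrite -FN -Fk -lee_fin -!FE//; exact: mono.
  have a2 : k%:R * F t <= N.+1%:R * F 1 by rewrite -FN -Fk -lee_fin -!FE//; apply: mono => //; exact: ltW.
  have b1 : N%:R * F 1 <= k%:R * t * F 1 by rewrite ler_wpM2r.
  have b2 : k%:R * t * F 1 <= N.+1%:R * F 1 by rewrite ler_wpM2r// ltW.
  rewrite ler_norml mulrBr mulrA; move: a2 b2; rewrite -natr1 mulrDl mul1r => a2 b2.
  by apply/andP; split; lra.
apply/eqP; rewrite -subr_eq0; apply/negPn/negP => ne.
have n0 : 0 < `|F t - t * F 1| by rewrite normr_gt0.
have := near (Num.Def.archi_bound (F 1 / `|F t - t * F 1|)).
rewrite leNgt => /negP; apply; rewrite normrM normr_nat -ltr_pdivrMr//.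
by rewrite archi_boundP// divr_ge0.
Qed.

Variable m : nat.
Variable mu : {measure set (bor R m) -> \bar R}.
Local Open Scope ereal_scope.
Hypothesis invariant : forall (v a b : 'cV[R]_m), mu (box (a + v) (b + v)) = mu (box a b).
Hypothesis unit_fin : mu (box 0 (const_mx 1%R)) < +oo.

Let upd (l : 'cV[R]_m) i (t : R) : 'cV[R]_m := (\col_j if j == i then t else l j ord0)%R.

Let cut (l : 'cV[R]_m) i s t : (0 <= s)%R -> (0 <= t)%R ->
  mu (box 0 (upd l i (s + t)%R)) = mu (box 0 (upd l i s)) + mu (box 0 (upd l i t)).
Proof.
move=> s0 t0; rewrite -(invariant (\col_j if j == i then s else 0)%R 0 (upd l i t)) -measureU//.
- congr (mu _); apply/seteqP; split => [z hz|z [|] hz j].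
  + have [zs|sz] := ltP (z i ord0) s; [left|right] => j; have := hz j; rewrite !mxE; case: eqVneq => [->|_] //.
    * by rewrite zs => /andP[->].
    * by rewrite add0r sz addrC => /andP[_ ->].
    * by rewrite add0r addr0.
  + by have := hz j; rewrite !mxE; case: eqVneq => // _ /andP[-> h] /=; rewrite (lt_le_trans h)// lerDl.
  + have := hz j; rewrite !mxE; case: eqVneq => [_|_]; last by rewrite add0r addr0.
    by rewrite add0r addrC => /andP[h ->]; rewrite (le_trans s0 h).
- exact: box_bor.
- exact: box_bor.
- rewrite -subset0 => z [h1 h2]; have := h1 i; have := h2 i; rewrite !mxE eqxx add0r.
  by move=> /andP[h _] /andP[_]; rewrite ltNge h.
Qed.

Lemma haar_box0 (l : 'cV[R]_m) : (forall i, 0 <= l i ord0)%R ->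
  mu (box 0 l) = (\prod_i l i ord0)%:E * mu (box 0 (const_mx 1%R)).
Proof.
move=> l0.
pose ls (s : seq 'I_m) : 'cV[R]_m := (\col_j if j \in s then l j ord0 else 1)%R.
suff h s : uniq s -> mu (box 0 (ls s)) = (\prod_(i <- s) l i ord0)%:E * mu (box 0 (const_mx 1%R)).
  rewrite -h ?index_enum_uniq//; congr (mu (box _ _)).
  by apply: cvP => i; rewrite mxE mem_index_enum.
elim: s => [_|i s IH /= /andP[nis us]].
  by rewrite big_nil mul1e; congr (mu (box _ _)); apply: cvP => i; rewrite !mxE.
have lsE : ls (i :: s) = upd (ls s) i (l i ord0).
  by apply: cvP => j; rewrite !mxE in_cons; case: eqVneq => [->|].
rewrite lsE; have := @additive_linear (fun t => mu (box 0 (upd (ls s) i t))) _ _ _ _ (l0 i) => ->.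
- rewrite (_ : upd (ls s) i 1 = ls s) ?IH// ?big_cons ?EFinM ?muleA//.
  by apply: cvP => j; rewrite !mxE; case: eqVneq => // ->; rewrite (negbTE nis).
- by move=> t _; exact: measure_ge0.
- exact: cut.
- rewrite (_ : upd (ls s) i 1 = ls s) ?IH//.
    by rewrite lte_mul_pinfty// lee_fin prodr_ge0.
  by apply: cvP => j; rewrite !mxE; case: eqVneq => // ->; rewrite (negbTE nis).
Qed.

(** A translation-invariant measure is additive, hence linear, in each side of
a box, so that it is determined by the measure of the unit cube. *)
Lemma haar (E : set (bor R m)) : measurable E -> mu E = mu (box 0 (const_mx 1%R)) * leb m E.
Proof.
have c0 : (0 <= fine (mu (box 0 (const_mx 1%R))))%R by rewrite fine_ge0.
have cE : mu (box 0 (const_mx 1%R)) = (fine (mu (box 0 (const_mx 1%R))))%:E.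
  by rewrite fineK// ge0_fin_numE.
have boxE (a b : 'cV[R]_m) : (forall i, a i ord0 <= b i ord0)%R ->
    mu (box a b) = mu (box 0 (const_mx 1%R)) * leb m (box a b).
  move=> ab; rewrite -(invariant (- a)%R) subrr (@haar_box0 (b - a)%R) => [|i]; last by rewrite !mxE subr_ge0.
  by rewrite leb_box// muleC; congr (_ * _%:E); apply: eq_bigr => i _; rewrite !mxE.
move=> mE; rewrite [in RHS]cE.
rewrite -[RHS]/(mscale (NngNum c0) (leb_bor m) E); apply: measure_bor_unique => // [a b ab|k].
  by rewrite boxE// [X in X * _ = _]cE.
rewrite boxE => [|i]; last by rewrite !mxE -subr_ge0 opprK addr_ge0.
by rewrite cE lte_mul_pinfty// leb_box_lt_pinfty.
Qed.

End haar.

(** * Hausdorff measure of flat sets *)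

Section flat_hausdorff.
Context {R : realType}.
Local Open Scope ereal_scope.

Lemma covering_outer_fin (T : pointedType) (rho : set T -> \bar R) (I : finType) (U : I -> set T)
    (X : set T) (c : R) : rho set0 = 0 -> (forall Y, 0 <= rho Y) -> X `<=` \bigcup_i U i ->
  (forall i, rho (U i) <= c%:E) -> covering_outer rho X <= (#|I|%:R * c)%:E.
Proof.
move=> rho0 rho_ge0 XU Uc.
pose s := [seq U i | i <- enum I].
have sE : size s = #|I| by rewrite size_map -cardE.
apply: (@le_trans _ _ (\sum_(k <oo) rho (nth set0 s k))).
  apply: ereal_inf_lbound; exists (nth set0 s) => // x /XU[i _ Ui].
  exists (index i (enum I)) => //.
  by rewrite (nth_map i) ?nth_index ?mem_enum// index_mem mem_enum.
rewrite (nneseries_split 0%N (size s)); last by move=> *; exact: rho_ge0.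
rewrite add0n [X in _ + X]eseries0 ?adde0; last first.
  by move=> k /= sk _; rewrite nth_default.
rewrite big_mkord; apply: (@le_trans _ _ (\sum_(i < size s) c%:E)).
  apply: lee_sum => k _; have ks : (k < size (enum I))%N by rewrite -(size_map U).
  have [i0 _] : exists i0 : I, True.
    by move: ks; case: (enum I) => // i _ _; exists i.
  by rewrite (nth_map i0).
by rewrite sumEFin sumr_const card_ord sE mulr_natl.
Qed.

Variable n : nat.

Lemma unit_ball_volume_fin : @unit_ball_volume R n < +oo.
Proof.
apply: le_lt_trans (leb_cbox_fin (const_mx (- 1)%R) (const_mx 1%R)); apply: le_outer_measure => x /= x1 i.
by rewrite !mxE -ler_norml (le_trans (coord_le_enorm _ _ _)).
Qed.

Lemma unit_ball_volume_gt0 : 0 < @unit_ball_volume R n.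
Proof.
pose r : R := (n.+1%:R^-1)%R.
have r0 : (0 < r)%R by rewrite invr_gt0.
apply: (@lt_le_trans _ _ (leb n (box (const_mx (- r)%R) (const_mx r)))).
  rewrite leb_box => [|i]; last by rewrite !mxE; lra.
  by rewrite lte_fin prodr_gt0// => i _; rewrite !mxE; lra.
apply: le_outer_measure => x hx /=; apply: (le_trans (enorm_le_norm _)).
apply: (@le_trans _ _ (n%:R * r)%R).
  rewrite ler_wpM2l//; apply: cv_norm_le => [|i]; first exact: ltW.
  by rewrite ler_norml; have /andP[] := hx i; rewrite !mxE => -> /ltW.
by rewrite ler_pdivrMr// mul1r ler_nat.
Qed.

Let pt0 (x : 'cV[R]_n) : 'cV[R]_n.+1 := pt x 0%R.

Lemma pt0B x y : (pt0 x - pt0 y = pt0 (x - y))%R.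
Proof. by apply: cvP => i; rewrite !mxE; case: unliftP => [j _|_]; rewrite ?mxE ?subr0. Qed.

Lemma enorm_pt (x : 'cV[R]_n) (y : R) : (enorm (pt x y) ^+ 2 = enorm x ^+ 2 + y ^+ 2)%R.
Proof.
rewrite !enorm_sqr !inner_cv (big_ord_recr n) /= -expr2.
rewrite (_ : pt x y _ _ = y); last by rewrite -[RHS](pt_max x y); congr (pt x y _ _); apply: val_inj.
congr (_ + _)%R; apply: eq_bigr => i _.
have -> : widen_ord (leqnSn n) i = lift ord_max i; last by rewrite pt_lift.
by apply/val_inj => /=; rewrite /bump leqNgt ltn_ord.
Qed.

Lemma enorm_pt0 x : enorm (pt0 x) = enorm x.
Proof.
by apply/eqP; rewrite -(@eqrXn2 _ 2) ?enorm_ge0// enorm_pt expr0n addr0.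
Qed.

Definition flat_area (E : set 'cV[R]_n) : \bar R := hausdorff_outer n (pt0 @` E).

(** Cover the unit cell by a grid of small cubes. *)
Lemma flat_area_unit_fin : flat_area (box 0 (const_mx 1%R)) < +oo.
Proof.
have Bfin : @unit_ball_volume R n \is a fin_num.
  by rewrite ge0_fin_numE ?unit_ball_volume_fin// ltW// unit_ball_volume_gt0.
pose B := fine (@unit_ball_volume R n).
have B0 : (0 <= B)%R by rewrite fine_ge0// ltW// unit_ball_volume_gt0.
apply: (@le_lt_trans _ _ (B * (n.+1%:R / 2) ^+ n)%:E); last by rewrite ltry.
apply: ge_ereal_sup => _ [d /= d0 <-].
pose N := Num.Def.archi_bound (n.+1%:R / d)%R.
have Nd : (n.+1%:R / N.+1%:R <= d)%R.
  rewrite ler_pdivrMr// mulrC -ler_pdivrMr// ltW//.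
  apply: lt_le_trans (archi_boundP _) _; first by rewrite divr_ge0// ltW.
  by rewrite ler_nat.
pose cube (f : {ffun 'I_n -> 'I_N.+1}) : set 'cV[R]_n :=
  box (\col_i ((f i)%:R / N.+1%:R))%R (\col_i ((f i).+1%:R / N.+1%:R))%R.
have diam f : diameter (pt0 @` cube f) <= (n.+1%:R / N.+1%:R)%:E.
  apply: diameter_le => _ _ [x hx <-] [y hy <-]; rewrite pt0B enorm_pt0.
  apply: (le_trans (enorm_le_norm _)).
  apply: (@le_trans _ _ (n%:R * N.+1%:R^-1)%R); last by rewrite ler_wpM2r// ler_nat.
  rewrite ler_wpM2l//; apply: cv_norm_le => // i; rewrite !mxE.
  have := hx i; have := hy i; rewrite !mxE -[(f i).+1%:R]natr1 mulrDl mul1r ler_norml.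
  set u := (_ / _)%R; set v := (_^-1)%R; move: u v => u v /andP[h1 h2] /andP[h3 h4].
  by apply/andP; split; lra.
apply: (@le_trans _ _ ((#|{ffun 'I_n -> 'I_N.+1}|)%:R * (B * (n.+1%:R / N.+1%:R / 2) ^+ n))%:E).
  apply: (@covering_outer_fin _ _ _ (fun f => pt0 @` cube f)).
  - exact: hausdorff_gauge0.
  - exact: hausdorff_gauge_ge0.
  - move=> _ [x x01 <-].
    have xN i : (0 <= x i ord0 * N.+1%:R)%R by have /andP[h _] := x01 i; rewrite mulr_ge0//; move: h; rewrite mxE.
    have fN i : (Num.truncn (x i ord0 * N.+1%:R) < N.+1)%N.
      have /andP[h _] := truncn_itv (xN i); rewrite -(ltr_nat R) (le_lt_trans h)// gtr_pMl//.
      by have /andP[_] := x01 i; rewrite mxE.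
    exists [ffun i => Ordinal (fN i)] => //; exists x => // i; rewrite !mxE ffunE /=.
    have /andP[h1 h2] := truncn_itv (xN i).
    by rewrite ler_pdivrMr// h1 ltr_pdivlMr.
  - move=> f; rewrite /hausdorff_gauge; case: asboolP => [_|/eqP/set0P ne].
      by rewrite lee_fin mulr_ge0// exprn_ge0// !divr_ge0.
    rewrite ifT; last by rewrite (le_trans (diam f))// lee_fin.
    rewrite -[X in X * _](fineK Bfin) -EFinM lee_fin ler_wpM2l//.
    apply: lerXn2r; rewrite ?nnegrE ?divr_ge0 ?fine_ge0 ?diameter_ge0//.
    by rewrite ler_pM2r ?invr_gt0// -lee_fin -(diameter_fin ne (diam f)).
rewrite lee_fin card_ffun !card_ord natrX mulrCA ler_wpM2l// -exprMn le_eqVlt; apply/orP; left.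
by apply/eqP; congr (_ ^+ _)%R; rewrite mulrA [(_ * (n.+1%:R / _))%R]mulrC divfK.
Qed.

Lemma leb_le_diameter (P : set 'cV[R]_n) (D : R) : (forall x y, P x -> P y -> `|x - y| <= D)%R -> P !=set0 ->
  forall e, (D < e)%R -> leb n P <= ((2 * e) ^+ n)%:E.
Proof.
move=> hP [u Pu] e De.
apply: (@le_trans _ _ (leb n (box (u - const_mx e)%R (u + const_mx e)%R))).
  apply: le_outer_measure => x Px i; have h := le_lt_trans (hP _ _ Px Pu) De.
  have := le_lt_trans (cv_coord_norm (x - u)%R i) h; rewrite !mxE ltr_norml => /andP[h1 h2].
  by apply/andP; split; lra.
have e0 : (0 <= e)%R by apply: le_trans (ltW De); apply: le_trans (hP _ _ Pu Pu).
rewrite leb_box => [|i]; last by rewrite !mxE; lra.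
rewrite lee_fin (eq_bigr (fun=> (2 * e)%R)) => [|i _]; last by rewrite !mxE; ring.
by rewrite prodr_const card_ord.
Qed.

(** A set of diameter D lies in a box of side 4 D, whose volume is [K] times the
cost of the set in a cover. *)
Lemma flat_area_unit_gt0 : (0 < n)%N -> 0 < flat_area (box 0 (const_mx 1%R)).
Proof.
move=> n0.
have Bfin : @unit_ball_volume R n \is a fin_num.
  by rewrite ge0_fin_numE ?unit_ball_volume_fin// ltW// unit_ball_volume_gt0.
pose B := fine (@unit_ball_volume R n).
have B0 : (0 < B)%R by rewrite fine_gt0// unit_ball_volume_gt0 unit_ball_volume_fin.
pose K := (8 ^+ n / B)%R.
have K0 : (0 < K)%R by rewrite divr_gt0// exprn_gt0.
apply: (@lt_le_trans _ _ (K^-1)%:E); first by rewrite lte_fin invr_gt0.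
apply: (@le_trans _ _ (covering_outer (hausdorff_gauge n 1) (pt0 @` box 0 (const_mx 1%R)))); last first.
  by apply: ereal_sup_ubound; exists 1%R => /=.
apply: le_ereal_inf_tmp => _ [U XU <-].
rewrite -(@lee_pmul2l _ K%:E)// -EFinM divff ?gt_eqF//.
rewrite -nneseriesZl; last by move=> *; exact: hausdorff_gauge_ge0.
have -> : 1 = leb n (box 0 (const_mx 1%R)) :> \bar R.
  rewrite leb_box => [|i]; last by rewrite !mxE.
  by rewrite big1// => i _; rewrite !mxE subr0.
pose P k : set 'cV[R]_n := [set x | U k (pt0 x)].
apply: (@le_trans _ _ (leb n (\bigcup_k P k))).
  by apply: le_outer_measure => x hx; have [|k _ Ux] := XU (pt0 x); [exists x|exists k].
apply: (le_trans (outer_measure_sigma_subadditive (@lebesgue_outer R n) P)).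
apply: lee_nneseries => [k _ _|k _]; first exact: outer_measure_ge0.
have [[u Pu]|nP] := pselect (P k !=set0); last first.
  rewrite (_ : P k = set0); last by apply: contrapT => /eqP/set0P.
  by rewrite outer_measure0 mule_ge0 ?hausdorff_gauge_ge0// lee_fin ltW.
have U0 : U k !=set0 by exists (pt0 u).
rewrite /hausdorff_gauge; case: asboolP => [/eqP|_]; first by move/set0P: U0 => /negP.
case: (ifPn (diameter (U k) <= 1%:E)) => [Ud|_]; last by rewrite gt0_muley ?lte_fin// leey.
set D := fine (diameter (U k)).
have DE := diameter_fin U0 Ud.
have D0 : (0 <= D)%R by rewrite fine_ge0 ?diameter_ge0.
have PD x y : P k x -> P k y -> (`|x - y| <= D)%R.
  move=> Px Py; apply: (le_trans (norm_le_enorm _)).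
  by rewrite -lee_fin /D -DE -enorm_pt0 -pt0B diameter_ge.
rewrite (_ : unit_ball_volume n = B%:E); last by rewrite fineK.
rewrite -!EFinM.
have -> : (K * (B * (D / 2) ^+ n) = (4 * D) ^+ n)%R.
  by rewrite mulrA divfK ?gt_eqF// -exprMn; congr (_ ^+ _)%R; lra.
have [D00|Dn0] := eqVneq D 0%R; last first.
  have Dp : (0 < D)%R by rewrite lt_def Dn0.
  have := leb_le_diameter PD (ex_intro _ u Pu) (e := (2 * D)%R).
  by rewrite mulrA -natrM => /(_ _)/le_trans; apply => //; lra.
rewrite D00 mulr0 expr0n gtn_eqF//=.
apply/lee_addgt0Pr => e e0; rewrite add0e.
pose e' := (Num.min e 1 / 2)%R.
have m0 : (0 < Num.min e 1)%R by rewrite lt_min e0 ltr01.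
have De' : (D < e')%R by rewrite D00 divr_gt0.
apply: (le_trans (leb_le_diameter PD (ex_intro _ u Pu) De')).
rewrite lee_fin mulrC divfK// -(prednK n0) exprS.
apply: (@le_trans _ _ (Num.min e 1)%R); last by rewrite ge_min lexx.
rewrite ler_piMr ?(ltW m0)// exprn_ile1 ?(ltW m0)//.
by rewrite ge_min lexx orbT.
Qed.

Let plane : set 'cV[R]_n.+1 := [set z | vpart z = 0%R].

Lemma measurable_plane : measurable (plane : set (caratheodory_type (@hausdorff_outer R n n.+1))).
Proof.
apply: hausdorff_bor; apply: closed_bor.
have cv : continuous (fun z : 'cV[R]_n.+1 => z ord_max ord0) by exact: coord_continuous.
by apply: (@preimage_closed _ _ _ [set 0%R]) => //; exact: closed_eq.
Qed.

Lemma measurable_hpart_bor : measurable_fun setT (@hpart R n : caratheodory_type (@hausdorff_outer R n n.+1) -> bor R n).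
Proof.
apply: measurable_bor => i.
rewrite (_ : (fun z => _) = fun z : 'cV[R]_n.+1 => z (lift ord_max i) ord0); last by apply/funext => z; rewrite hpartE.
move=> _ Y mY; rewrite setTI; apply: hausdorff_bor.
by rewrite -[X in measurable X]setTI; apply: measurable_coord_bor.
Qed.

Definition flat_area_measure : {measure set (bor R n) -> \bar R} :=
  measure_function_pushforward__canonical__measure_function_Measure
    (measure_function_mrestr__canonical__measure_function_Measure (hausdorff n n.+1) measurable_plane) measurable_hpart_bor.

Lemma flat_area_measureE E : flat_area_measure E = flat_area E.
Proof.
rewrite /flat_area_measure/= /pushforward /mrestr /flat_area; congr (hausdorff_outer n _).
apply/seteqP; split => [z [Ez z0]|_ [x Ex <-]].
  by exists (hpart z) => //; rewrite /pt0 -[in RHS](pt_hv z); congr pt.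
by split; [rewrite /= hpart_pt|rewrite /plane /= vpart_pt].
Qed.

(** On a horizontal hyperplane the Hausdorff measure is invariant under
translations, so that [haar] applies. *)
Lemma flat_areaE (E : set (bor R n)) : measurable E -> flat_area E = flat_area (box 0 (const_mx 1%R)) * leb n E.
Proof.
move=> mE; rewrite -!flat_area_measureE; apply: haar => // [v a b|]; last by rewrite flat_area_measureE flat_area_unit_fin.
rewrite !flat_area_measureE /flat_area.
have inv (w a' b' : 'cV[R]_n) : hausdorff_outer n (pt0 @` box (a' + w)%R (b' + w)%R) <= hausdorff_outer n (pt0 @` box a' b').
  have := @hausdorff_lipschitz R n n.+1 n.+1 (fun z => z + pt0 w)%R (pt0 @` box a' b') 1 1 ltr01 ltr01.
  rewrite expr1n mul1e => h; apply: le_trans (h _); last first.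
    by move=> x y _ _ _; rewrite mul1r opprD addrACA subrr addr0.
  apply: le_hausdorff_outer => _ [x hx <-]; exists (pt0 (x - w)%R).
    by exists (x - w)%R => // i; have := hx i; rewrite !mxE => /andP[h1 h2]; apply/andP; split; lra.
  by rewrite -pt0B subrK.
apply/eqP; rewrite eq_le inv/=.
by have := inv (- v)%R (a + v)%R (b + v)%R; rewrite !addrK.
Qed.

End flat_hausdorff.

(** * Surface integrals over Lipschitz graphs *)

Section stretch.
Context {R : realType}.
Local Open Scope ereal_scope.

Lemma ptD n (x x' : 'cV[R]_n) y y' : (pt x y + pt x' y' = pt (x + x') (y + y'))%R.
Proof. by apply: cvP => i; rewrite !mxE; case: unliftP => [j _|_]; rewrite ?mxE. Qed.

Lemma ptB n (x x' : 'cV[R]_n) y y' : (pt x y - pt x' y' = pt (x - x') (y - y'))%R.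
Proof. by apply: cvP => i; rewrite !mxE; case: unliftP => [j _|_]; rewrite ?mxE. Qed.

Lemma inner_pt n (x x' : 'cV[R]_n) y y' : inner (pt x y) (pt x' y') = (inner x x' + y * y')%R.
Proof.
rewrite !inner_cv (big_ord_recr n)/=.
rewrite (_ : pt x y _ _ = y); last by rewrite -[RHS](pt_max x y); congr (pt x y _ _); apply: val_inj.
rewrite (_ : pt x' y' _ _ = y'); last by rewrite -[RHS](pt_max x' y'); congr (pt x' y' _ _); apply: val_inj.
congr (_ + _)%R; apply: eq_bigr => i _.
have -> : widen_ord (leqnSn n) i = lift ord_max i; last by rewrite !pt_lift.
by apply/val_inj => /=; rewrite /bump leqNgt ltn_ord.
Qed.

(** The linear stretch by which the graph of a linear form of gradient [p] is
isometric to the base; it is triangular, obtained by completing squares in the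
last coordinate. *)
Definition is_stretch n (p : 'cV[R]_n) (T S : 'cV[R]_n -> 'cV[R]_n) : Prop :=
  [/\ cancel T S /\ cancel S T,
      (forall x y, T (x + y)%R = (T x + T y)%R),
      (forall x, enorm (T x) ^+ 2 = enorm x ^+ 2 + inner p x ^+ 2)%R,
      measurable_fun setT (S : bor R n -> bor R n) &
      leb n (S @^-1` box 0 (const_mx 1%R)) = (Num.sqrt (1 + enorm p ^+ 2))%:E].

Lemma stretch_exists n (p : 'cV[R]_n) : exists T S, is_stretch p T S.
Proof.
elim: n p => [p|n IH p].
  exists id, id; split => //.
  - move=> x; rewrite (_ : x = 0%R); last by apply: cvP => -[].
    by rewrite inner0r expr0n/= addr0.
  - rewrite preimage_id leb_box => [|[]//]; rewrite big_ord0.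
    by rewrite enorm_sqr inner_cv big_ord0 addr0 sqrtr1.
set q := vpart p; pose gam := Num.sqrt (1 + q ^+ 2)%R.
have g2 : (gam ^+ 2 = 1 + q ^+ 2)%R by rewrite sqr_sqrtr// addr_ge0// sqr_ge0.
have g0 : (0 < gam)%R by rewrite sqrtr_gt0 ltr_pwDl// sqr_ge0.
have gne : (gam != 0)%R by rewrite gt_eqF.
have [T [S [[TS ST] TD Tn mS vS]]] := IH (gam^-1 *: hpart p)%R.
pose phi (x : 'cV[R]_n) := (q / gam * inner (hpart p) x)%R.
have hD (z z' : 'cV[R]_n.+1) : hpart (z + z')%R = (hpart z + hpart z')%R by apply: cvP => i; rewrite !mxE.
have vD (z z' : 'cV[R]_n.+1) : vpart (z + z')%R = (vpart z + vpart z')%R by rewrite /vpart mxE.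
have mS' : measurable_fun setT
    ((fun z => pt (S (hpart z)) ((vpart z - phi (S (hpart z))) / gam)%R) : bor R n.+1 -> bor R n.+1).
  have mh : measurable_fun setT (@hpart R n : bor R n.+1 -> bor R n).
      apply: measurable_bor => i; rewrite (_ : (fun z => _) = fun z : 'cV[R]_n.+1 => z (lift ord_max i) ord0).
        exact: measurable_coord_bor.
      by apply/funext => z; rewrite hpartE.
    have mSh : measurable_fun setT (S \o @hpart R n : bor R n.+1 -> bor R n) by exact: (measurableT_comp mS mh).
    have mSi i : measurable_fun setT (fun z : bor R n.+1 => S (hpart z) i ord0).
      exact: (measurableT_comp (@measurable_coord_bor R n i) mSh).
    apply: measurable_pt => //.
    apply: measurable_funM => //; apply: measurable_funB; first exact: measurable_coord_bor.
    rewrite /phi; apply: measurable_funM => //.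
    rewrite (_ : (fun z => _) = fun z : bor R n.+1 => \sum_i (hpart p i ord0 * S (hpart z) i ord0))%R; last first.
      by apply/funext => z; rewrite inner_cv.
    by apply: measurable_sum => i; apply: measurable_funM.
exists (fun z => pt (T (hpart z)) (gam * vpart z + phi (hpart z))%R).
exists (fun z => pt (S (hpart z)) ((vpart z - phi (S (hpart z))) / gam)%R); split.
- split=> z; first by rewrite !hpart_pt !vpart_pt TS addrK mulrAC mulfV// mul1r; exact: pt_hv.
  by rewrite !hpart_pt !vpart_pt ST mulrC divfK// subrK; exact: pt_hv.
- by move=> x y; rewrite ptD -TD hD vD /phi innerDr; congr pt; rewrite !mulrDr addrACA.
- move=> z; rewrite enorm_pt Tn -[in RHS](pt_hv z) enorm_pt -[in RHS](pt_hv p) inner_pt -/q /phi innerZl.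
  set I := inner _ _; move: (vpart z) (enorm _ ^+ 2)%R => y E.
  have gi : (gam^-1 ^+ 2 * (1 + q ^+ 2) = 1)%R by rewrite -g2 -exprMn mulVf// expr1n.
  have -> : (E + (gam^-1 * I) ^+ 2 + (gam * y + q / gam * I) ^+ 2 =
    E + gam ^+ 2 * y ^+ 2 + (gam^-1 ^+ 2 * (1 + q ^+ 2)) * I ^+ 2 + (gam / gam) * (2 * q * y * I))%R by ring.
  by rewrite gi mulfV// g2; ring.
- exact: mS'.
- set B := _ @^-1` _.
  have mB : measurable (B : set (bor R n.+1)) by rewrite -[X in measurable X]setTI; apply: mS' => //; exact: box_bor.
  rewrite (leb_sliced mB) slicedE.
  pose D : set (cara R n) := S @^-1` box 0 (const_mx 1%R).
  have mD : measurable D by apply: bor_cara; rewrite -[X in measurable X]setTI; apply: mS => //; exact: box_bor.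
  transitivity (\int[leb n]_(x in D) (gam)%:E).
    rewrite [RHS]integral_mkcond; apply: eq_integral => u _; rewrite /patch.
    case: ifPn => [|nD].
      rewrite inE => Du.
      transitivity (lebesgue_measure `[phi (S u), (phi (S u) + gam)%R[%classic).
        congr (lebesgue_measure _); apply/seteqP; split => y.
          rewrite /B /= => /box_pt[_]; rewrite hpart_pt vpart_pt /vpart !mxE in_itv/=.
          by rewrite ler_pdivlMr// ltr_pdivrMr// mul0r mul1r subr_ge0 ltrBlDl.
        rewrite /B /= in_itv/= => h; apply/box_pt; rewrite hpart_pt vpart_pt /vpart !mxE; split.
          by move=> i; have := Du i; rewrite !mxE.
        by rewrite ler_pdivlMr// ltr_pdivrMr// mul0r mul1r subr_ge0 ltrBlDl.
      rewrite lebesgue_measure_itv/= lte_fin ltrDl g0 -EFinB.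
      by congr EFin; rewrite addrAC subrr add0r.
    rewrite (_ : [set y | B (pt u y)] = set0) ?measure0//.
    rewrite -subset0 => y; rewrite /B /= => /box_pt[h _]; move: nD; rewrite notin_setE; apply.
    by move=> i; have := h i; rewrite !hpart_pt !mxE.
  rewrite (integral_cst _ mD) vS -EFinM; congr EFin.
  rewrite /gam -sqrtrM ?addr_ge0 ?sqr_ge0//; congr (Num.sqrt _).
  rewrite -[in RHS](pt_hv p) enorm_pt -/q enormZ ger0_norm ?invr_ge0 ?(ltW g0)// exprMn.
  rewrite exprVn g2; move: (enorm _ ^+ 2)%R => E; field.
  by rewrite gt_eqF// ltr_pwDl// sqr_ge0.
Qed.

(** The volume of the preimage is again a translation-invariant measure, hence
determined by its value on the unit cube. *)
Lemma stretch_leb n (p : 'cV[R]_n) T S (E : set (bor R n)) : is_stretch p T S -> measurable E ->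
  leb n (S @^-1` E) = (Num.sqrt (1 + enorm p ^+ 2))%:E * leb n E.
Proof.
move=> [[TS ST] TD _ mS vS] mE.
pose mu : {measure set (bor R n) -> \bar R} :=
  measure_function_pushforward__canonical__measure_function_Measure (leb_bor n) mS.
rewrite -vS -[LHS]/(mu E) -[X in X * _]/(mu (box 0 (const_mx 1%R))); apply: haar => //.
  move=> v a b; rewrite /mu/= /pushforward /leb_bor/=.
  rewrite -(lebesgue_outer_translate (T v)); congr (lebesgue_outer _).
  have SD x : S (x + T v)%R = (S x + v)%R by apply: (can_inj TS); rewrite ST TD ST.
  apply/seteqP; split => z h i; have := h i; rewrite /translate SD !mxE.
    by rewrite lerD2r ltrD2r.
  by rewrite lerD2r ltrD2r.
by rewrite -[X in X < _]/(leb n (S @^-1` box 0 (const_mx 1%R))) vS ltry.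
Qed.

(** Over a set on which [g] is nearly affine with slope [p], the graph of [g]
is mapped by an almost 1-Lipschitz map onto the stretched base. *)
Lemma hausdorff_graph_piece n (g : 'cV[R]_n -> R) (p : 'cV[R]_n) (e d : R) (E : set (bor R n)) :
  (0 <= e)%R -> (0 < d)%R -> measurable E ->
  (forall x y, E x -> E y -> `|x - y| < d -> `|g x - g y - inner p (x - y)| <= e * `|x - y|)%R ->
  flat_area (box (0 : 'cV[R]_n) (const_mx 1%R)) * ((Num.sqrt (1 + enorm p ^+ 2))%:E * leb n E) <=
  ((1 + e) ^+ n)%:E * hausdorff_outer n [set pt x (g x) | x in E].
Proof.
move=> e0 d0 mE hE; have [T [S st]] := stretch_exists p.
have mSE : measurable (S @^-1` E : set (bor R n)).
  by have [_ _ _ mS _] := st; rewrite -[X in measurable X]setTI; apply: mS.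
rewrite -(stretch_leb st mE) -flat_areaE//.
have [[TS ST] TD Tn _ _] := st.
have e1 : (0 < 1 + e)%R by rewrite ltr_pwDl.
have := @hausdorff_lipschitz R n n.+1 n.+1 (fun z => pt (T (hpart z)) 0%R) [set pt x (g x) | x in E] (1 + e)%R d e1 d0.
move=> h; apply: le_trans (h _).
  apply: le_hausdorff_outer => _ [u Eu <-]; exists (pt (S u) (g (S u))); first by exists (S u).
  by rewrite hpart_pt ST.
move=> _ _ [x Ex <-] [y Ey <-]; rewrite !hpart_pt !ptB subr0.
have TB : (T x - T y = T (x - y))%R.
  by apply/eqP; rewrite subr_eq -TD subrK.
have xyn : (enorm (x - y) <= enorm (pt (x - y) (g x - g y)))%R.
  by rewrite -(@ler_pXn2r _ 2) ?nnegrE ?enorm_ge0// enorm_pt lerDl sqr_ge0.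
move=> xyd; have hxy := hE _ _ Ex Ey (le_lt_trans (le_trans (norm_le_enorm _) xyn) xyd).
have -> : enorm (pt (T x - T y) 0)%R = enorm (pt (x - y) (inner p (x - y)))%R.
  by apply/eqP; rewrite -(@eqrXn2 _ 2) ?enorm_ge0// !enorm_pt TB Tn expr0n addr0.
rewrite (_ : pt (x - y) (inner p (x - y)) = pt (x - y) (g x - g y) - pt 0 (g x - g y - inner p (x - y)))%R; last first.
  by rewrite ptB subr0 subKr.
apply: (le_trans (enormD _ _)); rewrite enormN mulrDl mul1r lerD2l.
have -> (t : R) : enorm (pt (0 : 'cV[R]_n) t) = `|t|%R.
  by apply/eqP; rewrite -(@eqrXn2 _ 2) ?enorm_ge0// enorm_pt enorm0 expr0n add0r real_normK// num_real.
apply: (le_trans hxy); rewrite ler_wpM2l//.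
exact: le_trans (norm_le_enorm _) xyn.
Qed.

End stretch.

Opaque hausdorff_outer.

Lemma single_series {R : realType} (u : (\bar R)^nat) j : (forall i, (0 <= u i)%E) ->
  (forall i, i != j -> u i = 0%E) -> (\sum_(i <oo) u i = u j)%E.
Proof.
move=> u0 uj; rewrite (nneseries_split 0%N j.+1) => [|k _]; last exact: u0.
rewrite add0n eseries0 => [|k jk _]; last by apply: uj; rewrite gt_eqF.
rewrite adde0 big_nat_recr//= big_nat big1 ?add0e// => k /andP[_ kj].
by apply: uj; rewrite lt_eqF.
Qed.

Lemma integral_simple_series d (T : measurableType d) {R : realType} (mu : {measure set T -> \bar R})
    (A : nat -> set T) (k : nat -> R) : (forall j, measurable (A j)) -> (forall j, 0 <= k j) ->
  (\int[mu]_z \sum_(j <oo) ((k j)%:E * (\1_(A j) z)%:E) = \sum_(j <oo) (k j)%:E * mu (A j))%E.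
Proof.
move=> mA k0.
have mI j : measurable_fun setT (fun z => (\1_(A j) z)%:E : \bar R).
  by apply/measurable_EFinP; exact: measurable_indic.
rewrite integral_nneseries//.
- apply: eq_eseriesr => j _; rewrite ge0_integralZl//; last by rewrite lee_fin.
  by rewrite integral_indic// setIT.
- by move=> j; apply: measurable_funeM.
- by move=> j z _; rewrite mule_ge0// lee_fin.
Qed.

Lemma continuous_hpart {R : realType} n : continuous (@hpart R n).
Proof.
move=> z U /cv_nbhs_ball[e e0 hU]; apply/nbhs_ballP; exists e => // y; rewrite mx_norm_ball => zy.
apply: hU; apply: cv_norm_lt => // i.
rewrite (_ : (hpart z - hpart y) i ord0 = (z - y) (lift ord_max i) ord0); last by rewrite !mxE.
exact: le_lt_trans (cv_coord_norm _ _) zy.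
Qed.

Section surface.
Context {R : realType}.
Variable n : nat.
Local Open Scope ereal_scope.

Let c : \bar R := flat_area (box (0 : 'cV[R]_n) (const_mx 1%R)).

Lemma unit_cube_bor : measurable (@unit_cube R n : set (bor R n)).
Proof.
rewrite (_ : @unit_cube R n = \bigcap_(i in [set: 'I_n]) [set x : 'cV[R]_n | 0 < x i ord0 < 1]%R).
  apply: fin_bigcap_measurable => // i _.
  rewrite (_ : [set x | _] = setT `&` (fun x : bor R n => x i ord0) @^-1` `]0%R, 1%R[%classic).
    exact: measurable_coord_bor.
  by apply/seteqP; split => x /=; rewrite in_itv/=; [|case].
by apply/seteqP; split => [x h i _|x h i]; [exact: h|exact: (h i I)].
Qed.

Lemma leb_unit_cube_le : leb n (@unit_cube R n) <= 1.
Proof.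
apply: (@le_trans _ _ (leb n (box 0 (const_mx 1%R)))).
  by apply: le_outer_measure => x hx i; have /andP[h1 h2] := hx i; rewrite !mxE ltW.
rewrite leb_box => [|i]; last by rewrite !mxE.
by rewrite big1// => i _; rewrite !mxE subr0.
Qed.

Variables (g : 'cV[R]_n -> R) (K : R).
Hypotheses (K0 : (0 <= K)%R) (lg : lip K g).

Lemma measurable_grad_norm : measurable_fun setT ((fun x => enorm (grad g x)) : cara R n -> R).
Proof.
rewrite (_ : (fun x => _) = (@Num.sqrt R) \o (fun x => \sum_i 'D_(basis_vec i) g x ^+ 2)%R); last first.
  by apply/funext => x /=; rewrite /enorm inner_cv; congr Num.sqrt; apply: eq_bigr => i _; rewrite mxE expr2.
apply: (measurableT_comp (continuous_measurable_fun (@sqrt_continuous R))).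
apply: measurable_sum => i; apply: measurable_funX; exact: measurable_derive lg.
Qed.

Section pieces.
Variable e : R.
Hypothesis e0 : (0 < e)%R.

Definition almost_affine (p : 'cV[R]_n) (d : R) : set 'cV[R]_n := [set x | forall h : 'cV[R]_n, (`|h| < d ->
  `|g (x + h) - g x - inner p h| <= e * `|h|)%R].

Lemma almost_affine_bor p d : measurable (almost_affine p d : set (bor R n)).
Proof.
apply: closed_bor.
rewrite (_ : almost_affine p d = \bigcap_(h in [set h : 'cV[R]_n | `|h| < d]%R)
   [set x | `|g (x + h)%R - g x - inner p h| <= e * `|h|]%R); last first.
  by apply/seteqP; split => x hx h; [move=> /hx|exact: hx].
apply: closed_bigI => h _.
have cg := lip_cont lg.
have cgh : continuous (fun x : 'cV[R]_n => g (x + h)%R).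
  move=> x; apply: (@continuous_comp _ _ _ (fun x : 'cV[R]_n => (x + h)%R) g) => //; last exact: cg.
  by apply: (@continuousD _ _ _ id (fun=> h)); [exact: cvg_id|exact: cst_continuous].
have cf : continuous (fun x : 'cV[R]_n => `|g (x + h)%R - g x - inner p h|%R).
  move=> x; apply: (@continuous_comp _ _ _ (fun x : 'cV[R]_n => (g (x + h)%R - g x - inner p h)%R) Num.norm); last exact: norm_continuous.
  apply: (@continuousB _ _ _ (fun x : 'cV[R]_n => (g (x + h)%R - g x)%R) (fun=> inner p h)); last exact: cst_continuous.
  by apply: (@continuousB _ _ _ (fun x : 'cV[R]_n => g (x + h)%R) g); [exact: cgh|exact: cg].
by apply: (@preimage_closed _ _ _ [set y | y <= e * `|h|]%R) => //; exact: closed_le.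
Qed.

Lemma almost_affine_grad p d x : (0 < d)%R -> almost_affine p d x -> frechet g (grad g x) x ->
  (enorm (grad g x - p) <= n%:R * (2 * e))%R.
Proof.
move=> d0 hx fx.
apply: (le_trans (enorm_le_norm _)); rewrite ler_wpM2l//; apply: cv_norm_le => [|i].
  by rewrite mulr_ge0// ltW.
have [r r0 hr] := fx e e0.
pose t := (Num.min r d / 2)%R.
have m0 : (0 < Num.min r d)%R by rewrite lt_min r0.
have t0 : (0 < t)%R by rewrite divr_gt0.
have tm : (t < Num.min r d)%R by rewrite ltr_pdivrMr// ltr_pMr// ltr1n.
pose h : 'cV[R]_n := (t *: basis_vec i)%R.
have hn : (`|h| <= t)%R.
  apply: cv_norm_le => [|j]; first exact: ltW.
  by rewrite !mxE; case: eqP => _; rewrite ?mulr1 ?mulr0 ?normr0 ?gtr0_norm// ltW.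
have h1 := hx h (le_lt_trans hn (lt_le_trans tm _)); have h2 := hr h (le_lt_trans hn (lt_le_trans tm _)).
rewrite !ge_min !lexx orbT in h1 h2; have {}h1 := h1 isT; have {}h2 := h2 isT.
have hE q : (inner q h = t * q i ord0)%R.
  rewrite inner_cv (bigD1 i)//= !mxE eqxx/= mulr1 big1 ?addr0 1?mulrC// => j ji.
  by rewrite !mxE (negbTE ji)/= !mulr0.
rewrite -(ler_pM2l t0) -[X in (X * _ <= _)%R](gtr0_norm t0) -normrM !mxE mulrBr.
have := hE (grad g x); rewrite mxE => <-; rewrite -hE.
have -> : (inner (grad g x) h - inner p h = (g (x + h) - g x - inner p h) - (g (x + h) - g x - inner (grad g x) h))%R by lra.
apply: (le_trans (ler_normB _ _)); apply: (le_trans (lerD h1 h2)).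
by have := ler_wpM2l (ltW e0) hn; lra.
Qed.

(** Slopes and radii may be taken rational, hence in a countable set. *)
Lemma almost_affine_cover x : frechet g (grad g x) x ->
  exists (p : 'cV[rat]_n) (k : nat), almost_affine (map_mx ratr p) k.+1%:R^-1 x.
Proof.
move=> fx.
pose eps := (e / (2 * n.+1%:R))%R.
have eps0 : (0 < eps)%R by rewrite divr_gt0// mulr_gt0.
have /choice[p hp] : forall i, exists q : rat, ratr q \in `](grad g x) i ord0, ((grad g x) i ord0 + eps)%R[.
  by move=> i; apply: rat_in_itvoo; rewrite ltrDl.
have e2 : (0 < e / 2)%R by rewrite divr_gt0.
have [r r0 hr] := fx _ e2.
pose k := Num.Def.archi_bound (r^-1).
have kr : (k.+1%:R^-1 <= r)%R.
  rewrite invf_ple ?posrE// ltW//; apply: lt_le_trans (archi_boundP _) _; first by rewrite invr_ge0 ltW.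
  by rewrite ler_nat.
exists (\col_i p i), k => h hk.
have pn : (`|grad g x - map_mx ratr (\col_i p i)| <= eps)%R.
  apply: cv_norm_le => [|i]; first exact: ltW.
  have := hp i; rewrite !mxE in_itv/= => /andP[h1 h2]; rewrite ler_norml; apply/andP; split; lra.
have -> : (g (x + h) - g x - inner (map_mx ratr (\col_i p i)) h = (g (x + h) - g x - inner (grad g x) h) + inner (grad g x - map_mx ratr (\col_i p i)) h)%R.
  by rewrite innerBl addrA subrK.
apply: (le_trans (ler_normD _ _)); rewrite [e]splitr mulrDl lerD//; first by apply: hr; exact: lt_le_trans kr.
apply: (le_trans (inner_le_norm _ _)); rewrite ler_wpM2r//.
apply: (@le_trans _ _ (n.+1%:R * eps)%R); first by rewrite ler_pM// ler_nat.
rewrite /eps mulrA ler_pdivrMr ?mulr_gt0//.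
by move: (n.+1%:R : R)%R => y; lra.
Qed.

End pieces.

Variables (a b : R) (F : 'cV[R]_n.+1 -> R).
Hypotheses (a0 : (0 <= a)%R) (b0 : (0 <= b)%R) (F0 : forall z, (0 <= F z)%R).
Hypothesis Fab : forall x, ((b + a * enorm (grad g x)) / Num.sqrt (1 + enorm (grad g x) ^+ 2) <= F (pt x (g x)))%R.
Let f x : \bar R := (b + a * enorm (grad g x))%:E.
Let S := \int[hausdorff n n.+1]_(z in Gamma g) (F z)%:E.

Lemma c_fin : c \is a fin_num.
Proof. by rewrite ge0_fin_numE ?flat_area_unit_fin// hausdorff_outer_ge0. Qed.

Let mf : measurable_fun setT (f : cara R n -> \bar R).
Proof.
apply/measurable_EFinP; apply: measurable_funD; first exact: measurable_cst.
by apply: measurable_funM; [exact: measurable_cst|exact: measurable_grad_norm].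
Qed.

Let f_ge0 x : 0 <= f x.
Proof. by rewrite lee_fin addr_ge0// mulr_ge0// enorm_ge0. Qed.

Let area (p : 'cV[R]_n) : R := Num.sqrt (1 + enorm p ^+ 2).

Let area_pt p : area p = enorm (pt p (1 : R)).
Proof. by apply/eqP; rewrite -(@eqrXn2 _ 2) ?enorm_ge0 ?sqrtr_ge0// enorm_pt /area sqr_sqrtr ?expr1n 1?addrC// addr_ge0// sqr_ge0. Qed.

Let area_ge1 p : (1 <= area p)%R.
Proof. by rewrite -[leLHS]sqrtr1 ler_wsqrtr// lerDl sqr_ge0. Qed.

Let area_close p q (s : R) : (0 <= s -> enorm (q - p) <= s -> area q <= (1 + s) * area p)%R.
Proof.
move=> s0 pq; rewrite mulrDl mul1r !area_pt.
rewrite (_ : pt q (1 : R) = pt p 1 + pt (q - p) 0)%R; last by rewrite ptD subrKC addr0.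
apply: (le_trans (enormD _ _)); rewrite lerD2l.
have -> : enorm (pt (q - p) (0 : R)) = enorm (q - p).
  by apply/eqP; rewrite -(@eqrXn2 _ 2) ?enorm_ge0// enorm_pt expr0n addr0.
by rewrite (le_trans pq)// ler_peMr// -area_pt.
Qed.

Section fixed_precision.
Variable e : R.
Hypothesis e0 : (0 < e)%R.
Let eta : R := (n%:R * (2 * e))%R.
Let eta0 : (0 <= eta)%R. Proof. by rewrite mulr_ge0// mulr_ge0// ltW. Qed.
Let slope (p : 'cV[R]_n) : R := (b + a * Num.max (enorm p - eta) 0)%R.
Let slope_ge0 p : (0 <= slope p)%R.
Proof. by rewrite addr_ge0// mulr_ge0// le_max lexx orbT. Qed.
Let val (p : 'cV[R]_n) : R := (slope p / ((1 + eta) * area p))%R.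
Let graph (B : set 'cV[R]_n) : set 'cV[R]_n.+1 := [set pt x (g x) | x in B].

Lemma graph_bor (B : set (bor R n)) : measurable B ->
  measurable (graph B : set (caratheodory_type (@hausdorff_outer R n n.+1))).
Proof.
move=> mB; rewrite (_ : graph B = @hpart R n @^-1` B `&` [set z : 'cV[R]_n.+1 | (vpart z - g (hpart z) = 0)%R]); last first.
  apply/seteqP; split => [_ [x Bx <-]|z [Bz]] /=; first by rewrite hpart_pt vpart_pt subrr.
  by move=> /eqP; rewrite subr_eq0 => /eqP h; exists (hpart z) => //; rewrite -[in RHS](pt_hv z) h.
apply: measurableI; first by rewrite -[X in measurable X]setTI; apply: measurable_hpart_bor.
apply: hausdorff_bor; apply: closed_bor.
have ch := @continuous_hpart R n.
apply: (@preimage_closed _ _ (fun z : 'cV[R]_n.+1 => (vpart z - g (hpart z))%R) [set 0%R]); last exact: closed_eq.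
move=> z _; apply: (@continuousB _ _ _ (fun z : 'cV[R]_n.+1 => vpart z) (fun z => g (hpart z))).
  exact: coord_continuous.
have cg := lip_cont lg.
by apply: (@continuous_comp _ _ _ (@hpart R n) g); [exact: ch|exact: cg].
Qed.

(** On such a piece the gradient differs from the slope by at most [eta], and the
measure of the graph is controlled by [hausdorff_graph_piece]. *)
Lemma piece_le (B : set (bor R n)) (p : 'cV[R]_n) (d : R) : (0 < d)%R -> measurable B ->
  B `<=` @unit_cube R n -> B `<=` almost_affine e p d -> (forall x, B x -> frechet g (grad g x) x) ->
  c * \int[leb n]_(x in B) f x <=
  ((1 + eta) * (1 + e) ^+ n)%:E * ((val p)%:E * hausdorff_outer n (graph B)) + c * (2 * a * eta)%:E * leb n B.
Proof.
move=> d0 mB BQ BA Bfr.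
have mB' : measurable (B : set (cara R n)) by exact: bor_cara.
have c0 : 0 <= c by exact: hausdorff_outer_ge0.
have lB : leb n B \is a fin_num.
  rewrite ge0_fin_numE ?outer_measure_ge0//; apply: (@le_lt_trans _ _ 1); last exact: ltry.
  by apply: le_trans leb_unit_cube_le; exact: le_outer_measure.
have h1 : \int[leb n]_(x in B) f x <= ((slope p + 2 * a * eta)%:E * leb n B).
  rewrite -(integral_cst _ mB'); apply: le_integral_ae; apply: ae_all => x Bx.
  rewrite lee_fin /slope -addrA lerD2l.
  have hg : (enorm (grad g x) <= enorm p + eta)%R.
    rewrite -[grad g x](subrK p) addrC; apply: (le_trans (enormD _ _)); rewrite lerD2l.
    by apply: (almost_affine_grad e0 d0); [exact: BA|exact: Bfr].
  rewrite (_ : 2 * a * eta = a * (2 * eta))%R; last by ring.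
  rewrite -mulrDr ler_wpM2l//; apply: (le_trans hg).
  have := le_max (enorm p - eta)%R (enorm p - eta)%R 0%R; rewrite lexx/=; move: eta0; lra.
have hp := hausdorff_graph_piece (g := g) (p := p) (ltW e0) d0 mB.
have {}hp : c * ((area p)%:E * leb n B) <= ((1 + e) ^+ n)%:E * hausdorff_outer n (graph B).
  have aux (x y : 'cV[R]_n) : B x -> B y -> (`|x - y| < d)%R ->
      (`|g x - g y - inner p (x - y)| <= e * `|x - y|)%R.
    by move=> Bx By /(BA _ By); rewrite subrKC.
  by apply: hp; exact: aux.
have ap : (0 < area p)%R by apply: lt_le_trans (area_ge1 p).
have et : (0 < 1 + eta)%R by rewrite ltr_pwDl.
have hs : c * ((slope p)%:E * leb n B) <= ((1 + eta) * (1 + e) ^+ n)%:E * ((val p)%:E * hausdorff_outer n (graph B)).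
  have -> : c * ((slope p)%:E * leb n B) = (slope p / area p)%:E * (c * ((area p)%:E * leb n B)).
    by rewrite [RHS]muleCA; congr (_ * _); rewrite muleA -EFinM divfK// gt_eqF.
  have -> : ((1 + eta) * (1 + e) ^+ n)%:E * ((val p)%:E * hausdorff_outer n (graph B)) =
      (slope p / area p)%:E * (((1 + e) ^+ n)%:E * hausdorff_outer n (graph B)).
    rewrite !muleA -!EFinM; congr (_%:E * _); rewrite /val.
    by field; rewrite !gt_eqF.
  by apply: lee_wpmul2l => //; rewrite lee_fin divr_ge0// ltW.
apply: (le_trans (lee_wpmul2l c0 h1)).
have ae0 : (0 <= 2 * a * eta)%R by rewrite mulr_ge0// mulr_ge0.
have -> : (slope p + 2 * a * eta)%:E * leb n B = (slope p)%:E * leb n B + (2 * a * eta)%:E * leb n B.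
  by rewrite EFinD ge0_muleDl// lee_fin.
rewrite ge0_muleDr ?mule_ge0 ?lee_fin// -muleA.
exact: leeD2r.
Qed.

(** Almost every point of the cell lies in one of countably many disjoint pieces,
and on their graphs [F] dominates the step function of the values [val]. *)
Lemma surface_lower_step : c * \int[leb n]_(x in @unit_cube R n) f x <=
  ((1 + eta) * (1 + e) ^+ n)%:E * S + c * (2 * a * eta)%:E.
Proof.
have /leb_null_hull[Z mZ [hZ Z0]] : leb n [set x | ~ frechet g (grad g x) x] = 0.
  by apply/leb_negligibleP; exact: (rademacher K0 lg).
have Zfr x : ~ Z x -> frechet g (grad g x) x by move=> nz; apply: contrapT => h; exact/nz/hZ.
pose slp (j : nat) : 'cV[R]_n * R := if @unpickle ('cV[rat]_n * nat)%type j is Some t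
  then (map_mx ratr t.1, t.2.+1%:R^-1)%R else (0, 1)%R.
have slp0 j : (0 < (slp j).2)%R by rewrite /slp; case: (unpickle j) => //= t; rewrite invr_gt0.
pose A j : set 'cV[R]_n := (@unit_cube R n `\` Z) `&` almost_affine e (slp j).1 (slp j).2.
pose B := seqDU A.
have mA j : measurable (A j : set (bor R n)).
  by apply: measurableI; [apply: measurableD => //; exact: unit_cube_bor|exact: almost_affine_bor].
have mB j : measurable (B j : set (bor R n)).
  by apply: measurableD => //; apply: bigsetU_measurable => i _; exact: mA.
have BA j : B j `<=` A j by move=> x [].
have tB : trivIset setT B by exact: trivIset_seqDU.
have UB : \bigcup_j B j = @unit_cube R n `\` Z.
  rewrite -seqDU_bigcup_eq; apply/seteqP; split => [x [j _ [] //]|x xQ].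
  have [p [k hpk]] := almost_affine_cover e0 (Zfr _ xQ.2).
  exists (pickle (p, k)) => //; split => //.
  by rewrite /slp pickleK.
have c0 : 0 <= c by exact: hausdorff_outer_ge0.
have mB' j : measurable (B j : set (cara R n)) by exact: bor_cara.
have -> : \int[leb n]_(x in @unit_cube R n) f x = \sum_(j <oo) \int[leb n]_(x in B j) f x.
  rewrite -ge0_integral_bigcup//; last by exact: measurable_funTS.
  rewrite UB [LHS]integral_mkcond [RHS]integral_mkcond; apply: eq_integral_ae.
  have Zneg : (leb n).-negligible Z by apply/leb_negligibleP.
  apply: negligibleS Zneg => x /= h; apply: contrapT => nZ; apply: h => _.
  rewrite /patch; congr (if _ then _ else _).
  by apply/idP/idP; rewrite !inE => //; case.
have SE : \sum_(j <oo) (val (slp j).1)%:E * hausdorff_outer n (graph (B j)) <= S.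
  have mG j : measurable (graph (B j) : set (caratheodory_type (@hausdorff_outer R n n.+1))) by exact: graph_bor.
  have val0 j : (0 <= val (slp j).1)%R by rewrite divr_ge0// mulr_ge0// ?sqrtr_ge0// addr_ge0.
  apply: (@le_trans _ _ (\int[hausdorff n n.+1]_z \sum_(j <oo) ((val (slp j).1)%:E * (\1_(graph (B j)) z)%:E))).
    rewrite le_eqVlt; apply/orP; left; apply/eqP/esym.
    exact: (integral_simple_series (hausdorff n n.+1) mG val0).
  rewrite /S [leRHS]integral_mkcond; apply: le_integral_ae; apply: aeW => z _.
  have [[j Gj]|nG] := pselect (exists j, graph (B j) z); last first.
    rewrite eseries0 => [|j _ _]; last by rewrite indicE memNset ?mule0// => h; apply: nG; exists j.
    by rewrite /patch; case: ifP => // _; rewrite lee_fin.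
  have [x Bx xz] := Gj.
  have [[xQ xZ] xA] := BA _ _ Bx.
  rewrite (_ : \sum_(i <oo) _ = (val (slp j).1)%:E); last first.
    rewrite (single_series (j := j)).
    - by rewrite indicE mem_set// mule1.
    - by move=> i; rewrite mule_ge0// lee_fin.
    - move=> i ij; rewrite indicE memNset ?mule0// => -[y By yz]; move/eqP: ij; apply.
      have xy : y = x by rewrite -[x](hpart_pt x (g x)) xz -yz hpart_pt.
      by apply: (tB i j) => //; exists x; split => //; rewrite -xy.
  rewrite /patch ifT ?inE; last by exists x.
  rewrite -xz lee_fin; apply: le_trans (Fab x).
  have hg := almost_affine_grad e0 (slp0 j) xA (Zfr _ xZ).
  have ap := lt_le_trans ltr01 (area_ge1 (slp j).1).
  have ag := lt_le_trans ltr01 (area_ge1 (grad g x)).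
  have et : (0 < 1 + eta)%R by rewrite ltr_pwDl.
  rewrite /val ler_pdivrMr ?mulr_gt0// mulrAC ler_pdivlMr//.
  apply: ler_pM; [exact: slope_ge0|exact: sqrtr_ge0| |exact: area_close].
  rewrite /slope lerD2l ler_wpM2l// ge_max enorm_ge0 andbT lerBlDr.
  rewrite -[X in (enorm X <= _)%R](subrK (grad g x)) addrC; apply: (le_trans (enormD _ _)).
  by rewrite lerD2l -enormN opprB.
have f0' j : 0 <= \int[leb n]_(x in B j) f x by apply: integral_ge0 => x _; exact: f_ge0.
rewrite -(fineK c_fin) -nneseriesZl; last by move=> j _; exact: f0'.
rewrite (fineK c_fin).
have C0 : (0 <= (1 + eta) * (1 + e) ^+ n)%R by rewrite mulr_ge0 ?exprn_ge0 ?addr_ge0 ?(ltW e0).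
have val0 j : (0 <= val (slp j).1)%R by rewrite divr_ge0// mulr_ge0// ?sqrtr_ge0// addr_ge0.
have et2 : 0 <= c * (2 * a * eta)%:E by rewrite mule_ge0// lee_fin mulr_ge0// mulr_ge0.
apply: (@le_trans _ _ (\sum_(j <oo) (((1 + eta) * (1 + e) ^+ n)%:E * ((val (slp j).1)%:E * hausdorff_outer n (graph (B j))) + c * (2 * a * eta)%:E * leb n (B j)))).
  apply: lee_nneseries => [j _ _|j _]; first by rewrite mule_ge0.
  apply: (piece_le (slp0 j)) => //.
  - by move=> x /BA[[]].
  - by move=> x /BA[].
  - by move=> x /BA[[_ xZ] _]; exact: Zfr.
have w0 j : 0 <= (val (slp j).1)%:E * hausdorff_outer n (graph (B j)) by rewrite mule_ge0 ?hausdorff_outer_ge0// lee_fin.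
rewrite nneseriesD; last 2 first.
- by move=> j _ _; rewrite mule_ge0.
- by move=> j _ _; rewrite mule_ge0// outer_measure_ge0.
rewrite nneseriesZl; last by move=> j _; exact: w0.
apply: leeD; first by apply: lee_wpmul2l.
have cfin : c * (2 * a * eta)%:E \is a fin_num by rewrite fin_numM// c_fin.
rewrite -(fineK cfin) nneseriesZl; last by move=> j _; exact: outer_measure_ge0.
rewrite (fineK cfin) -[leRHS]mule1; apply: lee_wpmul2l => //.
rewrite -(measure_semi_bigcup (leb n) mB' tB); last first.
  by apply: bigcupT_measurable.
by apply: le_trans leb_unit_cube_le; rewrite UB; apply: le_outer_measure => x [].
Qed.

End fixed_precision.

(** The errors of the decomposition into nearly flat pieces vanish as the
precision [e] tends to zero. *)
Lemma surface_lower : c * \int[leb n]_(x in @unit_cube R n) f x <= S.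
Proof.
have S0 : 0 <= S by apply: integral_ge0 => z _; rewrite lee_fin.
have c0 : 0 <= c by exact: hausdorff_outer_ge0.
have [Soo|] := ltP S +oo; last by rewrite leye_eq => /eqP ->; rewrite leey.
have Sfin : S \is a fin_num by rewrite ge0_fin_numE.
pose s := fine S; pose C := fine c.
have SE : S = s%:E by rewrite fineK.
have CE : c = C%:E by rewrite fineK// c_fin.
have s0 : (0 <= s)%R by rewrite fine_ge0.
have C0 : (0 <= C)%R by rewrite fine_ge0.
apply/lee_addgt0Pr => r r0.
have pow (e : R) : (0 <= e <= 1)%R -> ((1 + e) ^+ n <= 1 + 3 ^+ n * e)%R.
  move=> /andP[e0 e1]; elim: (n) => [|k IH]; first by rewrite !expr0; lra.
  rewrite exprS; apply: (le_trans (ler_wpM2l _ IH)); first by rewrite addr_ge0.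
  have : (1 <= 3 ^+ k :> R)%R by rewrite exprn_ege1// ler1n.
  rewrite exprS; move: (3 ^+ k)%R => y y1.
  have h1 : (e * e <= e * 1)%R by rewrite ler_wpM2l.
  have h2 : (y * (e * e) <= y * e)%R by rewrite ler_wpM2l ?(le_trans _ y1)// -[leRHS]mulr1.
  have h3 : (1 * e <= y * e)%R by rewrite ler_wpM2r.
  by lra.
pose D := ((4 * n%:R + 3 ^+ n + 2 * n%:R * 3 ^+ n) * s + C * (2 * a * (n%:R * 2)) + 1)%R.
have n0 : (0 <= n%:R :> R)%R by [].
have t0 : (0 <= 3 ^+ n :> R)%R by rewrite exprn_ge0.
have D0 : (0 < D)%R.
  by rewrite ltr_pwDr// addr_ge0// ?mulr_ge0// ?addr_ge0 ?mulr_ge0.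
pose e := (Num.min 1 (r / D))%R.
have e0 : (0 < e)%R by rewrite lt_min ltr01 divr_gt0.
have e1 : (e <= 1)%R by rewrite ge_min lexx.
have eD : (e * D <= r)%R by rewrite -ler_pdivlMr// ge_min lexx orbT.
apply: (le_trans (surface_lower_step e0)); rewrite SE CE -!EFinM -!EFinD lee_fin.
have h1 : ((1 + n%:R * (2 * e)) * (1 + e) ^+ n <= 1 + (4 * n%:R + 3 ^+ n + 2 * n%:R * 3 ^+ n) * e)%R.
  have := pow e; rewrite (ltW e0) e1 => /(_ isT) hp.
  apply: (le_trans (ler_wpM2l _ hp)); first by rewrite addr_ge0// !mulr_ge0// ltW.
  have ee : (e * e <= e)%R by rewrite ger_pMr.
  have h3 : (2 * n%:R * 3 ^+ n * (e * e) <= 2 * n%:R * 3 ^+ n * e)%R by rewrite ler_wpM2l// !mulr_ge0.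
  have h4 : (0 <= n%:R * e)%R by rewrite mulr_ge0// ltW.
  by move: h3 h4; rewrite !mulrA; move: (3 ^+ n)%R (n%:R : R)%R => y w; lra.
have h2 := ler_wpM2r s0 h1.
apply: (le_trans (lerD h2 (lexx _))).
move: eD; rewrite /D; move: e0 h1 t0 n0 s0 C0; move: (3 ^+ n)%R (n%:R : R)%R => y w e0 _ _ _ _ _.
by lra.
Qed.

End surface.

(** * The facet of the Wulff shape *)

Section wulff_facet.
Context {R : realType}.
Variable n : nat.
Variable psi : 'cV[R]_n.+1 -> R.
Hypothesis psi_ge0 : forall z, 0 <= psi z.
Hypothesis psi_hom : forall (t : R) (z : 'cV[R]_n.+1), 0 < t -> psi (t *: z) = t * psi z.
Variables a b : R.
Hypotheses (a0 : 0 < a) (b0 : 0 < b).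
Hypothesis facet : [set pt x b | x in [set x | enorm x <= a]] `<=` closure (wulff psi) `\` interior (wulff psi).

Lemma closure_wulff z : closure (wulff psi) z -> wulff psi z.
Proof.
move=> cz nu nu1; apply/ler_addgt0Pr => e e0.
pose r := e / n.+1%:R.
have r0 : 0 < r by rewrite divr_gt0.
have [y [wy]] : (wulff psi `&` [set y | `|z - y| < r]) !=set0.
  by apply: cz; apply/nbhs_ballP; exists r => // y; rewrite mx_norm_ball.
rewrite /= => zy; rewrite -(subrK y z) innerDl addrC; apply: lerD; first exact: wy.
apply: (le_trans (ler_norm _)); apply: (le_trans (cauchy_schwarz _ _)).
rewrite nu1 mulr1; apply: (le_trans (enorm_le_norm _)).
by rewrite mulrC -ler_pdivlMr// ltW.
Qed.

Lemma facet_wulff x nu : enorm x <= a -> 0 < enorm nu -> inner (pt x b) nu <= psi nu.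
Proof.
move=> xa nu0; have [/closure_wulff wx _] := facet (ex_intro2 _ _ x xa erefl).
have := wx ((enorm nu)^-1 *: nu); rewrite enormZ ger0_norm ?invr_ge0 ?enorm_ge0//.
by rewrite mulVf ?gt_eqF// innerZr psi_hom ?invr_gt0// ler_pM2l ?invr_gt0// => /(_ erefl).
Qed.

(** Test with the point of the facet in the direction of [x]. *)
Lemma facet_direction x t : 0 < enorm (pt x t) -> a * enorm x + b * t <= psi (pt x t).
Proof.
move=> nu0; have [x0|xn0] := eqVneq (enorm x) 0.
  have := @facet_wulff 0 _ _ nu0; rewrite enorm0 (ltW a0) inner_pt => /(_ isT).
  by rewrite (innerC 0) inner0r x0 mulr0.
have xp : 0 < enorm x by rewrite lt_def xn0 enorm_ge0.
have := @facet_wulff ((a / enorm x) *: x) _ _ nu0.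
rewrite enormZ ger0_norm ?divr_ge0 ?enorm_ge0 ?(ltW a0)// divfK// lexx inner_pt innerZl.
by rewrite -enorm_sqr expr2 mulrA divfK// => /(_ isT).
Qed.

Lemma psi_slope p : b + a * enorm p <= psi (pt (- p) 1).
Proof.
have := @facet_direction (- p) 1; rewrite enormN mulr1 addrC; apply.
by rewrite -(@ltr_pXn2r _ 2) ?nnegrE ?enorm_ge0// expr0n enorm_pt expr1n ltr_wpDl ?sqr_ge0.
Qed.

Variable K : R.
Hypotheses (K0 : 0 <= K) (psi_lip : forall x y, `|psi x - psi y| <= K * `|x - y|).

(** If the vertical direction did not attain its value on the facet, the
support inequalities at the centre of the facet would all be strict, uniformly
in the direction, and the centre would be an interior point. *)
Lemma psi_vertical : psi (pt 0 1) <= b.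
Proof.
rewrite leNgt; apply/negP => psib.
set gam := psi (pt 0 1) - b; have gam0 : 0 < gam by rewrite subr_gt0.
pose e := Num.min (1 / 2) (gam / (2 * (K + 1))).
have K1 : 0 < 2 * (K + 1) by rewrite mulr_gt0// ltr_wpDl.
have e0 : 0 < e by rewrite lt_min !divr_gt0.
have e1 : e <= 1 / 2 by rewrite ge_min lexx.
have eK : K * e <= gam / 2.
  have : e * (2 * (K + 1)) <= gam by rewrite -ler_pdivlMr// ge_min lexx orbT.
  by move: e0; nra.
pose m := Num.min (a * e) (Num.min (gam / 2) (b / 2)).
have m0 : 0 < m by rewrite !lt_min mulr_gt0 ?divr_gt0.
have [ma mg mb] : [/\ m <= a * e, m <= gam / 2 & m <= b / 2] by rewrite /m !ge_min !lexx !orbT.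
have gap x t : enorm (pt x t) = 1 -> b * t + m <= psi (pt x t).
  move=> u1; have u0 : 0 < enorm (pt x t) by rewrite u1.
  have h := facet_direction u0.
  have E : enorm x ^+ 2 + t ^+ 2 = 1 by rewrite -enorm_pt u1 expr1n.
  have x0 := enorm_ge0 x.
  have [ex|xe] := leP e (enorm x).
    have : a * e <= a * enorm x by rewrite ler_wpM2l// ltW.
    by move: h ma; lra.
  have [t0|t0] := leP 0 t; last first.
    have : t <= - (1 / 2) by nra.
    by have := psi_ge0 (pt x t); move: mb; nra.
  have t1 : t <= 1 by nra.
  have t2 : 1 - t <= enorm x by nra.
  have : `|pt 0 1 - pt x t| <= enorm x.
    apply: cv_norm_le => // i; rewrite ptB sub0r mxE; case: unliftP => [j _|_].
      by rewrite mxE normrN coord_le_enorm.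
    by rewrite ger0_norm ?subr_ge0.
  move=> d; have := psi_lip (pt 0 1) (pt x t).
  have : K * `|pt 0 1 - pt x t| <= gam / 2.
    by apply: le_trans eK; rewrite ler_wpM2l// (le_trans d)// ltW.
  move=> h1 h2; have := le_trans (ler_norm _) (le_trans h2 h1); rewrite -/gam => h3.
  have : b * t <= b * 1 by rewrite ler_wpM2l// ltW.
  by move: mg h3; rewrite /gam; lra.
have z0 : enorm (0 : 'cV[R]_n) <= a by rewrite enorm0 ltW.
have [_] := facet (ex_intro2 _ _ (0 : 'cV[R]_n) z0 erefl); apply.
have r0 : 0 < m / n.+1%:R by rewrite divr_gt0.
apply/nbhs_ballP; exists (m / n.+1%:R) => // y; rewrite mx_norm_ball => zy nu nu1.
have := gap (hpart nu) (vpart nu); rewrite pt_hv => /(_ nu1); apply: le_trans.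
rewrite -(subrK (pt 0 b) y) innerDl addrC; apply: lerD.
  by rewrite -[in leLHS](pt_hv nu) inner_pt (innerC 0) inner0r add0r.
apply: (le_trans (ler_norm _)); apply: (le_trans (cauchy_schwarz _ _)).
rewrite nu1 mulr1; apply: (le_trans (enorm_le_norm _)).
by rewrite mulrC -ler_pdivlMr// -normrN opprB ltW.
Qed.

Lemma psi_normal (g : 'cV[R]_n -> R) x :
  (b + a * enorm (grad g x)) / Num.sqrt (1 + enorm (grad g x) ^+ 2) <= psi (normal g (pt x (g x))).
Proof.
have s0 : 0 < Num.sqrt (1 + enorm (grad g x) ^+ 2) by rewrite sqrtr_gt0 ltr_pwDl// sqr_ge0.
rewrite /normal hpart_pt psi_hom ?invr_gt0// mulrC ler_pM2l ?invr_gt0//.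
exact: psi_slope.
Qed.

(** * Surface energy *)

Local Open Scope ereal_scope.

(** The normal of the flat film is vertical, so [psi_vertical] applies. *)
Lemma flat_surface_le d : \int[hausdorff n n.+1]_(z in Gamma (cst d)) (psi (normal (cst d) z))%:E <=
  b%:E * flat_area (box (0 : 'cV[R]_n) (const_mx 1%R)).
Proof.
have l0 : lip 0 (cst d : 'cV[R]_n -> R) by move=> x y; rewrite subrr normr0 mul0r.
have mG : measurable (Gamma (cst d) : set (caratheodory_type (@hausdorff_outer R n n.+1))).
  exact: (graph_bor l0 (@unit_cube_bor R n)).
apply: (@le_trans _ _ (\int[hausdorff n n.+1]_(z in Gamma (cst d)) b%:E)).
  apply: le_integral_ae; apply: aeW => z _; rewrite lee_fin /normal.
  rewrite (_ : grad _ _ = 0%R); last by apply: cvP => i; rewrite !mxE derive_cst.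
  by rewrite enorm0 expr0n addr0 sqrtr1 invr1 scale1r oppr0 psi_vertical.
rewrite (integral_cst _ mG); apply: lee_wpmul2l; first by rewrite lee_fin ltW.
have := @hausdorff_lipschitz R n n.+1 n.+1 (fun z => z + pt 0 d)%R [set pt x 0%R | x in box 0 (const_mx 1%R)] 1 1 ltr01 ltr01.
rewrite expr1n mul1e => h; apply: le_trans (h _); last first.
  by move=> x y _ _ _; rewrite mul1r opprD addrACA subrr addr0.
apply: le_hausdorff_outer => _ [x hx <-]; exists (pt x 0%R); last by rewrite ptD addr0 add0r.
by exists x => // i; have /andP[h1 h2] := hx i; rewrite !mxE ltW.
Qed.

End wulff_facet.

(** * Second-order expansion of the stored energy *)

Section taylor.
Context {R : realType}.
Variable p : nat.
Implicit Types (W f : 'M[R]_p.+1 -> R) (M H : 'M[R]_p.+1).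

Lemma mx_norm_le_enorm M : `|M| <= enorm M.
Proof. by rewrite [X in X <= _]mx_normrE bigmax_le// => [|i _]; [exact: enorm_ge0|exact: coord_le_enorm]. Qed.

Lemma derive_lincomb_mx f H M : differentiable f M ->
  'D_H f M = \sum_i \sum_j H i j * 'D_(delta_mx i j) f M.
Proof.
move=> df; rewrite deriveE// [X in 'd f M X](matrix_sum_delta H) linear_sum.
apply: eq_bigr => i _; rewrite linear_sum; apply: eq_bigr => j _.
by rewrite linearZ/= deriveE.
Qed.

Lemma differentiable_expansion f M (e : R) : 0 < e -> differentiable f M ->
  exists2 r : R, 0 < r & forall H, `|H| < r -> `|f (M + H) - f M - 'D_H f M| <= e * `|H|.
Proof.
move=> e0 df; have /eqaddoP/(_ e e0) := diff_locally df.
move=> /nbhs_ballP[r r0 hr]; exists r => // H Hr; rewrite deriveE//.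
have E : f (H + M) - f M - 'd f M H = (f \o shift M - (cst (f M) + 'd f M)) H.
  by rewrite /= !fctE /= opprD addrA.
rewrite (addrC M) E; apply: hr.
by rewrite mx_norm_ball /ball_/= sub0r normrN.
Qed.

Lemma mx_nbhs M (U : set 'M[R]_p.+1) : nbhs M U ->
  exists2 r : R, 0 < r & forall H, `|H| < r -> U (M + H).
Proof.
move=> /nbhs_ballP[r r0 hr]; exists r => // H Hr; apply: hr.
by rewrite mx_norm_ball /ball_/= opprD addrA subrr sub0r normrN.
Qed.

Lemma det_continuous : continuous (fun M => \det M).
Proof.
move=> M; rewrite /determinant.
refine (@cvg_big _ _ _ _ _ add_continuous _ (nbhs M) _ _ _ (nbhs_filter M) _) => s _.
apply: cvgM; first exact: cvg_cst.
refine (@cvg_big _ _ _ _ _ mul_continuous _ (nbhs M) _ _ _ (nbhs_filter M) _) => i _.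
exact: coord_continuous.
Qed.

Lemma inner_derive W H M : differentiable W M -> 'D_H W M = inner (DW W M) H.
Proof.
move=> dW; rewrite derive_lincomb_mx// innerE; apply: eq_bigr => i _; apply: eq_bigr => j _.
by rewrite mxE mulrC.
Qed.

Lemma quadratic_derive (c0 c1 c2 t : R) : ((c0%:P + c1 *: 'X + c2 *: 'X^2)^`()).[t] = c1 + 2 * t * c2.
Proof. by rewrite !derivD !derivZ derivC derivX derivXn !hornerE; ring. Qed.

Lemma quadratic_at0 (c0 c1 c2 : R) : (c0%:P + c1 *: 'X + c2 *: 'X^2).[0] = c0.
Proof. by rewrite !hornerD !hornerZ hornerC hornerX hornerXn; ring. Qed.

Lemma quadratic_at1 (c0 c1 c2 : R) : (c0%:P + c1 *: 'X + c2 *: 'X^2).[1] = c0 + c1 + c2.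
Proof. by rewrite !hornerD !hornerZ hornerC hornerX hornerXn; ring. Qed.

Lemma differentiable_DW W M i j : 0 < \det M -> classC 2 [set xi | 0 < \det xi] W ->
  differentiable (fun xi => DW W xi i j) M.
Proof.
move=> dM [_ cW]; have [h _] := cW (delta_mx i j).
rewrite (_ : (fun xi => DW W xi i j) = fun xi => 'D_(delta_mx i j) W xi); first exact: h.
by apply/funext => xi; rewrite mxE.
Qed.

Lemma D2W_coord W M B i j : 0 < \det M -> classC 2 [set xi | 0 < \det xi] W ->
  D2W W M B i j = \sum_k \sum_l B k l * 'D_(delta_mx k l) (fun xi => DW W xi i j) M.
Proof. by move=> dM cW; rewrite mxE (derive_lincomb_mx _ (differentiable_DW i j dM cW)). Qed.

Lemma D2W_bound W M : 0 < \det M -> classC 2 [set xi | 0 < \det xi] W ->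
  exists2 C : R, 0 <= C & forall B, `|inner (D2W W M B) B| <= C * enorm B ^+ 2.
Proof.
move=> dM cW; pose c i j k l := 'D_(delta_mx k l) (fun xi => DW W xi i j) M.
exists (\sum_i \sum_j \sum_k \sum_l `|c i j k l|).
  by do 4![apply: sumr_ge0 => ? _].
move=> B; rewrite innerE mulr_suml; apply: (le_trans (ler_norm_sum _ _ _)); apply: ler_sum => i _.
rewrite mulr_suml; apply: (le_trans (ler_norm_sum _ _ _)); apply: ler_sum => j _.
rewrite normrM expr2 mulrA; apply: ler_pM => //; last exact: coord_le_enorm.
rewrite (D2W_coord _ _ _ dM cW) mulr_suml; apply: (le_trans (ler_norm_sum _ _ _)); apply: ler_sum => k _.
rewrite mulr_suml; apply: (le_trans (ler_norm_sum _ _ _)); apply: ler_sum => l _.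
by rewrite normrM mulrC ler_wpM2l// coord_le_enorm.
Qed.

(** The second-order remainder is controlled from below by integrating the
first-order expansion of the differential along a segment. *)
Lemma taylor_lower W M (om : R) : 0 < \det M -> classC 2 [set xi | 0 < \det xi] W -> 0 < om ->
  exists2 r : R, 0 < r & forall H, enorm H < r ->
    W M + inner (DW W M) H + 2^-1 * inner (D2W W M H) H - om * enorm H ^+ 2 <= W (M + H).
Proof.
move=> dM cW om0; have [dW _] := cW.
have [r0 r00 hr0] : exists2 r : R, 0 < r & forall H, `|H| < r -> 0 < \det (M + H).
  apply: (@mx_nbhs M [set xi | 0 < \det xi]).
  exact: (cvgr_gt _ (@det_continuous M)).
pose N := (p.+1 * p.+1)%:R : R.
have N0 : 0 < N by rewrite ltr0n.
have dDW i j := differentiable_DW i j dM cW.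
pose e := 2 * om / N.
have e0 : 0 < e by rewrite divr_gt0// mulr_gt0.
have [r1 r10 hr1] : exists2 r : R, 0 < r & forall i j H, `|H| < r ->
    `|DW W (M + H) i j - DW W M i j - 'D_H (fun xi => DW W xi i j) M| <= e * `|H|.
  have /choice[r hr] : forall t : 'I_p.+1 * 'I_p.+1, exists r : R, 0 < r /\ forall H, `|H| < r ->
    `|DW W (M + H) t.1 t.2 - DW W M t.1 t.2 - 'D_H (fun xi => DW W xi t.1 t.2) M| <= e * `|H|.
    by move=> t; have [r rp h] := differentiable_expansion e0 (dDW t.1 t.2); exists r.
  exists (\big[Order.min/1]_t r t).
    by apply: lt_bigmin => // t _; have [] := hr t.
  move=> i j H Hr; have [_] := hr (i, j); apply; apply: (lt_le_trans Hr).
  exact: (@bigmin_le_cond _ _ _ _ (i, j)).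
exists (Num.min r0 r1) => [|H]; first by rewrite lt_min r00.
rewrite lt_min => /andP[Hr0 Hr1].
have Hn := mx_norm_le_enorm H.
have tH (t : R) : 0 <= t <= 1 -> `|t *: H| <= `|H|.
  by move=> /andP[t0 t1]; rewrite normrZ ger0_norm// ler_piMl.
pose q := inner (D2W W M H) H.
have [c2 c2E] : exists c2, c2 = 2^-1 * q - om * enorm H ^+ 2 by eexists.
pose P : {poly R} := (W M)%:P + inner (DW W M) H *: 'X + c2 *: 'X^2.
pose phi t := W (M + t *: H) - P.[t].
pose dphi t := inner (DW W (M + t *: H)) H - (inner (DW W M) H + t * q - 2 * t * (om * enorm H ^+ 2)).
have inU (t : R) : 0 <= t <= 1 -> 0 < \det (M + t *: H).
  by move=> t01; apply: hr0; apply: le_lt_trans (tH _ t01) (le_lt_trans Hn Hr0).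
have dphiE (t : R) : 0 <= t <= 1 -> is_derive t 1 phi (dphi t).
  move=> t01; have dWt : differentiable W (M + t *: H) by apply: dW; exact: inU.
  have h1 := derive_line dWt; rewrite inner_derive// in h1.
  apply: (is_derive_eq (is_deriveB h1 (is_derive_poly P t))).
  rewrite /dphi; congr (_ - _).
  by rewrite quadratic_derive c2E; field.
have dphi0 (t : R) : 0 <= t <= 1 -> 0 <= dphi t.
  move=> t01; have /andP[t0 t1] := t01.
  have -> : dphi t = inner (DW W (M + t *: H) - DW W M - t *: D2W W M H) H + 2 * t * (om * enorm H ^+ 2).
    by rewrite !innerBl innerZl /dphi -/q !opprD opprK !addrA.
  suff : `|inner (DW W (M + t *: H) - DW W M - t *: D2W W M H) H| <= 2 * t * (om * enorm H ^+ 2).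
    by rewrite ler_norml => /andP[h _]; rewrite -lerBlDr sub0r.
  rewrite innerE; apply: (le_trans (ler_norm_sum _ _ _)).
  apply: (@le_trans _ _ (\sum_(i < p.+1) \sum_(j < p.+1) (e * t * enorm H ^+ 2))); last first.
    rewrite !sumr_const !card_ord -!mulrnA -mulr_natl -/N /e le_eqVlt; apply/orP; left; apply/eqP.
    by field; rewrite gt_eqF.
  apply: ler_sum => i _; apply: (le_trans (ler_norm_sum _ _ _)); apply: ler_sum => j _.
  rewrite normrM expr2 mulrA ler_pM//; last exact: coord_le_enorm.
  have := hr1 i j (t *: H) (le_lt_trans (tH _ t01) (le_lt_trans Hn Hr1)).
  rewrite !mxE.
  have -> : 'D_(t *: H) (fun xi => DW W xi i j) M = t * 'D_H (fun xi => DW W xi i j) M.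
    by rewrite !deriveE// linearZ.
  move=> h; apply: (le_trans h); rewrite normrZ ger0_norm// -mulrA ler_wpM2l ?(ltW e0)//.
  by rewrite ler_wpM2l.
have [] := @MVT R phi dphi 0 1 ltr01.
- by move=> t /[!in_itv]/= /andP[t0 t1]; apply: dphiE; rewrite !ltW.
- apply: continuous_in_subspaceT => t /[!inE]/= /[!in_itv]/= t01.
  by apply: differentiable_continuous; apply/derivable1_diffP; case: (dphiE t t01).
move=> t /[!in_itv]/= /andP[t0 t1].
have -> : phi 0 = 0 by rewrite /phi scale0r addr0 quadratic_at0 subrr.
rewrite /phi scale1r !subr0 mulr1 => E.
have := dphi0 t; rewrite (ltW t0) (ltW t1) => /(_ isT).
by rewrite -E quadratic_at1 c2E -/q; lra.
Qed.

End taylor.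

(** * Periodic Lipschitz extension *)

Lemma coordB {R : realType} m (A B : 'cV[R]_m) i : (A - B) i ord0 = A i ord0 - B i ord0.
Proof. by rewrite !mxE. Qed.

Section mcshane.
Context {R : realType}.
Variable V : normedModType R.
Variables (I : Type) (i0 : I) (c : I -> R) (pnt : I -> V) (L : R).
Hypothesis L0 : 0 <= L.
Hypothesis compat : forall i j, c i - c j <= L * `|pnt i - pnt j|.

(** The largest L-Lipschitz function below the values [c i] at the points
[pnt i].  Indexing the data allows the same value to be prescribed at all integer
translates of a point. *)
Definition mcshane (z : V) : R := inf [set c i + L * `|z - pnt i| | i in [set: I]].

Let lb z j : lbound [set c i + L * `|z - pnt i| | i in [set: I]] (c j - L * `|z - pnt j|).
Proof.
move=> _ [i _ <-]; rewrite lerBlDr -addrA -mulrDr -lerBlDl.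
apply: (le_trans (compat j i)); rewrite ler_wpM2l//.
by apply: (le_trans (ler_distD z _ _)); rewrite addrC (distrC (pnt j)).
Qed.

Let nonempty z : [set c i + L * `|z - pnt i| | i in [set: I]] !=set0.
Proof. by exists (c i0 + L * `|z - pnt i0|); exists i0. Qed.

Let hlb z : has_lbound [set c i + L * `|z - pnt i| | i in [set: I]].
Proof. by exists (c i0 - L * `|z - pnt i0|); exact: lb. Qed.

Lemma mcshane_le z i : mcshane z <= c i + L * `|z - pnt i|.
Proof. by apply: ge_inf; [exact: hlb|exists i]. Qed.

Lemma mcshane_ge z x : (forall i, x <= c i + L * `|z - pnt i|) -> x <= mcshane z.
Proof. by move=> h; apply: lb_le_inf => // _ [i _ <-]; exact: h. Qed.

Lemma mcshane_ext i : mcshane (pnt i) = c i.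
Proof.
apply/eqP; rewrite eq_le; apply/andP; split.
  by apply: (le_trans (mcshane_le _ i)); rewrite subrr normr0 mulr0 addr0.
by apply: mcshane_ge => j; rewrite -lerBlDl; exact: compat.
Qed.

Lemma mcshane_lip : lip L mcshane.
Proof.
have h x y : mcshane x - mcshane y <= L * `|x - y|.
  rewrite lerBlDl -lerBlDr; apply: mcshane_ge => i; rewrite lerBlDr.
  apply: (le_trans (mcshane_le x i)); rewrite -addrA lerD2l -mulrDr ler_wpM2l// [leRHS]addrC.
  exact: ler_distD.
move=> x y; rewrite ler_norml h andbT lerNl opprB distrC; exact: h.
Qed.

Lemma mcshane_periodic v : (forall i, exists2 j, c j = c i & pnt j = pnt i + v) ->
  (forall i, exists2 j, c j = c i & pnt j = pnt i - v) -> forall z, mcshane (z + v) = mcshane z.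
Proof.
move=> hp hm z; apply/eqP; rewrite eq_le; apply/andP; split; apply: mcshane_ge => i.
  by have [j <- jE] := hp i; apply: (le_trans (mcshane_le _ j)); rewrite jE opprD addrACA subrr addr0.
have [j <- jE] := hm i; apply: (le_trans (mcshane_le _ j)); rewrite jE opprB addrA.
by rewrite addrAC.
Qed.

End mcshane.

Section film_extension.
Context {R : realType}.
Variable n : nat.
Hypothesis n2 : (n <= 2)%N.
Variables (g : 'cV[R]_n -> R) (u : 'cV[R]_n.+1 -> R) (d T L : R).
Hypotheses (L0 : 0 <= L) (d0 : 0 <= d) (dT : d <= T).
Hypothesis g0 : forall x, 0 < g x.

Definition cylinder : set 'cV[R]_n.+1 :=
  [set z | (forall i, 0 <= hpart z i ord0 <= 1) /\ 0 <= vpart z <= T].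

Hypothesis u_lip : forall p q, cylinder p -> cylinder q -> `|u p - u q| <= L * `|p - q|.
Hypothesis u_per : forall i x y, 0 <= y <= g x -> u (pt (x + basis_vec i) y) = u (pt x y).
Hypothesis u_bot : forall x, u (pt x 0) = 0.

Definition set_coord (x : 'cV[R]_n) i (t : R) : 'cV[R]_n := \col_j if j == i then t else x j ord0.

(** The condition on the traces is what allows one to use the periodicity of [u]
where the horizontal lines through a point of the core meet the walls. *)
Definition core : set 'cV[R]_n.+1 :=
  [set z | [/\ forall i, 0 <= hpart z i ord0 <= 1, 0 <= vpart z <= d,
             vpart z <= g (hpart z) & forall i, vpart z <= g (set_coord (hpart z) i 0)]].

Let core_cylinder z : core z -> cylinder z.
Proof. by move=> [h1 /andP[h2 h3] _ _]; split => //; rewrite h2 (le_trans h3). Qed.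

Let wall (z : 'cV[R]_n.+1) i t : 'cV[R]_n.+1 := pt (set_coord (hpart z) i t) (vpart z).

Let wall_cylinder z i t : 0 <= t <= 1 -> cylinder z -> cylinder (wall z i t).
Proof.
move=> t01 [h1 h2]; split; rewrite ?hpart_pt ?vpart_pt// => j; rewrite mxE.
by case: eqP.
Qed.

Let wall_cross z i (s t : bool) : core z -> u (wall z i s%:R) = u (wall z i t%:R).
Proof.
move=> [_ /andP[h1 h2] h3 h4].
have E : u (wall z i 1) = u (wall z i 0).
  rewrite /wall (_ : set_coord (hpart z) i 1 = set_coord (hpart z) i 0 + basis_vec i).
    by apply: u_per; rewrite h1 h4.
  by apply: cvP => j; rewrite !mxE; case: eqP => _; rewrite ?add0r ?addr0.
by case: s; case: t.
Qed.

(* [m] is the number of periods by which the second point has to be moved *)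
Let gap (p q : 'cV[R]_n.+1) (m : 'cV[int]_n) : R := `|p - q - pt (map_mx intr m) 0|.

Let gap_h p q (m : 'cV[int]_n) i : `|hpart p i ord0 - hpart q i ord0 - (m i ord0)%:~R| <= gap p q m.
Proof.
have := cv_coord_norm (p - q - pt (map_mx intr m) 0) (lift ord_max i).
by rewrite !coordB pt_lift mxE -!hpartE.
Qed.

Let gap_v p q m : `|vpart p - vpart q| <= gap p q m.
Proof.
have := cv_coord_norm (p - q - pt (map_mx intr m) 0) ord_max.
by rewrite !coordB pt_max subr0.
Qed.

Let side p q (m : 'cV[int]_n) i : core p -> core q -> m i ord0 != 0 ->
  exists s : bool, `|hpart p i ord0 - s%:R| <= gap p q m /\ `|(~~ s)%:R - hpart q i ord0| <= gap p q m.
Proof.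
move=> [/(_ i)/andP[p0 p1] _ _ _] [/(_ i)/andP[q0 q1] _ _ _] mi.
have := gap_h p q m i; move: p0 p1 q0 q1; set x := hpart p i ord0; set y := hpart q i ord0 => p0 p1 q0 q1.
have [m1|m1] := leP 1 (m i ord0).
  have : 1 <= (m i ord0)%:~R :> R by rewrite ler1z.
  rewrite ler_norml => h /andP[h1 _]; exists true; rewrite /=.
  by split; rewrite ler_norml; apply/andP; split; move: h h1; lra.
have : (m i ord0)%:~R <= -1 :> R.
  have -> : (-1 : R) = (-1)%:~R by [].
  by rewrite ler_int -ltzD1 addNr lt_neqAle mi -ltzD1 add0r.
rewrite ler_norml => h /andP[_ h1]; exists false; rewrite /=.
by split; rewrite ler_norml; apply/andP; split; move: h h1; lra.
Qed.

Let dist_le (p q : 'cV[R]_n.+1) (D : R) : 0 <= D -> (forall i, `|hpart p i ord0 - hpart q i ord0| <= D) -> `|vpart p - vpart q| <= D ->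
  `|p - q| <= D.
Proof.
move=> D0 h v; apply: cv_norm_le => // i; rewrite -(pt_hv p) -(pt_hv q) ptB mxE.
by case: unliftP => [j _|_]//; rewrite coordB.
Qed.

(** Two points of the core are joined, through the translation, by at most
three segments in the cylinder: cross one wall at the height of the first
point, then the other wall at the height of the second point. *)
Lemma core_compat p q (m : 'cV[int]_n) : core p -> core q ->
  u p - u q <= 3 * L * `|p - q - pt (map_mx intr m) 0|.
Proof.
move=> cp cq; rewrite -/(gap p q m); set D := gap p q m.
have D0 : 0 <= D by exact: normr_ge0.
have LD : 0 <= L * D by exact: mulr_ge0.
have Cp := core_cylinder cp; have Cq := core_cylinder cq.
have step x y : cylinder x -> cylinder y -> `|x - y| <= D -> u x - u y <= L * D.
  move=> Cx Cy xy; apply: (le_trans (ler_norm _)); apply: (le_trans (u_lip Cx Cy)).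
  by rewrite ler_wpM2l.
have v0 := gap_v p q m.
have b01 (s : bool) : 0 <= (s%:R : R) <= 1 by case: s; rewrite /= ?ler01 ?lexx.
have hw z i t j : hpart (wall z i t) j ord0 = if j == i then t else hpart z j ord0.
  by rewrite /wall hpart_pt mxE.
have [[i mi]|nm] := pselect (exists i, m i ord0 != 0); last first.
  have m0 i : m i ord0 = 0 by apply/eqP/negPn/negP => h; apply: nm; exists i.
  have -> : 3 * L * D = L * D + 2 * (L * D) by ring.
  rewrite (@le_trans _ _ (L * D))// ?lerDl ?mulr_ge0//; apply: step => //; apply: dist_le => // i.
  have := gap_h p q m i; rewrite m0 subr0.
  exact.
have [s [s1 s2]] := side cp cq mi.
have w1 : `|p - wall p i s%:R| <= D.
  apply: dist_le => // [j|]; last by rewrite vpart_pt subrr normr0.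
  by rewrite hw; case: eqP => [->//|_]; rewrite subrr normr0.
have e1 : u p - u (wall p i s%:R) <= L * D by apply: step => //; exact: wall_cylinder.
have e2 := wall_cross i s (~~ s) cp.
have [[j [ji mj]]|nj] := pselect (exists j, j != i /\ m j ord0 != 0); last first.
  have : u (wall p i (~~ s)%:R) - u q <= L * D.
    apply: step => //; [exact: wall_cylinder|apply: dist_le => // [k|]; last by rewrite vpart_pt].
    rewrite hw; case: eqP => [->//|/eqP ki].
    have := gap_h p q m k; have -> : m k ord0 = 0 by apply/eqP/negPn/negP => h; apply: nj; exists k.
    by rewrite subr0.
  move: e1; rewrite e2 => h1 h2.
  have -> : 3 * L * D = L * D + L * D + L * D by ring.
  by move: h1 h2 LD; lra.
have [t [t1 t2]] := side cp cq mj.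
have w3 : `|wall q j (~~ t)%:R - q| <= D.
  apply: dist_le => // [k|]; last by rewrite vpart_pt subrr normr0.
  by rewrite hw; case: eqP => [->//|_]; rewrite subrr normr0.
have e3 : u (wall q j (~~ t)%:R) - u q <= L * D by apply: step => //; exact: wall_cylinder.
have e4 := wall_cross j (~~ t) t cq.
have e5 : u (wall p i (~~ s)%:R) - u (wall q j t%:R) <= L * D.
  apply: step; [exact: wall_cylinder|exact: wall_cylinder|].
  apply: dist_le => // [k|]; last by rewrite !vpart_pt.
  rewrite !hw; case: eqP => [ki|/eqP ki].
    by rewrite ki eq_sym (negbTE ji) -ki ki.
  case: eqP => [-> //|/eqP kj].
  exfalso; have : (2 < #|'I_n|)%N.
    have : uniq [:: k; i; j] by rewrite /= !inE !negb_or ki kj eq_sym ji.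
    by move=> /card_uniqP /= <-; apply: subset_leq_card; apply/fintype.subsetP.
  by rewrite card_ord ltnNge n2.
move: e1; rewrite e2 => h1; move: e3; rewrite e4 => h3.
have -> : 3 * L * D = L * D + L * D + L * D by ring.
by move: h1 h3 e5; lra.
Qed.

(** The values on all integer translates of the core are compatible by
[core_compat]; the core contains the bottom of the cell. *)
Lemma film_extension : exists f : 'cV[R]_n.+1 -> R,
  [/\ lip (3 * L) f, forall z, core z -> f z = u z,
      forall i z, f (z + pt (basis_vec i) 0) = f z & forall x, f (pt x 0) = 0].
Proof.
pose I := ({z | core z} * 'cV[int]_n)%type.
have core0 (x : 'cV[R]_n) : (forall i, 0 <= x i ord0 <= 1) -> core (pt x 0).
  by move=> hx; split; rewrite ?hpart_pt ?vpart_pt ?lexx//= ?ltW// => i; rewrite ?vpart_pt ?ltW.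
have z0 : core (pt 0 0) by apply: core0 => i; rewrite mxE lexx ler01.
(* one datum for each translate of each point of the core *)
pose c (i : I) := u (sval i.1).
pose pnt (i : I) : 'cV[R]_n.+1 := sval i.1 + pt (map_mx intr i.2) 0.
have L3 : 0 <= 3 * L by rewrite mulr_ge0.
have compat i j : c i - c j <= 3 * L * `|pnt i - pnt j|.
  case: i j => [[p cp] k] [[q cq] l]; rewrite /c /pnt/=.
  apply: (le_trans (core_compat (l - k) cp cq)); rewrite ler_wpM2l//.
  rewrite (_ : _ - _ - _ = p + pt (map_mx intr k) 0 - (q + pt (map_mx intr l) 0))//.
  rewrite map_mxB (_ : pt _ 0 = pt (map_mx intr l) 0 - pt (map_mx intr k) 0); last by rewrite ptB subr0.
  by rewrite opprB opprD addrACA.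
pose i0 : I := (exist _ _ z0, 0).
exists (mcshane c pnt (3 * L)); split.
- exact: (mcshane_lip i0).
- move=> z cz; rewrite [X in mcshane _ _ _ X = _](_ : z = pnt (exist _ z cz, 0)) ?(mcshane_ext i0 L3 compat)//.
  rewrite /pnt/= (_ : pt _ 0 = 0) ?addr0//.
  by apply: cvP => i; rewrite !mxE; case: unliftP => [j _|_]; rewrite ?mxE.
- have ptint (k l : 'cV[int]_n) : pt (map_mx intr (k + l)) 0 = pt (map_mx intr k) 0 + pt (map_mx intr l) 0 :> 'cV[R]_n.+1.
    by rewrite ptD addr0 map_mxD.
  have bE i : basis_vec i = map_mx intr (delta_mx i ord0) :> 'cV[R]_n.
    by apply: cvP => j; rewrite !mxE; case: (_ && _).
  move=> i; apply: (mcshane_periodic i0 L3 compat) => -[p k].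
    by exists (p, k + delta_mx i ord0) => //; rewrite /pnt/= ptint addrA bE.
  exists (p, k - delta_mx i ord0) => //; rewrite /pnt/= bE.
  apply/eqP; rewrite eq_sym subr_eq -addrA -ptint subrK; exact/eqP.
- move=> x.
  pose y : 'cV[R]_n := \col_i (x i ord0 - (Num.floor (x i ord0))%:~R).
  have cy : core (pt y 0).
    apply: core0 => i; rewrite mxE; have /andP[h1 h2] := floor_itv (x i ord0).
    by rewrite subr_ge0 h1 lerBlDl ltW//; move: h2; rewrite intrD.
  have -> : pt x 0 = pnt (exist _ _ cy, \col_i Num.floor (x i ord0)).
    rewrite /pnt/= ptD addr0; congr pt; apply: cvP => i; rewrite !mxE.
    by rewrite subrK.
  by rewrite (mcshane_ext i0 L3 compat) /c/= u_bot.
Qed.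

End film_extension.

(** * Integrals over a period cell *)

Section null_sets.
Context {R : realType}.
Local Open Scope ereal_scope.

Lemma sum_cst (c : \bar R) N : 0 <= c -> \sum_(0 <= l < N) c = N%:R%:E * c.
Proof.
move=> c0; elim: N => [|N IH]; first by rewrite big_geq// mul0e.
by rewrite big_nat_recr//= IH -natr1 EFinD ge0_muleDl// mul1e.
Qed.

Lemma integrable_cst_fin d (T : measurableType d) (mu : {measure set T -> \bar R}) (D : set T) (c : R) :
  measurable D -> mu D < +oo -> mu.-integrable D (fun=> c%:E).
Proof.
move=> mD fD; apply/integrableP; split; first exact: measurable_cst.
by rewrite (integral_cst _ mD) lte_mul_pinfty.
Qed.

Lemma leb_hyperplane m (i : 'I_m) (t : R) : leb m [set z : 'cV[R]_m | z i ord0 = t] = 0.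
Proof.
apply: (@leb0_lines _ _ (basis_vec i)).
  rewrite -[X in measurable X]setTI.
  exact: (@measurable_coord_bor R m i measurableT [set t] (measurable_set1 t)).
move=> x; rewrite (_ : [set s | _] = [set (t - x i ord0)%R]) ?lebesgue_measure_set1//.
apply/seteqP; split => s /=; rewrite !mxE !eqxx mulr1.
  by move=> <-; rewrite addrAC subrr add0r.
by move=> ->; rewrite addrC subrK.
Qed.

Lemma leb_graph n (g : 'cV[R]_n -> R) : continuous g -> leb n.+1 [set z | vpart z = g (hpart z)] = 0.
Proof.
move=> cg; apply: (@leb0_lines _ _ (basis_vec ord_max)).
  apply: closed_bor.
  rewrite (_ : [set z | _] = (fun z : 'cV[R]_n.+1 => vpart z - g (hpart z))%R @^-1` [set 0%R]); last first.
    by apply/seteqP; split => z /= => [->|/eqP]; rewrite ?subrr// subr_eq0 => /eqP.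
  apply: preimage_closed; last exact: closed_eq.
  move=> z _; apply: (@continuousB _ _ _ (fun z : 'cV[R]_n.+1 => vpart z) (fun z => g (hpart z))).
    exact: coord_continuous.
  have ch := @continuous_hpart R n.
  by apply: (@continuous_comp _ _ _ (@hpart R n) g); [exact: ch|exact: cg].
move=> x; rewrite (_ : [set s | _] = [set (g (hpart x) - vpart x)%R]) ?lebesgue_measure_set1//.
have hE (s : R) : hpart (x + s *: basis_vec ord_max) = hpart x.
  by apply: cvP => i; rewrite !mxE eq_sym (negbTE (neq_lift _ _)) mulr0 addr0.
apply/seteqP; split => s /=; rewrite hE /vpart !mxE !eqxx mulr1.
  by move=> <-; rewrite addrAC subrr add0r.
by move=> ->; rewrite addrC subrK.
Qed.

Lemma eq_integral_null m (D E : set (cara R m)) (N : set 'cV[R]_m) (f : 'cV[R]_m -> \bar R) : leb m N = 0 ->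
  (forall z, ~ N z -> (D z <-> E z)) -> \int[leb m]_(z in D) f z = \int[leb m]_(z in E) f z.
Proof.
move=> N0 DE; rewrite [LHS]integral_mkcond [RHS]integral_mkcond; apply: eq_integral_ae.
have Nneg : (leb m).-negligible N by apply/leb_negligibleP.
apply: negligibleS Nneg => z /= h; apply: contrapT => nN; apply: h => _.
by rewrite /patch; congr (if _ then _ else _); apply/idP/idP; rewrite !inE => /(DE _ nN).
Qed.

End null_sets.

Section cell_shift.
Context {R : realType}.
Variables (m : nat) (i : 'I_m) (D : set 'cV[R]_m) (F : 'cV[R]_m -> \bar R).
Local Open Scope ereal_scope.
Hypothesis mD : measurable (D : set (bor R m)).
Hypothesis D_inv : forall z (t : R), D (z + t *: basis_vec i)%R <-> D z.
Hypothesis mF : measurable_fun setT (F : cara R m -> \bar R).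
Hypothesis F0 : forall z, 0 <= F z.
Hypothesis F_per : forall z, F (z + basis_vec i)%R = F z.

Let strip (a b : R) : set (cara R m) := D `&` [set z | a <= z i ord0 < b]%R.

Let m_strip a b : measurable (strip a b).
Proof.
apply: bor_cara; apply: measurableI => //.
rewrite [X in measurable X](_ : _ = setT `&` (fun z : bor R m => z i ord0) @^-1` `[a, b[%classic).
  exact: measurable_coord_bor.
by apply/seteqP; split => z /=; rewrite in_itv/=; [|case].
Qed.

Let shift_strip a b t (G : 'cV[R]_m -> \bar R) : measurable_fun setT (G : cara R m -> \bar R) -> (forall z, 0 <= G z) ->
  \int[leb m]_(z in strip a b) G (z + t *: basis_vec i)%R = \int[leb m]_(z in strip (a + t)%R (b + t)%R) G z.
Proof.
move=> mG G0; rewrite -[RHS](ge0_integral_translate (t *: basis_vec i)%R).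
- congr (integral _ _ _); apply/seteqP; split => z [Dz /= h]; split; rewrite /translate/=.
  + exact/D_inv.
  + by rewrite !mxE !eqxx mulr1 lerD2r ltrD2r.
  + by move: Dz; rewrite /translate => /D_inv.
  + by move: h; rewrite /translate !mxE !eqxx mulr1 lerD2r ltrD2r.
- exact: m_strip.
- exact: measurable_funTS.
- by move=> z _; exact: G0.
Qed.

Let split_strip a b c (G : 'cV[R]_m -> \bar R) : measurable_fun setT (G : cara R m -> \bar R) -> (forall z, 0 <= G z) ->
  (a <= b)%R -> (b <= c)%R ->
  \int[leb m]_(z in strip a c) G z = \int[leb m]_(z in strip a b) G z + \int[leb m]_(z in strip b c) G z.
Proof.
move=> mG G0 ab bc; rewrite -ge0_integral_setU.
- congr (integral _ _ _); apply/seteqP; split => z; rewrite /strip /=.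
    by move=> [Dz /andP[h1 h2]]; have [h|h] := ltP (z i ord0) b; [left|right]; rewrite ?h1 ?h2.
  by move=> [|] [Dz /andP[h1 h2]]; split => //; rewrite ?h1 ?h2 ?(le_trans ab)// (lt_le_trans h2).
- exact: m_strip.
- exact: m_strip.
- exact: measurable_funTS.
- by move=> z _; exact: G0.
- apply/disj_set2P; rewrite -subset0 => z [[_ /= /andP[_ h1]] [_ /= /andP[h2 _]]].
  by move: h1; rewrite ltNge h2.
Qed.

Definition cell : set (cara R m) := D `&` [set z | 0 < z i ord0 < 1]%R.

Let cell_strip (G : 'cV[R]_m -> \bar R) : \int[leb m]_(z in cell) G z = \int[leb m]_(z in strip 0 1) G z.
Proof.
apply: (@eq_integral_null R m cell (strip 0 1) _ G (leb_hyperplane i 0%R)) => z /= z0; split => -[Dz /= /andP[h1 h2]]; split => //=.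
  by rewrite ltW.
by rewrite lt_def h1 h2 andbT; apply/andP; split => //; apply/eqP.
Qed.

(** The part that leaves the cell re-enters on the other side. *)
Lemma cell_shift (s : R) : (0 <= s <= 1)%R ->
  \int[leb m]_(z in cell) F (z + s *: basis_vec i)%R = \int[leb m]_(z in cell) F z.
Proof.
move=> /andP[s0 s1]; rewrite !cell_strip shift_strip// add0r.
rewrite (@split_strip _ 1%R)//; last by rewrite lerDl.
rewrite (@split_strip 0%R s)// addeC; congr (_ + _).
have := @shift_strip 0%R s 1%R F mF F0; rewrite add0r addrC => <-.
by apply: eq_integral => z _; rewrite scale1r F_per.
Qed.

End cell_shift.

(** Difference quotients of a Lipschitz function converge almost everywhere and
are dominated by a constant. *)
Lemma quot_integral_cvg {R : realType} m (f : 'cV[R]_m -> R) (K : R) (v : 'cV[R]_m) (D : set (cara R m)) (phi : R -> R) :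
  0 <= K -> lip K f -> measurable D -> (leb m D < +oo)%E -> continuous phi -> (forall t, `|phi t| <= `|t|) ->
  (\int[leb m]_(x in D) (phi (quot f v (harmonic_seq k) x))%:E @[k --> \oo] -->
   \int[leb m]_(x in D) (phi ('D_v f x))%:E)%E.
Proof.
move=> K0 lf mD fD cphi phi_le; have mphi := continuous_measurable_fun cphi.
have [] := @dominated_convergence _ _ _ (leb m) D mD
  (fun k x => (phi (quot f v (harmonic_seq k) x))%:E) (fun x => (phi ('D_v f x))%:E)
  (fun=> (K * `|v|)%:E)%E.
- move=> k; apply: measurable_funTS; apply/measurable_EFinP; apply: (measurableT_comp mphi).
  exact: measurable_quot lf.
- apply: measurable_funTS; apply/measurable_EFinP; apply: (measurableT_comp mphi).
  exact: measurable_derive lf.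
- apply: ae_mono (lip_ae_derivable v lf) => x dx _; apply: cvg_EFin; first exact: nearW.
  apply: continuous_cvg; first exact: cphi.
  exact: (quot_cvg dx (@harmonic_cvg0 R) (@harmonic_neq0 R)).
- exact: integrable_cst_fin.
- apply: ae_all => x k _; rewrite abse_EFin lee_fin (le_trans (phi_le _))//.
  exact: lip_quot.
by [].
Qed.

Section cube_calculus.
Context {R : realType}.
Variable n : nat.
Local Open Scope ereal_scope.
Let Q := @unit_cube R n.

Let rest (i : 'I_n) : set 'cV[R]_n := [set x | forall j, j != i -> (0 < x j ord0 < 1)%R].

Let rest_cell i : Q = cell i (rest i).
Proof.
apply/seteqP; split => [x hx|x [h1 h2] j]; first by split; [move=> j _; exact: hx|exact: (hx i)].
by have [->|ji] := eqVneq j i; [exact: h2|exact: h1].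
Qed.

Lemma open_slab m (j : 'I_m) : measurable ([set x : 'cV[R]_m | 0 < x j ord0 < 1]%R : set (bor R m)).
Proof.
rewrite [X in measurable X](_ : _ = setT `&` (fun x : bor R m => x j ord0) @^-1` `]0%R, 1%R[%classic).
  exact: measurable_coord_bor.
by apply/seteqP; split => x /=; rewrite in_itv/=; [|case].
Qed.

Let m_rest i : measurable (rest i : set (bor R n)).
Proof.
rewrite (_ : rest i = \bigcap_(j in [set j | j != i]) [set x : 'cV[R]_n | 0 < x j ord0 < 1]%R).
  by apply: fin_bigcap_measurable => [|j _]; [exact: finite_finset|exact: open_slab].
by apply/seteqP; split => x h j; exact: h.
Qed.

Let rest_inv i z (t : R) : rest i (z + t *: basis_vec i)%R <-> rest i z.
Proof.
by split => h j ji; have := h j ji; rewrite !mxE (negbTE ji)/= mulr0 addr0.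
Qed.

Definition periodic_fun (F : 'cV[R]_n -> \bar R) := forall i x, F (x + basis_vec i)%R = F x.

Lemma cube_shift1 (F : 'cV[R]_n -> \bar R) i (s : R) : measurable_fun setT (F : cara R n -> \bar R) ->
  (forall x, 0 <= F x) -> periodic_fun F -> (0 <= s <= 1)%R ->
  \int[leb n]_(x in Q) F (x + s *: basis_vec i)%R = \int[leb n]_(x in Q) F x.
Proof. by move=> mF F0 Fp s01; rewrite (rest_cell i); apply: cell_shift. Qed.

Lemma measurable_shift (F : 'cV[R]_n -> \bar R) v : measurable_fun setT (F : cara R n -> \bar R) ->
  measurable_fun setT ((fun x => F (x + v)%R) : cara R n -> \bar R).
Proof. by move=> mF; exact: (measurableT_comp mF (measurable_translate v)). Qed.

Lemma periodic_shift F v : periodic_fun F -> periodic_fun (fun x => F (x + v)%R).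
Proof. by move=> Fp i x; rewrite addrAC Fp. Qed.

Lemma cube_shift (F : 'cV[R]_n -> \bar R) (v : 'cV[R]_n) : measurable_fun setT (F : cara R n -> \bar R) ->
  (forall x, 0 <= F x) -> periodic_fun F -> (forall i, 0 <= v i ord0 <= 1)%R ->
  \int[leb n]_(x in Q) F (x + v)%R = \int[leb n]_(x in Q) F x.
Proof.
move=> mF F0 Fp v01.
have vE : v = (\sum_i v i ord0 *: basis_vec i)%R.
  apply: cvP => i; rewrite summxE (bigD1 i)//= !mxE eqxx mulr1 big1 ?addr0// => j ji.
  by rewrite !mxE eq_sym (negbTE ji)/= mulr0.
rewrite vE; elim: (index_enum _) => [|i s IH].
  by apply: eq_integral => x _; rewrite big_nil addr0.
rewrite big_cons -[RHS]IH.
under eq_integral do rewrite addrCA addrC.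
rewrite -(@cube_shift1 (fun x => F (x + \sum_(j <- s) v j ord0 *: basis_vec j)%R) i (v i ord0))//.
- by apply: eq_integral => x _; rewrite addrAC.
- exact: measurable_shift.
- exact: periodic_shift.
Qed.

(** Half-open boxes fill the open cube up to arbitrarily small volume, by
Bernoulli's inequality. *)
Lemma leb_unit_cube : leb n Q = 1.
Proof.
apply/eqP; rewrite eq_le leb_unit_cube_le/=.
pose lo (e : R) : R := Num.min e (1 / 2)%R.
have h (e : R) : (0 < e)%R -> (((1 - 2 * lo e) ^+ n)%:E <= leb n Q).
  move=> e0; have l0 : (0 < lo e)%R by rewrite lt_min e0 divr_gt0.
  have l2 : (lo e <= 1 / 2)%R by rewrite ge_min lexx orbT.
  apply: (@le_trans _ _ (leb n (box (const_mx (lo e)) (const_mx (1 - lo e)%R)))).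
    rewrite leb_box => [|i]; last by rewrite !mxE; lra.
    rewrite (eq_bigr (fun=> (1 - 2 * lo e)%R)) => [|i _]; last by rewrite !mxE; ring.
    by rewrite prodr_const card_ord.
  apply: le_outer_measure => x hx i; have := hx i; rewrite !mxE => /andP[h1 h2].
  by apply/andP; split; lra.
have bern (t : R) (k : nat) : (0 <= t <= 1)%R -> (1 - k%:R * t <= (1 - t) ^+ k)%R.
  move=> /andP[t0 t1]; elim: k => [|k IH]; first by rewrite mul0r subr0 expr0.
  rewrite exprS; apply: (@le_trans _ _ ((1 - t) * (1 - k%:R * t))%R); last first.
    by rewrite ler_wpM2l// subr_ge0.
  rewrite -natr1; have : (0 <= k%:R * (t * t))%R by rewrite !mulr_ge0.
  by move: (k%:R : R)%R => y; lra.
apply/lee_addgt0Pr => e e0.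
pose e' := (e / (2 * n.+1%:R))%R.
have e'0 : (0 < e')%R by rewrite divr_gt0// mulr_gt0.
have l0 : (0 < lo e')%R by rewrite lt_min e'0 divr_gt0.
have l2 : (lo e' <= 1 / 2)%R by rewrite ge_min lexx orbT.
apply: (@le_trans _ _ (((1 - 2 * lo e') ^+ n)%:E + e%:E)); last by rewrite leeD2r// h.
rewrite -EFinD lee_fin -lerBlDr; apply: le_trans (bern _ n _); last first.
  by apply/andP; split; lra.
rewrite lerD2l lerN2; apply: (@le_trans _ _ (n.+1%:R * (2 * e'))%R).
  by rewrite ler_pM// ?mulr_ge0 ?(ltW l0)// ?ler_nat// ler_wpM2l// ge_min lexx.
have y0 : (n.+1%:R != 0 :> R)%R by [].
by rewrite /e' le_eqVlt; apply/orP; left; apply/eqP; move: (n.+1%:R : R)%R y0 => y y0; field.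
Qed.

Variables (g : 'cV[R]_n -> R) (K : R).
Hypotheses (K0 : (0 <= K)%R) (lg : lip K g).
Hypothesis g_per : one_periodic g.

Definition variation (i : 'I_n) : \bar R := \int[leb n]_(x in Q) (`|'D_(basis_vec i) g x|)%:E.

Let mQ : measurable (Q : set (cara R n)).
Proof. by apply: bor_cara; exact: unit_cube_bor. Qed.

Let incr (v : 'cV[R]_n) (x : 'cV[R]_n) : \bar R := (`|g (x + v) - g x|)%:E.

Let cg : continuous g. Proof. exact: (lip_cont lg). Qed.

Let incr_cont (v : 'cV[R]_n) : continuous (fun x : 'cV[R]_n => `|g (x + v)%R - g x|%R).
Proof.
move=> x; apply: (@continuous_comp _ _ _ (fun x : 'cV[R]_n => (g (x + v)%R - g x)%R) Num.norm); last exact: norm_continuous.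
apply: (@continuousB _ _ _ (fun x : 'cV[R]_n => g (x + v)%R) g); last exact: cg.
apply: (@continuous_comp _ _ _ (fun x : 'cV[R]_n => (x + v)%R) g); last exact: cg.
by apply: (@continuousD _ _ _ id (fun=> v)); [exact: cvg_id|exact: cst_continuous].
Qed.

Let incr_meas v : measurable_fun setT (incr v : cara R n -> \bar R).
Proof. by apply/measurable_EFinP; apply: continuous_cara; exact: incr_cont. Qed.

Let incr_per v : periodic_fun (incr v).
Proof. by move=> i x; rewrite /incr addrAC !g_per. Qed.

Let b1 i : (`|basis_vec i : 'cV[R]_n| <= 1)%R.
Proof. by apply: cv_norm_le => // j; rewrite !mxE; case: (_ && _); rewrite ?normr1 ?normr0. Qed.

Let telescope i x (tau : R) (N : nat) : (0 <= tau <= 1)%R ->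
  (`|g (x + tau *: basis_vec i) - g x| <=
   \sum_(0 <= l < N.+1) `|g (x + (l%:R / N.+1%:R) *: basis_vec i + N.+1%:R^-1 *: basis_vec i)
      - g (x + (l%:R / N.+1%:R) *: basis_vec i)| + K / N.+1%:R)%R.
Proof.
move=> /andP[t0 t1]; set b := basis_vec i.
have N0 : (0 < N.+1%:R :> R)%R by [].
have tN : (0 <= tau * N.+1%:R)%R by rewrite mulr_ge0.
have /andP[h1 h2] := truncn_itv tN; set j := Num.truncn _ in h1 h2.
have jN : (j <= N.+1)%N.
  by rewrite -(ler_nat R) (le_trans h1)// ler_piMl.
have hj : (`|g (x + (j%:R / N.+1%:R) *: b) - g x| <= \sum_(0 <= l < j)
    `|g (x + (l%:R / N.+1%:R) *: b + N.+1%:R^-1 *: b) - g (x + (l%:R / N.+1%:R) *: b)|)%R.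
  elim: (j) => [|k IH]; first by rewrite mul0r scale0r addr0 subrr normr0 big_geq.
  rewrite big_nat_recr//= addrC; apply: (le_trans _ (lerD (lexx _) IH)).
  have -> : (x + (k.+1%:R / N.+1%:R) *: b = x + (k%:R / N.+1%:R) *: b + N.+1%:R^-1 *: b)%R.
    by rewrite -natr1 mulrDl mul1r scalerDl addrA.
  exact: ler_distD.
apply: (le_trans (ler_distD (g (x + (j%:R / N.+1%:R) *: b)%R) _ _)); rewrite addrC; apply: lerD.
  apply: (le_trans hj); rewrite [leRHS](@big_cat_nat _ _ _ j)//= lerDl.
  by apply: sumr_ge0.
apply: (le_trans (lg _ _)); rewrite ler_wpM2l// opprD addrACA subrr add0r -scalerBl normrZ.
apply: (@le_trans _ _ (`|tau - j%:R / N.+1%:R| * 1)%R); first by rewrite ler_wpM2l ?b1.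
rewrite mulr1 ger0_norm; last by rewrite subr_ge0 ler_pdivrMr.
by rewrite lerBlDr -[X in (X + _)%R]mul1r -mulrDl ler_pdivlMr// addrC natr1 ltW.
Qed.

Let Qfin : leb n Q < +oo.
Proof. by rewrite leb_unit_cube ltry. Qed.

Lemma variation_cvg i : \int[leb n]_(x in Q) (`|quot g (basis_vec i) (harmonic_seq k) x|)%:E @[k --> \oo] --> variation i.
Proof.
have cn : continuous (fun t : R => `|t|%R) by move=> t; exact: norm_continuous.
have nn (t : R) : (`|(`|t|)| <= `|t|)%R by rewrite normr_id.
exact: (quot_integral_cvg (v := basis_vec i) K0 lg mQ Qfin cn nn).
Qed.

Lemma incr_quot i k : k.+1%:R%:E * \int[leb n]_(x in Q) incr (k.+1%:R^-1 *: basis_vec i) x =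
  \int[leb n]_(x in Q) (`|quot g (basis_vec i) (@harmonic_seq R k) x|)%:E.
Proof.
rewrite -ge0_integralZl.
- by apply: eq_integral => x _; rewrite /incr /quot /harmonic_seq invrK normrM normr_nat EFinM.
- exact: mQ.
- by apply: measurable_funTS; exact: incr_meas.
- by move=> x _; rewrite lee_fin.
- by rewrite lee_fin.
Qed.

(** Cut the move into many equal steps and complete it to the full period, which
removes the dependence on [tau]; each step costs the same by invariance under
translations. *)
Lemma shift_variation i (tau : 'cV[R]_n -> R) : (forall x, Q x -> 0 <= tau x <= 1)%R ->
  \int[leb n]_(x in Q) (`|g (x + tau x *: basis_vec i) - g x|)%:E <= variation i.
Proof.
move=> t01; set I := integral _ _ _.
have h k : I <= \int[leb n]_(x in Q) (`|quot g (basis_vec i) (harmonic_seq k) x|)%:E + (K / k.+1%:R)%:E.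
  apply: (@le_trans _ _ (\int[leb n]_(x in Q) (\sum_(0 <= l < k.+1)
     incr (k.+1%:R^-1 *: basis_vec i) (x + (l%:R / k.+1%:R) *: basis_vec i)%R + (K / k.+1%:R)%:E))).
    apply: le_integral_ae; apply: ae_all => x Qx.
    by rewrite /incr sumEFin -EFinD lee_fin; apply: telescope; exact: t01.
  have mS (l : nat) : measurable_fun (Q : set (cara R n)) ((fun x => incr (k.+1%:R^-1 *: basis_vec i) (x + (l%:R / k.+1%:R) *: basis_vec i)%R) : cara R n -> \bar R).
    by apply: measurable_funTS; apply: measurable_shift.
  rewrite ge0_integralD//; last 3 first.
  - by move=> x _; apply: sume_ge0 => l _; rewrite lee_fin.
  - by apply: emeasurable_sum.
  - by move=> x _; rewrite lee_fin divr_ge0.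
  rewrite ge0_integral_sum//; last by move=> l x _; rewrite lee_fin.
  apply: leeD; last first.
    by rewrite (integral_cst _ mQ) leb_unit_cube mule1.
  rewrite -incr_quot; apply: (@le_trans _ _ (\sum_(0 <= l < k.+1) \int[leb n]_(x in Q) incr (k.+1%:R^-1 *: basis_vec i) x)).
    rewrite big_nat [leRHS]big_nat; apply: lee_sum => l /andP[_ lk].
    rewrite (@cube_shift1 (incr (k.+1%:R^-1 *: basis_vec i)))//.
    - by move=> x; rewrite lee_fin.
    - by rewrite divr_ge0//= ler_pdivrMr// mul1r ler_nat ltnW.
  by rewrite sum_cst ?integral_ge0// => x _; rewrite lee_fin.
have cvh : \int[leb n]_(x in Q) (`|quot g (basis_vec i) (harmonic_seq k) x|)%:E + (K / k.+1%:R)%:E @[k --> \oo] -->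
    variation i + 0.
  apply: cvgeD; [by rewrite fin_num_adde_defl|exact: variation_cvg|].
  apply: cvg_EFin; first exact: nearW.
  by rewrite -[X in _ --> X](mulr0 K); apply: cvgMr; exact: harmonic_cvg0.
rewrite -[leRHS]adde0 -(cvg_lim (@ereal_hausdorff R) cvh); apply: lime_ge; first by apply/cvg_ex; eexists; exact: cvh.
by apply: nearW => k; exact: h.
Qed.

End cube_calculus.

Section poincare.
Context {R : realType}.
Variable n : nat.
Local Open Scope ereal_scope.
Variables (g : 'cV[R]_n -> R) (K : R).
Hypotheses (K0 : (0 <= K)%R) (lg : lip K g).
Hypothesis g_per : one_periodic g.
Let Q : set (cara R n) := @unit_cube R n.

Let mQ : measurable Q. Proof. by apply: bor_cara; exact: unit_cube_bor. Qed.

Let cg : continuous g. Proof. exact: (lip_cont lg). Qed.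

Let incr (v x : 'cV[R]_n) : \bar R := (`|g (x + v) - g x|)%:E.

Let incr_meas v : measurable_fun setT (incr v : cara R n -> \bar R).
Proof.
apply/measurable_EFinP; apply: continuous_cara => x.
apply: (@continuous_comp _ _ _ (fun x : 'cV[R]_n => (g (x + v)%R - g x)%R) Num.norm); last exact: norm_continuous.
apply: (@continuousB _ _ _ (fun x : 'cV[R]_n => g (x + v)%R) g); last exact: cg.
apply: (@continuous_comp _ _ _ (fun x : 'cV[R]_n => (x + v)%R) g); last exact: cg.
by apply: (@continuousD _ _ _ id (fun=> v)); [exact: cvg_id|exact: cst_continuous].
Qed.

Lemma variation_fin i : variation g i \is a fin_num.
Proof.
rewrite ge0_fin_numE; last by apply: integral_ge0 => x _; rewrite lee_fin.
apply: (@le_lt_trans _ _ (\int[leb n]_(x in Q) (K * `|basis_vec i : 'cV[R]_n|)%:E)).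
  by apply: le_integral_ae; apply: ae_all => x _; rewrite lee_fin; exact: lip_derive_bound.
by rewrite (integral_cst _ mQ) leb_unit_cube mule1 ltry.
Qed.

(** Move one coordinate at a time; the moves made before are translations. *)
Lemma translate_variation (t : 'cV[R]_n) : (forall i, 0 <= t i ord0 <= 1)%R ->
  \int[leb n]_(x in Q) (`|g (x + t) - g x|)%:E <= \sum_i variation g i.
Proof.
move=> t01.
have tE : t = (\sum_i t i ord0 *: basis_vec i)%R.
  apply: cvP => i; rewrite summxE (bigD1 i)//= !mxE eqxx mulr1 big1 ?addr0// => j ji.
  by rewrite !mxE eq_sym (negbTE ji)/= mulr0.
suff h (s : seq 'I_n) : \int[leb n]_(x in Q) (`|g (x + \sum_(i <- s) t i ord0 *: basis_vec i) - g x|)%:E <=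
    \sum_(i <- s) variation g i by have := h (index_enum 'I_n); rewrite -tE.
elim: s => [|i s IH].
  rewrite !big_nil (_ : integral _ _ _ = 0).
    exact: lexx.
  by apply: integral0_eq => x _; rewrite addr0 subrr normr0.
rewrite !big_cons; pose v := (\sum_(j <- s) t j ord0 *: basis_vec j : 'cV[R]_n)%R.
apply: (@le_trans _ _ (\int[leb n]_(x in Q) (incr (t i ord0 *: basis_vec i)%R x + incr v (x + t i ord0 *: basis_vec i)%R))).
  apply: le_integral_ae; apply: ae_all => x _; rewrite /incr -EFinD lee_fin [leRHS]addrC addrA.
  exact: ler_distD.
rewrite ge0_integralD.
- apply: leeD; first exact: (@shift_variation _ _ _ _ K0 lg g_per i (fun=> t i ord0) (fun x _ => t01 i)).
  rewrite (@cube_shift1 _ _ (incr v)) ?t01//.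
  + by move=> x; rewrite lee_fin.
  + by move=> j x; rewrite /incr addrAC !g_per.
- exact: mQ.
- by move=> x _; rewrite lee_fin.
- by apply: measurable_funTS.
- by move=> x _; rewrite lee_fin.
- by apply: measurable_funTS; apply: measurable_shift.
Qed.

(** Going forward by 1 - x_i leads to the opposite wall, where periodicity gives
the same value. *)
Lemma wall_variation i : \int[leb n]_(x in Q) (`|g x - g (set_coord x i 0)|)%:E <= variation g i.
Proof.
have h := @shift_variation _ _ _ _ K0 lg g_per i (fun x => (1 - x i ord0)%R).
apply: le_trans (h _); last by move=> x /(_ i); lra.
apply: le_integral_ae; apply: ae_all => x _; rewrite lee_fin distrC.
suff -> : (x + (1 - x i ord0) *: basis_vec i = set_coord x i 0 + basis_vec i)%R by rewrite g_per.
by apply: cvP => j; rewrite !mxE; case: eqP => [->|_]/=; [rewrite mulr1 addrCA subrr addr0 add0r|rewrite mulr0 !addr0].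
Qed.

Let joint (p : cara R n * cara R n) : \bar R :=
  ((`|g ((p.1 : 'cV[R]_n) + p.2) - g p.1|)%:E * (\1_Q p.1)%:E) * (\1_Q p.2)%:E.

Let joint_meas : measurable_fun setT joint.
Proof.
have madd : measurable_fun setT ((fun p : cara R n * cara R n => (p.1 : 'cV[R]_n) + p.2)%R : _ -> bor R n).
  apply: measurable_bor => j; rewrite (_ : (fun _ => _) = (fun p : cara R n * cara R n => (p.1 : 'cV[R]_n) j ord0 + (p.2 : 'cV[R]_n) j ord0)%R); last first.
    by apply/funext => p; rewrite mxE.
  by apply: measurable_funD; (apply: (measurableT_comp (@measurable_coord_cara R n j)); [exact: measurable_fst || exact: measurable_snd]).
have mb : measurable_fun setT (g : bor R n -> R) by exact: continuous_bor.
have mc : measurable_fun setT (g : cara R n -> R) by exact: continuous_cara.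
have mI : measurable_fun setT (\1_Q : cara R n -> R) by exact: measurable_indic.
apply: emeasurable_funM; [apply: emeasurable_funM|].
- apply/measurable_EFinP; apply: (measurableT_comp (@normr_measurable R setT)); apply: measurable_funB.
    exact: (measurableT_comp mb madd).
  exact: (measurableT_comp mc measurable_fst).
- by apply/measurable_EFinP; exact: (measurableT_comp mI measurable_fst).
- by apply/measurable_EFinP; exact: (measurableT_comp mI measurable_snd).
Qed.

(** Poincare inequality on the period cell: the mean value is the average over
all translates, and each translate costs at most the variation. *)
Lemma poincare (d : R) : (forall x, 0 <= g x)%R -> \int[leb n]_(x in Q) (g x)%:E = d%:E ->
  \int[leb n]_(x in Q) (`|g x - d|)%:E <= \sum_i variation g i.
Proof.
move=> g0 gd.
have cub x : Q x -> forall i, (0 <= x i ord0 <= 1)%R by move=> Qx i; have := Qx i; lra.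
have mgE v : measurable_fun setT ((fun t => (g (v + t)%R)%:E) : cara R n -> \bar R).
  have := @measurable_shift _ n (EFin \o g) v; rewrite (_ : (fun x => _) = (fun t => (g (v + t)%R)%:E)); last first.
    by apply/funext => x /=; rewrite addrC.
  by apply; apply/measurable_EFinP; exact: continuous_cara.
have avg x : Q x -> \int[leb n]_(t in Q) (g (x + t)%R)%:E = d%:E.
  move=> Qx; rewrite -gd -(@cube_shift _ _ (EFin \o g) x).
  - by apply: eq_integral => t _; rewrite addrC.
  - by apply/measurable_EFinP; exact: continuous_cara.
  - by move=> y; rewrite lee_fin.
  - by move=> i y; rewrite /= g_per.
  - exact: cub.
have cstg x : \int[leb n]_(t in Q) (g x)%:E = (g x)%:E.
  by rewrite (integral_cst _ mQ) leb_unit_cube mule1.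
have mJ x : measurable_fun Q ((fun t => (`|g (x + t)%R - g x|)%:E) : cara R n -> \bar R).
  apply: measurable_funTS; apply/measurable_EFinP; apply: (measurableT_comp (@normr_measurable R setT)).
  by apply: measurable_funB => //; apply/measurable_EFinP; exact: mgE.
pose J x := \int[leb n]_(t in Q) (`|g (x + t)%R - g x|)%:E.
have J0 x : 0 <= J x by apply: integral_ge0 => t _; rewrite lee_fin.
have le1 x : Q x -> (`|g x - d|)%:E <= J x.
  move=> Qx.
  have h1 : (g x)%:E <= d%:E + J x.
    rewrite -cstg -(avg x Qx) /J -ge0_integralD.
    - apply: le_integral_ae; apply: ae_all => t _; rewrite -EFinD lee_fin -lerBlDl distrC; exact: ler_norm.
    - exact: mQ.
    - by move=> t _; rewrite lee_fin.
    - by apply: measurable_funTS; exact: mgE.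
    - by move=> t _; rewrite lee_fin.
    - exact: mJ.
  have h2 : d%:E <= (g x)%:E + J x.
    rewrite -[X in X + _]cstg -(avg x Qx) /J -ge0_integralD.
    - apply: le_integral_ae; apply: ae_all => t _; rewrite -EFinD lee_fin -lerBlDl; exact: ler_norm.
    - exact: mQ.
    - by move=> t _; rewrite lee_fin.
    - exact: measurable_cst.
    - by move=> t _; rewrite lee_fin.
    - exact: mJ.
  move: h1 h2 (J0 x); case: (J x) => [r||]//; last by move=> *; rewrite leey.
  rewrite -!EFinD !lee_fin => h1 h2 _; rewrite ler_norml; apply/andP; split; lra.
apply: (@le_trans _ _ (\int[leb n]_(x in Q) J x)).
  by apply: le_integral_ae; apply: ae_all => x; exact: le1.
have jE x t : joint (x, t) = ((fun t => ((fun x => (`|g (x + t)%R - g x|)%:E) \_ Q) x) \_ Q) t.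
  by rewrite /joint /patch !indicE /=; case: (x \in Q); case: (t \in Q); rewrite ?mule1 ?mule0.
have -> : \int[leb n]_(x in Q) J x = \int[leb_sf n]_x \int[leb_sf n]_t joint (x, t).
  rewrite integral_mkcond; apply: eq_integral => x _; rewrite /patch; case: ifP => xQ.
    rewrite /J integral_mkcond; apply: eq_integral => t _; rewrite jE /patch xQ.
    by [].
  by apply/esym; apply: integral0_eq => t _; rewrite jE /patch xQ; case: ifP.
rewrite fubini_tonelli; last 2 first.
- exact: joint_meas.
- by move=> p; rewrite /joint !mule_ge0// lee_fin.
apply: (@le_trans _ _ (\int[leb n]_(t in Q) \sum_i variation g i)); last first.
  by rewrite (integral_cst _ mQ) leb_unit_cube mule1.
rewrite [leRHS]integral_mkcond; apply: le_integral_ae; apply: ae_all => t _.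
rewrite [leRHS]/patch; case: ifP => tQ.
  rewrite (_ : integral _ _ _ = \int[leb n]_(x in Q) (`|g (x + t)%R - g x|)%:E).
    by apply: translate_variation; apply: cub; rewrite inE in tQ.
  by rewrite [RHS]integral_mkcond; apply: eq_integral => x _; rewrite jE /patch tQ.
by rewrite integral0_eq// => x _; rewrite jE /patch tQ.
Qed.

End poincare.

Section volumes.
Context {R : realType}.
Variable n : nat.
Local Open Scope ereal_scope.
Variables (g : 'cV[R]_n -> R) (K : R).
Hypotheses (K0 : (0 <= K)%R) (lg : lip K g).
Hypothesis g_per : one_periodic g.
Hypothesis g_pos : forall x, (0 < g x)%R.
Let Q : set (cara R n) := @unit_cube R n.

Let cg : continuous g. Proof. exact: (lip_cont lg). Qed.

Lemma leb_Omega (h : 'cV[R]_n -> R) : continuous h -> (forall x, (0 < h x)%R) ->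
  leb n.+1 (Omega h) = \int[leb n]_(x in Q) (h x)%:E.
Proof.
move=> ch h0; rewrite [LHS](leb_between (f := fun=> 0%R) (g := h) (@unit_cube_bor R n)) => [||//]; last exact: cst_continuous.
by apply: eq_integral => x _; rewrite subr0 max_l// ltW.
Qed.

Lemma leb_Omega_cst (d : R) : (0 < d)%R -> leb n.+1 (Omega (cst d : 'cV[R]_n -> R)) = d%:E.
Proof.
move=> d0; rewrite leb_Omega//; last exact: cst_continuous.
have mQ : measurable Q by apply: bor_cara; exact: unit_cube_bor.
transitivity (\int[leb n]_(x in Q) d%:E); first by [].
by rewrite (integral_cst _ mQ) leb_unit_cube mule1.
Qed.

(** Here both bodies are present and the extension of the displacement provided
by [film_extension] agrees with the displacement itself. *)
Definition common (d : R) : set 'cV[R]_n.+1 :=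
  [set z | [/\ unit_cube (hpart z), (0 < vpart z < d)%R, (vpart z < g (hpart z))%R &
     forall i, (vpart z < g (set_coord (hpart z) i 0))%R]].

Let cset i : continuous (fun x : 'cV[R]_n => g (set_coord x i 0)).
Proof.
have l1 : lip K (fun x : 'cV[R]_n => g (set_coord x i 0)).
  move=> x y; apply: (le_trans (lg _ _)); rewrite ler_wpM2l//.
  apply: cv_norm_le => // j; rewrite !mxE; case: eqP => _; first by rewrite subrr normr0.
  by rewrite -coordB cv_coord_norm.
exact: (lip_cont l1).
Qed.

Lemma continuous_wall i : continuous (fun x : 'cV[R]_n => g (set_coord x i 0)).
Proof. exact: cset. Qed.

Let cdist (h k : 'cV[R]_n -> R) : continuous h -> continuous k -> continuous (fun x => `|h x - k x|%R).
Proof.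
move=> ch ck x; apply: (@continuous_comp _ _ _ (fun x => (h x - k x)%R) Num.norm); last exact: norm_continuous.
by apply: (@continuousB _ _ _ h k); [exact: ch|exact: ck].
Qed.

Let cdev (d : R) : continuous (fun x => (\sum_i `|g x - g (set_coord x i 0)|)%R).
Proof.
move=> x; refine (@cvg_big _ _ _ _ _ add_continuous _ (nbhs x) _ _ _ (nbhs_filter x) _).
by move=> i _; exact: cdist.
Qed.

(** Both bodies differ from their common part only between two graphs whose
distance is controlled by the variation of the profile. *)
Lemma leb_uncommon (d : R) : (0 < d)%R -> leb n.+1 (Omega g) = d%:E ->
  leb n.+1 ((Omega g `|` Omega (cst d)) `\` common d) <= 3%:R%:E * \sum_i variation g i.
Proof.
move=> d0 vol.
pose lo x : R := (g x - `|g x - d| - \sum_i `|g x - g (set_coord x i 0)|)%R.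
pose hi x : R := (g x + `|g x - d|)%R.
have clo : continuous lo.
  move=> x; apply: (@continuousB _ _ _ (fun x => g x - `|g x - d|)%R (fun x => \sum_i `|g x - g (set_coord x i 0)|)%R); last exact: cdev.
  by apply: (@continuousB _ _ _ g (fun x => `|g x - d|)%R); [exact: cg|apply: (cdist cg); exact: cst_continuous].
have chi : continuous hi.
  by move=> x; apply: (@continuousD _ _ _ g (fun x => `|g x - d|)%R); [exact: cg|apply: (cdist cg); exact: cst_continuous].
pose N := [set z : 'cV[R]_n.+1 | vpart z = lo (hpart z)].
pose N' := [set z : 'cV[R]_n.+1 | vpart z = hi (hpart z)].
pose B := [set z : 'cV[R]_n.+1 | unit_cube (hpart z) /\ (lo (hpart z) < vpart z < hi (hpart z))%R].
apply: (@le_trans _ _ (leb n.+1 (N `|` N' `|` B))).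
  apply: le_outer_measure => z [h nK].
  have Qz : unit_cube (hpart z) by case: h => -[].
  have v0 : (0 < vpart z)%R by case: h => -[_ /andP[]].
  have s0 : (0 <= \sum_i `|g (hpart z) - g (set_coord (hpart z) i 0)|)%R by apply: sumr_ge0.
  have a0 : (0 <= `|g (hpart z) - d|)%R by [].
  have up : (vpart z <= hi (hpart z))%R.
    rewrite /hi; case: h => -[_ /andP[_ h]]; first by rewrite (le_trans (ltW h))// lerDl.
    by apply: (le_trans (ltW h)); rewrite -lerBlDl distrC ler_norm.
  have dn : (lo (hpart z) <= vpart z)%R.
    have [//|hlt] := leP; exfalso; apply: nK; split => //.
    - rewrite v0/=; apply: (lt_le_trans hlt); rewrite /lo.
      have := ler_norm (g (hpart z) - d); move: s0; set S := (\sum_i _)%R; lra.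
    - by apply: (lt_le_trans hlt); rewrite /lo; move: s0 a0; set S := (\sum_i _)%R; lra.
    - move=> i; apply: (lt_le_trans hlt); rewrite /lo (bigD1 i)//=.
      have := ler_norm (g (hpart z) - g (set_coord (hpart z) i 0)).
      have : (0 <= \sum_(j | j != i) `|g (hpart z) - g (set_coord (hpart z) j 0)|)%R by apply: sumr_ge0.
      by move: a0; set S := (\sum_(j | _) _)%R; lra.
  have [e|ne] := eqVneq (vpart z) (lo (hpart z)); first by left; left.
  have [e|ne'] := eqVneq (vpart z) (hi (hpart z)); first by left; right.
  by right; split => //; rewrite lt_def ne dn lt_neqAle ne' up.
have m0 : leb n.+1 (N `|` N' `|` B) <= leb n.+1 N + leb n.+1 N' + leb n.+1 B.
  by apply: (le_trans (outer_measureU2 _ _ _)); apply: leeD => //; exact: outer_measureU2.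
apply: (le_trans m0); rewrite (leb_graph clo) (leb_graph chi) !add0e.
rewrite [leLHS](leb_between (@unit_cube_bor R n) clo chi).
have mQ : measurable (Q : set (cara R n)) by apply: bor_cara; exact: unit_cube_bor.
have mc (h : 'cV[R]_n -> R) : continuous h -> measurable_fun Q ((fun x => (h x)%:E) : cara R n -> \bar R).
  by move=> ch; apply: measurable_funTS; apply/measurable_EFinP; exact: continuous_cara.
apply: (@le_trans _ _ (\int[leb n]_(x in Q) ((`|g x - d|)%:E + (`|g x - d|)%:E + \sum_i (`|g x - g (set_coord x i 0)|)%:E))).
  apply: le_integral_ae; apply: ae_all => x _; rewrite sumEFin -!EFinD lee_fin /lo /hi.
  have s0 : (0 <= \sum_i `|g x - g (set_coord x i 0)|)%R by apply: sumr_ge0.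
  have a0 : (0 <= `|g x - d|)%R by [].
  by rewrite ge_max; apply/andP; split; move: s0; set S := (\sum_i _)%R; lra.
have mgd := mc _ (cdist cg (@cst_continuous _ _ d)).
have msum : measurable_fun Q ((fun x => \sum_i (`|g x - g (set_coord x i 0)|)%:E) : cara R n -> \bar R).
  by apply: emeasurable_sum => i; apply: mc; exact: cdist.
rewrite ge0_integralD; last 5 first.
- exact: mQ.
- by move=> x _; rewrite -EFinD lee_fin addr_ge0.
- exact: emeasurable_funD.
- by move=> x _; apply: sume_ge0 => i _; rewrite lee_fin.
- exact: msum.
rewrite ge0_integralD; last 5 first.
- exact: mQ.
- by move=> x _; rewrite lee_fin.
- exact: mgd.
- by move=> x _; rewrite lee_fin.
- exact: mgd.
rewrite ge0_integral_sum; last 3 first.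
- exact: mQ.
- by move=> i; apply: mc; exact: cdist.
- by move=> i x _; rewrite lee_fin.
have V0 : 0 <= \sum_i variation g i.
  by apply: sume_ge0 => i _; apply: integral_ge0 => x _; rewrite lee_fin.
have pc : \int[leb n]_(x in Q) (`|g x - d|)%:E <= \sum_i variation g i.
  apply: (poincare K0 lg g_per); first by move=> x; exact: ltW.
  by rewrite -vol leb_Omega.
rewrite (_ : 3%:R = 1 + 1 + 1 :> R)%R; last by ring.
rewrite !EFinD !ge0_muleDl ?adde_ge0// !mul1e; apply: leeD; first by apply: leeD.
by apply: lee_sum => i _; exact: (wall_variation K0 lg g_per).
Qed.

End volumes.

Section first_order.
Context {R : realType}.
Variable n : nat.
Local Open Scope ereal_scope.
Variables (g : 'cV[R]_n -> R) (K : R).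
Hypotheses (K0 : (0 <= K)%R) (lg : lip K g).
Hypothesis g_per : one_periodic g.
Hypothesis g_pos : forall x, (0 < g x)%R.
Variables (f : 'cV[R]_n.+1 -> R) (L S T : R) (i : 'I_n).
Hypotheses (L0 : (0 <= L)%R) (lf : lip L f).
Hypothesis f_per : forall z, f (z + pt (basis_vec i) 0) = f z.
Hypothesis gT : forall x, (g x <= T)%R.
Hypothesis f_bnd : forall z, (0 <= vpart z <= T)%R -> (`|f z| <= S)%R.
Let Q : set (cara R n) := @unit_cube R n.
Let E : 'cV[R]_n.+1 := basis_vec (lift ord_max i).

Let cg : continuous g. Proof. exact: (lip_cont lg). Qed.
Let cf : continuous f. Proof. exact: (lip_cont lf). Qed.

Let EE : E = pt (basis_vec i) 0.
Proof.
apply: cvP => k; rewrite /E /basis_vec !mxE; case: (unliftP ord_max k) => [j ->|->].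
  by rewrite (inj_eq lift_inj) !mxE.
by rewrite (negbTE (neq_lift _ _)).
Qed.

Let hE z (s : R) : hpart (z + s *: E)%R = (hpart z + s *: basis_vec i)%R.
Proof. by apply: cvP => k; rewrite !mxE (inj_eq lift_inj). Qed.

Let vE z (s : R) : vpart (z + s *: E)%R = vpart z.
Proof. by rewrite /vpart !mxE (negbTE (neq_lift _ _))/= mulr0 addr0. Qed.

Let inside : set (cara R n.+1) := Omega_sharp g.

Let m_inside : measurable inside.
Proof.
rewrite (_ : inside = [set z : 'cV[R]_n.+1 | setT (hpart z) /\ (0 < vpart z < g (hpart z))%R]).
  by apply: bor_cara; apply: (@measurable_between R n setT (fun=> 0%R) g) => //; exact: cst_continuous.
by apply/seteqP; split => z //= [].
Qed.

Let F (z : 'cV[R]_n.+1) : \bar R := ((f z + S) * \1_inside z)%:E.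

Let f_lo z : (0 <= vpart z <= T)%R -> (0 <= f z + S <= S + S)%R.
Proof. by move=> /f_bnd; rewrite ler_norml => /andP[h1 h2]; apply/andP; split; lra. Qed.

Let in_strip z : inside z -> (0 <= vpart z <= T)%R.
Proof. by move=> /andP[h1 h2]; rewrite (ltW h1)/= (le_trans (ltW h2)). Qed.

Let F0 z : 0 <= F z.
Proof.
rewrite /F lee_fin indicE; case: (boolP (z \in inside)) => [|_]; last by rewrite mulr0.
by rewrite inE mulr1 => /in_strip/f_lo/andP[].
Qed.

Let mf : measurable_fun setT (f : cara R n.+1 -> R).
Proof. exact: continuous_cara. Qed.

Let mF : measurable_fun setT (F : cara R n.+1 -> \bar R).
Proof.
apply/measurable_EFinP; apply: measurable_funM; last exact: measurable_indic.
by apply: measurable_funD => //; exact: measurable_cst.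
Qed.

Let F_per z : F (z + E)%R = F z.
Proof.
rewrite /F EE f_per -EE; congr (((_ + _) * _)%:E); rewrite !indicE; congr (_%:R); congr nat_of_bool.
have hz := hE z 1; have vz := vE z 1; rewrite scale1r in hz vz; rewrite scale1r in hz.
by apply/idP/idP; rewrite !inE /inside /Omega_sharp /= hz vz g_per.
Qed.

Let D : set 'cV[R]_n.+1 := [set z | forall j, j != i -> (0 < hpart z j ord0 < 1)%R].

Let cellE : cell (lift ord_max i) D = [set z | unit_cube (hpart z)].
Proof.
apply/seteqP; split => [z [h1 h2] j|z h]; last first.
  by split; [move=> j _; exact: h|have := h i; rewrite /= hpartE].
by have [->|ji] := eqVneq j i; [rewrite hpartE; exact: h2|exact: h1].
Qed.

Let mD : measurable (D : set (bor R n.+1)).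
Proof.
rewrite (_ : D = \bigcap_(j in [set j | j != i]) [set z : 'cV[R]_n.+1 | 0 < z (lift ord_max j) ord0 < 1]%R).
  by apply: fin_bigcap_measurable => [|j _]; [exact: finite_finset|exact: open_slab].
by apply/seteqP; split => z h j ji; have := h j ji; rewrite /= hpartE.
Qed.

Let D_inv z (t : R) : D (z + t *: E)%R <-> D z.
Proof.
by split => h j ji; have := h j ji; rewrite hE !mxE (negbTE ji)/= mulr0 addr0.
Qed.

Let Om : set (cara R n.+1) := Omega g.

Let mOm : measurable Om.
Proof.
by apply: bor_cara; apply: (@measurable_between R n _ (fun=> 0%R) g (@unit_cube_bor R n)) => //; exact: cst_continuous.
Qed.

Let Omfin : leb n.+1 Om < +oo.
Proof.
rewrite [ltLHS](leb_Omega cg g_pos).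
apply: (@le_lt_trans _ _ (\int[leb n]_(x in Q) T%:E)).
  by apply: le_integral_ae; apply: ae_all => x _; rewrite lee_fin.
by rewrite integral_cst ?leb_unit_cube ?mule1 ?ltry//; apply: bor_cara; exact: unit_cube_bor.
Qed.

Let shift_bound (s : R) : (0 <= s <= 1)%R ->
  \int[leb n.+1]_(z in Om) (f (z + s *: E)%R + S)%:E <=
  \int[leb n.+1]_(z in Om) (f z + S)%:E + (S + S)%:E * \int[leb n]_(x in Q) (`|g (x + s *: basis_vec i) - g x|)%:E.
Proof.
move=> s01; pose gs (x : 'cV[R]_n) := g (x + s *: basis_vec i)%R.
have S0 : (0 <= S)%R by apply: (le_trans (normr_ge0 (f 0))); apply: f_bnd; rewrite /vpart mxE lexx (le_trans (ltW (g_pos 0)))//.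
have cgs : continuous gs.
  move=> x; apply: (@continuous_comp _ _ _ (fun x : 'cV[R]_n => (x + s *: basis_vec i)%R) g); last exact: cg.
  by apply: (@continuousD _ _ _ id (fun=> _)); [exact: cvg_id|exact: cst_continuous].
pose B := [set z : 'cV[R]_n.+1 | unit_cube (hpart z) /\ (gs (hpart z) < vpart z < g (hpart z))%R].
pose N := [set z : 'cV[R]_n.+1 | vpart z = gs (hpart z)].
have mB : measurable (B : set (cara R n.+1)).
  by apply: bor_cara; exact: (measurable_between (@unit_cube_bor R n) cgs cg).
have mFs : measurable_fun setT ((fun z => F (z + s *: E)%R) : cara R n.+1 -> \bar R) by exact: measurable_shift.
pose Qc : set (cara R n.+1) := [set z | unit_cube (hpart z)].
have mQc : measurable Qc.
  apply: bor_cara; rewrite (_ : Qc = \bigcap_(j in [set: 'I_n]) [set z : 'cV[R]_n.+1 | 0 < z (lift ord_max j) ord0 < 1]%R).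
    by apply: fin_bigcap_measurable => [|j _]; [exact: finite_finset|exact: open_slab].
  by apply/seteqP; split => [z h j _|z h j]; have := h j; rewrite /= hpartE//; apply.
have eF : \int[leb n.+1]_(z in Qc) F z = \int[leb n.+1]_(z in Om) (f z + S)%:E.
  rewrite integral_mkcond [RHS]integral_mkcond; apply: eq_integral => z _; rewrite /patch /F indicE.
  have -> : (z \in Om) = (z \in Qc) && (z \in inside).
    by apply/idP/andP; rewrite !inE => -[].
  by case: ifP => //= _; case: ifP => _; rewrite ?mulr1 ?mulr0.
rewrite -eF -(_ : \int[leb n.+1]_(z in Qc) F (z + s *: E)%R = \int[leb n.+1]_(z in Qc) F z); last first.
  by rewrite /Qc -cellE; exact: cell_shift.
apply: (@le_trans _ _ (\int[leb n.+1]_(z in Qc) (F (z + s *: E)%R + (S + S)%:E * (\1_B z)%:E))).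
  rewrite integral_mkcond [leRHS]integral_mkcond.
  have Nneg : (leb n.+1).-negligible N by apply/leb_negligibleP; exact: leb_graph.
  apply: le_integral_ae; apply: negligibleS Nneg => z /= h; apply: contrapT => nN; apply: h.
  rewrite /patch; case: ifPn => zO; last first.
    by case: ifP => // _; rewrite adde_ge0// mule_ge0// lee_fin ?addr_ge0.
  move: zO; rewrite inE => -[zQ zg]; rewrite mem_set//.
  have zin : inside z by [].
  have /andP[lo up] : (0 <= f (z + s *: E)%R + S <= S + S)%R by apply: f_lo; rewrite vE; exact: in_strip.
  rewrite /F -EFinM -EFinD lee_fin.
  have [h|h] := ltP (vpart z) (gs (hpart z)).
    rewrite [X in (_ * X + _)%R]indicE mem_set; last first.
      by rewrite /inside /Omega_sharp /= vE hE h; case/andP: zg => ->.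
    by rewrite mulr1 lerDl mulr_ge0// addr_ge0.
  rewrite [X in (_ + _ * X)%R]indicE mem_set; last first.
    split => //; rewrite lt_neqAle h eq_sym; case/andP: zg => _ ->; rewrite !andbT; apply/eqP => e.
    exact: nN.
  by rewrite mulr1 (le_trans up)// lerDr mulr_ge0.
rewrite ge0_integralD; last 5 first.
- exact: mQc.
- by move=> z _; exact: F0.
- exact: measurable_funTS.
- by move=> z _; rewrite mule_ge0// lee_fin addr_ge0.
- apply: measurable_funTS; apply: measurable_funeM.
  by apply/measurable_EFinP; exact: measurable_indic.
apply: leeD => //; rewrite ge0_integralZl; last 4 first.
- exact: mQc.
- by apply: measurable_funTS; apply/measurable_EFinP; exact: measurable_indic.
- by move=> z _; rewrite lee_fin.
- by rewrite lee_fin addr_ge0.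
apply: lee_wpmul2l; first by rewrite lee_fin addr_ge0.
rewrite integral_indic//.
apply: (@le_trans _ _ (leb n.+1 B)); first by apply: le_outer_measure => z [].
rewrite [leLHS](leb_between (@unit_cube_bor R n) cgs cg).
apply: le_integral_ae; apply: ae_all => x _; rewrite lee_fin ge_max normr_ge0 andbT distrC.
exact: ler_norm.
Qed.

(** The derivative of a periodic function along a period integrates to zero
over a cell with a flat top; over the cell below the profile, only the
variation of the profile contributes. *)
Lemma integral_derive_le : \int[leb n.+1]_(z in Om) ('D_E f z)%:E <= (S + S)%:E * variation g i.
Proof.
have icont (h : 'cV[R]_n.+1 -> R) : continuous h -> (exists M, forall z, inside z -> `|h z| <= M)%R ->
    (leb n.+1).-integrable Om (EFin \o h).
  move=> ch [M hM]; apply: measurable_bounded_integrable => //.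
    by apply: measurable_funTS; exact: continuous_cara.
  exists M; split; first exact: num_real.
  by move=> N MN z [_ zi]; apply: (le_trans (hM z zi)); exact: ltW.
have cfs s : continuous (fun z : 'cV[R]_n.+1 => f (z + s *: E)%R).
  move=> z; apply: (@continuous_comp _ _ _ (fun z : 'cV[R]_n.+1 => (z + s *: E)%R) f); last exact: cf.
  by apply: (@continuousD _ _ _ id (fun=> _)); [exact: cvg_id|exact: cst_continuous].
have is_ s : (leb n.+1).-integrable Om (EFin \o (fun z => f (z + s *: E)%R)).
  by apply: icont => //; exists S => z /in_strip h; apply: f_bnd; rewrite vE.
have i0 : (leb n.+1).-integrable Om (EFin \o f).
  by apply: icont => //; exists S => z /in_strip h; apply: f_bnd.
have iS : (leb n.+1).-integrable Om (EFin \o (fun=> S)).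
  exact: integrable_cst_fin.
have step k : \int[leb n.+1]_(z in Om) (quot f E (harmonic_seq k) z)%:E <=
    (S + S)%:E * \int[leb n]_(x in Q) (`|quot g (basis_vec i) (harmonic_seq k) x|)%:E.
  rewrite -(incr_quot lg) -(_ : k.+1%:R%:E * (\int[leb n.+1]_(z in Om) (f (z + k.+1%:R^-1 *: E)%R - f z)%:E) = 
     \int[leb n.+1]_(z in Om) (quot f E (harmonic_seq k) z)%:E); last first.
    rewrite -integralZl; first by apply: eq_integral => z _; rewrite /quot /harmonic_seq invrK -EFinM.
    - exact: mOm.
    - have := integrableB mOm (is_ k.+1%:R^-1%R) i0.
      by apply: eq_integrable => // z _; rewrite /= EFinB.
  rewrite muleCA; apply: lee_wpmul2l; first by rewrite lee_fin.
  have s01 : (0 <= (k.+1%:R^-1 : R) <= 1)%R by rewrite invr_ge0 ler0n/= invf_le1// ler1n.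
  have := shift_bound s01; under eq_integral do rewrite EFinD.
  under [X in _ <= X + _]eq_integral do rewrite EFinD.
  rewrite (integralD_EFin mOm (is_ _) iS) (integralD_EFin mOm i0 iS).
  under [X in _ -> X <= _]eq_integral do rewrite EFinB.
  rewrite (integralB_EFin mOm (is_ _) i0).
  have f1 := integrable_fin_num mOm (is_ k.+1%:R^-1%R).
  have f2 := integrable_fin_num mOm i0.
  have f3 := integrable_fin_num mOm iS.
  move: f1 f2 f3; rewrite /comp/=.
  case: (\int[leb n.+1]_(x in Om) (f (x + _)%R)%:E) => [r1| |]// _.
  case: (\int[leb n.+1]_(x in Om) (f x)%:E) => [r2| |]// _.
  case: (\int[leb n.+1]_(x in Om) S%:E) => [r3| |]// _.
  case: (_ * _) => [r4| |]; rewrite ?leey// -?EFinB -?EFinD ?lee_fin//; lra.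
have c1 := quot_integral_cvg (v := E) L0 lf mOm Omfin (fun x => @cvg_id _ (nbhs x)) (fun t => lexx _).
have c2 : (S + S)%:E * \int[leb n]_(x in Q) (`|quot g (basis_vec i) (harmonic_seq k) x|)%:E @[k --> \oo] -->
    (S + S)%:E * variation g i.
  by apply: cvgeMl => //; exact: (variation_cvg K0 lg).
rewrite -(cvg_lim (@ereal_hausdorff R) c1) -(cvg_lim (@ereal_hausdorff R) c2); apply: lee_lim.
- by apply/cvg_ex; eexists; exact: c1.
- by apply/cvg_ex; eexists; exact: c2.
- by apply: nearW => k; exact: step.
Qed.

End first_order.

(** * Displacements close to an affine one *)

Section linear_maps.
Context {R : realType}.

Lemma mulmx_coord m p (M : 'M[R]_(p, m)) (z : 'cV[R]_m) i : (M *m z) i ord0 = \sum_k M i k * z k ord0.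
Proof. by rewrite mxE. Qed.

Lemma mulmx_lip m p (M : 'M[R]_(p, m)) i : lip (\sum_k `|M i k|) (fun z : 'cV[R]_m => (M *m z) i ord0).
Proof.
move=> x y; rewrite -coordB -mulmxBr mulmx_coord mulr_suml.
apply: (le_trans (ler_norm_sum _ _ _)); apply: ler_sum => k _; rewrite normrM ler_wpM2l//.
exact: cv_coord_norm.
Qed.

Lemma derive_mulmx m p (M : 'M[R]_(p, m)) i (v z : 'cV[R]_m) :
  'D_v (fun z : 'cV[R]_m => (M *m z) i ord0) z = (M *m v) i ord0.
Proof.
apply: cvg_lim => //; apply: cvg_near_cst; near=> h.
have h0 : h != 0 by near: h; exact: nbhs_dnbhs_neq.
rewrite /= -[X in h^-1 *: X]coordB -mulmxBr addrK -scalemxAr mxE.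
by rewrite /GRing.scale/= mulKf.
Unshelve. all: by end_near. Qed.

Lemma jac_mulmx m p (M : 'M[R]_(p, m)) (z : 'cV[R]_m) : jac (fun z => M *m z) z = M.
Proof.
apply/matrixP => i j; rewrite mxE derive_mulmx mulmx_coord (bigD1 j)//= big1.
  by rewrite addr0 /basis_vec !mxE !eqxx mulr1.
by move=> k kj; rewrite /basis_vec mxE (negbTE kj) mulr0.
Qed.

Lemma weak_gradient_mulmx m p (Om : set 'cV[R]_m) (M : 'M[R]_(p, m)) :
  weak_gradient Om (fun z => M *m z) (fun=> M).
Proof.
have K0 : 0 <= \sum_i \sum_k `|M i k| by apply: sumr_ge0 => i _; apply: sumr_ge0.
have -> : (fun=> M) = jac (fun z => M *m z) :> ('cV[R]_m -> _) by apply/funext => z; rewrite jac_mulmx.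
apply: (lip_weak_gradient Om K0) => i x y; apply: (le_trans (mulmx_lip M i _ _)).
by rewrite ler_wpM2r// (bigD1 i)//= lerDl; apply: sumr_ge0 => j _; apply: sumr_ge0.
Qed.

End linear_maps.

Section strip.
Context {R : realType}.
Variable n : nat.
Implicit Types (z p q : 'cV[R]_n.+1) (T : R).

Definition strip T : set 'cV[R]_n.+1 := Omega_sharp (cst T).

Definition center T : 'cV[R]_n.+1 := pt (const_mx (1 / 2)) (T / 2).

Lemma vpartD z (s : R) p : vpart (z + s *: p) = vpart z + s * vpart p.
Proof. by rewrite /vpart !mxE. Qed.

Lemma vpart_dist z p : `|vpart z - vpart p| <= `|z - p|.
Proof. by rewrite /vpart -coordB cv_coord_norm. Qed.

Lemma strip_path T z (s : R) : 0 < s <= 1 -> 0 < T -> 0 <= vpart z <= T -> strip T (z + s *: (center T - z)).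
Proof.
move=> /andP[s0 s1] T0 /andP[z0 zT]; rewrite /strip /Omega_sharp /= vpartD.
have -> : vpart (center T - z) = T / 2 - vpart z by rewrite -(vpart_pt (const_mx (1/2) : 'cV[R]_n) (T / 2)) /vpart mxE; congr (_ + _); rewrite mxE.
have h1 : 0 < s * (T / 2) by rewrite mulr_gt0// divr_gt0.
have h2 : 0 <= (1 - s) * vpart z by rewrite mulr_ge0// subr_ge0.
have h3 : 0 <= (1 - s) * (T - vpart z) by rewrite mulr_ge0// subr_ge0.
apply/andP; split; lra.
Qed.

Lemma path_near z p (e : R) : 0 < e -> exists2 t : R, 0 < t <= 1 & forall s, 0 < s <= t -> `|z + s *: p - z| < e.
Proof.
move=> e0; have p0 : 0 < `|p| + 1 by rewrite ltr_wpDl.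
exists (Num.min 1 (e / (`|p| + 1) / 2)).
  by rewrite lt_min ltr01 !divr_gt0//= ge_min lexx.
move=> s /andP[s0]; rewrite le_min => /andP[_ s1]; rewrite addrAC subrr add0r normrZ gtr0_norm//.
apply: (@le_lt_trans _ _ (s * (`|p| + 1))); first by rewrite ler_wpM2l ?(ltW s0)// lerDl.
rewrite -ltr_pdivlMr//; apply: (le_lt_trans s1).
by rewrite gtr_pMr ?divr_gt0// invf_lt1// ltr1n.
Qed.

Lemma strip_closure T z : 0 < T -> 0 <= vpart z <= T -> closure (strip T) z.
Proof.
move=> T0 zT B /nbhs_ballP[e e0 he].
have [t /andP[t0 t1] ht] := path_near z (center T - z) e0.
exists (z + t *: (center T - z)); split; first by apply: strip_path => //; rewrite t0.
by apply: he; rewrite mx_norm_ball /ball_/= distrC; apply: ht; rewrite t0 lexx.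
Qed.

Lemma within_dist T (f : 'cV[R]_n.+1 -> 'cV[R]_n.+1) p (e : R) : 0 < T -> {within closure (strip T), continuous f} ->
  0 <= vpart p <= T -> 0 < e ->
  exists2 r : R, 0 < r & forall z, 0 <= vpart z <= T -> `|z - p| < r -> forall i, `|f z i ord0 - f p i ord0| <= e.
Proof.
move=> T0 /subspace_continuousP cf pT e0.
have := cf p (strip_closure T0 pT) => /cvgrPdist_le/(_ e e0).
rewrite near_withinE => /nbhs_ballP[r r0 hr]; exists r => // z zT zp i.
rewrite distrC -coordB; apply: (le_trans (cv_coord_norm _ _)); apply: hr; last exact: strip_closure.
by rewrite mx_norm_ball /ball_/= distrC.
Qed.

End strip.
Arguments strip {R n} T.
Arguments center {R n} T.

Section affine_datum.
Context {R : realType}.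
Variable n : nat.
Variables (A : 'M[R]_n) (M : 'M[R]_n.+1).
Hypothesis M_bot : forall x, M *m pt x 0 = datum A (pt x 0).

Lemma affine_datumE z : M *m z - datum A z = vpart z *: (M *m basis_vec ord_max).
Proof.
have zE : z = pt (hpart z) 0 + vpart z *: basis_vec ord_max.
  apply: cvP => k; rewrite /basis_vec !mxE; case: (unliftP ord_max k) => [j ->|->].
    by rewrite mxE eq_sym (negbTE (neq_lift _ _)) mulr0 addr0.
  by rewrite eqxx mulr1 add0r.
rewrite {1}zE mulmxDr M_bot -scalemxAr /datum hpart_pt addrAC subrr add0r.
by [].
Qed.

(** The datum is the affine map without its vertical part, hence the linear map
of this matrix. *)
Definition datum_mx : 'M[R]_n.+1 := M - (M *m basis_vec ord_max) *m (basis_vec ord_max)^T.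

Lemma datum_mulmx z : datum A z = datum_mx *m z.
Proof.
rewrite /datum_mx mulmxBl -!mulmxA.
have -> : (basis_vec ord_max)^T *m z = (vpart z)%:M :> 'M[R]_1.
  apply/matrixP => i j; rewrite !ord1 mxE (bigD1 ord_max)//= big1.
    by rewrite /basis_vec !mxE !eqxx mul1r addr0 mulr1n.
  by move=> k kn; rewrite /basis_vec !mxE (negbTE kn) mul0r.
by rewrite mul_mx_scalar -scalemxAr -affine_datumE opprB addrC subrK.
Qed.

End affine_datum.

Section open_domains.
Context {R : realType}.
Variable n : nat.
Implicit Types g : 'cV[R]_n -> R.

Lemma cvg_vpart (z : 'cV[R]_n.+1) : vpart x @[x --> z] --> vpart z.
Proof. exact: coord_continuous. Qed.

Lemma cvg_hpart_comp g (z : 'cV[R]_n.+1) : continuous g -> g (hpart x) @[x --> z] --> g (hpart z).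
Proof.
move=> cg; have ch := @continuous_hpart R n.
by apply: (@continuous_comp _ _ _ (@hpart R n) g); [exact: ch|exact: cg].
Qed.

Lemma open_between f g : continuous f -> continuous g ->
  open [set z : 'cV[R]_n.+1 | f (hpart z) < vpart z < g (hpart z)].
Proof.
move=> cf cg; rewrite openE => z /= /andP[h1 h2]; rewrite /interior.
have c1 : (vpart x - f (hpart x)) @[x --> z] --> vpart z - f (hpart z).
  by apply: (@continuousB _ _ _ (fun x : 'cV[R]_n.+1 => vpart x) (fun x => f (hpart x))); [exact: cvg_vpart|exact: cvg_hpart_comp].
have c2 : (g (hpart x) - vpart x) @[x --> z] --> g (hpart z) - vpart z.
  by apply: (@continuousB _ _ _ (fun x => g (hpart x)) (fun x : 'cV[R]_n.+1 => vpart x)); [exact: cvg_hpart_comp|exact: cvg_vpart].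
have p1 : 0 < vpart z - f (hpart z) by rewrite subr_gt0.
have p2 : 0 < g (hpart z) - vpart z by rewrite subr_gt0.
by apply: filterS2 (cvgr_gt _ c1 _ p1) (cvgr_gt _ c2 _ p2) => x /=; rewrite !subr_gt0 => -> ->.
Qed.

Lemma open_unit_column : open [set z : 'cV[R]_n.+1 | unit_cube (hpart z)].
Proof.
rewrite openE => z /= h; rewrite /interior; refine (@filter_forall _ _ _ (nbhs z) (nbhs_filter z) _) => i.
have c : hpart x i ord0 @[x --> z] --> hpart z i ord0.
  have ch := @continuous_hpart R n.
  by apply: (@continuous_comp _ _ _ (@hpart R n) (fun x : 'cV[R]_n => x i ord0)); [exact: ch|exact: coord_continuous].
have /andP[h1 h2] := h i.
by apply: filterS2 (cvgr_gt _ c _ h1) (cvgr_lt _ c _ h2) => x /= -> ->.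
Qed.

Lemma open_Omega_sharp g : continuous g -> open (Omega_sharp g).
Proof. by move=> cg; apply: (@open_between (fun=> 0) g) => //; exact: cst_continuous. Qed.

Lemma open_Omega g : continuous g -> open (Omega g).
Proof. by move=> cg; apply: openI; [exact: open_unit_column|exact: open_Omega_sharp]. Qed.

Lemma open_common g K d : 0 <= K -> lip K g -> open (common g d).
Proof.
move=> K0 lg; have cg := lip_cont lg.
rewrite (_ : common g d = [set z | unit_cube (hpart z)] `&` Omega_sharp (cst d) `&` Omega_sharp g `&`
    [set z | forall i, vpart z < g (set_coord (hpart z) i 0)]); last first.
  apply/seteqP; split => z; first by move=> [h1 h2 h3 h4]; split => //; split => //; case/andP: h2 => h2 _; rewrite /Omega_sharp /= h2 h3.
  by move=> [[[h1 h2] /andP[_ h3]] h4].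
apply: openI; last first.
  rewrite openE => z /= h; rewrite /interior; refine (@filter_forall _ _ _ (nbhs z) (nbhs_filter z) _) => i.
  have c : (g (set_coord (hpart x) i 0) - vpart x) @[x --> z] --> g (set_coord (hpart z) i 0) - vpart z.
    apply: (@continuousB _ _ _ (fun x => g (set_coord (hpart x) i 0)) (fun x : 'cV[R]_n.+1 => vpart x)); last exact: cvg_vpart.
    exact: (@cvg_hpart_comp (fun x : 'cV[R]_n => g (set_coord x i 0)) z (@continuous_wall _ _ g K K0 lg i)).
  have p : 0 < g (set_coord (hpart z) i 0) - vpart z by rewrite subr_gt0.
  by apply: filterS (cvgr_gt _ c _ p) => x /=; rewrite subr_gt0.
apply: openI; last exact: open_Omega_sharp.
apply: openI; first exact: open_unit_column.
by apply: open_Omega_sharp; exact: cst_continuous.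
Qed.

End open_domains.

Section displacement.
Context {R : realType}.
Variable n : nat.
Hypothesis n2 : (n <= 2)%N.
Variables (A : 'M[R]_n) (M : 'M[R]_n.+1) (d eta delta : R).
Hypothesis M_bot : forall x, M *m pt x 0 = datum A (pt x 0).
Hypotheses (d0 : 0 < d) (eta0 : 0 < eta) (delta0 : 0 <= delta).
Let T := d + eta.
Variables (g : 'cV[R]_n -> R) (K : R) (v : 'cV[R]_n.+1 -> 'cV[R]_n.+1) (G : 'cV[R]_n.+1 -> 'M[R]_n.+1).
Hypotheses (K0 : 0 <= K) (lg : lip K g) (g0 : forall x, 0 < g x) (gT : forall x, g x <= T).
Hypothesis v_cont : {within closure (strip T), continuous (v \- datum A)}.
Hypothesis v_bot : forall x, (v \- datum A) (pt x 0) = 0.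
Hypothesis v_per : forall i x y, 0 < y < g x ->
  (v \- datum A) (pt (x + basis_vec i) y) = (v \- datum A) (pt x y).
Hypothesis v_grad : weak_gradient (strip T) v G.
Hypothesis G_near : {ae leb n.+1, forall z, Omega (cst T) z -> enorm (G z - M) <= delta}.

Let T0 : 0 < T. Proof. by rewrite /T addr_gt0. Qed.

Let w (z : 'cV[R]_n.+1) : 'cV[R]_n.+1 := v z - M *m z.

Let mN : 'cV[R]_n.+1 := M *m basis_vec ord_max.

Let wE z : w z = (v \- datum A) z - vpart z *: mN.
Proof. by rewrite /w /mN -(affine_datumE M_bot) /= opprB addrA subrK. Qed.

Let w_dist p (e : R) : 0 <= vpart p <= T -> 0 < e -> exists2 r : R, 0 < r &
  forall z, 0 <= vpart z <= T -> `|z - p| < r -> forall i, `|w z i ord0 - w p i ord0| <= e.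
Proof.
move=> pT e0; have e2 : 0 < e / 2 by rewrite divr_gt0.
have N0 : 0 < `|mN| + 1 by rewrite ltr_wpDl.
have [r r0 hr] := within_dist T0 v_cont pT e2.
exists (Num.min r (e / 2 / (`|mN| + 1))); first by rewrite lt_min r0 divr_gt0.
move=> z zT; rewrite lt_min => /andP[z1 z2] i.
have h1 := hr z zT z1 i.
have h2 : `|(vpart z - vpart p) * mN i ord0| <= e / 2.
  rewrite normrM; apply: (@le_trans _ _ (`|z - p| * (`|mN| + 1))).
    rewrite ler_pM// ?vpart_dist//; apply: (le_trans (cv_coord_norm _ _)); by rewrite lerDl.
  by rewrite -ler_pdivlMr// ltW.
have -> : w z i ord0 - w p i ord0 = ((v \- datum A) z i ord0 - (v \- datum A) p i ord0) - (vpart z - vpart p) * mN i ord0.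
  by rewrite !wE !coordB [X in _ - X - _]mxE [X in _ - (_ - X)]mxE; ring.
apply: (le_trans (ler_normB _ _)); rewrite [leRHS](splitr e); exact: lerD.
Qed.

Let OmT_strip (z : 'cV[R]_n.+1) : Omega (cst T) z -> strip T z. Proof. by case. Qed.

Let w_cont z i : strip T z -> {for z, continuous (fun x => w x i ord0)}.
Proof.
move=> zS; have /andP[z1 z2] := zS; have zc : 0 <= vpart z <= T by rewrite !ltW.
suff h : (fun x => w x i ord0) x @[x --> z] --> w z i ord0 by exact: h.
apply: (iffRL (@cvgrPdist_le _ _ _ (nbhs z) (nbhs_filter z) (fun x => w x i ord0) (w z i ord0))) => e e0.
have [r r0 hr] := w_dist zc e0.
have oS : nbhs z (strip T).
  by apply: open_nbhs_nbhs; split => //; apply: open_Omega_sharp; exact: cst_continuous.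
have : nbhs z [set x : 'cV[R]_n.+1 | `|x - z| < r].
  by apply/nbhs_ballP; exists r => // x; rewrite mx_norm_ball /ball_/= distrC.
apply: filterS2 oS => x /andP[x1 x2] xz; rewrite distrC.
by apply: hr => //; rewrite !ltW.
Qed.

Let wG : weak_gradient (strip T) w (fun z => G z - M).
Proof. exact: (weak_gradientB v_grad (weak_gradient_mulmx _ M)). Qed.

Let top : 'cV[R]_n.+1 := pt (const_mx 1) T.

Let OmTE z : Omega (cst T) z <-> forall k, 0 < z k ord0 < top k ord0.
Proof.
split => [[h1 h2] k|h].
  rewrite /top mxE; case: (unliftP ord_max k) => [j ->|->]; last exact: h2.
  by have := h1 j; rewrite hpartE mxE.
split => [j|]; first by have := h (lift ord_max j); rewrite hpartE /top mxE liftK mxE.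
by have := h ord_max; rewrite /top mxE unlift_none.
Qed.

Let w_lip_open p q i : Omega (cst T) p -> Omega (cst T) q ->
  `|w q i ord0 - w p i ord0| <= n.+1%:R * delta * `|q - p|.
Proof.
move=> Up Uq; have /OmTE hp := Up; have /OmTE hq := Uq.
pose a : 'cV[R]_n.+1 := \col_k (Num.min (p k ord0) (q k ord0) / 2).
pose b : 'cV[R]_n.+1 := \col_k ((Num.max (p k ord0) (q k ord0) + top k ord0) / 2).
have wGU := weak_gradient_sub OmT_strip wG.
have [l1 l2 l3] := (weak_gradientTP _ _ _).1 wGU.
apply: (@box_gradient_lip _ _ a b (Omega (cst T)) (fun z => w z i ord0) (fun j z => (G z - M) i j) delta).
- move=> z hz; apply/OmTE => k; have := hz k; rewrite !mxE.
  have /andP[p1 p2] := hp k; have /andP[q1 q2] := hq k.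
  have m1 : 0 < Num.min (p k ord0) (q k ord0) by rewrite lt_min p1.
  have m2 : Num.max (p k ord0) (q k ord0) < top k ord0 by rewrite gt_max p2.
  by move: m1 m2; move: (Num.min _ _) (Num.max _ _) => x y; rewrite /top mxE => *; lra.
- exact: l1.
- by move=> j; exact: l2.
- by move=> phi tphi j; exact: l3.
- by move=> j; apply: ae_mono G_near => z h /h; apply: le_trans; exact: coord_le_enorm.
- move=> k; rewrite !mxE; have /andP[p1 p2] := hp k; have /andP[q1 q2] := hq k.
  have m1 : 0 < Num.min (p k ord0) (q k ord0) by rewrite lt_min p1.
  have m2 : Num.max (p k ord0) (q k ord0) < top k ord0 by rewrite gt_max p2.
  have m3 : Num.min (p k ord0) (q k ord0) <= p k ord0 by rewrite ge_min lexx.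
  have m4 : p k ord0 <= Num.max (p k ord0) (q k ord0) by rewrite le_max lexx.
  by move: m1 m2 m3 m4; move: (Num.min _ _) (Num.max _ _) => x y; rewrite /top mxE => *; lra.
- move=> k; rewrite !mxE; have /andP[p1 p2] := hp k; have /andP[q1 q2] := hq k.
  have m1 : 0 < Num.min (p k ord0) (q k ord0) by rewrite lt_min p1.
  have m2 : Num.max (p k ord0) (q k ord0) < top k ord0 by rewrite gt_max p2.
  have m3 : Num.min (p k ord0) (q k ord0) <= q k ord0 by rewrite ge_min lexx orbT.
  have m4 : q k ord0 <= Num.max (p k ord0) (q k ord0) by rewrite le_max lexx orbT.
  by move: m1 m2 m3 m4; move: (Num.min _ _) (Num.max _ _) => x y; rewrite /top mxE => *; lra.
- by apply: w_cont; exact: OmT_strip.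
- by apply: w_cont; exact: OmT_strip.
Qed.

Let path_in (p : 'cV[R]_n.+1) (s : R) : 0 < s <= 1 -> cylinder T p -> Omega (cst T) (p + s *: (center T - p)).
Proof.
move=> /andP[s0 s1] [h1 h2]; split; last by apply: strip_path => //; rewrite s0.
move=> j; have := h1 j; rewrite !hpartE !mxE liftK !mxE => /andP[p0 p1].
set y := p _ _ in p0 p1 *.
have h3 : 0 <= (1 - s) * y by rewrite mulr_ge0// subr_ge0.
have h4 : 0 <= (1 - s) * (1 - y) by rewrite mulr_ge0// subr_ge0.
apply/andP; split; lra.
Qed.

Let w_lip i p q : cylinder T p -> cylinder T q ->
  `|w p i ord0 - w q i ord0| <= n.+1%:R * delta * `|p - q|.
Proof.
move=> cp cq; apply/ler_addgt0Pr => e e0; have e2 : 0 < e / 2 by rewrite divr_gt0.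
have [r r0 hr] := w_dist cp.2 e2.
have [r' r'0 hr'] := w_dist cq.2 e2.
have [t /andP[t0 t1] ht] := path_near p (center T - p) r0.
have [t' /andP[t'0 t'1] ht'] := path_near q (center T - q) r'0.
pose s := Num.min t t'.
have s0 : 0 < s by rewrite lt_min t0.
have st : s <= t by rewrite ge_min lexx.
have st' : s <= t' by rewrite ge_min lexx orbT.
have s1 : s <= 1 := le_trans st t1.
set p' := p + s *: (center T - p).
set q' := q + s *: (center T - q).
have Up : Omega (cst T) p' by apply: path_in => //; rewrite s0.
have Uq : Omega (cst T) q' by apply: path_in => //; rewrite s0.
have Sp : 0 <= vpart p' <= T by case: Up => _ /andP[? ?]; rewrite !ltW.
have Sq : 0 <= vpart q' <= T by case: Uq => _ /andP[? ?]; rewrite !ltW.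
have k1 : `|w p' i ord0 - w p i ord0| <= e / 2 by apply: hr => //; apply: ht; rewrite s0.
have k2 : `|w q' i ord0 - w q i ord0| <= e / 2 by apply: hr' => //; apply: ht'; rewrite s0.
have k3 := w_lip_open i Uq Up.
have k4 : `|p' - q'| <= `|p - q|.
  have -> : p' - q' = (1 - s) *: (p - q).
    by apply: cvP => k; rewrite /p' /q' !mxE; ring.
  by rewrite normrZ ger0_norm ?subr_ge0// ler_piMl// gerBl ltW.
have k5 : n.+1%:R * delta * `|p' - q'| <= n.+1%:R * delta * `|p - q| by rewrite ler_wpM2l// mulr_ge0.
rewrite (_ : w p i ord0 - w q i ord0 = (w p i ord0 - w p' i ord0) + (w p' i ord0 - w q' i ord0) + (w q' i ord0 - w q i ord0)); last by ring.
apply: (@le_trans _ _ (e / 2 + n.+1%:R * delta * `|p - q| + e / 2)); last first.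
  by move: (n.+1%:R * delta * `|p - q|) => X; lra.
apply: (le_trans (ler_normD _ _)); apply: lerD => //.
apply: (le_trans (ler_normD _ _)); apply: lerD; last exact: (le_trans k3).
by rewrite distrC.
Qed.

Let w_bot x : w (pt x 0) = 0.
Proof. by rewrite wE v_bot vpart_pt scale0r subr0. Qed.

Let w_per_open i x y : 0 < y < g x -> w (pt (x + basis_vec i) y) = w (pt x y).
Proof. by move=> h; rewrite !wE v_per// !vpart_pt. Qed.

Let w_per i x y : 0 <= y <= g x -> w (pt (x + basis_vec i) y) = w (pt x y).
Proof.
move=> /andP[]; rewrite le_eqVlt => /orP[/eqP <- _|y0 yg]; first by rewrite !w_bot.
apply: cvP => j; apply/eqP; rewrite -subr_eq0 -normr_le0; apply/ler_addgt0Pr => e e0; rewrite add0r.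
have e2 : 0 < e / 2 by rewrite divr_gt0.
have yT : 0 <= y <= T by rewrite ltW//= (le_trans yg).
have c1 : 0 <= vpart (pt (x + basis_vec i) y) <= T by rewrite vpart_pt.
have c2 : 0 <= vpart (pt x y) <= T by rewrite vpart_pt.
have [r r0 hr] := w_dist c1 e2.
have [r' r'0 hr'] := w_dist c2 e2.
have rr : 0 < Num.min r r' by rewrite lt_min r0.
have [t /andP[t0 t1] ht] := path_near (0 : 'cV[R]_n.+1) (pt 0 (- y)) rr.
pose y' := y - t / 2 * y.
have t2 : 0 < t / 2 <= t by apply/andP; split; lra.
have y'0 : 0 < y' by rewrite /y' subr_gt0 gtr_pMl//; lra.
have y'y : y' < y by rewrite /y' gtrBl mulr_gt0// divr_gt0.
have dE z : pt z y' - pt z y = 0 + (t / 2) *: pt 0 (- y) - 0 :> 'cV[R]_n.+1.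
  apply: cvP => k; rewrite /y' !mxE; case: (unliftP ord_max k) => [l _|_]; rewrite ?mxE; ring.
have near_ z : `|pt z y' - pt z y : 'cV[R]_n.+1| < Num.min r r' by rewrite dE; exact: ht.
have y'T : 0 <= y' <= T by case/andP: yT => _ h; rewrite ltW//= ltW// (lt_le_trans y'y).
have k1 : `|w (pt (x + basis_vec i) y') j ord0 - w (pt (x + basis_vec i) y) j ord0| <= e / 2.
  by apply: hr; [rewrite vpart_pt|apply: (lt_le_trans (near_ _)); rewrite ge_min lexx].
have k2 : `|w (pt x y') j ord0 - w (pt x y) j ord0| <= e / 2.
  by apply: hr'; [rewrite vpart_pt|apply: (lt_le_trans (near_ _)); rewrite ge_min lexx orbT].
have E : w (pt (x + basis_vec i) y') = w (pt x y') by apply: w_per_open; rewrite y'0 (lt_le_trans y'y).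
rewrite (_ : _ - _ = (w (pt x y') j ord0 - w (pt x y) j ord0) - (w (pt (x + basis_vec i) y') j ord0 - w (pt (x + basis_vec i) y) j ord0)); last first.
  by rewrite E; ring.
by apply: (le_trans (ler_normB _ _)); rewrite [leRHS](splitr e); apply: lerD.
Qed.

(** The bound on the gradient makes the deviation from the affine map Lipschitz on
the closed cell, and [film_extension] applies to each of its components. *)
Lemma displacement_extension : exists wt : 'cV[R]_n.+1 -> 'cV[R]_n.+1,
  [/\ forall i, lip (3 * (n.+1%:R * delta)) (fun z => wt z i ord0),
      forall i z, wt (z + pt (basis_vec i) 0) = wt z,
      forall x, wt (pt x 0) = 0 &
      {ae leb n.+1, forall z, common g d z -> G z - M = jac wt z}].
Proof.
have L0 : 0 <= n.+1%:R * delta by rewrite mulr_ge0.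
have dT : d <= T by rewrite lerDl ltW.
have ext k : exists f : 'cV[R]_n.+1 -> R, [/\ lip (3 * (n.+1%:R * delta)) f, forall z, core g d z -> f z = w z k ord0,
    forall i z, f (z + pt (basis_vec i) 0) = f z & forall x, f (pt x 0) = 0].
  apply: (film_extension n2 L0 (ltW d0) dT g0); first exact: w_lip.
    by move=> i x y h; rewrite w_per.
  by move=> x; rewrite w_bot mxE.
have [f hf] := choice ext.
pose wt z : 'cV[R]_n.+1 := \col_k f k z.
have wtE k z : wt z k ord0 = f k z by rewrite mxE.
have L3 : 0 <= 3 * (n.+1%:R * delta) by rewrite mulr_ge0.
have lwt k : lip (3 * (n.+1%:R * delta)) (fun z => wt z k ord0).
  by move=> x y; rewrite !wtE; case: (hf k) => h _ _ _; exact: h.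
exists wt; split => //.
- by move=> i z; apply: cvP => k; rewrite !wtE; case: (hf k).
- by move=> x; apply: cvP => k; rewrite wtE mxE; case: (hf k).
have sub : common g d `<=` strip T.
  by move=> z [h1 /andP[h2 h3] _ _]; rewrite /strip /Omega_sharp /= h2 (lt_le_trans h3).
have eqw z : common g d z -> w z = wt z.
  move=> [h1 /andP[h2 h3] h4 h5]; apply: cvP => k; rewrite wtE; case: (hf k) => _ -> //.
  by split => //; rewrite ?(ltW h2) ?(ltW h3) ?(ltW h4)// => i; [have /andP[? ?] := h1 i; rewrite !ltW|rewrite ltW].
have h := (@weak_gradient_local R n.+1 n.+1 (strip T) setT (common g d) w wt _ _ (open_common (d := d) K0 lg) sub (@subsetT _ _)
  eqw wG (lip_weak_gradient setT L3 lwt)).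
by apply: ae_mono h => z.
Qed.

End displacement.

(** * Lower bound for the elastic energy *)

Section bounded_integrals.
Context {R : realType}.
Variable m : nat.
Variables (D : set (cara R m)).
Hypotheses (mD : measurable D) (fD : (leb m D < +oo)%E).

Lemma integrable_bounded (h : 'cV[R]_m -> R) (C : R) : measurable_fun setT (h : cara R m -> R) ->
  (forall z, D z -> `|h z| <= C) -> (leb m).-integrable D (EFin \o h).
Proof.
move=> mh hC; apply: measurable_bounded_integrable => //; first exact: measurable_funTS.
exists C; split; first exact: num_real.
by move=> N CN z Dz /=; apply: (le_trans (hC z Dz)); exact: ltW.
Qed.

Lemma integrable_scale (k : R) (h : 'cV[R]_m -> R) : (leb m).-integrable D (EFin \o h) ->
  (leb m).-integrable D (EFin \o (fun z => k * h z)).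
Proof.
by move=> ih; have := integrableZl mD k ih; apply: eq_integrable.
Qed.

Lemma integrable_cut (h : 'cV[R]_m -> R) : (leb m).-integrable D (EFin \o h) ->
  (leb m).-integrable setT (EFin \o (fun z => \1_D z * h z)) /\
  (\int[leb m]_z (\1_D z * h z)%:E = \int[leb m]_(z in D) (h z)%:E)%E.
Proof.
have E : EFin \o (fun z => \1_D z * h z) = (EFin \o h) \_ D.
  by apply/funext => z; rewrite /patch /= indicE; case: (z \in D); rewrite ?mul1r ?mul0r.
move=> ih; split; first by rewrite E -integrable_mkcond.
by rewrite [RHS]integral_mkcond -E.
Qed.

End bounded_integrals.

Section periodic_maps.
Context {R : realType}.
Variable n : nat.
Variables (u : 'cV[R]_n.+1 -> 'cV[R]_n.+1) (L : R).
Hypotheses (L0 : 0 <= L) (lu : forall i, lip L (fun z => u z i ord0)).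
Hypothesis u_per : forall i z, u (z + pt (basis_vec i) 0) = u z.
Hypothesis u_bot : forall x, u (pt x 0) = 0.

Let N : R := n.+1%:R.

Lemma jac_coord_le i j z : `|jac u z i j| <= L.
Proof.
rewrite mxE; apply: (le_trans (lip_derive_bound _ _ L0 (lu i))); rewrite ler_piMr//.
by apply: cv_norm_le => // k; rewrite !mxE; case: (_ && _); rewrite ?normr1 ?normr0.
Qed.

Lemma enorm_jac_le z : enorm (jac u z) <= N * L.
Proof.
have N0 : 0 <= N * L by rewrite mulr_ge0.
rewrite -(ler_pXn2r (_ : 0 < 2)%N)// ?nnegrE ?enorm_ge0//.
by apply: (le_trans (enorm_sqr_le (fun i j => jac_coord_le i j z))); rewrite /N exprMn natrM expr2.
Qed.

Lemma film_coord_le i z : `|u z i ord0| <= L * `|vpart z|.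
Proof.
have h := lu i z (pt (hpart z) 0); rewrite u_bot mxE subr0 in h.
apply: (le_trans h); rewrite ler_wpM2l//; apply: cv_norm_le => // k.
rewrite mxE [X in _ + X]mxE; case: (unliftP ord_max k) => [j ->|->].
  by rewrite /pt !mxE liftK mxE subrr normr0.
by rewrite mxE unlift_none subr0.
Qed.

Lemma measurable_jac i j : measurable_fun setT ((fun z => jac u z i j) : cara R n.+1 -> R).
Proof.
rewrite (_ : (fun z => _) = 'D_(basis_vec j) (fun z => u z i ord0)); first exact: measurable_derive (lu i).
by apply/funext => z; rewrite mxE.
Qed.

Variable d : R.
Hypothesis d0 : 0 < d.

Let cd : continuous (cst d : 'cV[R]_n -> R). Proof. exact: cst_continuous. Qed.

Lemma film_calV : calV (cst d) u.
Proof.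
split; last 2 first.
- exact: u_bot.
- move=> i x y _; rewrite -(u_per i (pt x y)); congr u.
  by apply: cvP => k; rewrite !mxE; case: (unlift _ _) => [j|]; rewrite ?mxE// addr0.
split.
- apply: continuous_subspaceT => z.
  apply: (iffRL (@cvgrPdist_le _ _ _ (nbhs z) (nbhs_filter z) u (u z))) => e e0.
  have L1 : 0 < L + 1 by rewrite ltr_wpDl.
  apply/nbhs_ballP; exists (e / (L + 1)) => /=; first by rewrite divr_gt0.
  move=> z'; rewrite mx_norm_ball /ball_/= => h; apply: cv_norm_le; first exact: ltW.
  move=> i; rewrite coordB; apply: (le_trans (lu i z z')).
  apply: (@le_trans _ _ ((L + 1) * `|z - z'|)); first by rewrite ler_wpM2r// lerDl.
  by rewrite mulrC -ler_pdivlMr// ltW.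
- exists (Num.sqrt ((n.+1 * 1)%:R * (L * d) ^+ 2)); apply: ae_all => z /andP[z1 z2].
  rewrite /enorm; apply: ler_wsqrtr; rewrite -enorm_sqr; apply: enorm_sqr_le => i j; rewrite ord1.
  apply: (le_trans (film_coord_le i z)); rewrite ler_wpM2l// gtr0_norm//; exact: ltW.
exists (jac u); split; first exact: lip_weak_gradient L0 lu.
by exists (N * L); apply: ae_all => z _; exact: enorm_jac_le.
Qed.

Let Om : set (cara R n.+1) := Omega (cst d).

Lemma nabla_film : nabla (Omega (cst d)) u = jac u %[ae leb n.+1 in Om].
Proof.
exact: (nablaP (open_Omega cd) (lip_weak_gradient (Omega (cst d)) L0 lu)).2.
Qed.

Let mOm : measurable Om.
Proof. by apply: open_cara; exact: open_Omega. Qed.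

Let nabla_sq : (\int[leb n.+1]_(z in Om) (enorm (nabla (Omega (cst d)) u z) ^+ 2)%:E =
  \int[leb n.+1]_(z in Om) (enorm (jac u z) ^+ 2)%:E)%E.
Proof. by apply: eq_integral_ae; apply: ae_mono nabla_film => z h /h ->. Qed.

Let int_le (h : 'cV[R]_n.+1 -> R) (C : R) : (forall z, Om z -> h z <= C) ->
  (\int[leb n.+1]_(z in Om) (h z)%:E < +oo)%E.
Proof.
move=> hC; apply: (@le_lt_trans _ _ (\int[leb n.+1]_(z in Om) C%:E)%E).
  by apply: le_integral_ae; apply: ae_all => z Oz; rewrite lee_fin hC.
by rewrite (integral_cst _ mOm) [X in (_ * X)%E](leb_Omega_cst n d0) -EFinM ltry.
Qed.

(** The map already belongs to the space that is completed. *)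
Lemma film_calVtilde : calVtilde (cst d) u.
Proof.
split; first split.
- move=> i; apply: measurable_funTS; apply: continuous_cara; exact: lip_cont (lu i).
- by exists (jac u); exact: lip_weak_gradient L0 lu.
- rewrite /H1norm2 nabla_sq lte_add_pinfty//.
    apply: (@int_le _ ((n.+1 * 1)%:R * (L * d) ^+ 2)) => z [_ /andP[z1 z2]].
    apply: enorm_sqr_le => i j; rewrite ord1.
    apply: (le_trans (film_coord_le i z)); rewrite ler_wpM2l// gtr0_norm//; exact: ltW.
  apply: (@int_le _ ((N * L) ^+ 2)) => z _.
  by rewrite ler_pXn2r ?nnegrE ?enorm_ge0 ?enorm_jac_le// mulr_ge0.
move=> e e0; exists u; split; first exact: film_calV.
have -> : u \- u = fun=> 0 by apply/funext => z; rewrite /= subrr.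
have w0 : @weak_gradient R n.+1 n.+1 (Omega (cst d : 'cV[R]_n -> R)) (fun=> 0) (fun=> 0).
  have h := @weak_gradient_mulmx R n.+1 n.+1 (Omega (cst d)) 0.
  by apply: weak_gradient_ext h => z _; rewrite mul0mx.
rewrite /H1norm2 (eq_integral_ae (g := fun=> 0%E)); last first.
  by apply: ae_all => z _; rewrite enorm0 expr0n.
rewrite integral0 add0e (eq_integral_ae (g := fun=> 0%E)) ?integral0 ?lte_fin//.
have h := (nablaP (open_Omega cd) w0).2.
by apply: ae_mono h => z h /h ->; rewrite enorm0 expr0n.
Qed.

End periodic_maps.

Section quadratic.
Context {R : realType}.
Variable n : nat.
Variables (W : 'M[R]_n.+1 -> R) (M : 'M[R]_n.+1) (u : 'cV[R]_n.+1 -> 'cV[R]_n.+1) (L : R).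
Hypotheses (dM : 0 < \det M) (cW : classC 2 [set xi | 0 < \det xi] W).
Hypotheses (L0 : 0 <= L) (lu : forall i, lip L (fun z => u z i ord0)).
Let J := jac u.

Let mJ i j : measurable_fun setT ((fun z => J z i j) : cara R n.+1 -> R) := measurable_jac lu i j.

Lemma measurable_quadratic : measurable_fun setT ((fun z => inner (D2W W M (J z)) (J z)) : cara R n.+1 -> R).
Proof.
rewrite (_ : (fun z => _) = (fun z => \sum_i \sum_j
    (\sum_k \sum_l J z k l * 'D_(delta_mx k l) (fun xi => DW W xi i j) M) * J z i j)); last first.
  apply/funext => z; rewrite innerE; apply: eq_bigr => i _; apply: eq_bigr => j _.
  by rewrite (D2W_coord _ _ _ dM cW).
apply: measurable_sum => i; apply: measurable_sum => j; apply: measurable_funM; last exact: mJ.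
by apply: measurable_sum => k; apply: measurable_sum => l; apply: measurable_funM; [exact: mJ|exact: measurable_cst].
Qed.

Lemma measurable_enorm_jac : measurable_fun setT ((fun z => enorm (J z) ^+ 2) : cara R n.+1 -> R).
Proof.
rewrite (_ : (fun z => _) = (fun z => \sum_i \sum_j J z i j * J z i j)); last first.
  by apply/funext => z; rewrite enorm_sqr innerE.
by apply: measurable_sum => i; apply: measurable_sum => j; apply: measurable_funM; exact: mJ.
Qed.

Lemma coercive_film (c0 d : R) : 0 <= c0 -> 0 < d ->
  (c0%:E * H1norm2 (Omega (cst d)) u <= \int[leb n.+1]_(z in Omega (cst d))
    (inner (D2W W M (nabla (Omega (cst d)) u z)) (nabla (Omega (cst d)) u z))%:E)%E ->
  (0 <= \int[leb n.+1]_(z in Omega (cst d))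
    (2^-1 * inner (D2W W M (J z)) (J z) - c0 / 2 * enorm (J z) ^+ 2)%:E)%E.
Proof.
move=> c00 d0; have [Cq Cq0 q_le] := D2W_bound dM cW.
pose Od : set (cara R n.+1) := Omega (cst d).
have mOd : measurable Od by apply: open_cara; apply: open_Omega; exact: cst_continuous.
have fOd : (leb n.+1 Od < +oo)%E by rewrite [ltLHS](leb_Omega_cst n d0) ltry.
have nab := nabla_film L0 lu d.
have -> : (\int[leb n.+1]_(z in Omega (cst d))
    (inner (D2W W M (nabla (Omega (cst d)) u z)) (nabla (Omega (cst d)) u z))%:E =
    \int[leb n.+1]_(z in Od) (inner (D2W W M (J z)) (J z))%:E)%E.
  by apply: eq_integral_ae; apply: ae_mono nab => z h /h ->.
have e2 z : enorm (J z) ^+ 2 <= (n.+1%:R * L) ^+ 2.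
  by rewrite ler_pXn2r ?nnegrE ?enorm_ge0 ?enorm_jac_le// mulr_ge0.
have i1 : (leb n.+1).-integrable Od (EFin \o (fun z => inner (D2W W M (J z)) (J z))).
  apply: (integrable_bounded mOd fOd (C := Cq * (n.+1%:R * L) ^+ 2)); first exact: measurable_quadratic.
  by move=> z _; apply: (le_trans (q_le _)); rewrite ler_wpM2l.
have i2 : (leb n.+1).-integrable Od (EFin \o (fun z => enorm (J z) ^+ 2)).
  apply: (integrable_bounded mOd fOd (C := (n.+1%:R * L) ^+ 2)); first exact: measurable_enorm_jac.
  by move=> z _; rewrite ger0_norm ?sqr_ge0.
have h2 : (\int[leb n.+1]_(z in Od) (enorm (J z) ^+ 2)%:E <= H1norm2 (Omega (cst d)) u)%E.
  rewrite /H1norm2 (_ : (\int[leb n.+1]_(z in Omega (cst d)) (enorm (nabla (Omega (cst d)) u z) ^+ 2)%:E =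
      \int[leb n.+1]_(z in Od) (enorm (J z) ^+ 2)%:E)%E).
    by rewrite leeDr// integral_ge0// => z _; rewrite lee_fin sqr_ge0.
  by apply: eq_integral_ae; apply: ae_mono nab => z h /h ->.
move=> h; have h' : (c0%:E * \int[leb n.+1]_(z in Od) (enorm (J z) ^+ 2)%:E <=
    \int[leb n.+1]_(z in Od) (inner (D2W W M (J z)) (J z))%:E)%E.
  by apply: le_trans h; apply: lee_wpmul2l; rewrite ?lee_fin.
under eq_integral do rewrite EFinB.
rewrite (integralB_EFin mOd (integrable_scale mOd _ i1) (integrable_scale mOd _ i2)).
under eq_integral do rewrite EFinM.
under [X in (_ - X)%E]eq_integral do rewrite EFinM.
rewrite (integralZl mOd i1) (integralZl mOd i2).
have f1 := fineK (integrable_fin_num mOd i1); have f2 := fineK (integrable_fin_num mOd i2).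
move: h'; rewrite -[X in (_ <= X)%E -> _]f1 -[X in (_ * X <= _)%E -> _]f2.
rewrite -[X in (_ <= _ * X - _)%E]f1 -[X in (_ <= _ - _ * X)%E]f2.
by rewrite -!EFinM -EFinN -EFinD !lee_fin; lra.
Qed.

End quadratic.

Section elastic.
Context {R : realType}.
Variable n : nat.
Variables (W : 'M[R]_n.+1 -> R) (M : 'M[R]_n.+1) (om Cq d T delta : R).
Let N : R := n.+1%:R.
Let sg := DW W M.
Let q (B : 'M[R]_n.+1) : R := inner (D2W W M B) B.
Let p (B : 'M[R]_n.+1) : R := 2^-1 * q B - om * enorm B ^+ 2.
Hypotheses (dM : 0 < \det M) (cW : classC 2 [set xi | 0 < \det xi] W).
Hypothesis sg_top : sg *m basis_vec ord_max = 0.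
Hypotheses (om0 : 0 <= om) (Cq0 : 0 <= Cq) (q_le : forall B, `|q B| <= Cq * enorm B ^+ 2).
Hypotheses (d0 : 0 < d) (dT : d <= T) (delta0 : 0 <= delta) (delta1 : delta <= 1).
Hypothesis W_taylor : forall H, enorm H <= delta ->
  W M + inner sg H + 2^-1 * q H - om * enorm H ^+ 2 <= W (M + H).
Variables (g : 'cV[R]_n -> R) (K : R).
Hypotheses (K0 : 0 <= K) (lg : lip K g) (g_per : one_periodic g) (g0 : forall x, 0 < g x).
Hypotheses (gT : forall x, g x <= T) (g_vol : leb n.+1 (Omega g) = d%:E).
Variables (P : 'cV[R]_n.+1 -> 'M[R]_n.+1) (u : 'cV[R]_n.+1 -> 'cV[R]_n.+1).
Let L := 3 * (N * delta).
Hypothesis lu : forall i, lip L (fun z => u z i ord0).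
Hypothesis u_per : forall i z, u (z + pt (basis_vec i) 0) = u z.
Hypothesis u_bot : forall x, u (pt x 0) = 0.
Hypothesis P_near : {ae leb n.+1, forall z, Omega g z -> enorm (P z - M) <= delta}.
Hypothesis P_u : {ae leb n.+1, forall z, common g d z -> P z - M = jac u z}.
Hypothesis coercive : (0 <= \int[leb n.+1]_(z in Omega (cst d)) (p (jac u z))%:E)%E.

Let J := jac u.
Let Og : set (cara R n.+1) := Omega g.
Let Od : set (cara R n.+1) := Omega (cst d).
Let U : set (cara R n.+1) := (Omega g `|` Omega (cst d)) `\` common g d.

Let N0 : 0 <= N. Proof. by rewrite /N. Qed.
Let L0 : 0 <= L. Proof. by rewrite /L !mulr_ge0. Qed.
Let cg : continuous g := lip_cont lg.

Let mOg : measurable Og. Proof. by apply: open_cara; exact: open_Omega. Qed.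
Let mOd : measurable Od. Proof. by apply: open_cara; apply: open_Omega; exact: cst_continuous. Qed.
Let mU : measurable U.
Proof.
apply: measurableD; first exact: measurableU.
by apply: open_cara; exact: (open_common K0 lg).
Qed.

Let fOg : (leb n.+1 Og < +oo)%E. Proof. by rewrite [ltLHS]g_vol ltry. Qed.
Let fOd : (leb n.+1 Od < +oo)%E. Proof. by rewrite [ltLHS](leb_Omega_cst n d0) ltry. Qed.

Let gam : R := fine (\sum_i variation g i)%E.

Let gamE : (\sum_i variation g i = gam%:E)%E.
Proof. by rewrite /gam fineK//; apply/sum_fin_numP => i _ _; exact: (variation_fin K0 lg). Qed.

Let var_ge0 i : (0 <= variation g i)%E.
Proof. by apply: integral_ge0 => x _; rewrite lee_fin. Qed.

Let gam0 : 0 <= gam. Proof. by rewrite -lee_fin -gamE; apply: sume_ge0 => i _. Qed.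

Let U_le : (leb n.+1 U <= (3 * gam)%:E)%E.
Proof. by have := leb_uncommon K0 lg g_per g0 d0 g_vol; rewrite gamE -EFinM. Qed.

Let fU : (leb n.+1 U < +oo)%E. Proof. by apply: (le_lt_trans U_le); rewrite ltry. Qed.

Let J_le z : enorm (J z) <= 3 * N ^+ 2 * delta.
Proof. by apply: (le_trans (enorm_jac_le L0 lu z)); rewrite /L le_eqVlt; apply/orP; left; apply/eqP; rewrite -/N; ring. Qed.

(* the gradient of [u] is bounded by [B * delta], see [J_le] *)
Let B : R := 3 * N ^+ 2.
Let B1 : 1 <= B.
Proof.
have N1 : 1 <= N by rewrite /N ler1n.
have : 1 <= N ^+ 2 by rewrite expr_ge1.
by rewrite /B; lra.
Qed.
Let B0 : 0 <= B := le_trans ler01 B1.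

Let p_le H (t : R) : 0 <= t -> enorm H <= t * delta -> `|p H| <= (Cq + om) * t ^+ 2 * delta.
Proof.
move=> t0 Ht; have t1 : 0 <= t * delta by rewrite mulr_ge0.
have Hq : enorm H ^+ 2 <= t ^+ 2 * delta.
  apply: (@le_trans _ _ ((t * delta) ^+ 2)); first by rewrite ler_pXn2r ?nnegrE ?enorm_ge0.
  by rewrite exprMn ler_wpM2l ?sqr_ge0// expr2 ler_piMl.
have e0 : 0 <= enorm H ^+ 2 by rewrite sqr_ge0.
rewrite /p; apply: (le_trans (ler_normB _ _)).
have h1 : `|2^-1 * q H| <= Cq * enorm H ^+ 2.
  rewrite normrM; apply: (@le_trans _ _ (1 * `|q H|)); last by rewrite mul1r.
  by rewrite ler_wpM2r// ger0_norm// invf_le1// ler1n.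
have h2 : `|om * enorm H ^+ 2| = om * enorm H ^+ 2 by rewrite ger0_norm// mulr_ge0.
rewrite h2; apply: (le_trans (lerD h1 (lexx _))); rewrite -mulrDl -mulrA; apply: ler_wpM2l => //.
exact: addr_ge0.
Qed.

Let s := enorm sg.
Let C1 : R := 2 * (s * B + (Cq + om) * B ^+ 2).

Let sB (H : 'M[R]_n.+1) (t : R) : enorm H <= t * delta -> `|inner sg H| <= s * t * delta.
Proof.
move=> Ht; apply: (le_trans (cauchy_schwarz _ _)); rewrite -mulrA ler_wpM2l//.
exact: enorm_ge0.
Qed.

Let rhs z := \1_Og z * (W M + inner sg (J z)) + \1_Od z * p (J z) - \1_U z * (C1 * delta).

(* On the common part the expansion applies with the gradient of [u]; elsewhere
   every term is at most of order delta, which the last indicator pays for. *)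
Let pointwise : {ae leb n.+1, forall z, ((rhs z)%:E <= ((fun z => (W (P z))%:E) \_ Og) z)%E}.
Proof.
have C0 : 0 <= Cq + om by exact: addr_ge0.
have s0 : 0 <= s := enorm_ge0 _.
have bJ z := sB (J_le z).
have pJ z := p_le (le_trans ler01 B1) (J_le z).
apply: ae_mono2 P_near P_u => z hn hu; rewrite /patch; case: ifPn => zg; last first.
  rewrite lee_fin /rhs indicE (negbTE zg) mul0r add0r.
  have [zd|zd] := boolP (z \in Od); last first.
    rewrite indicE (negbTE zd) mul0r sub0r oppr_le0 mulr_ge0//; last first.
    by rewrite /C1 !mulr_ge0 ?addr_ge0 ?mulr_ge0 ?sqr_ge0.
  have zU : z \in U.
    rewrite inE; split; first by right; rewrite inE in zd.
    by move=> [h1 /andP[h2 _] h3 _]; apply: (negP zg); rewrite inE; split => //; rewrite h2.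
  rewrite !indicE zd zU !mul1r subr_le0.
  have := pJ z; rewrite ler_norml => /andP[_ h]; apply: (le_trans h).
  rewrite ler_wpM2r// /C1; have : 0 <= s * B by rewrite mulr_ge0.
  have : 0 <= (Cq + om) * B ^+ 2 by rewrite mulr_ge0 ?sqr_ge0.
  by move: (s * B) ((Cq + om) * B ^+ 2) => x y; lra.
rewrite lee_fin /rhs; rewrite inE in zg.
have hH := hn zg.
have := W_taylor hH; rewrite (_ : M + (P z - M) = P z); last by rewrite addrC subrK.
move=> hT; apply: le_trans hT.
rewrite [\1_Og z]indicE mem_set// mul1r.
have [zk|zk] := pselect (common g d z).
  have zd : z \in Od by rewrite inE; case: zk => h1 h2 _ _.
  have zU : (z \in U) = false by apply/negbTE/negP; rewrite inE => -[].
  by rewrite !indicE zd zU mul1r mul0r subr0 (hu zk) /p addrA.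
have zU : z \in U by rewrite inE; split => //; left.
rewrite [\1_U z]indicE zU mul1r.
have hH' : enorm (P z - M) <= 1 * delta by rewrite mul1r.
have k1 := sB hH'; have k2 := p_le ler01 hH'.
have k3 := bJ z; have k4 := pJ z.
have k5 : \1_Od z * p (J z) <= (Cq + om) * B ^+ 2 * delta.
  rewrite indicE; case: (z \in Od); rewrite ?mul1r ?mul0r.
    by move: k4; rewrite ler_norml => /andP[].
  by rewrite !mulr_ge0 ?sqr_ge0.
have k6 : s * 1 * delta <= s * B * delta by rewrite ler_wpM2r// ler_wpM2l.
have k7 : (Cq + om) * 1 ^+ 2 * delta <= (Cq + om) * B ^+ 2 * delta.
  by rewrite ler_wpM2r// ler_wpM2l// ler_pXn2r ?nnegrE//; lra.
have E : C1 * delta = 2 * (s * B * delta) + 2 * ((Cq + om) * B ^+ 2 * delta) by rewrite /C1; ring.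
rewrite E -addrA -[in leRHS]addrA -/(p (P z - M)).
move: k1 k2 k3 k4 k5 k6 k7; rewrite !ler_norml -/B.
move: (s * B * delta) ((Cq + om) * B ^+ 2 * delta) => x y.
move: (s * 1 * delta) ((Cq + om) * 1 ^+ 2 * delta) (\1_Od z * p (J z)) => x' y' w.
by move=> /andP[? ?] /andP[? ?] /andP[? ?] *; lra.
Qed.

Let m_inner (S : 'M[R]_n.+1) : measurable_fun setT ((fun z => inner S (J z)) : cara R n.+1 -> R).
Proof.
rewrite (_ : (fun z => _) = (fun z => \sum_i \sum_j S i j * J z i j)); last by apply/funext => z; rewrite innerE.
apply: measurable_sum => i; apply: measurable_sum => j; apply: measurable_funM; first exact: measurable_cst.
exact: measurable_jac lu i j.
Qed.

Let m_p : measurable_fun setT ((fun z => p (J z)) : cara R n.+1 -> R).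
Proof.
apply: measurable_funB; (apply: measurable_funM; first exact: measurable_cst).
  exact: measurable_quadratic dM cW lu.
exact: measurable_enorm_jac lu.
Qed.

Let S : R := L * T.

Let T0 : 0 < T. Proof. exact: lt_le_trans dT. Qed.

Let int_DJ i j : j != ord_max -> `|\int[leb n.+1]_(z in Og) J z i j| <= (S + S) * gam.
Proof.
case: (unliftP ord_max j) => [k ->|->]; last by rewrite eqxx.
move=> _; have iJ : (leb n.+1).-integrable Og (EFin \o (fun z => J z i (lift ord_max k))).
  apply: (integrable_bounded mOg fOg (C := L)); first exact: measurable_jac lu i _.
  by move=> z _; exact: jac_coord_le.
have iE := fineK (integrable_fin_num mOg iJ).
have bnd (f : 'cV[R]_n.+1 -> R) : lip L f -> (forall z, f (z + pt (basis_vec k) 0) = f z) -> (forall z, `|f z| <= L * `|vpart z|) ->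
    (\int[leb n.+1]_(z in Og) ('D_(basis_vec (lift ord_max k)) f z)%:E <= ((S + S) * gam)%:E)%E.
  move=> lf fp fb.
  have S0 : 0 <= S + S by rewrite /S addr_ge0// mulr_ge0// ltW.
  apply: (le_trans (integral_derive_le K0 lg g_per g0 L0 lf fp gT (S := S) _)).
    move=> z /andP[z1 z2]; apply: (le_trans (fb z)); rewrite ler_wpM2l// ger0_norm//.
  rewrite EFinM lee_wpmul2l ?lee_fin// -gamE (bigD1 k)//= leeDl//.
  by apply: sume_ge0 => l _.
have h1 := bnd _ (lu i) (fun z => congr1 (fun x : 'cV[R]_n.+1 => x i ord0) (u_per k z)) (film_coord_le L0 lu u_bot i).
have lN : lip L (fun z => - u z i ord0).
  by move=> x y; rewrite -opprD normrN; exact: lu.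
have h2 := bnd _ lN (fun z => congr1 (fun x : 'cV[R]_n.+1 => - x i ord0) (u_per k z))
  (fun z => eq_ind_r (fun x => x <= _) (film_coord_le L0 lu u_bot i z) (normrN _)).
have JE z : J z i (lift ord_max k) = 'D_(basis_vec (lift ord_max k)) (fun z => u z i ord0) z by rewrite mxE.
have a1 : \int[leb n.+1]_(z in Og) J z i (lift ord_max k) <= (S + S) * gam.
  rewrite -lee_fin [X in (X <= _)%E]iE; apply: le_trans h1; rewrite le_eqVlt; apply/orP; left; apply/eqP.
  by apply: eq_integral => z _; rewrite /= JE.
have a2 : - (\int[leb n.+1]_(z in Og) J z i (lift ord_max k)) <= (S + S) * gam.
  rewrite -[X in X <= _]mulN1r -RintegralZl// -lee_fin /Rintegral fineK; last first.
    exact: (integrable_fin_num mOg (integrable_scale mOg _ iJ)).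
  apply: le_trans h2; apply: le_integral_ae.
  apply: ae_mono (lip_ae_derivable (basis_vec (lift ord_max k)) (lu i)) => z dz _.
  by rewrite lee_fin JE mulN1r deriveN.
by rewrite ler_norml a1 andbT lerNl.
Qed.

Let s2 : R := \sum_i \sum_j `|sg i j|.

Let first_order : - (s2 * ((S + S) * gam)) <= \int[leb n.+1]_(z in Og) inner sg (J z).
Proof.
have iJ i j : (leb n.+1).-integrable Og (EFin \o (fun z => J z i j)).
  apply: (integrable_bounded mOg fOg (C := L)); first exact: measurable_jac lu i _.
  by move=> z _; exact: jac_coord_le.
have iZ i j : (leb n.+1).-integrable Og (EFin \o (fun z => sg i j * J z i j)).
  exact: integrable_scale.
rewrite (_ : \int[leb n.+1]_(z in Og) inner sg (J z) = \int[leb n.+1]_(z in Og) \sum_i \sum_j sg i j * J z i j); last first.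
  by apply: eq_Rintegral => z _; rewrite innerE.
have E i := Rintegral_sum mOg (index_enum 'I_n.+1) (iZ i).
rewrite (Rintegral_sum mOg _ (fun i => (E i).1)).2 /s2 mulr_suml -sumrN.
apply: ler_sum => i _; rewrite (E i).2 mulr_suml -sumrN; apply: ler_sum => j _.
rewrite RintegralZl//; have [->|jn] := eqVneq j ord_max.
  have -> : sg i ord_max = 0.
    have := congr1 (fun x : 'cV[R]_n.+1 => x i ord0) sg_top; rewrite mulmx_coord mxE (bigD1 ord_max)//= big1.
      by rewrite addr0 /basis_vec !mxE !eqxx mulr1.
    by move=> k kn; rewrite /basis_vec [X in _ * X]mxE (negbTE kn) mulr0.
  by rewrite normr0 !mul0r oppr0.
have h := int_DJ i jn.
rewrite lerNl; apply: (le_trans (ler_norm _)); rewrite normrN normrM ler_wpM2l//.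
Qed.

(** It depends on the flat configuration and on the height of the reference strip
but not on the competitor, so that delta can be chosen beforehand. *)
Definition elastic_error : R := 3 * C1 + s2 * (6 * N * T).

(** The error terms live either in the small region where the two bodies differ
or in the lateral first-order term, and both are controlled by the variation of
the profile times the distance of the gradients. *)
Lemma elastic_lower :
  ((W M * d - elastic_error * delta * fine (\sum_i variation g i)%E)%:E <=
   \int[leb n.+1]_(z in Omega g) (W (P z))%:E)%E.
Proof.
have i1 : (leb n.+1).-integrable Og (EFin \o (fun z => W M + inner sg (J z))).
  apply: (integrable_bounded mOg fOg (C := `|W M| + s * B * delta)).
    by apply: measurable_funD => //; exact: m_inner.
  by move=> z _; apply: (le_trans (ler_normD _ _)); rewrite lerD2l; apply: sB; exact: J_le.
have i2 : (leb n.+1).-integrable Od (EFin \o (fun z => p (J z))).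
  apply: (integrable_bounded mOd fOd (C := (Cq + om) * B ^+ 2 * delta)); first exact: m_p.
  by move=> z _; apply: p_le; [exact: le_trans B1|exact: J_le].
have i3 : (leb n.+1).-integrable U (EFin \o (fun=> C1 * delta)) by exact: integrable_cst_fin.
have [j1 e1] := integrable_cut mOg i1.
have [j2 e2] := integrable_cut mOd i2.
have [j3 e3] := integrable_cut mU i3.
rewrite integral_mkcond; apply: (@le_trans _ _ (\int[leb n.+1]_z (rhs z)%:E)%E); last first.
  by apply: le_integral_ae; apply: ae_mono pointwise => z h _.
have j12 : (leb n.+1).-integrable setT (EFin \o (fun z => \1_Og z * (W M + inner sg (J z)) + \1_Od z * p (J z))).
  by have := integrableD measurableT j1 j2; apply: eq_integrable => // z _; rewrite /= EFinD.
under eq_integral do rewrite /rhs EFinB.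
rewrite (integralB_EFin measurableT j12 j3).
under eq_integral do rewrite EFinD.
rewrite (integralD_EFin measurableT j1 j2) e1 e2 e3.
have iJ : (leb n.+1).-integrable Og (EFin \o (fun z => inner sg (J z))).
  apply: (integrable_bounded mOg fOg (C := s * B * delta)); first exact: m_inner.
  by move=> z _; apply: sB; exact: J_le.
under eq_integral do rewrite EFinD.
rewrite (integralD_EFin mOg (integrable_cst_fin (W M) mOg fOg) iJ).
rewrite (integral_cst _ mOg) (integral_cst _ mU) [leb n.+1 Og]g_vol.
have E4 := fineK (integrable_fin_num mOg iJ); rewrite -[X in (_ + X + _ - _)%E]E4.
have C10 : 0 <= C1 * delta.
  have s0 : 0 <= s := enorm_ge0 _.
  by rewrite mulr_ge0// /C1 mulr_ge0// addr_ge0 ?mulr_ge0 ?sqr_ge0 ?addr_ge0.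
apply: (@le_trans _ _ ((W M)%:E * d%:E + (\int[leb n.+1]_(z in Og) inner sg (J z))%:E + 0 - (C1 * delta)%:E * (3 * gam)%:E)%E); last first.
  by apply: leeB; [apply: leeD|apply: lee_wpmul2l; rewrite ?lee_fin].
rewrite adde0 -!EFinM -EFinN -!EFinD lee_fin -/gam /elastic_error.
have := first_order; rewrite /S /L.
move: (\int[leb n.+1]_(z in Og) inner sg (J z)) => X h.
have E5 : s2 * ((3 * (N * delta) * T + 3 * (N * delta) * T) * gam) = s2 * (6 * N * T) * delta * gam by ring.
rewrite E5 in h.
have -> : (3 * C1 + s2 * (6 * N * T)) * delta * gam = C1 * delta * (3 * gam) + s2 * (6 * N * T) * delta * gam by ring.
by move: h; move: (s2 * (6 * N * T) * delta * gam) (C1 * delta * (3 * gam)) (W M * d) => x y w; lra.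
Qed.

End elastic.

(** * Comparison of the energies *)

Lemma lipschitz_lip {R : realType} (V : normedModType R) (f : V -> R) :
  lipschitz f -> exists2 K : R, 0 <= K & lip K f.
Proof.
case=> M [Mr hM]; exists (`|M| + 1); first by rewrite addr_ge0.
move=> x y; have /hM h : M < `|M| + 1 by rewrite (le_lt_trans (ler_norm M))// ltrDl.
exact: (h (x, y)).
Qed.

Lemma classC_le {R : realType} k (V : normedModType R) (U : set V) (f : V -> R) :
  classC k.+1 U f -> classC k U f.
Proof.
elim: k f => [|k IH] f [df cf]; first by move=> z /df; exact: differentiable_continuous.
by split => // v; apply: IH; exact: cf.
Qed.

Lemma Linfty_norm_ae {R : realType} m q r (Om : set 'cV[R]_m) (F : 'cV[R]_m -> 'M[R]_(q, r)) (t : R) :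
  (Linfty_norm Om F < t%:E)%E -> {ae leb m, forall z, Om z -> enorm (F z) <= t}.
Proof.
move=> h; have := ess_sup_ge (leb m) ((fun z => (enorm (F z))%:E) \_ Om).
apply: ae_mono => z hz Oz; rewrite -lee_fin; apply: le_trans (ltW h); apply: le_trans hz.
by rewrite /patch mem_set.
Qed.

Section surface.
Context {R : realType}.
Variable n : nat.
Variables (psi : 'cV[R]_n.+1 -> R) (a b : R).
Hypothesis psi_ge0 : forall z, 0 <= psi z.
Hypothesis psi_hom : forall (t : R) (z : 'cV[R]_n.+1), 0 < t -> psi (t *: z) = t * psi z.
Hypotheses (a0 : 0 < a) (b0 : 0 < b) (n0 : (0 < n)%N).
Hypothesis facet : [set pt x b | x in [set x | enorm x <= a]] `<=` closure (wulff psi) `\` interior (wulff psi).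
Variables (g : 'cV[R]_n -> R) (K : R).
Hypotheses (K0 : 0 <= K) (lg : lip K g).

(** The norm of the gradient is at least the mean of the |D_i g|. *)
Lemma surface_variation :
  (flat_area (box (0 : 'cV[R]_n) (const_mx 1%R)) * (b + a / n%:R * fine (\sum_i variation g i)%E)%:E <=
   \int[hausdorff n n.+1]_(z in Gamma g) (psi (normal g z))%:E)%E.
Proof.
apply: le_trans (surface_lower K0 lg (ltW a0) (ltW b0) (F := fun z => psi (normal g z)) _ _); last 2 first.
- by move=> z; exact: psi_ge0.
- by move=> x; exact: (psi_normal psi_hom a0 facet).
apply: lee_wpmul2l; first exact: ltW (flat_area_unit_gt0 n0).
pose Q : set (cara R n) := @unit_cube R n.
have mQ : measurable Q by apply: bor_cara; exact: unit_cube_bor.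
have nR : 0 < n%:R :> R by rewrite ltr0n.
have an : 0 <= a / n%:R by rewrite divr_ge0 ?ltW.
have V0 : (0 <= \sum_i variation g i)%E.
  by apply: sume_ge0 => i _; apply: integral_ge0 => x _; rewrite lee_fin.
have VE : ((fine (\sum_i variation g i)%E)%:E = \sum_i variation g i)%E.
  by rewrite fineK//; apply/sum_fin_numP => i _ _; exact: (variation_fin K0 lg).
have mD i : measurable_fun Q ((fun x => (`|'D_(basis_vec i) g x|)%:E) : cara R n -> \bar R).
  apply: measurable_funTS; apply/measurable_EFinP; apply: (measurableT_comp (@normr_measurable R setT)).
  exact: measurable_derive lg.
have E : (\int[leb n]_(x in Q) (b%:E + (a / n%:R)%:E * \sum_i (`|'D_(basis_vec i) g x|)%:E) =
    b%:E + (a / n%:R)%:E * \sum_i variation g i)%E.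
  have s0 x : (0 <= \sum_i (`|'D_(basis_vec i) g x|)%:E)%E by apply: sume_ge0 => i _; rewrite lee_fin.
  have ms : measurable_fun Q ((fun x => \sum_i (`|'D_(basis_vec i) g x|)%:E)%E : cara R n -> \bar R).
    by apply: emeasurable_sum => i; exact: mD.
  rewrite ge0_integralD; last 5 first.
  - exact: mQ.
  - by move=> x _; rewrite lee_fin ltW.
  - exact: measurable_cst.
  - by move=> x _; apply: mule_ge0; rewrite ?lee_fin.
  - exact: measurable_funeM.
  rewrite (integral_cst _ mQ) leb_unit_cube mule1; congr (_ + _)%E.
  rewrite ge0_integralZl; last 4 first.
  - exact: mQ.
  - exact: ms.
  - by move=> x _.
  - by rewrite lee_fin.
  congr (_ * _)%E; rewrite ge0_integral_sum//.
rewrite EFinD EFinM VE -E; apply: le_integral_ae; apply: ae_all => x _.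
rewrite sumEFin -EFinM -EFinD lee_fin lerD2l -mulrA ler_wpM2l ?(ltW a0)// ler_pdivrMl//.
apply: (@le_trans _ _ (\sum_(i < n) enorm (grad g x))); last by rewrite sumr_const card_ord mulr_natl.
apply: ler_sum => i _; have := coord_le_enorm (grad g x) i ord0.
by rewrite [grad g x i ord0]mxE.
Qed.

End surface.

Theorem theorem7p5 (R : realType) (n : nat) (hN : n.+1 = 2%N \/ n.+1 = 3%N)
    (A : 'M[R]_n) (hA : 0 < \det A)
    (W : 'M[R]_n.+1 -> R)
    (W_ge0 : forall xi, 0 < \det xi -> 0 <= W xi)
    (W_C3 : classC 3 [set xi | 0 < \det xi] W)
    (psi : 'cV[R]_n.+1 -> R)
    (psi_ge0 : forall z, 0 <= psi z)
    (psi_lip : lipschitz psi)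
    (psi_hom : forall (t : R) (z : 'cV[R]_n.+1), 0 < t -> psi (t *: z) = t * psi z)
    (psi_cvx : convex_function [set: 'cV[R]_n.+1] psi)
    (wulff_nbhs0 : nbhs (0 : 'cV[R]_n.+1) (wulff psi))
    (a b : R) (ha : 0 < a) (hb : 0 < b)
    (facet : [set pt x b | x in [set x | enorm x <= a]] `<=`
             closure (wulff psi) `\` interior (wulff psi))
    (d : R) (hd : 0 < d) (v0 : 'cV[R]_n.+1 -> 'cV[R]_n.+1)
    (hflat : flat A W d v0)
    (eta : R) (heta : 0 < eta) :
  exists2 delta : R, 0 < delta &
    forall (g : 'cV[R]_n -> R) (v : 'cV[R]_n.+1 -> 'cV[R]_n.+1),
      calX' A d eta g v ->
      (sup_norm (fun x => g x - d)%R < delta%:E)%E ->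
      leb n.+1 (Omega g) = leb n.+1 (Omega (cst d)) ->
      (Linfty_norm (Omega (cst (d + eta)%R))
         (fun z => nabla (Omega_sharp (cst (d + eta))) v z
                   - nabla (Omega_sharp (cst (d + eta))) v0 z)%R < delta%:E)%E ->
      (energy W psi (cst d) v0 <= energy W psi g v)%E.
Proof.
have n2 : (n <= 2)%N by case: hN => -[->].
have n0 : (0 < n)%N by case: hN => -[->].
have [Kp Kp0 psi_l] := lipschitz_lip psi_lip.
case: hflat => -[_ [_ v0_bot _] _] [M dM v0E] sg_top _ [c0 c00 coer].
have M_bot x : M *m pt x 0 = datum A (pt x 0).
  by apply/eqP; rewrite -subr_eq0 -v0E; apply/eqP; exact: v0_bot.
have jacM z : jac v0 z = M.
  by rewrite (_ : v0 = fun z => M *m z) ?jac_mulmx//; apply/funext.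
have cW : classC 2 [set xi | 0 < \det xi] W by apply: classC_le; exact: W_C3.
have sgM : DW W M *m basis_vec ord_max = 0.
  rewrite -(jacM (pt (const_mx (1 / 2)) d)); apply: sg_top; exists (const_mx (1 / 2)) => //.
  by move=> i; rewrite mxE; lra.
(* half of the coercivity constant absorbs the remainder of the expansion *)
pose om := c0 / 2; have om0 : 0 < om by rewrite divr_gt0.
have [r r0 taylor] := taylor_lower dM cW om0.
have [Cq Cq0 q_le] := D2W_bound dM cW.
pose T := d + eta; have T0 : 0 < T by rewrite addr_gt0.
pose C := elastic_error W M om Cq T.
(* the same constant multiplies both surface energies *)
pose cell_area := flat_area (box (0 : 'cV[R]_n) (const_mx 1%R)).
have ca_fin : (cell_area < +oo)%E := flat_area_unit_fin n.
have ca_gt0 : (0 < cell_area)%E := flat_area_unit_gt0 n0.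
pose cn := fine cell_area.
have cnE : cn%:E = cell_area by rewrite /cn fineK// ge0_fin_numE// ltW.
have cn0 : 0 < cn by rewrite -lte_fin cnE.
have nR : 0 < n%:R :> R by rewrite ltr0n.
have gain0 : 0 < cn * (a / n%:R) by rewrite mulr_gt0// divr_gt0.
have C1 : 0 < `|C| + 1 by rewrite ltr_wpDl.
(* below 1 and r for the expansion of the stored energy, below eta to keep the
   profile in the reference strip, and small enough for the gain of surface
   energy to beat the elastic error *)
pose delta := Num.min (Num.min 1 (r / 2)) (Num.min eta (cn * (a / n%:R) / (`|C| + 1))).
have delta0 : 0 < delta by rewrite !lt_min ltr01 heta !divr_gt0.
have delta1 : delta <= 1 by rewrite !ge_min lexx.
have deltar : delta < r.
  by apply: (@le_lt_trans _ _ (r / 2)); [rewrite !ge_min lexx !orbT|lra].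
have deltae : delta <= eta by rewrite !ge_min lexx !orbT.
have deltaC : C * delta <= cn * (a / n%:R).
  have h : delta <= cn * (a / n%:R) / (`|C| + 1) by rewrite !ge_min lexx !orbT.
  have := h; rewrite ler_pdivlMr// => h'; apply: le_trans h'; rewrite mulrC ler_wpM2l ?(ltW delta0)//.
  by apply: (le_trans (ler_norm C)); rewrite lerDl.
exists delta; first exact: delta0.
move=> g v [[[g_per glip g0] gsub] [v_cont _ [G0 [G0w _]]] [_ [_ v_bot v_per] _] _] gd vol near_v0.
have [K K0 lg] := lipschitz_lip glip.
have cg : continuous g := lip_cont lg.
have gT x : g x <= T.
  have : (`|g x - d|%:E < delta%:E)%E.
    by apply: le_lt_trans gd; apply: ereal_sup_ubound; exists x.
  rewrite lte_fin => h; have := ler_norm (g x - d); rewrite /T; lra.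
have vold : leb n.+1 (Omega g) = d%:E by rewrite vol; exact: leb_Omega_cst.
have ost : open (@strip R n T) by apply: open_Omega_sharp; exact: cst_continuous.
(* the datum is linear, so its gradient is added back to that of the deviation *)
have [v_grad _] : weak_gradient (strip T) v (nabla (strip T) v) /\ nabla (strip T) v = (fun z => G0 z + datum_mx M) %[ae leb n.+1 in strip T].
  apply: nablaP => //.
  apply: weak_gradient_ext (weak_gradientD G0w (weak_gradient_mulmx (strip T) (datum_mx M))) => z _.
  by rewrite -(datum_mulmx M_bot) /= subrK.
have v0_grad : nabla (strip T) v0 = (fun=> M) %[ae leb n.+1 in strip T].
  rewrite (_ : v0 = fun z => M *m z); last by apply/funext.
  exact: (nablaP ost (weak_gradient_mulmx _ M)).2.
have G_near : {ae leb n.+1, forall z, Omega (cst T) z -> enorm (nabla (strip T) v z - M) <= delta}.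
  apply: ae_mono2 v0_grad (Linfty_norm_ae near_v0) => z h1 h2 Oz.
  by have := h2 Oz; rewrite -/T -/(strip T) h1//; case: Oz.
have [u [lu u_per u_bot Gu]] := displacement_extension n2 M_bot hd heta (ltW delta0) K0 lg g0 gT v_cont v_bot v_per v_grad G_near.
have L0 : 0 <= 3 * (n.+1%:R * delta) by rewrite !mulr_ge0// ltW.
have subS : Omega_sharp g `<=` strip T.
  by move=> z /andP[z1 z2]; rewrite /strip /Omega_sharp /= z1 (lt_le_trans z2).
have og : open (Omega_sharp g) by exact: open_Omega_sharp.
have P_grad : nabla (Omega_sharp g) v = nabla (strip T) v %[ae leb n.+1 in Omega_sharp g].
  exact: (nablaP og (weak_gradient_sub subS v_grad)).2.
have P_near : {ae leb n.+1, forall z, Omega g z -> enorm (nabla (Omega_sharp g) v z - M) <= delta}.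
  apply: ae_mono2 P_grad G_near => z h1 h2 Oz.
  by rewrite h1; [apply: h2; exact: gsub|case: Oz].
have P_u : {ae leb n.+1, forall z, common g d z -> nabla (Omega_sharp g) v z - M = jac u z}.
  apply: ae_mono2 P_grad Gu => z h1 h2 Kz; rewrite h1 ?h2//.
  by case: Kz => _ /andP[z1 _] z2 _; rewrite /Omega_sharp /= z1.
have coerJ := film_calVtilde L0 lu u_per u_bot hd.
have := coer u coerJ.
rewrite (_ : (fun z => (inner (D2W W (jac v0 z) (nabla (Omega (cst d)) u z)) (nabla (Omega (cst d)) u z))%:E) =
  (fun z => (inner (D2W W M (nabla (Omega (cst d)) u z)) (nabla (Omega (cst d)) u z))%:E)); last first.
  by apply/funext => z; rewrite jacM.
move=> /(coercive_film dM cW L0 lu (ltW c00) hd) coercive.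
have dT : d <= T by rewrite lerDl ltW.
have taylor' H : enorm H <= delta ->
    W M + inner (DW W M) H + 2^-1 * inner (D2W W M H) H - om * enorm H ^+ 2 <= W (M + H).
  by move=> h; apply: taylor; exact: le_lt_trans deltar.
have elastic := elastic_lower dM cW sgM (ltW om0) Cq0 q_le hd dT (ltW delta0) delta1 taylor' K0 lg g_per g0 gT vold
  lu u_per u_bot P_near P_u coercive.
have surface := surface_variation psi_ge0 psi_hom ha hb n0 facet K0 lg.
pose gam := fine (\sum_i variation g i)%E.
have gam0 : 0 <= gam.
  apply: fine_ge0; apply: sume_ge0 => i _; apply: integral_ge0 => x _; by rewrite lee_fin.
have flat_le : (energy W psi (cst d) v0 <= (W M * d + b * cn)%:E)%E.
  rewrite /energy EFinD; apply: leeD; last first.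
    rewrite EFinM cnE; exact: (flat_surface_le psi_ge0 psi_hom ha hb facet Kp0 psi_l d).
  have osd : open (Omega_sharp (cst d : 'cV[R]_n -> R)) by apply: open_Omega_sharp; exact: cst_continuous.
  have nab : nabla (Omega_sharp (cst d)) v0 = (fun=> M) %[ae leb n.+1 in Omega_sharp (cst d)].
    rewrite (_ : v0 = fun z => M *m z); last by apply/funext.
    exact: (nablaP osd (weak_gradient_mulmx _ M)).2.
  apply: (@le_trans _ _ (\int[leb n.+1]_(z in Omega (cst d)) (W M)%:E)%E).
    by apply: le_integral_ae; apply: ae_mono nab => z h -[_ Oz]; rewrite h.
  have mOd : measurable (Omega (cst d) : set (cara R n.+1)).
    by apply: open_cara; apply: open_Omega; exact: cst_continuous.
  by rewrite (integral_cst _ mOd) [X in (_ * X)%E](leb_Omega_cst n hd) -EFinM.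
apply: (le_trans flat_le); rewrite /energy.
apply: le_trans (leeD elastic surface).
rewrite -[X in (_ + X * _)%E]cnE -EFinM -EFinD lee_fin -/gam -/C.
have h : C * delta * gam <= cn * (a / n%:R) * gam by rewrite ler_wpM2r.
have -> : cn * (b + a / n%:R * gam) = b * cn + cn * (a / n%:R) * gam by ring.
by move: h; move: (C * delta * gam) (cn * (a / n%:R) * gam) (W M * d) (b * cn) => x y w t; lra.
Qed.
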